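(* Let $(\Lambda,d)$ be an ordinal graph satisfying condition (S) (for ordinal graphs). Then for every $\alpha\in\mathrm{Ord}$ the $C^*$-correspondence $X_\alpha$ satisfies condition (S) for $C^*$-correspondences. Moreover, if $\pi:\mathcal{O}(\Lambda)\to\mathcal{A}$ is a $*$-homomorphism into a $C^*$-algebra $\mathcal{A}$, then $\pi$ is injective if and only if $\pi(T_v)\neq0$ for each $v\in\Lambda_0$.
   Context: **Ordinal graphs.** $\mathrm{Ord}$ is the class of ordinals with usual ordinal arithmetic. A category is identified with its collection of morphisms; $r(e),s(e)$ are the identity morphisms at the codomain and domain of $e$, and $ef$ is defined iff $s(e)=r(f)$. An ordinal graph is a pair $(\Lambda,d)$ with $\Lambda$ a small category and $d:\Lambda\to\mathrm{Ord}$ a functor ($d(ef)=d(e)+d(f)$) such that for every $e\in\Lambda$ and $\alpha\le d(e)$ there are unique $f,g\in\Lambda$ with $d(f)=\alpha$ and $e=fg$; write $f=e(\alpha)$, $g=e(\alpha)^{-1}e$. Put $\Lambda^\alpha=\{f:d(f)=\alpha\}$ and $\Lambda_\alpha=\{f:d(f)<\omega^\alpha\}$ (again an ordinal graph). $\Lambda_0=\Lambda^0$ is the set of vertices (identity morphisms). For $S\subseteq\Lambda$ and a vertex $v$: $vS=\{f\in S:r(f)=v\}$, $Sv=\{f\in S:s(f)=v\}$; $eS=\{ef:f\in S,\ r(f)=s(e)\}$. **Regularity.** $v\in\Lambda_0$ is $\alpha$-source-regular if for every $e\in v\Lambda_\alpha$ there exists $f\in s(e)\Lambda^{\omega^\alpha}$;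 $\alpha$-row-finite if $v\Lambda^{\omega^\alpha}$ is finite; $\alpha$-regular if both. **Condition (S) for ordinal graphs.** A path $e\in\Lambda^{\omega^\alpha\cdot n}$ ($n\in[0,\omega)$) is non-returning if for all $\gamma\in[\omega^\alpha,\omega^\alpha\cdot n)$ and $\beta\in[0,\omega^\alpha)$, $e(\gamma)e(\beta)^{-1}e\notin e\Lambda$ (vacuous when the composition is undefined). A connected component of an ordinal graph $\Gamma$ is a class of the smallest equivalence relation $\sim$ on $\Gamma$ with $f\sim g$ whenever $s(f)=r(g)$. A path $e$ is $\alpha$-full if for every $v\in\Lambda_0$ in the same connected component of $\Lambda_\alpha$ as $r(e)$ there exist $\beta\in[0,\omega^\alpha)$ and $f\in\Lambda_\alpha$ with $s(f)=s(e(\beta))$ and $r(f)=v$. $\Lambda$ satisfies condition (S) if for every $\alpha\in\mathrm{Ord}$ with $\Lambda^{\omega^\alpha}\ne\emptyset$, every connected component $F$ of $\Lambda_\alpha$ and every $n\in\mathbb{N}$ there exists a non-returning, $\alpha$-full $f\in\Lambda$ with $r(f)\in F$ and $d(f)\in[\omega^\alpha\cdot n,\omega^{\alpha+1})$. **Algebra.** $\mathcal{O}(\Lambda)$ is the universal $C^*$-algebra generated by partial isometries $T_e$, for $e\in\Lambda$ with $d(e)$ a power $\omega^\alpha$ or $e\in\Lambda_0$, subject to: (i) $T_e^*T_e=T_{s(e)}$; (ii) $T_eT_f=T_{ef}$ if $s(e)=r(f)$ and $d(e)<d(f)$; (iii) $T_e^*T_f=0$ if $e\Lambda\cap f\Lambda=\emptyset$;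 (iv) $T_v=\sum_{e\in v\Lambda^{\omega^\alpha}}T_eT_e^*$ if $v$ is $\alpha$-regular. For arbitrary $e=e_1\cdots e_n$ with each $d(e_i)$ a power of $\omega$, $T_e=T_{e_1}\cdots T_{e_n}$. The same notation is used for the generators of $\mathcal{O}(\Lambda_\alpha)$. **Correspondence $X_\alpha$.** $X_\alpha$ is the Hilbert $\mathcal{O}(\Lambda_\alpha)$-module completing $X_\alpha^\circ=\{x\in c_c(\Lambda^{\omega^\alpha},\mathcal{O}(\Lambda_\alpha)): T_{s(e)}x(e)=x(e)\ \forall e\}$ with $(x\cdot a)(e)=x(e)a$ and $\langle x,y\rangle=\sum_{e}x(e)^*y(e)$. For $e\in\Lambda^{\omega^\alpha}$, $\delta_e\in X_\alpha^\circ$ takes the value $T_{s(e)}$ at $e$ and $0$ elsewhere. The left action $\varphi_\alpha:\mathcal{O}(\Lambda_\alpha)\to\mathcal{L}(X_\alpha)$ is the $*$-homomorphism with $\varphi_\alpha(T_g)\delta_e=\delta_{ge}$ if $s(g)=r(e)$ and $0$ otherwise ($g\in\Lambda_\alpha$). **Condition (S) for correspondences** (Eryüzlü–Tomforde). Let $X$ be a $C^*$-correspondence over $A$ with universal covariant representation $(\psi,\pi)$ in $\mathcal{O}(X)$, and let $\psi^n:X^{\otimes n}\to\mathcal{O}(X)$ be the map with $\psi^n(x_1\otimes\cdots\otimes x_n)=\psi(x_1)\cdots\psi(x_n)$. A vector $\zeta\in X^{\otimes n}$ is non-returning if $\psi^n(\zeta)^*\psi^m(\xi)\psi^n(\zeta)=0$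 whenever $1\le m<n$ and $\xi\in X^{\otimes m}$. $X$ satisfies condition (S) if for every positive $a\in A$, every $n\in\mathbb{N}$ and every $\varepsilon>0$ there are $m>n$ and a non-returning $\zeta\in X^{\otimes m}$ with $\|\zeta\|=1$ and $\|\langle\zeta,a\cdot\zeta\rangle\|>\|a\|-\varepsilon$.
   Formalization: The first conclusion is stated for those α with Λ^{ω^α} nonempty; for other α (which always exist, Λ being small) X_α = 0 has no vector of norm 1 in any tensor power, so condition (S) for correspondences fails. *)

(* Defs.v *)
From Stdlib Require Import Relation_Operators.
From mathcomp Require Import all_boot all_order all_algebra complex.
From mathcomp Require Import all_classical all_reals all_analysis.

Set Implicit Arguments.
Unset Strict Implicit.
Unset Printing Implicit Defensive.

Import Order.TTheory GRing.Theory Num.Theory.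
Import numFieldNormedType.Exports.

Local Open Scope ring_scope.
Local Open Scope classical_set_scope.

(* [olim f] is the least ordinal strictly above every [f i].  Distinct trees
   may denote the same ordinal, so equality of ordinals is [oeq], never [=]. *)
Inductive Ord : Type := olim (I : Type) (f : I -> Ord).

Fixpoint ole (a b : Ord) {struct a} : Prop :=
  match a with
  | olim D f =>
      forall i : D, match b with olim J g => exists j : J, ole (f i) (g j) end
  end.

Definition olt (a b : Ord) : Prop :=
  match b with olim J g => exists j : J, ole a (g j) end.

Definition oeq (a b : Ord) : Prop := ole a b /\ ole b a.

Declare Scope ord_scope.
Delimit Scope ord_scope with Ord.
Bind Scope ord_scope with Ord.
Infix "<=" := ole : ord_scope.
Infix "<" := olt : ord_scope.
Infix "==" := oeq : ord_scope.

Definition ozero : Ord := olim (fun v : void => match v with end).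

Definition osucc (a : Ord) : Ord :=
  match a with olim D f => olim (fun o : option D => oapp f a o) end.

Definition ofin (n : nat) : Ord := iter n osucc ozero.

Definition oomega : Ord := olim ofin.

Definition odom (a : Ord) : Type := match a with olim D _ => D end.
Definition obelow (a : Ord) : odom a -> Ord :=
  match a with olim D f => f end.

Definition osup (I : Type) (f : I -> Ord) : Ord :=
  olim (fun p : {i : I & odom (f i)} => obelow (projT2 p)).

(* a + b = a \cup {a + b' | b' < b} *)
Fixpoint oadd (a b : Ord) {struct b} : Ord :=
  match b with
  | olim J g =>
      olim (fun s : odom a + J =>
              match s with inl i => obelow i | inr j => oadd a (g j) end)
  end.

(* a * b = {a * b' + a' | b' < b, a' < a} *)
Fixpoint omul (a b : Ord) {struct b} : Ord :=
  match b with
  | olim J g =>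
      olim (fun p : J * odom a => oadd (omul a (g p.1)) (obelow p.2))
  end.

(* w^b = sup ({1} \cup {w^b' * w | b' < b}) *)
Fixpoint oexpw (b : Ord) : Ord :=
  match b with
  | olim J g =>
      osup (fun o : option J =>
              if o is Some j then omul (oexpw (g j)) oomega else ofin 1)
  end.

Infix "+" := oadd : ord_scope.
Infix "*" := omul : ord_scope.
Notation "'ω^' a" := (oexpw a) (at level 1, a at level 1, format "'ω^' a")
  : ord_scope.

Lemma ole_lt I (f : I -> Ord) b : ole (olim f) b <-> forall i, olt (f i) b.
Proof. by case: b. Qed.

Lemma olexx a : ole a a.
Proof. by elim: a => I f IH i; exists i; apply: IH. Qed.

Lemma ole_trans b a c : ole a b -> ole b c -> ole a c.
Proof.
elim: b a c => J g IH [I f] [K h] ab bc i.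
have [j fg] := ab i; have [k gh] := bc j.
by exists k; apply: IH fg gh.
Qed.

Lemma olt_le_trans b a c : olt a b -> ole b c -> olt a c.
Proof.
case: b c => J g [K h] [j aj] bc; have [k gh] := bc j.
by exists k; apply: ole_trans aj gh.
Qed.

Lemma ole_lt_trans b a c : ole a b -> olt b c -> olt a c.
Proof. by case: c => K h ab [k bk]; exists k; apply: ole_trans ab bk. Qed.

Lemma oltW a b : olt a b -> ole a b.
Proof.
elim: a b => I f IH [J g] [j aj] i; exists j.
by apply: IH; apply: (proj1 (ole_lt f (g j))).
Qed.

Lemma ole_total a b : (ole a b \/ olt b a) /\ (olt a b \/ ole b a).
Proof.
elim: a b => I f IHa; elim=> J g IHb; split.
- case: (pselect (forall i, olt (f i) (olim g))) => [h|/existsNP[i h]].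
    by left; apply/ole_lt.
  by right; exists i; case: (IHa i (olim g)).2.
- case: (pselect (forall j, olt (g j) (olim f))) => [h|/existsNP[j h]].
    by right; apply/ole_lt.
  by left; exists j; case: (IHb j).1.
Qed.

Lemma obelow_lt a (i : odom a) : olt (obelow i) a.
Proof. by case: a i => I f i; exists i; apply: olexx. Qed.

Lemma oltP x a : olt x a <-> exists i : odom a, ole x (obelow i).
Proof. by case: a. Qed.

Lemma oleP a b : ole a b <-> forall i : odom a, olt (obelow i) b.
Proof. by case: a => I f; apply: ole_lt. Qed.

Lemma olt_osucc x a : olt x (osucc a) <-> ole x a.
Proof.
case: a => I f; split; last by exists None.
by case=> -[i|] //= h; apply: ole_trans h (oltW (obelow_lt (a := olim f) i)).
Qed.

Lemma osup_lt I (f : I -> Ord) x : olt x (osup f) <-> exists i, olt x (f i).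
Proof.
split; first by case=> -[i p] h; exists i; apply/oltP; exists p.
by case=> i /oltP[p h]; exists (existT _ i p).
Qed.

Lemma oadd_lt x a b :
  olt x (oadd a b) <-> olt x a \/ exists j : odom b, ole x (oadd a (obelow j)).
Proof.
case: b => J g; split.
  case=> -[i|j] h; last by right; exists j.
  by left; apply/oltP; exists i.
case=> [/oltP[i h]|[j h]]; first by exists (inl i).
by exists (inr j).
Qed.

Lemma ole_addr a b : ole a (oadd a b).
Proof. by apply/oleP => i; apply/oadd_lt; left; apply: obelow_lt. Qed.

Lemma oadd_monor a b c : ole b c -> ole (oadd a b) (oadd a c).
Proof.
elim: b c => J g IH c bc; apply/oleP => i.
have := obelow_lt i; move/oadd_lt => [h|[j h]].
  exact: olt_le_trans h (ole_addr _ _).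
have /oltP[k gk] := (proj1 (ole_lt g c)) bc j.
apply/oadd_lt; right; exists k; apply: ole_trans h _; exact: IH.
Qed.

Lemma oadd_monor_lt a b c : olt b c -> olt (oadd a b) (oadd a c).
Proof.
move=> /oltP[k h]; apply/oadd_lt; right; exists k; exact: oadd_monor.
Qed.

Lemma oadd_monol a b c : ole a b -> ole (oadd a c) (oadd b c).
Proof.
move=> ab; elim: c => J g IH; apply/oleP => i.
have := obelow_lt i; move/oadd_lt => [h|[j h]].
  exact: olt_le_trans (olt_le_trans h ab) (ole_addr _ _).
by apply/oadd_lt; right; exists j; apply: ole_trans h (IH j).
Qed.

Lemma ole_addl a b : ole b (oadd a b).
Proof.
elim: b => J g IH; apply/ole_lt => j.
by apply/oadd_lt; right; exists j; apply: IH.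
Qed.

Lemma oadd0 a : ole (oadd a ozero) a.
Proof. by apply/oleP => i; have /oadd_lt[//|[[]]] := obelow_lt i. Qed.

Arguments oadd0 : clear implicits.

Lemma o0add a : ole (oadd ozero a) a.
Proof.
elim: a => J g IH; apply/oleP => i; have /oadd_lt[|[j h]] := obelow_lt i.
  by case/oltP => -[].
by exists j; apply: ole_trans h (IH j).
Qed.

Lemma oaddA_le a b c : ole (oadd a (oadd b c)) (oadd (oadd a b) c).
Proof.
elim: c => J g IH; apply/oleP => i; have /oadd_lt[h|[j h]] := obelow_lt i.
  by apply: olt_le_trans h _; apply: ole_trans (ole_addr _ _) (ole_addr _ _).
have /oadd_lt[k|[k hk]] := obelow_lt j.
  apply: ole_lt_trans h _.
  exact: olt_le_trans (oadd_monor_lt _ k) (ole_addr _ _).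
apply/oadd_lt; right; exists k; apply: ole_trans (IH k).
exact: ole_trans h (oadd_monor _ hk).
Qed.

Lemma omul_lt x a b : olt x (omul a b) <->
  exists (j : odom b) (i : odom a),
    ole x (oadd (omul a (obelow j)) (obelow i)).
Proof.
case: b => J g; split; first by case=> -[j i] h; exists j, i.
by case=> j [i h]; exists (j, i).
Qed.

Lemma omul_monor a b c : ole b c -> ole (omul a b) (omul a c).
Proof.
elim: b c => J g IH c bc; apply/oleP => p.
have /omul_lt[j [i h]] := obelow_lt p.
have /oltP[k gk] := (proj1 (ole_lt g c)) bc j.
apply/omul_lt; exists k, i; apply: ole_trans h (oadd_monol _ _); exact: IH.
Qed.

Lemma omul_monol a b c : ole a b -> ole (omul a c) (omul b c).
Proof.
move=> ab; elim: c => J g IH; apply/oleP => p.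
have /omul_lt[j [i h]] := obelow_lt p.
have /oltP[k ik] := (proj1 (oleP a b)) ab i.
apply/omul_lt; exists j, k; apply: ole_trans h _.
exact: ole_trans (oadd_monol _ (IH j)) (oadd_monor _ ik).
Qed.

Lemma omulS_le a b : ole (omul a (osucc b)) (oadd (omul a b) a).
Proof.
apply/oleP => p; have /omul_lt[j [i h]] := obelow_lt p.
apply: ole_lt_trans h _.
have /olt_osucc jb := obelow_lt j.
apply: ole_lt_trans (oadd_monol _ (omul_monor _ jb)) _.
exact: oadd_monor_lt (obelow_lt i).
Qed.

Lemma omulS_ge a b : ole (oadd (omul a b) a) (omul a (osucc b)).
Proof.
apply/oleP => p; have /oadd_lt[h|[i h]] := obelow_lt p.
  apply: olt_le_trans h (omul_monor _ _).
  by apply: oltW; apply/olt_osucc; apply: olexx.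
have /oltP[j bj] : olt b (osucc b) by apply/olt_osucc; apply: olexx.
apply/omul_lt; exists j, i; apply: ole_trans h _.
exact: oadd_monol (omul_monor _ bj).
Qed.

Lemma omul_fin_add a n m :
  ole (oadd (omul a (ofin n)) (omul a (ofin m))) (omul a (ofin (n + m))).
Proof.
elim: m => [|m IH].
  rewrite addn0; suff h : ole (omul a ozero) ozero.
    exact: ole_trans (oadd_monor _ h) (oadd0 _).
  by apply/oleP => p; have /omul_lt[[]] := obelow_lt p.
rewrite addnS; apply: ole_trans (omulS_ge a (ofin (n + m))).
apply: (ole_trans (oadd_monor _ (omulS_le a (ofin m)))).
exact: ole_trans (oaddA_le _ _ _) (oadd_monol _ IH).
Qed.

Lemma oexpw_mono a b : ole a b -> ole (oexpw a) (oexpw b).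
Proof.
elim: a b => J g IH [K h] ab; apply/oleP => p.
have /osup_lt[[j|] lt] := obelow_lt p; last by apply/osup_lt; exists None.
have [k gh] := ab j; apply/osup_lt; exists (Some k).
apply: olt_le_trans lt (omul_monol _ _); exact: IH.
Qed.

Lemma oexpw_gt0 a : olt ozero (oexpw a).
Proof.
case: a => J g; apply/osup_lt; exists None.
by apply/olt_osucc; apply: olexx.
Qed.

Lemma oadd_oexpw a x y :
  olt x (oexpw a) -> olt y (oexpw a) -> olt (oadd x y) (oexpw a).
Proof.
have lt_omega c z : olt z (omul c oomega) -> exists n, olt z (omul c (ofin n)).
  move=> /omul_lt[n [i h]]; exists n.+1; apply: ole_lt_trans h _.
  exact: olt_le_trans (oadd_monor_lt _ (obelow_lt i)) (omulS_ge _ _).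
case: a => J g xa ya.
have /osup_lt[[i /lt_omega[n xn]|/olt_osucc x0]] := xa; last first.
  apply: ole_lt_trans ya; apply: ole_trans (o0add _); exact: oadd_monol.
have /osup_lt[[j /lt_omega[m ym]|/olt_osucc y0]] := ya; last first.
  apply: ole_lt_trans xa; apply: ole_trans (oadd0 _); exact: oadd_monor.
suff [k [xk yk]] : exists k : J, olt x (omul (oexpw (g k)) (ofin n)) /\
                                 olt y (omul (oexpw (g k)) (ofin m)).
  apply/osup_lt; exists (Some k).
  apply: ole_lt_trans (oadd_monol _ (oltW xk)) _.
  apply: olt_le_trans (oadd_monor_lt _ yk) _.
  apply: ole_trans (omul_fin_add _ _ _) (omul_monor _ _).
  by apply: oltW; exists (n + m)%N; apply: olexx.
case: (ole_total (g i) (g j)).1 => [ij|/oltW ji].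
  by exists j; split=> //; apply: olt_le_trans xn (omul_monol _ (oexpw_mono ij)).
by exists i; split=> //; apply: olt_le_trans ym (omul_monol _ (oexpw_mono ji)).
Qed.

(* A small category is given by its set of morphisms; [og_comp e f] is
   meaningful only when [og_s e = og_r f]. *)
Record ordinalGraph := OrdinalGraph {
  og_mor :> choiceType;
  og_r : og_mor -> og_mor;
  og_s : og_mor -> og_mor;
  og_comp : og_mor -> og_mor -> og_mor;
  og_d : og_mor -> Ord;
  og_rr : forall e, og_r (og_r e) = og_r e;
  og_sr : forall e, og_s (og_r e) = og_r e;
  og_rs : forall e, og_r (og_s e) = og_s e;
  og_ss : forall e, og_s (og_s e) = og_s e;
  og_idl : forall e, og_comp (og_r e) e = e;
  og_idr : forall e, og_comp e (og_s e) = e;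
  og_rM : forall e f, og_s e = og_r f -> og_r (og_comp e f) = og_r e;
  og_sM : forall e f, og_s e = og_r f -> og_s (og_comp e f) = og_s f;
  og_compA : forall e f g, og_s e = og_r f -> og_s f = og_r g ->
    og_comp e (og_comp f g) = og_comp (og_comp e f) g;
  og_d1 : forall e, (og_d (og_r e) == ozero)%Ord;
  og_dM : forall e f, og_s e = og_r f ->
    (og_d (og_comp e f) == og_d e + og_d f)%Ord;
  og_factor : forall e a, (a <= og_d e)%Ord ->
    exists! p : og_mor * og_mor,
      [/\ og_s p.1 = og_r p.2, (og_d p.1 == a)%Ord & e = og_comp p.1 p.2]
}.

Definition og_vertex (L : ordinalGraph) (v : L) : Prop := og_r v = v.

(* f = e(a) and g = e(a)^{-1} e *)
Definition og_splits (L : ordinalGraph) (e : L) (a : Ord) (f g : L) : Prop :=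
  [/\ og_s f = og_r g, (og_d f == a)%Ord & e = og_comp f g].

Section Truncation.
Variables (L : ordinalGraph) (a : Ord).

Definition og_small (e : L) : bool := `[< (og_d e < ω^a)%Ord >].

Definition trunc_mor : choiceType := {e : L | og_small e}.

Lemma og_small_r e : og_small (og_r e).
Proof.
by apply/asboolP; apply: ole_lt_trans (og_d1 e).1 (oexpw_gt0 a).
Qed.

Lemma og_small_s e : og_small (og_s e).
Proof. by rewrite -og_rs; apply: og_small_r. Qed.

Lemma og_small_comp e f : og_s e = og_r f ->
  og_small e -> og_small f -> og_small (og_comp e f).
Proof.
move=> ef /asboolP he /asboolP hf; apply/asboolP.
by apply: ole_lt_trans (og_dM ef).1 _; apply: oadd_oexpw.
Qed.

Definition trunc_r (e : L) : trunc_mor := exist _ (og_r e) (og_small_r e).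
Definition trunc_s (e : L) : trunc_mor := exist _ (og_s e) (og_small_s e).

Definition trunc_comp (e f : trunc_mor) : trunc_mor :=
  match pselect (og_s (val e) = og_r (val f)) with
  | left ef =>
      exist _ (og_comp (val e) (val f)) (og_small_comp ef (valP e) (valP f))
  | right _ => e
  end.

Lemma val_trunc_comp e f : og_s (val e) = og_r (val f) ->
  val (trunc_comp e f) = og_comp (val e) (val f).
Proof. by rewrite /trunc_comp; case: pselect. Qed.

Let r (e : trunc_mor) := trunc_r (val e).
Let s (e : trunc_mor) := trunc_s (val e).

Let val_sr e f : s e = r f -> og_s (val e) = og_r (val f).
Proof. by move/(congr1 val). Qed.

Lemma trunc_factor (e : trunc_mor) b : (b <= og_d (val e))%Ord ->
  exists! p : trunc_mor * trunc_mor,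
    [/\ s p.1 = r p.2, (og_d (val p.1) == b)%Ord & e = trunc_comp p.1 p.2].
Proof.
move=> be; have [[f g] [[/= fg df efg] uniq]] := og_factor be.
have lt_e : (og_d f + og_d g < ω^a)%Ord.
  apply: ole_lt_trans (og_dM fg).2 _; rewrite -efg.
  exact/asboolP/(valP e).
have hf : og_small f by apply/asboolP; apply: ole_lt_trans (ole_addr _ _) lt_e.
have hg : og_small g by apply/asboolP; apply: ole_lt_trans (ole_addl _ _) lt_e.
exists (exist _ f hf, exist _ g hg); split.
  have eqs : s (exist _ f hf) = r (exist _ g hg) by apply: val_inj.
  split; [exact: eqs | exact: df |].
  by apply: val_inj; rewrite val_trunc_comp //; apply: val_sr eqs.
move=> [f' g'] /= [fg' df' e'].
have [] : (f, g) = (val f', val g').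
  apply: uniq; split; [exact: val_sr fg' | exact: df' |].
  by rewrite {1}e' val_trunc_comp //; apply: val_sr fg'.
by move=> ff' gg'; congr pair; apply: val_inj.
Qed.

Let rr e : r (r e) = r e. Proof. by apply: val_inj; rewrite /= og_rr. Qed.
Let sr e : s (r e) = r e. Proof. by apply: val_inj; rewrite /= og_sr. Qed.
Let rs e : r (s e) = s e. Proof. by apply: val_inj; rewrite /= og_rs. Qed.
Let ss e : s (s e) = s e. Proof. by apply: val_inj; rewrite /= og_ss. Qed.

Let idl e : trunc_comp (r e) e = e.
Proof. by apply: val_inj; rewrite val_trunc_comp /= ?og_idl // og_sr. Qed.

Let idr e : trunc_comp e (s e) = e.
Proof. by apply: val_inj; rewrite val_trunc_comp /= ?og_idr // og_rs. Qed.

Let rM e f : s e = r f -> r (trunc_comp e f) = r e.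
Proof.
by move/val_sr => ef; apply: val_inj; rewrite /= val_trunc_comp ?og_rM.
Qed.

Let sM e f : s e = r f -> s (trunc_comp e f) = s f.
Proof.
by move/val_sr => ef; apply: val_inj; rewrite /= val_trunc_comp ?og_sM.
Qed.

Let compA e f g : s e = r f -> s f = r g ->
  trunc_comp e (trunc_comp f g) = trunc_comp (trunc_comp e f) g.
Proof.
move=> /val_sr ef /val_sr fg; apply: val_inj.
by rewrite !val_trunc_comp ?og_compA ?og_rM ?og_sM.
Qed.

Let d1 e : (og_d (val (r e)) == ozero)%Ord. Proof. exact: og_d1. Qed.

Let dM e f : s e = r f ->
  (og_d (val (trunc_comp e f)) == og_d (val e) + og_d (val f))%Ord.
Proof. by move/val_sr => ef; rewrite val_trunc_comp //; apply: og_dM. Qed.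

(* the ordinal graph \Lambda_a *)
Definition trunc : ordinalGraph :=
  @OrdinalGraph trunc_mor r s trunc_comp (fun e => og_d (val e))
    rr sr rs ss idl idr rM sM compA d1 dM trunc_factor.

End Truncation.

Section OrdinalGraphNotions.
Variable L : ordinalGraph.
Implicit Types (a : Ord) (e v : L).

(* v \Lambda^{w^a} *)
Definition og_paths v a : set L := [set f | og_r f = v /\ (og_d f == ω^a)%Ord].

Definition og_source_regular a v : Prop :=
  forall e, og_r e = v -> (og_d e < ω^a)%Ord -> og_paths (og_s e) a !=set0.

Definition og_row_finite a v : Prop := finite_set (og_paths v a).

Definition og_regular a v : Prop := og_source_regular a v /\ og_row_finite a v.

(* e \Lambda *)
Definition og_ext e : set L :=
  [set g | exists2 f, og_s e = og_r f & g = og_comp e f].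

Definition og_connected : L -> L -> Prop :=
  clos_refl_sym_trans L (fun f g => og_s f = og_r g).

Definition og_component (F : set L) : Prop :=
  exists g, F = [set f | og_connected g f].

Definition og_nonreturning a e : Prop :=
  (exists n : nat, (og_d e == ω^a * ofin n)%Ord) /\
  forall (c b : Ord) (e1 e2 f1 f2 : L),
    (ω^a <= c)%Ord -> (c < og_d e)%Ord -> (b < ω^a)%Ord ->
    og_splits e c e1 e2 -> og_splits e b f1 f2 ->
    og_s e1 = og_r f2 -> ~ og_ext e (og_comp e1 f2).

End OrdinalGraphNotions.

Definition og_full (L : ordinalGraph) (a : Ord) (e : L) : Prop :=
  forall v : trunc L a, og_vertex v -> og_connected v (trunc_r a e) ->
  exists (b : Ord) (e1 e2 : L) (f : trunc L a),
    [/\ (b < ω^a)%Ord, og_splits e b e1 e2,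
        og_s f = trunc_s a e1 & og_r f = v].

Definition og_conditionS (L : ordinalGraph) : Prop :=
  forall a : Ord, (exists e : L, (og_d e == ω^a)%Ord) ->
  forall F : set (trunc L a), og_component F ->
  forall n : nat, exists f : L,
    [/\ og_nonreturning a f, og_full a f, F (trunc_r a f),
        (ω^a * ofin n <= og_d f)%Ord & (og_d f < ω^(osucc a))%Ord].

(* not necessarily unital *)
Record cstarAlgebra (R : realType) := CstarAlgebra {
  cs_car :> completeNormedModType R[i];
  cs_mul : cs_car -> cs_car -> cs_car;
  cs_star : cs_car -> cs_car;
  cs_mulA : associative cs_mul;
  cs_mulDl : left_distributive cs_mul +%R;
  cs_mulDr : right_distributive cs_mul +%R;
  cs_scaleAl : forall (k : R[i]) x y, cs_mul (k *: x) y = k *: cs_mul x y;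
  cs_scaleAr : forall (k : R[i]) x y, cs_mul x (k *: y) = k *: cs_mul x y;
  cs_starK : involutive cs_star;
  cs_starD : {morph cs_star : x y / x + y};
  cs_starZ : forall (k : R[i]) x, cs_star (k *: x) = k^* *: cs_star x;
  cs_starM : forall x y, cs_star (cs_mul x y) = cs_mul (cs_star y) (cs_star x);
  cs_normM : forall x y, `|cs_mul x y| <= `|x| * `|y|;
  cs_normS : forall x, `|cs_mul (cs_star x) x| = `|x| ^+ 2
}.

Declare Scope cstar_scope.
Delimit Scope cstar_scope with CS.
Infix "**" := cs_mul (at level 40, left associativity) : cstar_scope.
Notation "x ^#" := (cs_star x) (at level 2, format "x ^#") : cstar_scope.
Local Open Scope cstar_scope.

Section CstarNotions.
Variable R : realType.
Implicit Types A B : cstarAlgebra R.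

Definition cs_positive A (x : A) : Prop := exists y : A, x = y^# ** y.

Record star_hom A B (f : A -> B) : Prop := StarHom {
  sh_linear : linear f;
  sh_mul : {morph f : x y / x ** y};
  sh_star : {morph f : x / x^#}
}.

Section OrdinalGraphAlgebra.
Variable L : ordinalGraph.

Definition og_power (e : L) : Prop := exists a, (og_d e == ω^a)%Ord.

Definition og_generator (e : L) : Prop := og_power e \/ og_vertex e.

(* A family indexed by the generators; the values of [T] elsewhere are
   irrelevant. *)
Record og_family A (T : L -> A) : Prop := OgFamily {
  of_partial : forall e, og_generator e -> T e ** (T e)^# ** T e = T e;
  of_source : forall e, og_generator e -> (T e)^# ** T e = T (og_s e);
  of_comp : forall e f, og_generator e -> og_generator f ->
    og_s e = og_r f -> (og_d e < og_d f)%Ord -> T e ** T f = T (og_comp e f);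
  of_disjoint : forall e f, og_generator e -> og_generator f ->
    og_ext e `&` og_ext f = set0 -> (T e)^# ** T f = 0;
  of_regular : forall v a, og_vertex v -> og_regular a v ->
    T v = \sum_(e \in og_paths v a) (T e ** (T e)^#)
}.

(* (A, T) is a model of O(L) *)
Definition og_algebra A (T : L -> A) : Prop :=
  og_family T /\
  forall B (t : L -> B), og_family t ->
    exists2 f : A -> B,
      star_hom f /\ (forall e, og_generator e -> f (T e) = t e) &
      forall g : A -> B,
        star_hom g -> (forall e, og_generator e -> g (T e) = t e) -> g =1 f.

(* [og_word T e x]: x = T_{e_1} ... T_{e_n} for some factorisation
   e = e_1 ... e_n of e into generators; thus x = T_e. *)
Inductive og_word A (T : L -> A) : L -> A -> Prop :=
| og_word1 e : og_generator e -> og_word T e (T e)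
| og_wordS e f x : og_power e -> og_s e = og_r f -> og_word T f x ->
    og_word T (og_comp e f) (T e ** x).

End OrdinalGraphAlgebra.

End CstarNotions.

Record hilbertModule (R : realType) (A : cstarAlgebra R) := HilbertModule {
  hm_car :> completeNormedModType R[i];
  hm_act : hm_car -> A -> hm_car;
  hm_ip : hm_car -> hm_car -> A;
  hm_actDl : forall x y a, hm_act (x + y) a = hm_act x a + hm_act y a;
  hm_actDr : forall x a b, hm_act x (a + b) = hm_act x a + hm_act x b;
  hm_actZl : forall (k : R[i]) x a, hm_act (k *: x) a = k *: hm_act x a;
  hm_actZr : forall (k : R[i]) x a, hm_act x (k *: a) = k *: hm_act x a;
  hm_actM : forall x a b, hm_act x (a ** b) = hm_act (hm_act x a) b;
  hm_ip_linear : forall x, linear (hm_ip x);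
  hm_ip_act : forall x y a, hm_ip x (hm_act y a) = hm_ip x y ** a;
  hm_ip_star : forall x y, (hm_ip x y)^# = hm_ip y x;
  hm_ip_pos : forall x, cs_positive (hm_ip x x);
  hm_norm : forall x, `|x| ^+ 2 = `|hm_ip x x|
}.

(* [co_adj] says that each [co_act a] is adjointable with adjoint
   [co_act a^#], so that [co_act] is a *-homomorphism into L(X). *)
Record correspondence (R : realType) (A : cstarAlgebra R) := Correspondence {
  co_mod :> hilbertModule A;
  co_act : A -> co_mod -> co_mod;
  co_adj : forall a x y, hm_ip (co_act a x) y = hm_ip x (co_act a^# y);
  co_actD : forall a b x, co_act (a + b) x = co_act a x + co_act b x;
  co_actZ : forall (k : R[i]) a x, co_act (k *: a) x = k *: co_act a x;
  co_actM : forall a b x, co_act (a ** b) x = co_act a (co_act b x)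
}.

Section CorrespondenceNotions.
Variables (R : realType) (A : cstarAlgebra R).

(* (Z, t) is a model of the balanced tensor product Y (x)_A X, where
   t y x is the elementary tensor. *)
Record tensor_product (Y X Z : correspondence A) (t : Y -> X -> Z) : Prop :=
  TensorProduct {
  tp_linearl : forall x, linear (t^~ x);
  tp_linearr : forall y, linear (t y);
  tp_balanced : forall y a x, t (hm_act y a) x = t y (co_act a x);
  tp_ip : forall y x y' x',
    hm_ip (t y x) (t y' x') = hm_ip x (co_act (hm_ip y y') x');
  tp_actr : forall y x a, hm_act (t y x) a = t y (hm_act x a);
  tp_actl : forall a y x, co_act a (t y x) = t (co_act a y) x;
  tp_dense : forall (z : Z) (eps : R[i]), 0 < eps ->
    exists l : seq (Y * X), `|z - \sum_(p <- l) t p.1 p.2| < eps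
}.

Variable X : correspondence A.

(* sum of the rank-one operators x |-> p.1 . <p.2, x> *)
Definition finite_rank (l : seq (X * X)) (x : X) : X :=
  \sum_(p <- l) hm_act p.1 (hm_ip p.2 x).

(* the operator norm of k - finite_rank l is at most eps *)
Definition finite_rank_near (k : X -> X) (l : seq (X * X)) (eps : R[i]) :=
  forall x, `|k x - finite_rank l x| <= eps * `|x|.

Definition compact_operator (k : X -> X) : Prop :=
  forall eps : R[i], 0 < eps -> exists l, finite_rank_near k l eps.

(* Katsura's ideal J_X = phi^{-1}(K(X)) \cap (ker phi)^\perp *)
Definition katsura_ideal (a : A) : Prop :=
  compact_operator (co_act a) /\
  forall b : A, (forall x : X, co_act b x = 0) -> a ** b = 0.

Section Representation.
Variables (B : cstarAlgebra R) (psi : X -> B) (pi : A -> B).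

Record representation : Prop := Representation {
  re_pi : star_hom pi;
  re_psi : linear psi;
  re_ip : forall x y, (psi x)^# ** psi y = pi (hm_ip x y);
  re_actl : forall a x, psi (co_act a x) = pi a ** psi x;
  re_actr : forall x a, psi (hm_act x a) = psi x ** pi a
}.

(* [psi_compact k b]: k is compact and b = psi^{(1)}(k), where psi^{(1)} is
   the *-homomorphism on K(X) with theta_{x,y} |-> psi(x) psi(y)^*; its graph
   is the closure of its restriction to finite-rank operators. *)
Definition psi_compact (k : X -> X) (b : B) : Prop :=
  forall eps : R[i], 0 < eps -> exists2 l : seq (X * X),
    finite_rank_near k l eps &
    `|b - \sum_(p <- l) (psi p.1 ** (psi p.2)^#)| <= eps.

Definition covariant : Prop :=
  representation /\
  forall a, katsura_ideal a -> psi_compact (co_act a) (pi a).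

End Representation.

(* (O, psi, pi) is a model of the Cuntz-Pimsner algebra O(X) *)
Definition universal_covariant (O : cstarAlgebra R) (psi : X -> O) (pi : A -> O)
    : Prop :=
  covariant psi pi /\
  forall (B : cstarAlgebra R) (psi' : X -> B) (pi' : A -> B),
    covariant psi' pi' ->
    exists2 f : O -> B,
      [/\ star_hom f, (forall x, f (psi x) = psi' x)
        & (forall a, f (pi a) = pi' a)] &
      forall g : O -> B, star_hom g -> (forall x, g (psi x) = psi' x) ->
        (forall a, g (pi a) = pi' a) -> g =1 f.

Section TensorPowers.
Variables (O : cstarAlgebra R) (psi : X -> O).

(* [tensor_power n Z psin], n >= 1: Z is a model of the n-fold tensor power of
   X and psin : Z -> O is the map psi^n. *)
Inductive tensor_power : nat -> forall Z : correspondence A, (Z -> O) -> Prop :=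
| tensor_power1 : tensor_power 1 psi
| tensor_powerS n (Y Z : correspondence A) (t : Y -> X -> Z)
    (psin : Y -> O) (psiSn : Z -> O) :
    tensor_power n psin -> tensor_product t ->
    linear psiSn -> continuous psiSn ->
    (forall y x, psiSn (t y x) = psin y ** psi x) ->
    tensor_power n.+1 psiSn.

Definition nonreturning_vector (n : nat) (Z : correspondence A) (psin : Z -> O)
    (z : Z) : Prop :=
  forall (m : nat) (W : correspondence A) (psim : W -> O) (w : W),
    (1 <= m < n)%N -> tensor_power m psim ->
    (psin z)^# ** psim w ** psin z = 0.

End TensorPowers.

Definition correspondence_conditionS : Prop :=
  forall (O : cstarAlgebra R) (psi : X -> O) (pi : A -> O),
  universal_covariant psi pi ->
  forall a : A, cs_positive a -> forall (n : nat) (eps : R[i]), 0 < eps ->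
  exists (m : nat) (Z : correspondence A) (psim : Z -> O) (z : Z),
    [/\ (n < m)%N, tensor_power psi m psim, nonreturning_vector psi m psim z,
        `|z| = 1 & `|a| - eps < `|hm_ip z (co_act a z)|].

End CorrespondenceNotions.

Section XAlpha.
Variables (R : realType) (L : ordinalGraph) (a : Ord).
Variables (A : cstarAlgebra R) (T : trunc L a -> A).

(* A function on \Lambda^{w^a} is extended by 0 to the whole of \Lambda. *)
Record xalpha_pre (x : L -> A) : Prop := XalphaPre {
  xp_supp : forall e, x e <> 0 -> (og_d e == ω^a)%Ord;
  xp_finite : finite_set [set e | x e <> 0];
  xp_source : forall e, T (trunc_s a e) ** x e = x e
}.

Definition xalpha_delta (e : L) : L -> A :=
  fun f => if f == e then T (trunc_s a e) else 0.

(* X, with i : X_a^o -> X, is a model of the correspondence X_a; here A and T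
   stand for O(\Lambda_a) and its generators. *)
Record xalpha (X : correspondence A) (i : (L -> A) -> X) : Prop := Xalpha {
  xa_linear : forall (k : R[i]) x y, xalpha_pre x -> xalpha_pre y ->
    i (fun e => k *: x e + y e) = k *: i x + i y;
  xa_act : forall x b, xalpha_pre x ->
    i (fun e => x e ** b) = hm_act (i x) b;
  xa_ip : forall x y, xalpha_pre x -> xalpha_pre y ->
    hm_ip (i x) (i y) = \sum_(e \in [set: L]) ((x e)^# ** y e);
  xa_dense : forall (z : X) (eps : R[i]), 0 < eps ->
    exists2 x, xalpha_pre x & `|z - i x| < eps;
  xa_left : forall (g : trunc L a) (b : A), og_word T g b ->
    forall e : L, (og_d e == ω^a)%Ord ->
    (og_s (val g) = og_r e ->
       co_act b (i (xalpha_delta e)) = i (xalpha_delta (og_comp (val g) e))) /\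
    (og_s (val g) <> og_r e -> co_act b (i (xalpha_delta e)) = 0)
}.

End XAlpha.

(* Main.v *)
(** Everything rests on one norm estimate, [ev_le]: the norm of a finite sum of
    elements T_g T_f^* in a Cuntz-Krieger family is at most its norm on any
    collection of vectors, invariant under Toeplitz families, on which no vertex
    acts as zero. Raise the self-adjoint sum b = a^* a to the power 2^k. By
    Cantor normal forms the lengths of the paths that occur take a number of
    values polynomial in 2^k; refining T_u along these lengths by relation (iv)
    splits b^(2^k) into polynomially many blocks, and condition (S) provides for
    each block a path separating its terms, so that the norm of the block can be
    read off in the other families. Taking 2^k-th roots removes the polynomial
    factor.

    A Cuntz-Krieger family on l2 of the maximal chains of prefixes shows that no
    T_v vanishes. The closure of the elements (a, p a), with a a finite sum, is a
    C*-algebra to which the universal property applies, so finite sums are dense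
    in the graph of p, and [ev_le] makes p contractive, and isometric as soon as
    no p (T_v) vanishes.

    For X_alpha, the Cuntz-Pimsner representation together with the one on l2
    is isometric, the tensor powers of X_alpha live inside its target, and it
    generates a Toeplitz family on Lambda_(alpha+1). In each component of
    Lambda_alpha pick a full non-returning path f. The combinations of the
    T_(g f') b, where f' is a tail of f and g lies in Lambda_alpha, form an
    invariant set of non-returning vectors, so by [ev_le] they compute the norm
    of O(Lambda_alpha). *)

(* Uniqueness theorems of this kind are often reduced to the fixed points of a gauge action. Lengths
   here are ordinals, whose addition is neither commutative nor right cancellative, so the possible
   lengths are counted instead. The count is polynomial because a product of sums has lengths built
   from sums and tails of the old ones: the exponents of their Cantor normal forms stay fixed, and
   only the coefficients grow, linearly in 2^k. With s exponents this gives about (2^k)^s lengths, a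
   bound of the form C B^k.

   The two sides of the estimate are asymmetric. The refinement and the upper bound for a block hold
   in every Toeplitz family; relation (iv) enters through the Cuntz-Krieger family alone, where a
   nonzero defect projection leaves room for a path that avoids all pieces. So the other families
   may be Toeplitz families tested on vectors attached to different components, which is what
   X_alpha requires. *)
From HB Require Import structures.
Require Import Defs.
From mathcomp Require Import all_boot all_order all_algebra complex finmap.
From mathcomp Require Import all_classical all_reals all_analysis.
From mathcomp Require Import ring lra.

Set Implicit Arguments.
Unset Strict Implicit.
Unset Printing Implicit Defensive.

Import Order.TTheory GRing.Theory Num.Theory.
Import numFieldNormedType.Exports.

(** * Ordinal arithmetic *)

Lemma olt_irr a : ~ olt a a.
Proof.
elim: a => I f IH [j h]; apply: (IH j).
by apply: olt_le_trans h; apply: (obelow_lt (a := olim f) j).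
Qed.

Lemma wf_olt : well_founded olt.
Proof.
suff h a b : ole b a -> Acc olt b by move=> a; apply: h (olexx a).
elim: a b => I f IH b ba; constructor=> c cb.
by have /oltP[i ci] := olt_le_trans cb ba; apply: IH ci.
Qed.

Lemma ole_gtF a b : ole a b -> ~ olt b a.
Proof. by move=> ab ba; apply: (@olt_irr a); apply: ole_lt_trans ab ba. Qed.

Lemma oltNge a b : ~ ole b a -> olt a b.
Proof. by case: (ole_total b a).1. Qed.

Lemma ole_or_lt a b : ole a b \/ olt b a.
Proof. exact: (ole_total a b).1. Qed.

Lemma olt_trans b a c : olt a b -> olt b c -> olt a c.
Proof. by move=> /oltW; apply: ole_lt_trans. Qed.

Lemma oeqxx a : oeq a a. Proof. by split; apply: olexx. Qed.

Lemma oeq_sym a b : oeq a b -> oeq b a. Proof. by case. Qed.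

Lemma oeq_trans b a c : oeq a b -> oeq b c -> oeq a c.
Proof.
by move=> [ab ba] [bc cb]; split; [apply: ole_trans ab bc|apply: ole_trans cb ba].
Qed.

Lemma ole0 a : ole ozero a. Proof. by apply/oleP => -[]. Qed.

Lemma olt0F a : ~ olt a ozero. Proof. by move/oltP => [[]]. Qed.

Lemma o0_or_gt a : oeq a ozero \/ olt ozero a.
Proof. by case: (ole_or_lt a ozero) => h; [left; split=> //; apply: ole0|right]. Qed.

Lemma olt_min (P : Ord -> Prop) a : P a ->
  exists2 b, P b & forall c, P c -> ole b c.
Proof.
move=> Pa; apply: contrapT => H; move: Pa.
have := wf_olt a; elim=> b _ IH Pb; apply: H; exists b => // c Pc.
by case: (ole_or_lt b c) => // cb; case: (IH c cb Pc).
Qed.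

Lemma oadd_oeq a b a' b' : oeq a a' -> oeq b b' -> oeq (oadd a b) (oadd a' b').
Proof.
move=> [h1 h2] [h3 h4]; split.
  exact: ole_trans (oadd_monol _ h1) (oadd_monor _ h3).
exact: ole_trans (oadd_monol _ h2) (oadd_monor _ h4).
Qed.

Lemma oaddA a b c : oeq (oadd a (oadd b c)) (oadd (oadd a b) c).
Proof.
split; first exact: oaddA_le.
elim: c => J g IH; apply/oleP => i; have /oadd_lt[h|[j h]] := obelow_lt i.
  exact: olt_le_trans h (oadd_monor _ (ole_addr _ _)).
apply: ole_lt_trans h _; apply: ole_lt_trans (IH j) _.
by apply/oadd_monor_lt/oadd_monor_lt; apply: (obelow_lt (a := olim g)).
Qed.

Lemma oaddx0 a b : oeq b ozero -> oeq (oadd a b) a.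
Proof.
move=> [b0 _]; split; last exact: ole_addr.
exact: ole_trans (oadd_monor _ b0) (oadd0 _).
Qed.

Lemma oadd0x a b : oeq a ozero -> oeq (oadd a b) b.
Proof.
move=> [a0 _]; split; last exact: ole_addl.
exact: ole_trans (oadd_monol _ a0) (o0add _).
Qed.

Lemma oadd_cancel_le a b c : ole (oadd a b) (oadd a c) -> ole b c.
Proof.
move=> h; case: (ole_or_lt b c) => // cb.
by case: (ole_gtF h); apply: oadd_monor_lt.
Qed.

Lemma oadd_cancel a b c : oeq (oadd a b) (oadd a c) -> oeq b c.
Proof. by case=> h1 h2; split; apply: oadd_cancel_le; eassumption. Qed.

Lemma oadd_cancel_lt a b c : olt (oadd a b) (oadd a c) -> olt b c.
Proof.
move=> h; apply: oltNge => cb; apply: (ole_gtF _ h); exact: oadd_monor.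
Qed.

(** The least [c] with [b <= a + c] does not overshoot: what lies below [a + c] lies below [a] or
    below some [a + c'] with [c' < c], hence below [b]. *)
Lemma osub a b : ole a b -> exists c, oeq (oadd a c) b.
Proof.
move=> ab; have [c bc min] := olt_min (P := fun c => ole b (oadd a c)) (ole_addl a b).
exists c; split=> //; apply/oleP => i; have /oadd_lt[h|[j h]] := obelow_lt i.
  exact: olt_le_trans h ab.
apply: ole_lt_trans h _; apply: oltNge => /min cj.
exact: ole_gtF cj (obelow_lt j).
Qed.

Lemma omul0 a : oeq (omul a ozero) ozero.
Proof. by split; [apply/oleP => p; have /omul_lt[[]] := obelow_lt p|apply: ole0]. Qed.

Lemma omulS a n : oeq (omul a (ofin n.+1)) (oadd (omul a (ofin n)) a).
Proof. by split; [apply: omulS_le|apply: omulS_ge]. Qed.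

Lemma omulD a n m :
  oeq (omul a (ofin (n + m))) (oadd (omul a (ofin n)) (omul a (ofin m))).
Proof.
elim: m => [|m IH].
  by rewrite addn0; apply: oeq_sym; apply: oaddx0; apply: omul0.
rewrite addnS; apply: oeq_trans (omulS _ _) _.
apply: oeq_trans (oadd_oeq IH (oeqxx a)) _.
apply: oeq_trans (oeq_sym (oaddA _ _ _)) _.
by apply: oadd_oeq (oeqxx _) (oeq_sym (omulS _ _)).
Qed.

Lemma omul1 a : oeq (omul a (ofin 1)) a.
Proof. exact: oeq_trans (omulS a 0) (oadd0x _ (omul0 a)). Qed.

Lemma omul_1D a n : oeq (omul a (ofin n.+1)) (oadd a (omul a (ofin n))).
Proof.
exact: oeq_trans (omulD a 1 n) (oadd_oeq (omul1 a) (oeqxx _)).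
Qed.

Lemma ofin_le n m : (n <= m)%N -> ole (ofin n) (ofin m).
Proof.
move=> /subnK <-; elim: (m - n)%N => [|k IH]; first exact: olexx.
by rewrite addSn; apply: ole_trans IH (oltW _); apply/olt_osucc/olexx.
Qed.

Lemma omul_le a n m : (n <= m)%N -> ole (omul a (ofin n)) (omul a (ofin m)).
Proof. by move=> nm; apply: omul_monor; apply: ofin_le. Qed.

Lemma omul_omega_lt c z : olt z (omul c oomega) -> exists n, olt z (omul c (ofin n)).
Proof.
move=> /omul_lt[n [i h]]; exists n.+1; apply: ole_lt_trans h _.
exact: olt_le_trans (oadd_monor_lt _ (obelow_lt i)) (omulS_ge _ _).
Qed.

Lemma omul_lt_omega c n : ole (omul c (ofin n)) (omul c oomega).
Proof. by apply/omul_monor/oltW; exists n; apply: olexx. Qed.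

Lemma oexpwS_ge a n : ole (omul (oexpw a) (ofin n)) (oexpw (osucc a)).
Proof.
apply: ole_trans (omul_lt_omega _ n) _; case: a => J g.
by apply/oleP => i; apply/osup_lt; exists (Some None); apply: obelow_lt.
Qed.

Lemma oexpwS_lt x a : olt x (oexpw (osucc a)) ->
  exists n, olt x (omul (oexpw a) (ofin n)).
Proof.
case: a => J g /osup_lt[[q|]].
- move=> /omul_omega_lt[n xn]; exists n; apply: olt_le_trans xn (omul_monol _ _).
  apply: oexpw_mono; case: q => [j|]; last exact: olexx.
  exact: oltW (obelow_lt (a := olim g) j).
- move=> h; exists 1; apply: olt_le_trans h _.
  apply: ole_trans (omul1 _).2; apply/oleP => i.
  have /olt_osucc h := obelow_lt i.
  by apply: ole_lt_trans h (oexpw_gt0 _).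
Qed.

Lemma oexpw_oeq a b : oeq a b -> oeq (oexpw a) (oexpw b).
Proof. by case=> h1 h2; split; apply: oexpw_mono. Qed.

Lemma olt_mulS a n : olt (omul (oexpw a) (ofin n)) (omul (oexpw a) (ofin n.+1)).
Proof.
apply: olt_le_trans (omulS_ge _ _); apply: ole_lt_trans (ole_addr _ ozero) _.
exact/oadd_monor_lt/oexpw_gt0.
Qed.

Lemma oexpwS_mul_lt a n : olt (omul (oexpw a) (ofin n)) (oexpw (osucc a)).
Proof. exact: olt_le_trans (olt_mulS a n) (oexpwS_ge a n.+1). Qed.

Lemma oexpw_ltS a : olt (oexpw a) (oexpw (osucc a)).
Proof. exact: ole_lt_trans (omul1 _).2 (oexpwS_mul_lt a 1). Qed.

Lemma osucc_le a b : olt a b -> ole (osucc a) b.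
Proof. by move=> ab; apply/oleP => i; have /olt_osucc h := obelow_lt i; apply: ole_lt_trans h ab. Qed.

Lemma oexpw_lt a b : olt a b -> olt (oexpw a) (oexpw b).
Proof.
by move=> ab; apply: olt_le_trans (oexpw_ltS a) (oexpw_mono (osucc_le ab)).
Qed.

Lemma oexpw_lt_inv a b : olt (oexpw a) (oexpw b) -> olt a b.
Proof. by move=> h; apply: oltNge => ba; apply: ole_gtF h; apply: oexpw_mono. Qed.

Lemma oexpw_ge_id x : ole x (oexpw x).
Proof.
elim: x => I f IH; apply/ole_lt => i; apply: ole_lt_trans (IH i) _.
by apply: oexpw_lt; apply: (obelow_lt (a := olim f)).
Qed.

(** The leading exponent is the least [a] with [x < ω^(a+1)]; if even [x < ω^a], the supremum that
    defines [ω^a] would provide a smaller one. *)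
Lemma lead_exp x : olt ozero x ->
  exists a, ole (oexpw a) x /\ olt x (oexpw (osucc a)).
Proof.
move=> x0.
have [a xa min] := olt_min (P := fun a => olt x (oexpw (osucc a)))
  (ole_lt_trans (oexpw_ge_id x) (oexpw_ltS x)).
exists a; split=> //; apply: contrapT => /oltNge xw.
case: a => J g in xa min xw *; have /osup_lt[[j|]] := xw.
  move=> /omul_omega_lt[n xn].
  have /min h : olt x (oexpw (osucc (g j))) by apply: olt_le_trans xn (oexpwS_ge _ _).
  exact: ole_gtF h (obelow_lt (a := olim g) j).
by move/olt_osucc => /(olt_le_trans x0)/olt_irr.
Qed.

Lemma oexpw_absorb a x : olt x (oexpw a) -> oeq (oadd x (oexpw a)) (oexpw a).
Proof.
move=> xa; split; last exact: ole_addl.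
apply/oleP => i; have /oadd_lt[h|[j h]] := obelow_lt i; first exact: olt_trans h xa.
by apply: ole_lt_trans h _; apply: oadd_oexpw xa (obelow_lt j).
Qed.

Lemma oabsorb a x y : olt x (oexpw a) -> ole (oexpw a) y -> oeq (oadd x y) y.
Proof.
move=> xa /osub[z yz].
apply: oeq_trans (oadd_oeq (oeqxx x) (oeq_sym yz)) _.
apply: oeq_trans (oaddA _ _ _) _; apply: oeq_trans yz.
by apply: oadd_oeq (oexpw_absorb xa) (oeqxx _).
Qed.

(** Used to see that a proper prefix of a path of length [ω^a] leaves a remainder of the full length
    [ω^a], so that remainders of generators are again generators. *)
Lemma oexpw_tail a x y : oeq (oadd x y) (oexpw a) -> olt ozero y ->
  olt x (oexpw a) /\ oeq y (oexpw a).
Proof.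
move=> xy y0; have xa : olt x (oexpw a).
  apply: olt_le_trans xy.1; apply: ole_lt_trans (ole_addr _ ozero) _.
  exact: oadd_monor_lt.
split=> //; split; first exact: ole_trans (ole_addl _ _) xy.1.
case: (ole_or_lt (oexpw a) y) => // ya.
by case: (ole_gtF xy.2); apply: oadd_oexpw.
Qed.

(** Iterating the equation puts [n] copies of [c] below [w], so [w] dominates every [ω^a * n]. *)
Lemma oadd_fix_ge a c w : oeq (oadd c w) w -> ole (oexpw a) c ->
  ole (oexpw (osucc a)) w.
Proof.
move=> cw ac; have h n : ole (omul (oexpw a) (ofin n)) w.
  elim: n => [|n IH]; first exact: ole_trans (omul0 _).1 (ole0 _).
  apply: ole_trans (omul_1D _ _).1 _; apply: ole_trans cw.1.
  exact: ole_trans (oadd_monol _ ac) (oadd_monor _ IH).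
apply/oleP => i; have /oexpwS_lt[n xn] := obelow_lt i.
exact: olt_le_trans xn (h n).
Qed.

Lemma omul_lt_split a m x : olt x (omul (oexpw a) (ofin m.+1)) ->
  exists j r, [/\ (j <= m)%N, olt r (oexpw a) & oeq x (oadd (omul (oexpw a) (ofin j)) r)].
Proof.
elim: m => [|m IH] h.
  exists 0, x; split=> //; first exact: olt_le_trans h (omul1 _).1.
  by apply: oeq_sym; apply: oadd0x; apply: omul0.
case: (ole_or_lt (omul (oexpw a) (ofin m.+1)) x) => [mx|/IH[j [r [jm ra xj]]]]; last first.
  by exists j, r; split=> //; apply: ltnW.
have [r rx] := osub mx; exists m.+1, r; split=> //; last exact: oeq_sym.
apply: (@oadd_cancel_lt (omul (oexpw a) (ofin m.+1))); apply: ole_lt_trans rx.1 _.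
exact: olt_le_trans h (omulS _ _).1.
Qed.

(** As [ω^a <= y], the remainder of [x] below [ω^a] is absorbed, and the multiples of [ω^a] add
    without a carry. *)
Lemma oadd_lt_mul a m k x y : olt x (omul (oexpw a) (ofin m.+1)) ->
  ole (oexpw a) y -> olt y (omul (oexpw a) (ofin k.+1)) ->
  olt (oadd x y) (omul (oexpw a) (ofin (m + k).+1)).
Proof.
move=> /omul_lt_split[j [r [jm ra xj]]] ay yk.
apply: ole_lt_trans (oadd_oeq xj (oeqxx y)).1 _.
apply: ole_lt_trans (oaddA _ _ _).2 _.
apply: ole_lt_trans (oadd_monor _ (oabsorb ra ay).1) _.
apply: olt_le_trans (oadd_monor_lt _ yk) _.
apply: ole_trans (omulD _ _ _).2 _.
by apply: omul_le; rewrite addnS ltnS leq_add2r.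
Qed.

Lemma omul_lt_mono a n m : (n < m)%N -> olt (omul (oexpw a) (ofin n)) (omul (oexpw a) (ofin m)).
Proof. by move=> nm; apply: olt_le_trans (olt_mulS a n) (omul_le _ nm). Qed.

(* Ordinals sum_i ω^{α_i} k_i with coefficients k_i <= m. *)
Fixpoint cnf (Ex : seq Ord) (m : nat) (x : Ord) : Prop :=
  if Ex is a :: r then
    exists k y, [/\ (k <= m)%N, cnf r m y & oeq x (oadd (omul (oexpw a) (ofin k)) y)]
  else oeq x ozero.

Fixpoint decr (Ex : seq Ord) : Prop :=
  if Ex is a :: r then decr r /\ (if r is b :: _ then olt b a else True) else True.

(** Representatives of all values of [cnf Ex m]. Ordinals are compared by [oeq], so the number of
    values is counted through positions in this list. *)
Fixpoint cnf_codes (Ex : seq Ord) (m : nat) : seq Ord :=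
  if Ex is a :: r then
    [seq oadd (omul (oexpw a) (ofin k)) y | k <- iota 0 m.+1, y <- cnf_codes r m]
  else [:: ozero].

Lemma cnf_codes_cons a r m : cnf_codes (a :: r) m =
  [seq oadd (omul (oexpw a) (ofin k)) y | k <- iota 0 m.+1, y <- cnf_codes r m].
Proof. by []. Qed.

Lemma size_cnf_codes Ex m : size (cnf_codes Ex m) = (m.+1 ^ size Ex)%N.
Proof.
by elim: Ex => // a r IH; rewrite cnf_codes_cons size_allpairs size_iota IH expnS.
Qed.

Lemma cnf_code Ex m x : cnf Ex m x ->
  exists2 i, (i < size (cnf_codes Ex m))%N & oeq x (nth ozero (cnf_codes Ex m) i).
Proof.
elim: Ex x => [|a r IH] x; first by exists 0.
move=> [k [y [km /IH[i ir yi] xk]]].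
(* The position of the pair [(k, i)] when the pairs are listed by [k] first. *)
exists (k * size (cnf_codes r m) + i)%N.
  rewrite cnf_codes_cons size_allpairs size_iota; apply: (@leq_trans (k.+1 * size (cnf_codes r m))).
    by rewrite mulSn addnC ltn_add2r.
  by rewrite leq_mul2r ltnS km orbT.
apply: oeq_trans xk _.
suff -> : nth ozero (cnf_codes (a :: r) m) (k * size (cnf_codes r m) + i) =
    oadd (omul (oexpw a) (ofin k)) (nth ozero (cnf_codes r m) i).
  exact: oadd_oeq (oeqxx _) yi.
rewrite cnf_codes_cons.
have : (k < m.+1)%N by rewrite ltnS.
move: (m.+1) => N kN.
suff gen s j : (j < size s)%N ->
  nth ozero [seq oadd (omul (oexpw a) (ofin k)) y | k <- s, y <- cnf_codes r m]
    (j * size (cnf_codes r m) + i) =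
  oadd (omul (oexpw a) (ofin (nth 0 s j))) (nth ozero (cnf_codes r m) i).
  by rewrite gen ?size_iota // nth_iota.
elim: s j => [//|k' s IHs] [|j] /= js.
  by rewrite nth_cat size_map ir (nth_map ozero).
rewrite nth_cat size_map mulSn -addnA ltnNge leq_addr /=.
by rewrite addKn IHs.
Qed.

Lemma cnf_oeq Ex m x y : oeq x y -> cnf Ex m x -> cnf Ex m y.
Proof.
case: Ex => [|a r] xy; first by apply: oeq_trans (oeq_sym xy).
move=> [k [z [km zr xk]]]; exists k, z; split=> //.
exact: oeq_trans (oeq_sym xy) xk.
Qed.

Lemma cnf_le Ex m n x : (m <= n)%N -> cnf Ex m x -> cnf Ex n x.
Proof.
move=> mn; elim: Ex x => //= a r IH x [k [y [km yr xk]]].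
by exists k, y; split=> //; [apply: leq_trans mn|apply: IH].
Qed.

Lemma cnf0 Ex m : cnf Ex m ozero.
Proof.
elim: Ex => [|a r IH] /=; first exact: oeqxx.
exists 0, ozero; split=> //; apply: oeq_sym; apply: oadd0x; exact: omul0.
Qed.

Lemma cnf_consl a r m y : cnf r m y -> cnf (a :: r) m y.
Proof.
move=> yr; exists 0, y; split=> //; apply: oeq_sym; apply: oadd0x; exact: omul0.
Qed.

Lemma cnf_lt a r m y : decr (a :: r) -> cnf r m y -> olt y (oexpw a).
Proof.
elim: r a y => [|b r IH] a y /=.
  by move=> _ y0; apply: ole_lt_trans y0.1 (oexpw_gt0 _).
move=> [dr ba] [k [z [km zr yk]]]; apply: ole_lt_trans yk.1 _.
apply: oadd_oexpw; last exact: olt_trans (IH b z dr zr) (oexpw_lt ba).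
exact: olt_le_trans (oexpwS_mul_lt b k) (oexpw_mono (osucc_le ba)).
Qed.

(** If the leading coefficient of [y] is zero, the lower parts are added; otherwise the leading term
    of [y] absorbs the lower part of [x]. Either way no exponent is created and coefficients at most
    add. *)
Lemma cnfD Ex m n x y : decr Ex -> cnf Ex m x -> cnf Ex n y ->
  cnf Ex (m + n) (oadd x y).
Proof.
elim: Ex x y => [|a r IH] x y.
  by move=> _ x0 y0 /=; apply: oeq_trans (oadd0x _ x0) y0.
move=> dr [k [x' [km xr xk]]] [k' [y' [kn yr yk]]].
have [k0|k0] := posnP k'.
  exists k, (oadd x' y'); split; first exact: leq_trans km (leq_addr _ _).
    by apply: IH => //; case: dr.
  apply: oeq_trans (oeq_sym (oaddA _ _ _)).
  apply: oadd_oeq xk _; apply: oeq_trans yk _.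
  by rewrite k0; apply: oadd0x; apply: omul0.
exists (k + k')%N, y'; split; first exact: leq_add.
  exact: cnf_le (leq_addl _ _) yr.
apply: oeq_trans (oadd_oeq xk yk) _.
apply: oeq_trans (oeq_sym (oaddA _ _ _)) _.
apply: oeq_trans (oadd_oeq (oeqxx _) (oaddA _ _ _)) _.
apply: oeq_trans (oaddA _ _ _) _; apply: oadd_oeq (oeqxx _).
apply: oeq_trans (oeq_sym (omulD _ _ _)).
apply: oadd_oeq (oeqxx _) _; apply: (@oabsorb a).
  exact: cnf_lt dr xr.
exact: ole_trans (omul1 _).2 (omul_le _ k0).
Qed.

(** Removing an initial segment never raises a coefficient. With [cnfD] this controls the lengths in
    products of formal sums. *)
Lemma cnf_tail Ex m x y : cnf Ex m (oadd x y) -> cnf Ex m y.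
Proof.
elim: Ex x y => [|a r IH] x y.
  by move=> [xy _]; split; [apply: ole_trans (ole_addl _ _) xy|apply: ole0].
move=> [k [z [km zr xyk]]].
case: (ole_or_lt (omul (oexpw a) (ofin k)) x) => [/osub[x' xx']|xk].
  apply: cnf_consl; apply: (IH x'); apply: cnf_oeq zr.
  apply: oeq_sym; apply: (@oadd_cancel (omul (oexpw a) (ofin k))).
  apply: oeq_trans xyk; apply: oeq_trans (oaddA _ _ _) _.
  by apply: oadd_oeq xx' (oeqxx _).
case: k => [|k] in km xyk xk *; first by case: (@olt0F x); apply: olt_le_trans xk (omul0 _).1.
have [j [rho [jk ra xj]]] := omul_lt_split xk.
exists (k.+1 - j)%N, z; split=> //; first exact: leq_trans (leq_subr _ _) km.
apply: (@oadd_cancel x); apply: oeq_trans xyk _.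
have kE : k.+1 = (j + (k.+1 - j))%N by rewrite subnKC // ltnW.
apply: oeq_sym; apply: oeq_trans (oaddA _ _ _) _; apply: oadd_oeq (oeqxx _).
apply: oeq_trans (oadd_oeq xj (oeqxx _)) _.
apply: oeq_trans (oeq_sym (oaddA _ _ _)) _.
rewrite [X in oeq _ (omul _ (ofin X))]kE; apply: oeq_trans (oeq_sym (omulD _ _ _)).
apply: oadd_oeq (oeqxx _) _; apply: (oabsorb ra).
apply: ole_trans (omul1 _).2 _; apply: omul_le.
by rewrite subn_gt0 ltnS.
Qed.

(** The last clause carries the induction: it keeps the list decreasing when a larger exponent is
    put back in front. *)
Lemma cnf_insert Ex b : decr Ex -> exists Ex', [/\ decr Ex',
  forall m x, cnf Ex m x -> cnf Ex' m x, cnf Ex' 1 (oexpw b) &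
  forall c, decr (c :: Ex) -> olt b c -> decr (c :: Ex')].
Proof.
have one r c b' : oeq b' c -> cnf (c :: r) 1 (oexpw b').
  move=> bc; apply: cnf_oeq (oexpw_oeq (oeq_sym bc)) _.
  exists 1, ozero; split=> //; first exact: cnf0.
  by apply: oeq_sym; apply: oeq_trans (oaddx0 _ (oeqxx _)) (omul1 _).
elim: Ex => [|a r IH] dr.
  exists [:: b]; split=> //; last exact: one (oeqxx _).
  by move=> m x; apply: cnf_consl.
case: (ole_or_lt a b) => ab.
  case: (ole_or_lt b a) => ba.
    by exists (a :: r); split=> //; apply: one.
  exists (b :: a :: r); split=> //; last exact: one (oeqxx _).
  by move=> m x; apply: cnf_consl.
have [Ex' [dE inE bE hE]] := IH dr.1.
exists (a :: Ex'); split; first exact: hE.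
- by move=> m x [k [y [km yr xk]]]; exists k, y; split=> //; apply: inE.
- exact: cnf_consl.
- by move=> c [_ ac] _; split=> //; apply: hE.
Qed.

Lemma cnf_exists1 Ex x : decr Ex -> exists Ex' m, [/\ decr Ex',
  forall n y, cnf Ex n y -> cnf Ex' n y & cnf Ex' m x].
Proof.
elim: (wf_olt x) Ex => {}x _ IH Ex dE.
have [x0|/lead_exp[a [ax xa]]] := o0_or_gt x.
  by exists Ex, 0; split=> //; apply: cnf_oeq (oeq_sym x0) (cnf0 _ _).
have [y xy] := osub ax.
(* Otherwise [ω^a + x = x], which forces [ω^(a+1) <= x]. *)
have yx : olt y x.
  apply: oltNge => xy'; apply: ole_gtF xa.
  apply: (oadd_fix_ge (c := oexpw a) (w := x)); last exact: olexx.
  split; last exact: ole_addl.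
  by apply: ole_trans xy.1; apply: oadd_monor.
have [E1 [m [d1 i1 y1]]] := IH y yx Ex dE.
have [E2 [d2 i2 a2 _]] := cnf_insert a d1.
exists E2, (1 + m)%N; split=> //; first by move=> n z /i1/i2.
by apply: cnf_oeq xy _; apply: cnfD => //; apply: i2.
Qed.

Lemma cnf_exists (I : eqType) (s : seq I) (d : I -> Ord) :
  exists Ex m, decr Ex /\ forall i, i \in s -> cnf Ex m (d i).
Proof.
elim: s => [|i s [E [m [dE sE]]]]; first by exists [::], 0.
have [E' [n [dE' EE' iE']]] := cnf_exists1 (d i) dE.
exists E', (n + m)%N; split=> // j; rewrite inE => /orP[/eqP->|/sE jE].
  exact: cnf_le (leq_addr _ _) iE'.
by apply: EE'; apply: cnf_le (leq_addl _ _) jE.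
Qed.

(** * Finite sets of lengths given by their increments *)

(** The levels are the partial sums of [ds]. Increments are stored instead of levels, since paths
    will be cut into pieces of these lengths. *)
Fixpoint levels (ds : seq Ord) (x : Ord) : Prop :=
  oeq x ozero \/
  if ds is d :: ds' then exists2 y, levels ds' y & oeq x (oadd d y) else False.

Fixpoint allpos (ds : seq Ord) : Prop :=
  if ds is d :: ds' then olt ozero d /\ allpos ds' else True.

Lemma levels0 ds x : oeq x ozero -> levels ds x.
Proof. by case: ds; left. Qed.

Lemma levels_insert ds a : allpos ds -> exists ds', [/\ allpos ds',
  (size ds' <= (size ds).+1)%N,
  forall x, levels ds x -> levels ds' x, levels ds' a &
  forall x, levels ds' x -> levels ds x \/ oeq x a].
Proof.
elim: ds a => [|d ds IH] a.
  move=> _; have [a0|a0] := o0_or_gt a.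
    by exists [::]; split=> //; [left|move=> x; left].
  exists [:: a]; split=> //.
  - by move=> x [x0|//]; left.
  - by right; exists ozero; [apply: levels0; apply: oeqxx|apply: oeq_sym; apply: oaddx0; apply: oeqxx].
  - move=> x [x0|[y [y0|//] xy]]; first by left; left.
    by right; apply: oeq_trans xy (oaddx0 _ y0).
move=> [d0 p]; have [a0|a0] := o0_or_gt a.
  exists (d :: ds); split=> //; first exact: levels0.
  by move=> x; left.
case: (ole_or_lt d a) => [/osub[a' aa']|ad].
  have [ds' [p' s' i' a'' c']] := IH a' p.
  exists (d :: ds'); split=> //.
  - by move=> x [x0|[y /i' ? ?]]; [left|right; exists y].
  - by right; exists a' => //; apply: oeq_sym.
  - move=> x [x0|[y /c' [yl|ya] xy]]; first by left; left.
      by left; right; exists y.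
    right; apply: oeq_trans xy _; apply: oeq_trans aa'.
    exact: oadd_oeq (oeqxx _) ya.
(* The new level falls strictly inside the first increment, which is split as [d = a + d']. *)
have [d' add'] := osub (oltW ad).
have d'0 : olt ozero d'.
  have [d'0|//] := o0_or_gt d'; case: (ole_gtF (a := d) (b := a)) => //.
  by apply: ole_trans add'.2 (oaddx0 _ d'0).1.
exists (a :: d' :: ds); split=> //.
- move=> x [x0|[y yl xy]]; first by left.
  right; exists (oadd d' y); first by right; exists y => //; apply: oeqxx.
  apply: oeq_trans xy _; apply: oeq_trans (oeq_sym (oaddA _ _ _)).
  exact: oadd_oeq (oeq_sym add') (oeqxx _).
- by right; exists ozero; [left; apply: oeqxx|apply: oeq_sym; apply: oaddx0; apply: oeqxx].
- move=> x [x0|[y [y0|[z zl yz]] xy]]; first by left; left.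
    by right; apply: oeq_trans xy (oaddx0 _ y0).
  left; right; exists z => //; apply: oeq_trans xy _.
  apply: oeq_trans (oadd_oeq (oeqxx _) yz) _; apply: oeq_trans (oaddA _ _ _) _.
  exact: oadd_oeq add' (oeqxx _).
Qed.

(** The last clause says that apart from zero no level is new, so that height bounds for the [d i]
    hold for all levels. *)
Lemma levels_cover (I : eqType) (s : seq I) (d : I -> Ord) :
  exists ds, [/\ allpos ds, (size ds <= size s)%N,
  forall i, i \in s -> levels ds (d i) &
  forall x, levels ds x -> oeq x ozero \/ exists2 i, i \in s & oeq x (d i)].
Proof.
elim: s => [|a s [ds [p sz inds out]]].
  by exists [::]; split=> // x [x0|//]; left.
have [ds' [p' sz' i' a' c']] := levels_insert (d a) p.
exists ds'; split=> //; first exact: leq_trans sz' _.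
  by move=> b; rewrite inE => /orP[/eqP->|/inds/i'].
move=> x /c'[/out[x0|[b bs xb]]|xa]; first by left.
  by right; exists b => //; rewrite inE bs orbT.
by right; exists a => //; rewrite inE eqxx.
Qed.

(** * Prefix order of an ordinal graph *)

Local Notation "e • f" := (og_comp e f) (at level 40, left associativity).

Definition og_perp (L : ordinalGraph) (e f : L) : Prop :=
  ~ og_ext e f /\ ~ og_ext f e.

Section Prefix.
Variable L : ordinalGraph.
Implicit Types c e f g h v w : L.

Lemma og_split e a : ole a (og_d e) -> exists f g, og_splits e a f g.
Proof. by move=> /og_factor[[f g] [[? ? ?] _]]; exists f, g. Qed.

Lemma og_factor_inj e f e' f' : og_s e = og_r f -> og_s e' = og_r f' ->
  oeq (og_d e) (og_d e') -> e • f = e' • f' -> e = e' /\ f = f'.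
Proof.
move=> ef ef' dd E.
have le : ole (og_d e) (og_d (e • f)).
  by apply: ole_trans (og_dM ef).2; apply: ole_addr.
have [p [_ uniq]] := og_factor le.
have h1 := uniq (e, f) (And3 ef (oeqxx _) (erefl _)).
have h2 := uniq (e', f') (And3 ef' (oeq_sym dd) E).
by move: h1; rewrite h2 => -[-> ->].
Qed.

Lemma og_cancel e f f' : og_s e = og_r f -> og_s e = og_r f' ->
  e • f = e • f' -> f = f'.
Proof. by move=> h h' E; case: (og_factor_inj h h' (oeqxx _) E). Qed.

Lemma og_d_eq0 e : oeq (og_d e) ozero -> og_r e = e.
Proof.
move=> d0; have [] // := @og_factor_inj (og_r e) e e (og_s e).
- by rewrite og_sr.
- by rewrite og_rs.
- exact: oeq_trans (og_d1 e) (oeq_sym d0).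
- by rewrite og_idl og_idr.
Qed.

Lemma og_d_vertex v : og_vertex v -> oeq (og_d v) ozero.
Proof. by move=> <-; apply: og_d1. Qed.

Lemma og_s_vertex v : og_vertex v -> og_s v = v.
Proof. by move=> h; rewrite -h og_sr. Qed.

Lemma og_vertex_r e : og_vertex (og_r e). Proof. exact: og_rr. Qed.
Lemma og_vertex_s e : og_vertex (og_s e). Proof. exact: og_rs. Qed.

Lemma og_ext_refl e : og_ext e e.
Proof. by exists (og_s e); rewrite ?og_rs ?og_idr. Qed.

Lemma og_ext_comp e f : og_s e = og_r f -> og_ext e (e • f).
Proof. by exists f. Qed.

Lemma og_ext_trans f e g : og_ext e f -> og_ext f g -> og_ext e g.
Proof.
move=> [x ex ->] [y fy ->]; rewrite og_sM // in fy.
by exists (x • y); rewrite ?og_rM // og_compA.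
Qed.

Lemma og_ext_d e f : og_ext e f -> ole (og_d e) (og_d f).
Proof. by move=> [x ex ->]; apply: ole_trans (og_dM ex).2; apply: ole_addr. Qed.

Lemma og_ext_r e f : og_ext e f -> og_r f = og_r e.
Proof. by move=> [x ex ->]; rewrite og_rM. Qed.

Lemma og_ext_le e f h : og_ext e h -> og_ext f h -> ole (og_d e) (og_d f) ->
  og_ext e f.
Proof.
move=> [x ex ->] [y fy E] /og_split[f1 [f2 [s12 d1 fE]]].
have sf2 : og_s f2 = og_r y by rewrite -fy fE og_sM.
rewrite fE -og_compA // in E.
have [eE _] : e = f1 /\ x = f2 • y.
  by apply: og_factor_inj => //; rewrite ?og_rM //; apply: oeq_sym.
by exists f2; rewrite eE.
Qed.

Lemma og_ext_eq e f h : og_ext e h -> og_ext f h -> oeq (og_d e) (og_d f) -> e = f.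
Proof.
move=> [x ex ->] [y fy E] d; by case: (og_factor_inj ex fy d E).
Qed.

Lemma og_ext_comparable e f h : og_ext e h -> og_ext f h -> og_ext e f \/ og_ext f e.
Proof.
move=> eh fh; case: (ole_or_lt (og_d e) (og_d f)) => [|/oltW] d.
  by left; apply: og_ext_le eh fh d.
by right; apply: og_ext_le fh eh d.
Qed.

Lemma og_ext_antisym e f : og_ext e f -> ole (og_d f) (og_d e) -> e = f.
Proof. by move=> ef fe; apply: (og_ext_eq ef (og_ext_refl f)); split=> //; apply: og_ext_d. Qed.

Lemma og_perpP e f : (og_ext e `&` og_ext f = set0)%classic <-> og_perp e f.
Proof.
split=> [E|[ef fe]].
  split=> h.
    suff : (og_ext e `&` og_ext f)%classic f by rewrite E.
    by split=> //; apply: og_ext_refl.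
  suff : (og_ext e `&` og_ext f)%classic e by rewrite E.
  by split=> //; apply: og_ext_refl.
apply/seteqP; split=> // x [ex fx].
by case: (og_ext_comparable ex fx).
Qed.

Lemma og_perp_sym e f : og_perp e f -> og_perp f e. Proof. by case. Qed.

Lemma og_perp_ext e f e' f' : og_perp e f -> og_ext e e' -> og_ext f f' ->
  og_perp e' f'.
Proof.
move=> [ef fe] ee' ff'; split=> h.
  by case: (og_ext_comparable (og_ext_trans ee' h) ff').
by case: (og_ext_comparable ee' (og_ext_trans ff' h)).
Qed.

Lemma og_ext_compl e f g : og_s g = og_r e -> og_s g = og_r f ->
  og_ext (g • e) (g • f) <-> og_ext e f.
Proof.
move=> ge gf; split=> [[x]|[x ex fE]].
  rewrite og_sM // => ex; rewrite -og_compA // => /og_cancel -> //.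
    by exists x.
  by rewrite og_rM.
by exists x; rewrite ?og_sM // fE -?og_compA.
Qed.

Lemma og_perp_compl e f g : og_s g = og_r e -> og_s g = og_r f ->
  og_perp (g • e) (g • f) <-> og_perp e f.
Proof. by move=> ge gf; rewrite /og_perp !og_ext_compl. Qed.

Lemma og_perp_d e f : oeq (og_d e) (og_d f) -> e <> f -> og_perp e f.
Proof.
move=> [d d'] ne; split=> h; apply: ne; first exact: og_ext_antisym h d'.
by apply/esym; apply: og_ext_antisym h d.
Qed.

Lemma og_perp_r e f : og_r e <> og_r f -> og_perp e f.
Proof. by move=> ne; split=> /og_ext_r // h; apply: ne. Qed.

Lemma og_not_perp e f : ~ og_perp e f -> og_ext e f \/ og_ext f e.
Proof.
by move=> h; case: (pselect (og_ext e f)) => ef; [left|right; apply: contrapT => fe; apply: h].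
Qed.

Lemma og_perp_irr e f : og_perp e f -> e <> f.
Proof. by move=> [h _] ef; apply: h; rewrite ef; apply: og_ext_refl. Qed.

Lemma og_perpxx e f h : og_ext e h -> og_ext f h -> ~ og_perp e f.
Proof. by move=> eh fh [a b]; case: (og_ext_comparable eh fh). Qed.

Lemma og_d_pos c : og_r c <> c -> olt ozero (og_d c).
Proof. by move=> h; case: (o0_or_gt (og_d c)) => // /og_d_eq0. Qed.

Lemma omul_bound a (I : eqType) (s : seq I) (d : I -> Ord) :
  (forall i, i \in s -> olt (d i) (oexpw (osucc a))) ->
  exists N, forall i, i \in s -> olt (d i) (omul (oexpw a) (ofin N)).
Proof.
elim: s => [|i s IH] H; first by exists 0.
have [N hN] := IH (fun j js => H j (mem_behead (s := i :: s) js)).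
have [M hM] := oexpwS_lt (H i (mem_head i s)).
exists (N + M)%N => j; rewrite inE => /orP[/eqP->|/hN h].
  exact: olt_le_trans hM (omul_le _ (leq_addl _ _)).
exact: olt_le_trans h (omul_le _ (leq_addr _ _)).
Qed.

End Prefix.

(** * Separating paths *)

(* The form in which condition (S) enters the uniqueness theorem: one path [h]
   shows that all cycles at [v] with leading exponent [a] and bounded length
   have no periodic continuation. *)
Definition og_separating (L : ordinalGraph) : Prop :=
  forall (v c0 : L) (a : Ord) (N : nat), og_r c0 = v -> og_s c0 = v ->
    ole (oexpw a) (og_d c0) -> olt (og_d c0) (oexpw (osucc a)) ->
  exists h : L, [/\ og_r h = v, olt (og_d h) (oexpw (osucc a)) &
    forall c : L, og_r c = v -> og_s c = v -> ole (oexpw a) (og_d c) ->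
      olt (og_d c) (omul (oexpw a) (ofin N)) -> og_perp (c • h) h].

Section CondS.
Variable L : ordinalGraph.

Lemma ole_tail a x y : olt x (oexpw a) -> ole (oexpw a) (oadd x y) -> ole (oexpw a) y.
Proof.
move=> xa axy; case: (ole_or_lt (oexpw a) y) => // ya.
by case: (ole_gtF axy); apply: oadd_oexpw.
Qed.

(** Fullness of [f = e1 e2] gives a short path [k] from the tail [e2] to [v]; take [h = k e2]. If
    [c h] and [h] were comparable, then [c h = h x]. Cancelling [k] by [c k = k c'] leaves
    [c' e2 = e2 x], and this makes [f] return to itself. *)
Lemma og_conditionS_separating : og_conditionS L -> og_separating L.
Proof.
move=> S v c0 a N rc0 sc0 ac0 c0a.
have [e0 [e0' [_ de0 _]]] := og_split ac0.
(* Length [ω^a (N + 1)] and not [ω^a N]: the conjugate [c'] in [c k = k c'] can be longer than [c]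
   by an amount below [ω^a], and it still has to be shorter than [f]. *)
have [f [[[n dfn] nret] full Ff nf fa]] := S a (ex_intro _ e0 de0)
  [set f : trunc L a | og_connected (trunc_r a v : trunc L a) f]%classic
  (ex_intro _ (trunc_r a v : trunc L a) (erefl _)) N.+1.
have vv : og_r v = v by rewrite -rc0 og_rr.
have [||b [e1 [e2 [k [ba [s12 de1 fE] sk rk]]]]] := full (trunc_r a v : trunc L a) => //.
  by apply: val_inj; rewrite /= og_rr.
have {}sk : og_s (val k) = og_s e1 by move/(congr1 val): sk.
have {}rk : og_r (val k) = v by move/(congr1 val): rk => /= ->.
have ka : olt (og_d (val k)) (oexpw a) by apply/asboolP/(valP k).
have kle : og_s (val k) = og_r e2 by rewrite sk.
have de1a : olt (og_d e1) (oexpw a) by apply: ole_lt_trans de1.1 ba.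
have aN n' : ole (oexpw a) (omul (oexpw a) (ofin n'.+1)).
  exact: ole_trans (omul1 _).2 (omul_le _ _).
have df : oeq (og_d f) (oadd (og_d e1) (og_d e2)) by rewrite {1}fE; apply: og_dM.
have ae2 : ole (oexpw a) (og_d e2).
  by apply: ole_tail de1a _; apply: ole_trans df.1; apply: ole_trans nf.
have de2 : oeq (og_d f) (og_d e2) by apply: oeq_trans df (oabsorb de1a ae2).
have dh : oeq (og_d (val k • e2)) (og_d e2).
  exact: oeq_trans (og_dM kle) (oabsorb ka ae2).
exists (val k • e2); split.
- by rewrite og_rM.
- by apply: ole_lt_trans dh.1 _; apply: ole_lt_trans de2.2 fa.
move=> c rc sc ac cN.
have sch : og_s c = og_r (val k • e2) by rewrite og_rM // rk.
have sck : og_s c = og_r (val k) by rewrite rk.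
apply: contrapT => /og_not_perp np.
have {np} : og_ext (val k • e2) (c • (val k • e2)).
  case: np => // h; apply: og_ext_le (og_ext_refl _) h _.
  by apply: ole_trans (og_dM sch).2; apply: ole_addl.
move=> [x sx E].
have sckk : og_s (c • val k) = og_s (val k) by rewrite og_sM.
have E' : (c • val k) • e2 = val k • (e2 • x).
  by rewrite -og_compA // E og_compA // -sx og_sM.
have se2x : og_s e2 = og_r x by rewrite -sx og_sM.
have kck : og_ext (val k) (c • val k).
  apply: (@og_ext_le _ _ _ ((c • val k) • e2)).
  - by rewrite E'; apply: og_ext_comp; rewrite og_rM.
  - by apply: og_ext_comp; rewrite sckk.
  apply: ole_trans (oltW ka) _; apply: ole_trans ac _.
  exact: ole_trans (ole_addr _ _) (og_dM sck).2.
case: kck => c' sc' ckE.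
have sc'e2 : og_s c' = og_r e2 by rewrite -kle -sckk ckE og_sM.
have {}E' : c' • e2 = e2 • x.
  apply: (@og_cancel _ (val k)); rewrite ?og_rM //.
  by rewrite og_compA // -ckE.
have dkc : oeq (oadd (og_d (val k)) (og_d c')) (oadd (og_d c) (og_d (val k))).
  apply: oeq_trans (oeq_sym (og_dM sc')) _; rewrite -ckE; exact: og_dM.
have ac' : ole (oexpw a) (og_d c').
  apply: (ole_tail ka); apply: ole_trans dkc.2; exact: ole_trans ac (ole_addr _ _).
have c'N : olt (og_d c') (omul (oexpw a) (ofin N.+1)).
  apply: ole_lt_trans (ole_addl (og_d (val k)) _) _; apply: ole_lt_trans dkc.1 _.
  apply: olt_le_trans (omulS _ _).2.
  exact: ole_lt_trans (oadd_monol _ (oltW cN)) (oadd_monor_lt _ ka).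
have c'e2 : olt (og_d c') (og_d e2).
  by apply: olt_le_trans c'N _; apply: ole_trans nf de2.1.
have [y sy e2E] : og_ext c' e2.
  apply: (@og_ext_le _ _ _ (c' • e2)); last exact: oltW.
    exact: og_ext_comp.
  by rewrite E'; apply: og_ext_comp.
have se1c' : og_s e1 = og_r c' by rewrite -sc' sk.
(* Following [f] along [e1 c'] and then restarting at its tail [e2] gives
   [e1 c' e2 = e1 e2 x = f x]. *)
apply: (nret (og_d (e1 • c')) b (e1 • c') y e1 e2).
- apply: ole_trans (og_dM se1c').2; exact: ole_trans ac' (ole_addl _ _).
- apply: ole_lt_trans (og_dM se1c').1 _; apply: olt_le_trans df.2.
  exact: oadd_monor_lt.
- exact: ba.
- by split; [rewrite og_sM|apply: oeqxx|rewrite {1}fE e2E og_compA].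
- by split.
- by rewrite og_sM.
by exists x; [rewrite fE og_sM|rewrite -og_compA // E' og_compA // fE].
Qed.

Lemma og_ext_trunc b (e f : trunc L b) : og_ext e f <-> og_ext (val e) (val f).
Proof.
split=> [[x ex ->]|[x ex fE]].
  have sx : og_s (val e) = og_r (val x) by move/(congr1 val): ex.
  by exists (val x); rewrite ?val_trunc_comp.
have hx : og_small b x.
  apply/asboolP; have /asboolP fb := valP f; apply: ole_lt_trans fb.
  by rewrite fE; apply: ole_trans (og_dM ex).2; apply: ole_addl.
exists (exist _ x hx); first exact: val_inj.
by apply: val_inj; rewrite val_trunc_comp.
Qed.

Lemma og_perp_trunc b (e f : trunc L b) : og_perp e f <-> og_perp (val e) (val f).
Proof. by rewrite /og_perp !og_ext_trunc. Qed.

(** A cycle shorter than [ω^b] has leading exponent [a < b], so [h], being shorter than [ω^(a+1)],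
    stays in the truncation. *)
Lemma og_separating_trunc b : og_separating L -> og_separating (trunc L b).
Proof.
move=> S v c0 a N rc0 sc0 ac0 c0a.
have cb : olt (og_d (val c0)) (oexpw b) by apply/asboolP/(valP c0).
have sab : ole (oexpw (osucc a)) (oexpw b).
  by apply/oexpw_mono/osucc_le/oexpw_lt_inv; apply: ole_lt_trans ac0 cb.
have [h [rh ha sep]] := S (val v) (val c0) a N (congr1 val rc0) (congr1 val sc0) ac0 c0a.
have hb : og_small b h by apply/asboolP; apply: olt_le_trans ha sab.
exists (exist _ h hb); split=> //; first exact: val_inj.
move=> c rc sc ac cN; apply/og_perp_trunc; rewrite val_trunc_comp /=.
  by apply: sep => //; [rewrite -rc|rewrite -sc].
by rewrite rh -sc.
Qed.

End CondS.

Lemma sub_in_count_lt (T : eqType) (a b : pred T) (s : seq T) (x : T) :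
  {in s, forall y, a y -> b y} -> x \in s -> b x -> ~~ a x ->
  (count a s < count b s)%N.
Proof.
elim: s => // y s IH ab; rewrite inE => /orP[/eqP<-|xs] bx ax /=.
  rewrite bx (negbTE ax) add0n add1n ltnS; elim: s ab {IH} => // z s IHs ab /=.
  rewrite leq_add ?IHs //; last first.
    by move=> t; rewrite inE => /orP[/eqP->|ts]; apply: ab; rewrite !inE ?eqxx ?ts ?orbT.
  by case: (a z) (ab z) => // ->; rewrite // !inE eqxx orbT.
have /(_ xs bx ax) h := IH (fun t ts => ab t (mem_behead (s := y :: s) ts)).
by rewrite -addnS leq_add // ; case: (a y) (ab y) => // ->; rewrite ?inE ?eqxx.
Qed.

Section Separate.
Variables (L : ordinalGraph) (SL : og_separating L).
Implicit Types (c e f g h v w p q k : L) (ps : seq L).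

Local Notation perpb e f := `[< og_perp e f >].

Let overlap ps k := count (fun pq : L * L => (pq.1 != pq.2) &&
  ~~ perpb (pq.1 • k) (pq.2 • k)) [seq (p, q) | p <- ps, q <- ps].

(** Induction on the number of comparable pairs. If [q k = p k c], then [c] is a cycle at the source
    of [k]. Take the least leading exponent [a] of such cycles and one separating path [h] for those
    of exponent [a]. Passing to [k h] makes their pairs incomparable; the other pairs stay distinct
    because their cycles are longer than [h]. *)
Lemma separate_from ps v w0 : og_r w0 = v -> {in ps, forall p, og_s p = v} ->
  {in ps &, forall p q, p <> q -> p • w0 <> q • w0} ->
  exists2 w, og_ext w0 w & {in ps &, forall p q, p <> q -> og_perp (p • w) (q • w)}.
Proof.
move=> rw0 sps.
have [n] := ubnP (overlap ps w0); elim: n w0 rw0 => // n IH k rk on dist.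
case: (pselect ({in ps &, forall p q, p <> q -> og_perp (p • k) (q • k)})) => [all|nall].
  by exists k => //; apply: og_ext_refl.
have spk p : p \in ps -> og_s p = og_r k by move=> pi; rewrite rk sps.
have sM p : p \in ps -> og_s (p • k) = og_s k by move=> /spk; apply: og_sM.
pose P a := exists p q c, [/\ p \in ps, q \in ps, p <> q, og_s k = og_r c &
  q • k = p • k • c /\ olt (og_d c) (oexpw (osucc a))].
have sc_k p q c : p \in ps -> q \in ps -> og_s k = og_r c -> q • k = p • k • c ->
    og_s c = og_s k.
  by move=> pi qi kc /(congr1 (@og_s L)); rewrite sM // og_sM // sM.
have dpos p q c : p \in ps -> q \in ps -> p <> q -> og_s k = og_r c -> q • k = p • k • c ->
    olt ozero (og_d c).
  move=> pi qi pq kc cE; apply: og_d_pos => rc; apply: (dist _ _ pi qi pq); rewrite cE.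
  by rewrite -rc -kc -(sM p pi) og_idr.
have [a0 Pa0] : exists a, P a.
  move: nall => /existsNP[p] /existsNP[q] /not_implyP[pi] /not_implyP[qi] /not_implyP[pq].
  suff ext p' q' : p' \in ps -> q' \in ps -> p' <> q' -> og_ext (p' • k) (q' • k) -> exists a, P a.
    by case/og_not_perp; [apply: ext|apply: ext => // /esym].
  move=> pi' qi' pq' [c sc cE]; rewrite sM // in sc.
  have [a [_ ca]] := lead_exp (dpos _ _ _ pi' qi' pq' sc cE).
  by exists a, p', q', c.
have [a [p0 [q0 [c0 [p0i q0i pq0 sc0 [c0E c0a]]]]] amin] := olt_min Pa0.
have tail_a p q c : p \in ps -> q \in ps -> p <> q -> og_s k = og_r c ->
    q • k = p • k • c -> ole (oexpw a) (og_d c).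
  move=> pi qi pq kc cE; have [a' [a'c ca']] := lead_exp (dpos _ _ _ pi qi pq kc cE).
  by apply: (ole_trans (oexpw_mono _) a'c); apply: amin; exists p, q, c.
pose tl (pq : L * L) := xget (og_s k) [set c | og_s k = og_r c /\ pq.2 • k = pq.1 • k • c]%classic.
have tlE p q c : p \in ps -> q \in ps -> og_s k = og_r c -> q • k = p • k • c -> tl (p, q) = c.
  move=> pi qi kc cE; rewrite /tl; case: xgetP => [y _ [ky yE]|/(_ c)]; last by case.
  by apply: (@og_cancel _ (p • k)); rewrite ?sM //= -cE -yE.
(* One bound for the cycles of all pairs with exponent [a], so that a single [h] serves them all. *)
have [|N hN] := @omul_bound a _ [seq pq <- [seq (p, q) | p <- ps, q <- ps] |
   `[< olt (og_d (tl pq)) (oexpw (osucc a)) >]] (fun pq => og_d (tl pq)).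
  by move=> pq; rewrite mem_filter => /andP[/asboolP].
have [h [rh ha sep]] := @SL (og_s k) c0 a N (esym sc0) (sc_k _ _ _ p0i q0i sc0 c0E)
  (tail_a _ _ _ p0i q0i pq0 sc0 c0E) c0a.
have skh : og_s k = og_r h by rewrite rh.
have hA p : p \in ps -> p • (k • h) = p • k • h by move=> pi; rewrite og_compA // spk.
have hE p q c : p \in ps -> q \in ps -> og_s k = og_r c ->
    q • k = p • k • c -> q • (k • h) = p • k • (c • h).
  move=> pi qi kc cE; rewrite hA // cE og_compA //; first by rewrite sM.
  by rewrite (sc_k p q).
have ext_h p : p \in ps -> og_ext (p • k) (p • (k • h)).
  by move=> pi; rewrite hA //; apply: og_ext_comp; rewrite sM.
have perp_h p q c : p \in ps -> q \in ps -> p <> q -> og_s k = og_r c ->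
    q • k = p • k • c -> olt (og_d c) (oexpw (osucc a)) -> og_perp (q • (k • h)) (p • (k • h)).
  move=> pi qi pq kc cE ca.
  have sch : og_s c = og_r h by rewrite rh; apply: sc_k cE.
  rewrite (hE p q c) // hA //.
  apply/og_perp_compl; rewrite ?sM ?og_rM //.
  apply: sep => //; first exact: sc_k cE.
    exact: tail_a cE.
  have tE := tlE p q c pi qi kc cE.
  rewrite -tE; apply: (hN (p, q)); rewrite mem_filter tE.
  by apply/andP; split; [apply/asboolP|apply: allpairs_f].
have dist_h p q c : p \in ps -> q \in ps -> p <> q -> og_s k = og_r c ->
    q • k = p • k • c -> p • (k • h) <> q • (k • h).
  move=> pi qi pq kc cE E.
  have sch : og_s c = og_r h by rewrite rh; apply: sc_k cE.
  case: (ole_or_lt (oexpw (osucc a)) (og_d c)) => ca; last first.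
    exact: og_perp_irr (perp_h _ _ _ pi qi pq kc cE ca) (esym E).
  move: E; rewrite (hE p q c) // hA // => /og_cancel; rewrite sM // og_rM // => /(_ skh kc) E.
  apply: (ole_gtF _ ha); rewrite E; apply: ole_trans ca _.
  exact: ole_trans (ole_addr _ _) (og_dM sch).2.
have skrh : og_r (k • h) = v by rewrite og_rM.
have [||w wk wall] := IH (k • h) skrh.
- apply: leq_trans (_ : overlap ps k <= n)%N; last by rewrite -ltnS.
  rewrite /overlap; set s := [seq _ | _ <- _, _ <- _].
  have mono pq : pq \in s -> (pq.1 != pq.2) && ~~ perpb (pq.1 • (k • h)) (pq.2 • (k • h)) ->
     (pq.1 != pq.2) && ~~ perpb (pq.1 • k) (pq.2 • k).
    move=> /allpairsP[[p q] [pi qi ->]] /= /andP[-> /asboolPn np] /=.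
    by apply/asboolPn => pp; apply: np; apply: og_perp_ext pp _ _; apply: ext_h.
  apply: (@sub_in_count_lt _ _ _ _ (q0, p0)) => //=; first exact: allpairs_f.
    apply/andP; split; first by apply/eqP => /esym.
    by apply/asboolPn => -[_]; apply; rewrite c0E; apply: og_ext_comp; rewrite sM.
  rewrite negb_and !negbK; apply/orP; right; apply/asboolP.
  exact: perp_h sc0 c0E c0a.
- move=> p q pi qi pq E.
  have h1 : og_ext (p • k) (q • (k • h)) by rewrite -E; apply: ext_h.
  case: (og_ext_comparable h1 (ext_h q qi)) => -[c]; rewrite sM // => kc cE.
    exact: (dist_h p q c).
  by apply: (dist_h q p c) => // /esym.
- by exists w => //; apply: og_ext_trans wk; apply: og_ext_comp.
Qed.

Fixpoint og_iter (c : L) (n : nat) : L := if n is n'.+1 then c • og_iter c n' else og_r c.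

Section Cycle.
Variables (u c : L).
Hypotheses (rc : og_r c = u) (sc : og_s c = u).

Lemma og_iter_rs n : og_r (og_iter c n) = u /\ og_s (og_iter c n) = u.
Proof.
by elim: n => [|n [IHr IHs]] /=; rewrite ?og_rr ?og_sr ?og_rM ?og_sM ?IHr ?rc.
Qed.

Lemma og_iterD n m : og_iter c (n + m) = og_iter c n • og_iter c m.
Proof.
elim: n => [|n IH] /=; first by rewrite rc -(og_iter_rs m).1 og_idl.
by rewrite IH og_compA // ?(og_iter_rs _).1 ?(og_iter_rs _).2.
Qed.

Lemma og_iter_d a n : olt (og_d c) (oexpw a) -> olt (og_d (og_iter c n)) (oexpw a).
Proof.
move=> ca; elim: n => [|n IH] /=.
  by apply: ole_lt_trans (og_d1 c).1 (oexpw_gt0 a).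
apply: ole_lt_trans (og_dM _).1 _; first by rewrite sc (og_iter_rs n).1.
exact: oadd_oexpw.
Qed.

End Cycle.

(** Start [separate_from] at a shortest [w0] incomparable to all of [H]. If [p w0 = q w0] with
    [p <> q], some cycle [c] fixes [w0], so [w0] is longer than every [c^n h], where [h] separates
    the powers of [c]. By minimality each [c^n h] is then a prefix of an element of [H]; these paths
    are pairwise incomparable, and [|H| + 1] of them contradict the pigeonhole principle. *)
Lemma separate_avoiding ps u d (H : seq L) :
  {in H, forall h, og_r h = u /\ oeq (og_d h) d} ->
  (exists2 w, og_r w = u & {in H, forall h, og_perp w h}) ->
  {in ps, forall p, og_s p = u} ->
  exists w, [/\ og_r w = u, {in H, forall h, og_perp w h} &
    {in ps &, forall p q, p <> q -> og_perp (p • w) (q • w)}].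
Proof.
move=> Hu [w0' rw0' pw0'] sps.
pose P x := exists w, [/\ og_r w = u, {in H, forall h, og_perp w h} & oeq (og_d w) x].
have [x0 [w0 [rw0 pw0 dw0]] min] : exists2 x, P x & forall y, P y -> ole x y.
  by apply: (@olt_min _ (og_d w0')); exists w0'; split=> //; apply: oeqxx.
have {}min w : og_r w = u -> {in H, forall h, og_perp w h} -> ole (og_d w0) (og_d w).
  by move=> rw pw; apply: ole_trans dw0.1 _; apply: min; exists w; split=> //; apply: oeqxx.
(* The prefix of length [d] of a longer path would do as well, since the elements of [H] have this
   length. *)
have w0d : ole (og_d w0) d.
  case: (ole_or_lt (og_d w0) d) => // dw.
  have [w1 [w2 [s12 d1 wE]]] := og_split (oltW dw).
  case: (ole_gtF (a := og_d w0) (b := og_d w1)); last exact: ole_lt_trans d1.1 dw.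
  have w1w : og_ext w1 w0 by rewrite wE; apply: og_ext_comp.
  apply: min => [|h hH]; first by rewrite -rw0 (og_ext_r w1w).
  apply: og_perp_d; first exact: oeq_trans d1 (oeq_sym (Hu h hH).2).
  by move=> w1h; case: (pw0 h hH) => _; rewrite -w1h.
suff dist : {in ps &, forall p q, p <> q -> p • w0 <> q • w0}.
  have [w w0w all] := separate_from rw0 sps dist.
  exists w; split=> //; first by rewrite (og_ext_r w0w).
  by move=> h hH; apply: og_perp_ext (pw0 h hH) w0w (og_ext_refl h).
suff noext p q : p \in ps -> q \in ps -> p <> q -> p • w0 = q • w0 -> og_ext p q -> False.
  move=> p q pi qi pq E.
  have h1 : og_ext p (p • w0) by apply: og_ext_comp; rewrite sps.
  have h2 : og_ext q (p • w0) by rewrite E; apply: og_ext_comp; rewrite sps.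
  case: (og_ext_comparable h1 h2); first exact: noext.
  by move=> qp; apply: (noext q p) => // pq2; apply: pq; rewrite pq2.
move=> pi qi pq E [c spc qE].
have rc : og_r c = u by rewrite -spc sps.
have sc : og_s c = u by rewrite -(sps q qi) qE og_sM.
have cw : c • w0 = w0.
  have scw : og_s c = og_r w0 by rewrite sc.
  apply: (@og_cancel _ p); first by rewrite og_rM.
    by rewrite sps.
  by rewrite E qE og_compA.
have c0 : olt ozero (og_d c).
  by apply: og_d_pos => ce; apply: pq; rewrite qE -ce -spc og_idr.
have [a [ac ca]] := lead_exp c0.
have dcw : oeq (oadd (og_d c) (og_d w0)) (og_d w0).
  by apply: oeq_trans (oeq_sym (og_dM _)) _; rewrite ?sc ?cw //; apply: oeqxx.
have aw := oadd_fix_ge dcw ac.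
have [N hN] := @omul_bound a _ (iota 0 (size H).+2) (fun j => og_d (og_iter c j))
  (fun j _ => og_iter_d rc sc j ca).
have [h [rh ha sep]] := @SL u c a N rc sc ac ca.
have irs := og_iter_rs rc sc.
have chr n : og_s (og_iter c n) = og_r h by rewrite (irs n).2.
pose w n := og_iter c n • h.
have rw n : og_r (w n) = u by rewrite /w og_rM // (irs n).1.
have wlt n : olt (og_d (w n)) (og_d w0).
  apply: olt_le_trans aw; apply: ole_lt_trans (og_dM (chr n)).1 _.
  by apply: oadd_oexpw => //; apply: (og_iter_d rc sc).
have wperp n m : (n < m)%N -> (m <= size H)%N -> og_perp (w m) (w n).
  move=> nm mH; rewrite /w -(subnKC nm) addSnnS (og_iterD rc sc) // -og_compA //; last first.
    by rewrite (irs _).1 (irs _).2.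
  apply/og_perp_compl; rewrite ?og_rM ?(irs _).1 ?(irs _).2 ?rh //.
  apply: sep; rewrite ?(irs _).1 ?(irs _).2 //=.
    apply: ole_trans ac _; apply: ole_trans (og_dM _).2; last by rewrite (irs _).1.
    exact: ole_addr.
  apply: (hN (m - n.+1).+1); rewrite mem_iota /= add0n ltnS.
  by rewrite ltnS (leq_trans (leq_subr _ _)).
have ex n : exists h', h' \in H /\ og_ext (w n) h'.
  have : ~ {in H, forall h', og_perp (w n) h'}.
    by move=> all; apply: (ole_gtF _ (wlt n)); apply: min.
  move=> /existsNP[h'] /not_implyP[h'H /og_not_perp np]; exists h'; split=> //.
  case: np => // h'w; case: (ole_gtF (og_ext_d h'w)).
  apply: olt_le_trans (wlt n) _; exact: ole_trans w0d (Hu _ h'H).2.2.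
have [g gP] := choice ex.
have : uniq [seq g n | n <- iota 0 (size H).+1].
  rewrite map_inj_in_uniq ?iota_uniq // => n m; rewrite !mem_iota /= !add0n !ltnS => nH mH gnm.
  case: (ltngtP n m) => // nm.
    by case: (og_perpxx (gP m).2 _ (wperp n m nm mH)); rewrite -gnm; apply: (gP n).2.
  by case: (og_perpxx (gP n).2 _ (wperp m n nm nH)); rewrite gnm; apply: (gP m).2.
move=> un; suff sub : {subset [seq g n | n <- iota 0 (size H).+1] <= H}.
  by have := uniq_leq_size un sub; rewrite size_map size_iota ltnn.
by move=> _ /mapP[n _ ->]; apply: (gP n).1.
Qed.

End Separate.

Local Open Scope ring_scope.
Local Open Scope cstar_scope.

(** * Norms and elementary C*-algebra *)

(** Norms take values in [R[i]]; the estimates are carried out on their real parts in the ordered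
    field [R]. *)
Definition nrm (R : realType) (V : normedModType R[i]) (x : V) : R := complex.Re `|x|.

Definition nrmc (R : realType) (k : R[i]) : R := complex.Re `|k|.

Section Nrm.
Variables (R : realType) (V : normedModType R[i]).
Implicit Types x y : V.

Lemma ge0_ReE (z : R[i]) : 0 <= z -> z = (complex.Re z)%:C%C.
Proof. by move=> z0; rewrite RRe_real // realE z0. Qed.

Lemma nrmE x : `|x| = (nrm x)%:C%C.
Proof. exact/ge0_ReE/normr_ge0. Qed.

Lemma nrmcE (k : R[i]) : `|k| = (nrmc k)%:C%C.
Proof. exact/ge0_ReE/normr_ge0. Qed.

Lemma nrm_ge0 x : 0 <= nrm x.
Proof. by rewrite -ler0c -nrmE normr_ge0. Qed.

Lemma nrmc_ge0 (k : R[i]) : 0 <= nrmc k.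
Proof. by rewrite -ler0c -nrmcE normr_ge0. Qed.

Lemma nrm0 : nrm (0 : V) = 0.
Proof. by apply: complexI; rewrite -nrmE normr0. Qed.

Lemma nrm_eq0 x : nrm x = 0 -> x = 0.
Proof. by move=> x0; apply/normr0_eq0; rewrite nrmE x0. Qed.

Lemma nrmD x y : nrm (x + y) <= nrm x + nrm y.
Proof. by rewrite -lecR rmorphD /= -!nrmE ler_normD. Qed.

Lemma nrmN x : nrm (- x) = nrm x.
Proof. by rewrite /nrm normrN. Qed.

Lemma nrmBC x y : nrm (x - y) = nrm (y - x).
Proof. by rewrite /nrm distrC. Qed.

Lemma nrmB x y : nrm (x - y) <= nrm x + nrm y.
Proof. by rewrite -[nrm y]nrmN nrmD. Qed.

Lemma nrm_tri y x z : nrm (x - z) <= nrm (x - y) + nrm (y - z).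
Proof. by apply: le_trans (nrmD _ _); rewrite addrA subrK. Qed.

Lemma nrmZ k x : nrm (k *: x) = nrmc k * nrm x.
Proof. by apply: complexI; rewrite -nrmE normrZ rmorphM /= -nrmE -nrmcE. Qed.

Lemma nrm_sum (I : Type) (s : seq I) (P : pred I) (F : I -> V) :
  nrm (\sum_(i <- s | P i) F i) <= \sum_(i <- s | P i) nrm (F i).
Proof.
elim/big_rec2: _ => [|i x y _ xy]; first by rewrite nrm0.
by apply: le_trans (nrmD _ _) _; rewrite lerD2l.
Qed.

Lemma nrm_le_dist x y : nrm x <= nrm y + nrm (x - y).
Proof. by have := nrmD y (x - y); rewrite addrC subrK. Qed.

Lemma nrm_small_eq x y : (forall e : R, 0 < e -> nrm (x - y) <= e) -> x = y.
Proof.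
move=> h; apply/subr0_eq/nrm_eq0/le_anti; rewrite nrm_ge0 andbT.
by apply/ler_addgt0Pl => e e0; rewrite addr0 h.
Qed.

End Nrm.

Lemma nrmc_real (R : realType) (r : R) : 0 <= r -> nrmc r%:C%C = r.
Proof. by move=> r0; apply: complexI; rewrite -nrmcE ger0_norm // ler0c. Qed.

Lemma nrmcJ (R : realType) (k : R[i]) : nrmc (k^*) = nrmc k.
Proof. by apply: complexI; rewrite -!nrmcE norm_conjC. Qed.

Lemma nrmcM (R : realType) (k l : R[i]) : nrmc (k * l) = nrmc k * nrmc l.
Proof. by apply: complexI; rewrite rmorphM /= -!nrmcE normrM. Qed.

Section Alg.
Variables (R : realType) (A : cstarAlgebra R).
Implicit Types x y z p : A.

Lemma cs_mul0 x : x ** 0 = 0.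
Proof. by apply: (addIr (x ** 0)); rewrite -cs_mulDr !add0r. Qed.

Lemma cs_0mul x : 0 ** x = 0.
Proof. by apply: (addIr (0 ** x)); rewrite -cs_mulDl !add0r. Qed.

Lemma cs_mulN x y : x ** (- y) = - (x ** y).
Proof. by apply: (addIr (x ** y)); rewrite -cs_mulDr !addNr cs_mul0. Qed.

Lemma cs_Nmul x y : (- x) ** y = - (x ** y).
Proof. by apply: (addIr (x ** y)); rewrite -cs_mulDl !addNr cs_0mul. Qed.

Lemma cs_mulBr x y z : x ** (y - z) = x ** y - x ** z.
Proof. by rewrite cs_mulDr cs_mulN. Qed.

Lemma cs_mulBl x y z : (x - y) ** z = x ** z - y ** z.
Proof. by rewrite cs_mulDl cs_Nmul. Qed.

Lemma cs_mul_sumr (I : Type) (s : seq I) (P : pred I) (F : I -> A) x :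
  x ** (\sum_(i <- s | P i) F i) = \sum_(i <- s | P i) x ** F i.
Proof. exact: (big_morph _ (cs_mulDr x) (cs_mul0 x)). Qed.

Lemma cs_mul_suml (I : Type) (s : seq I) (P : pred I) (F : I -> A) x :
  (\sum_(i <- s | P i) F i) ** x = \sum_(i <- s | P i) F i ** x.
Proof.
exact: (big_morph (fun y : A => @cs_mul R A y x) (fun y z => cs_mulDl y z x) (cs_0mul x)).
Qed.

Lemma cs_star0 : (0 : A)^# = 0.
Proof. by apply: (addIr (0 : A)^#); rewrite -cs_starD !add0r. Qed.

Lemma cs_starN x : (- x)^# = - x^#.
Proof. by apply: (addIr x^#); rewrite -cs_starD !addNr cs_star0. Qed.

Lemma cs_starB x y : (x - y)^# = x^# - y^#.
Proof. by rewrite cs_starD cs_starN. Qed.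

Lemma cs_star_sum (I : Type) (s : seq I) (P : pred I) (F : I -> A) :
  (\sum_(i <- s | P i) F i)^# = \sum_(i <- s | P i) (F i)^#.
Proof. exact: (big_morph _ (@cs_starD _ A) cs_star0). Qed.

Lemma nrmM x y : nrm (x ** y) <= nrm x * nrm y.
Proof. by rewrite -lecR rmorphM /= -!nrmE cs_normM. Qed.

Lemma nrmS x : nrm (x^# ** x) = nrm x ^+ 2.
Proof. by apply: complexI; rewrite rmorphXn /= -!nrmE cs_normS. Qed.

Lemma nrm_star x : nrm x^# = nrm x.
Proof.
suff h y : nrm y <= nrm y^# by apply/le_anti; rewrite h -{2}[x]cs_starK h.
have [->|y0] := eqVneq (nrm y) 0; first exact: nrm_ge0.
have yp : 0 < nrm y by rewrite lt_neqAle eq_sym y0 nrm_ge0.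
by rewrite -(ler_pM2r yp) -expr2 -nrmS nrmM.
Qed.

Lemma nrmS' x : nrm (x ** x^#) = nrm x ^+ 2.
Proof. by rewrite -{1}[x]cs_starK nrmS nrm_star. Qed.

Lemma nrm_proj p : p^# = p -> p ** p = p -> nrm p <= 1.
Proof.
move=> ps pp; have := nrmS p; rewrite ps pp => h.
have [->|p0] := eqVneq (nrm p) 0; first exact: ler01.
have pp0 : 0 < nrm p by rewrite lt_neqAle eq_sym p0 nrm_ge0.
by rewrite -(ler_pM2r pp0) mul1r -expr2 -h.
Qed.

(* cpow x n = x^(n+1): the algebra need not have a unit *)
Definition cpow x n := iter n (cs_mul x) x.

Lemma cpowD x n m : cpow x n ** cpow x m = cpow x (n + m).+1.
Proof. by elim: n => [//|n IH] /=; rewrite -cs_mulA IH. Qed.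

Lemma cpow_star x n : x^# = x -> (cpow x n)^# = cpow x n.
Proof.
move=> xs; elim: n => [//|n IH] /=; rewrite cs_starM IH xs.
by rewrite -[x in _ ** x]/(cpow x 0) cpowD addn0.
Qed.

(** For self-adjoint elements the C*-identity doubles the exponent. *)
Lemma nrm_cpow x k : x^# = x -> nrm (cpow x (2 ^ k).-1) = nrm x ^+ (2 ^ k).
Proof.
move=> xs; elim: k => [|k IH]; first by rewrite expr1.
have k0 : (0 < 2 ^ k)%N by rewrite expn_gt0.
rewrite expnS mul2n -addnn exprD -IH.
have -> : (2 ^ k + 2 ^ k).-1 = ((2 ^ k).-1 + (2 ^ k).-1).+1.
  by rewrite -{1 2}(prednK k0) addSn addnS.
by rewrite -cpowD -{1}(cpow_star _ xs) nrmS expr2.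
Qed.

End Alg.

(** If [t / s > 1], its power [2^k] grows doubly exponentially in [k], faster than [C B^k]. *)
Lemma growth (R : realType) (t s : R) (C B : nat) : 0 <= t -> 0 <= s ->
  (forall k, t ^+ (2 ^ k) <= (C * B ^ k)%:R * s ^+ (2 ^ k)) -> t <= s.
Proof.
move=> t0 s0 H; rewrite leNgt; apply/negP => st.
have tp : 0 < t by apply: le_lt_trans st.
have [s00|sn0] := eqVneq s 0.
  have := H 0; rewrite s00 expr1 expr1 mulr0 => /(lt_le_trans tp).
  by rewrite ltxx.
have sp : 0 < s by rewrite lt_neqAle eq_sym sn0.
pose q := t / s.
have q1 : 1 < q by rewrite ltr_pdivlMr // mul1r.
have q0 : 0 <= q by apply: ltW; apply: lt_trans q1.
have {}H k : q ^+ (2 ^ k) <= (C * B ^ k)%:R.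
  by rewrite expr_div_n ler_pdivrMr ?exprn_gt0.
have bern (x : R) n : 0 <= x -> 1 + n%:R * x <= (1 + x) ^+ n.
  move=> x0; elim: n => [|n IH]; first by rewrite mul0r addr0.
  rewrite exprS; apply: le_trans (_ : (1 + x) * (1 + n%:R * x) <= _).
    have : 0 <= n%:R * (x * x) by rewrite mulr_ge0 // mulr_ge0.
    rewrite -natr1; lra.
  by rewrite ler_wpM2l // addr_ge0.
have pow2 n : (n < 2 ^ n)%N by apply: ltn_expl.
pose e := q - 1; have e0 : 0 < e by rewrite subr_gt0.
have arch (x y : R) : 0 < x -> exists n, y <= n%:R * x.
  move=> x0; exists (Num.truncn (`|y| / x)).+1; rewrite -ler_pdivrMr //.
  apply: le_trans (_ : `|y| / x <= _); first by rewrite ler_pM2r ?invr_gt0 ?ler_norm.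
  by apply/ltW/truncnS_gt.
(* By Bernoulli's inequality [q^(2^k0) >= 2 (B + 1)]. Raising this to the power [2^j >= j] gives
   [2^j <= C (B + 1)^k0] for all [j], which fails at [j = C (B + 1)^k0]. Using [B + 1] keeps the
   base positive. *)
have [k0 hk0] := arch e (2 * B.+1)%:R e0.
have hQ : (2 * B.+1)%:R <= q ^+ (2 ^ k0).
  apply: le_trans hk0 _; apply: le_trans (_ : 1 + (2 ^ k0)%:R * e <= _).
    apply: le_trans (_ : (2 ^ k0)%:R * e <= _); last by rewrite lerDr ler01.
    by apply: ler_wpM2r; [apply: ltW|rewrite ler_nat ltnW].
  have := bern e (2 ^ k0)%N (ltW e0).
  by have -> : 1 + e = q by rewrite /e addrC subrK.
have main j : ((2 * B.+1) ^ j)%:R <= (C * B.+1 ^ (k0 + j))%:R :> R.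
  apply: le_trans (_ : q ^+ (2 ^ (k0 + j)) <= _); last first.
    apply: le_trans (H _) _; rewrite ler_nat leq_mul2l; apply/orP; right.
    by case: (k0 + j)%N => // n; rewrite leq_exp2r // leqnSn.
  rewrite expnD exprM natrX; apply: le_trans (_ : (q ^+ (2 ^ k0)) ^+ j <= _).
    by rewrite lerXn2r // nnegrE ?exprn_ge0.
  rewrite ler_weXn2l //; last exact: ltnW.
  by rewrite exprn_ege1 // ltW.
have := main (C * B.+1 ^ k0)%N; rewrite ler_nat expnMn expnD mulnA.
by rewrite leq_pmul2r ?expn_gt0 // leqNgt pow2.
Qed.

(** * Words and the elements T_e *)

Section Toeplitz.
Variables (R : realType) (L : ordinalGraph).
Implicit Types (e f g v : L).

(* The relations (i)-(iii), without the Cuntz-Krieger relation (iv). *)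
Record toeplitz (A : cstarAlgebra R) (T : L -> A) : Prop := Toeplitz {
  tp_partial : forall e, og_generator e -> T e ** (T e)^# ** T e = T e;
  tp_source : forall e, og_generator e -> (T e)^# ** T e = T (og_s e);
  tp_comp : forall e f, og_generator e -> og_generator f ->
    og_s e = og_r f -> olt (og_d e) (og_d f) -> T e ** T f = T (e • f);
  tp_disjoint : forall e f, og_generator e -> og_generator f ->
    og_perp e f -> (T e)^# ** T f = 0
}.

Lemma og_family_toeplitz (A : cstarAlgebra R) (T : L -> A) : og_family T -> toeplitz T.
Proof. by move=> [? ? ? h _]; split=> // e f ? ? /og_perpP; apply: h. Qed.

Variables (A : cstarAlgebra R) (T : L -> A) (TT : toeplitz T).

(** Unlike in [og_word], every word ends in a vertex and carries its number of letters, on which the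
    inductions below run. *)
Inductive word : nat -> L -> A -> Prop :=
| word0 v : og_vertex v -> word 0 v (T v)
| wordS n e f x : og_power e -> og_s e = og_r f -> word n f x ->
    word n.+1 (e • f) (T e ** x).

Let gen_v v : og_vertex v -> og_generator v. Proof. by right. Qed.
Let gen_p e : og_power e -> og_generator e. Proof. by left. Qed.

Lemma og_power_gt0 e : og_power e -> olt ozero (og_d e).
Proof. by move=> [a [_ ae]]; apply: olt_le_trans (oexpw_gt0 a) ae. Qed.

Lemma tp_vertex_star v : og_vertex v -> (T v)^# = T v.
Proof.
move=> vv; have h := tp_source TT (gen_v vv); rewrite og_s_vertex // in h.
by rewrite -h cs_starM cs_starK.
Qed.

Lemma tp_vertex_idem v : og_vertex v -> T v ** T v = T v.
Proof.
by move=> vv; rewrite -{1}tp_vertex_star // tp_source ?og_s_vertex //; apply: gen_v.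
Qed.

Lemma tp_rng e : og_power e -> T (og_r e) ** T e = T e.
Proof.
move=> pe; rewrite tp_comp ?og_idl ?og_sr //.
- exact/gen_v/og_vertex_r.
- exact: gen_p.
- by apply: ole_lt_trans (og_d1 e).1 (og_power_gt0 pe).
Qed.

Lemma tp_src e : og_power e -> T e ** T (og_s e) = T e.
Proof. by move=> pe; rewrite -tp_source ?cs_mulA ?tp_partial //; apply: gen_p. Qed.

Lemma word_rng n e x : word n e x -> T (og_r e) ** x = x.
Proof.
case=> [v vv|m f g y pf fg _]; first by rewrite vv tp_vertex_idem.
by rewrite og_rM // cs_mulA tp_rng.
Qed.

Lemma word_vertex n v x : og_vertex v -> word n v x -> n = 0 /\ x = T v.
Proof.
move=> vv w; case: w vv => // m e f y pe ef _ vv.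
have := og_d_vertex vv; move=> [d0 _]; case: (@olt0F (og_d e)).
have := olt_le_trans (og_power_gt0 pe) (ole_trans (ole_addr _ (og_d f)) (og_dM ef).2).
by move=> h; case: (@olt_irr ozero); apply: olt_le_trans h d0.
Qed.

Lemma word0_inv e x : word 0 e x -> og_vertex e /\ x = T e.
Proof.
by move En: 0%N => n w; case: w En.
Qed.

Lemma wordS_inv n e x : word n.+1 e x -> exists e1 f y,
  [/\ og_power e1, og_s e1 = og_r f, word n f y, e = e1 • f & x = T e1 ** y].
Proof.
move En: n.+1 => n' w; case: w En => // m e1 f y pe ef wf [->].
by exists e1, f, y.
Qed.

(** If [f = e z] has length [ω^b] and [z] is not a vertex, then [z] also has length [ω^b] and is
    longer than [e], so relation (ii) applies. *)
Lemma letter_ext e f : og_power e -> og_power f -> og_ext e f ->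
  e = f \/ exists z, [/\ og_power z, og_s e = og_r z, f = e • z & T f = T e ** T z].
Proof.
move=> pe [b fb] [z ez fE].
have dz : oeq (oadd (og_d e) (og_d z)) (oexpw b).
  by apply: oeq_trans (oeq_sym (og_dM ez)) _; rewrite -fE.
have [z0|z0] := o0_or_gt (og_d z).
  by left; rewrite fE -(og_d_eq0 z0) -ez og_idr.
have [eb zb] := oexpw_tail dz z0.
have pz : og_power z by exists b.
right; exists z; split=> //; rewrite tp_comp -?fE //.
- exact: gen_p.
- exact: gen_p.
- exact: olt_le_trans eb zb.2.
Qed.

(** [T_e] does not depend on the factorisation: of two first letters one is a prefix of the other,
    the longer one is split by [letter_ext], and fewer letters remain to be compared. *)
Lemma word_uniq n m e x y : word n e x -> word m e y -> x = y.
Proof.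
have [N] := ubnP (n + m); elim: N n m e x y => // N IH n m e x y.
case: n => [|n] nm; first by move=> /word0_inv[vv ->] /(word_vertex vv)[].
case: m nm => [|m] nm; first by move=> w /word0_inv[vv ->]; case: (word_vertex vv w).
move=> /wordS_inv[e1 [f [x' [pe1 ef wf eE ->]]]].
move=> /wordS_inv[e2 [g [y' [pe2 eg wg eE' ->]]]].
have aux k l (a1 a2 b1 b2 : L) u w : (k + l < N)%N ->
    og_power a1 -> og_power b1 -> og_s a1 = og_r a2 -> og_s b1 = og_r b2 ->
    word k a2 u -> word l b2 w -> a1 • a2 = b1 • b2 -> og_ext a1 b1 ->
    (forall u w e, word k e u -> word l e w -> u = w) ->
    (forall u w e, word k e u -> word l.+1 e w -> u = w) ->
    T a1 ** u = T b1 ** w.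
  move=> kl pa pb sa sb wu ww E ab IH1 IH2.
  have [ab1|[z [pz sz bE ->]]] := letter_ext pa pb ab.
    rewrite ab1 in sa E *; congr (_ ** _); apply: IH1 wu _.
    by rewrite (og_cancel sa sb E).
  rewrite -cs_mulA; congr (_ ** _).
  have szb : og_s z = og_r b2 by rewrite -sb bE og_sM.
  apply: IH2 wu _; have -> : a2 = z • b2; last exact: wordS.
  by apply: (@og_cancel _ a1) => //; rewrite ?og_rM // E bE og_compA.
have E : e1 • f = e2 • g by rewrite -eE.
have h1 : og_ext e1 e by rewrite eE; apply: og_ext_comp.
have h2 : og_ext e2 e by rewrite eE'; apply: og_ext_comp.
rewrite addSn addnS ltnS in nm.
have lt1 : (n + m < N)%N by apply: leq_trans nm; rewrite ltnS leqnSn.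
have lt2 : (n + m.+1 < N)%N by rewrite addnS.
have lt3 : (n.+1 + m < N)%N by rewrite addSn.
case: (og_ext_comparable h1 h2) => ext.
  apply: (aux n m e1 f e2 g) => // u w e' wu ww; [exact: (IH n m e')|exact: (IH n m.+1 e')].
apply/esym; apply: (aux m n e2 g e1 f) => //; first by rewrite addnC.
- by move=> u w e' wu ww; apply/esym; apply: (IH n m e').
- by move=> u w e' wu ww; apply/esym; apply: (IH n.+1 m e').
Qed.

(** The induction of [word_uniq]: equal first letters cancel by (i), the longer of two comparable
    ones is split, and incomparable ones are orthogonal by (iii). *)
Lemma word_perp n m e f x y : word n e x -> word m f y -> og_perp e f -> x^# ** y = 0.
Proof.
have [N] := ubnP (n + m); elim: N n m e f x y => // N IH n m e f x y.
case: n => [|n] nm.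
  move=> /word0_inv[vv ->]; case: m nm => [|m] nm.
    by move=> /word0_inv[ww ->] p; rewrite tp_disjoint //; apply: gen_v.
  move=> /wordS_inv[f1 [g [y' [pf1 fg _ fE ->]]]] p; rewrite cs_mulA tp_disjoint ?cs_0mul //.
  - exact: gen_v.
  - exact: gen_p.
  - apply: og_perp_r => vE; have eE : e = og_r f by rewrite -[LHS]vv vE fE og_rM.
    case: p => p _; apply: p; exists f; first by rewrite og_s_vertex.
    by rewrite eE og_idl.
case: m nm => [|m] nm.
  move=> /wordS_inv[e1 [g [y' [pf1 fg _ fE ->]]]] /word0_inv[vv ->] p.
  rewrite cs_starM -cs_mulA tp_disjoint ?cs_mul0 //.
  - exact: gen_p.
  - exact: gen_v.
  - apply: og_perp_r => vE; have eE : f = og_r e by rewrite -[LHS]vv -vE fE og_rM.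
    case: p => _ p; apply: p; exists e; first by rewrite og_s_vertex.
    by rewrite eE og_idl.
move=> /wordS_inv[e1 [e2 [x' [pe1 se we eE ->]]]].
move=> /wordS_inv[f1 [f2 [y' [pf1 sf wf fE ->]]]] p.
have aux k l (a1 a2 b1 b2 : L) u w : og_power a1 -> og_power b1 ->
    og_s a1 = og_r a2 -> og_s b1 = og_r b2 ->
    word k a2 u -> word l b2 w -> og_perp (a1 • a2) (b1 • b2) -> og_ext a1 b1 ->
    (forall u w e f, word k e u -> word l f w -> og_perp e f -> u^# ** w = 0) ->
    (forall u w e f, word k e u -> word l.+1 f w -> og_perp e f -> u^# ** w = 0) ->
    (T a1 ** u)^# ** (T b1 ** w) = 0.
  move=> pa pb sa sb wu ww ab ext IH1 IH2; rewrite cs_starM -!cs_mulA.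
  have [ab1|[z [pz sz bE ->]]] := letter_ext pa pb ext.
    rewrite -ab1 in sb ab *; rewrite [(T a1)^# ** _]cs_mulA (tp_source TT); last exact: gen_p.
    rewrite sb (word_rng ww); apply: IH1 wu ww _.
    exact: (og_perp_compl sa sb).1.
  have szb : og_s z = og_r b2 by rewrite -sb bE og_sM.
  have wz := wordS pz szb ww.
  rewrite -cs_mulA [(T a1)^# ** _]cs_mulA (tp_source TT); last exact: gen_p.
  have := word_rng wz; rewrite og_rM // -sz => ->; apply: IH2 wu wz _.
  have saz : og_s a1 = og_r (z • b2) by rewrite og_rM.
  by apply: (og_perp_compl sa saz).1; move: ab; rewrite bE -og_compA.
rewrite addSn addnS ltnS in nm.
have lt1 : (n + m < N)%N by apply: leq_trans nm; rewrite ltnS leqnSn.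
have lt2 : (n + m.+1 < N)%N by rewrite addnS.
have lt3 : (n.+1 + m < N)%N by rewrite addSn.
case: (pselect (og_perp e1 f1)) => [pp|/og_not_perp[] ext].
- rewrite cs_starM -!cs_mulA [(T e1)^# ** _]cs_mulA tp_disjoint ?cs_0mul ?cs_mul0 //; exact: gen_p.
- apply: (aux n m e1 e2 f1 f2) => //; first by rewrite -eE -fE.
    by move=> u w a b wu ww; apply: (IH n m a b).
  by move=> u w a b wu ww; apply: (IH n m.+1 a b).
rewrite -[LHS]cs_starK cs_starM cs_starK (aux m n f1 f2 e1 e2) ?cs_star0 //.
- by rewrite -eE -fE; apply: og_perp_sym.
- move=> u w a b wu ww /og_perp_sym p'; rewrite -[LHS]cs_starK cs_starM cs_starK.
  by rewrite (IH n m b a) ?cs_star0.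
- move=> u w a b wu ww /og_perp_sym p'; rewrite -[LHS]cs_starK cs_starM cs_starK.
  by rewrite (IH n.+1 m b a) ?cs_star0.
Qed.

Lemma word_exists e : exists n x, word n e x.
Proof.
have [a] : exists a, ole (og_d e) a by exists (og_d e); apply: olexx.
elim: (wf_olt a) e => {}a _ IH e ea.
have [e0|/lead_exp[b [be eb]]] := o0_or_gt (og_d e).
  by exists 0, (T e); apply: word0; apply: og_d_eq0.
have [f [g [fg df eE]]] := og_split be.
have dg : olt (og_d g) a.
  apply: olt_le_trans ea; apply: oltNge => eg; apply: ole_gtF eb.
  apply: (oadd_fix_ge (c := oexpw b)); last exact: olexx.
  split; last exact: ole_addl.
  apply: ole_trans (oadd_monor _ eg) _; apply: ole_trans (oadd_monol _ df.2) _.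
  by rewrite eE; apply: (og_dM fg).2.
have [n [x w]] := IH _ dg g (olexx _).
exists n.+1, (T f ** x); rewrite eE; apply: wordS => //.
by exists b.
Qed.

(* T_e for an arbitrary path e *)
Definition tt e : A := xget 0 [set x | exists n, word n e x]%classic.

Lemma tt_word n e x : word n e x -> tt e = x.
Proof.
move=> w; rewrite /tt; case: xgetP => [y _ [m w']|/(_ x)].
  exact: word_uniq w' w.
by case; exists n.
Qed.

Lemma ttP e : exists n, word n e (tt e).
Proof. by have [n [x w]] := word_exists e; exists n; rewrite (tt_word w). Qed.

Lemma tt_vertex v : og_vertex v -> tt v = T v.
Proof. by move=> vv; apply: tt_word (word0 vv). Qed.

Lemma tt_power e : og_power e -> tt e = T e.
Proof.
move=> pe; have := wordS pe (esym (og_rs e)) (word0 (og_vertex_s e)).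
by rewrite og_idr tp_src // => /tt_word.
Qed.

Lemma tt_og_word e : og_word T e (tt e).
Proof.
have [n w] := ttP e; elim: w => [v vv|m f g x pf fg _ IH].
  by apply: og_word1; right.
exact: og_wordS.
Qed.

Lemma tt_rng e : tt (og_r e) ** tt e = tt e.
Proof. by have [n w] := ttP e; rewrite tt_vertex ?(word_rng w) //; apply: og_vertex_r. Qed.

Lemma word_comp n m e f x y : word n e x -> word m f y -> og_s e = og_r f ->
  word (n + m) (e • f) (x ** y).
Proof.
move=> w wf; elim: w => [v vv|k e1 e2 z pe1 ee we IH] ef.
  have vE : v = og_r f by rewrite -ef og_s_vertex.
  by rewrite vE og_idl (word_rng wf).
rewrite og_sM // in ef; rewrite -og_compA // -cs_mulA addSn.
by apply: wordS => //; [rewrite og_rM|apply: IH].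
Qed.

Lemma tt_comp e f : og_s e = og_r f -> tt (e • f) = tt e ** tt f.
Proof.
move=> ef; have [n w] := ttP e; have [m w'] := ttP f.
exact: tt_word (word_comp w w' ef).
Qed.

Lemma tt_src e : tt e ** tt (og_s e) = tt e.
Proof. by rewrite -tt_comp ?og_rs ?og_idr. Qed.

Lemma tt_source e : (tt e)^# ** tt e = tt (og_s e).
Proof.
rewrite (tt_vertex (og_vertex_s e)); have [n w] := ttP e.
elim: w => [v vv|k e1 e2 x pe1 ee we IH]; first by rewrite tp_source // ; apply: gen_v.
rewrite cs_starM -cs_mulA [(T e1)^# ** _]cs_mulA (tp_source TT); last exact: gen_p.
by rewrite ee (word_rng we) og_sM.
Qed.

Lemma tt_perp e f : og_perp e f -> (tt e)^# ** tt f = 0.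
Proof. by move=> p; have [n w] := ttP e; have [m w'] := ttP f; apply: word_perp w w' p. Qed.

Lemma tt_extl e z : og_s e = og_r z -> (tt e)^# ** tt (e • z) = tt z.
Proof. by move=> ez; rewrite tt_comp // cs_mulA tt_source ez tt_rng. Qed.

Lemma tt_extr e z : og_s e = og_r z -> (tt (e • z))^# ** tt e = (tt z)^#.
Proof. by move=> ez; rewrite -[LHS]cs_starK cs_starM cs_starK tt_extl. Qed.

Lemma tt_vertex_star v : og_vertex v -> (tt v)^# = tt v.
Proof. by move=> vv; rewrite tt_vertex // tp_vertex_star. Qed.

Lemma tt_vertex_idem v : og_vertex v -> tt v ** tt v = tt v.
Proof. by move=> vv; rewrite tt_vertex // tp_vertex_idem. Qed.

Lemma tt_comp0 e f : og_s e <> og_r f -> tt e ** tt f = 0.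
Proof.
move=> ne; rewrite -(tt_src e) -(tt_rng f) -cs_mulA [tt (og_s e) ** _]cs_mulA.
rewrite -(tt_vertex_star (og_vertex_s e)) tt_perp ?cs_0mul ?cs_mul0 //.
by apply: og_perp_r; rewrite og_rs og_rr.
Qed.

Lemma nrm_tt e : nrm (tt e) <= 1.
Proof.
rewrite -(@expr_le1 _ 2) ?nrm_ge0 // -nrmS tt_source.
apply: nrm_proj; [apply: tt_vertex_star|apply: tt_vertex_idem]; exact: og_vertex_s.
Qed.

End Toeplitz.

Section StarHom.
Variables (R : realType) (L : ordinalGraph) (A B : cstarAlgebra R) (f : A -> B).
Hypothesis fh : star_hom f.

Lemma sh0 : f 0 = 0.
Proof. by have := sh_linear fh (-1) 0 0; rewrite !scaleN1r !addNr. Qed.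

Lemma shD x y : f (x + y) = f x + f y.
Proof. by have := sh_linear fh 1 x y; rewrite !scale1r. Qed.

Lemma shZ k x : f (k *: x) = k *: f x.
Proof. by have := sh_linear fh k x 0; rewrite !addr0 sh0 addr0. Qed.

Lemma shN x : f (- x) = - f x.
Proof. by rewrite -scaleN1r shZ scaleN1r. Qed.

Lemma shB x y : f (x - y) = f x - f y.
Proof. by rewrite shD shN. Qed.

Lemma sh_sum (I : Type) (s : seq I) (P : pred I) (F : I -> A) :
  f (\sum_(i <- s | P i) F i) = \sum_(i <- s | P i) f (F i).
Proof. exact: (big_morph _ shD sh0). Qed.

Lemma toeplitz_hom (T : L -> A) : toeplitz T -> toeplitz (f \o T).
Proof.
move=> TT; split=> /=.
- by move=> e ge; rewrite -(sh_star fh) -!(sh_mul fh) tp_partial.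
- by move=> e ge; rewrite -(sh_star fh) -!(sh_mul fh) tp_source.
- by move=> e g ge gg eg d; rewrite -!(sh_mul fh) tp_comp.
- by move=> e g ge gg p; rewrite -(sh_star fh) -!(sh_mul fh) tp_disjoint ?sh0.
Qed.

Lemma word_hom (T : L -> A) n e x : word T n e x -> word (f \o T) n e (f x).
Proof.
elim=> [v vv|m g h y pg gh _ IH]; first exact: (word0 (f \o T) vv).
rewrite (sh_mul fh); exact: (wordS (T := f \o T)).
Qed.

Lemma tt_hom (T : L -> A) e : toeplitz T -> tt (f \o T) e = f (tt T e).
Proof.
move=> TT; have [n w] := ttP TT e.
exact: (tt_word (toeplitz_hom TT) (word_hom w)).
Qed.

End StarHom.

Definition og_tail (L : ordinalGraph) (f g : L) : L :=
  xget (og_s f) [set z | og_s f = og_r z /\ g = f • z]%classic.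

Lemma og_tailP (L : ordinalGraph) (f g : L) : og_ext f g ->
  og_s f = og_r (og_tail f g) /\ g = f • og_tail f g.
Proof.
by move=> [z fz gE]; rewrite /og_tail; case: xgetP => [y _ //|/(_ z)]; case.
Qed.

(** * Range projections and their defects *)

Section Projections.
Variables (R : realType) (L : ordinalGraph) (A : cstarAlgebra R) (T : L -> A).
Hypothesis TT : toeplitz T.
Implicit Types (l : seq L).

Definition pairwise_perp l := uniq l /\ {in l &, forall e f, e <> f -> og_perp e f}.

Definition rproj l : A := \sum_(e <- l) tt T e ** (tt T e)^#.

Lemma rproj_star l : (rproj l)^# = rproj l.
Proof.
by rewrite cs_star_sum; apply: eq_bigr => e _; rewrite cs_starM cs_starK.
Qed.

Lemma rproj_mem l e z : pairwise_perp l -> e \in l -> og_s e = og_r z ->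
  rproj l ** tt T (e • z) = tt T (e • z).
Proof.
move=> [ul pl] el ez; rewrite cs_mul_suml (bigD1_seq e) //= big1_seq ?addr0.
  by rewrite -cs_mulA tt_extl // -tt_comp.
move=> f /andP[/eqP fe fl]; rewrite -cs_mulA tt_perp ?cs_mul0 //.
by apply: og_perp_ext (pl _ _ fl el fe) (og_ext_refl _) _; exists z.
Qed.

Lemma rproj_mem1 l e : pairwise_perp l -> e \in l -> rproj l ** tt T e = tt T e.
Proof. by move=> pl el; rewrite -{1}[e]og_idr rproj_mem ?og_rs ?og_idr. Qed.

Lemma rproj_perp l w : {in l, forall e, og_perp e w} -> rproj l ** tt T w = 0.
Proof.
move=> pl; rewrite cs_mul_suml big1_seq // => e /andP[_ el].
by rewrite -cs_mulA tt_perp ?cs_mul0 //; apply: pl.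
Qed.

Lemma rproj_idem l : pairwise_perp l -> rproj l ** rproj l = rproj l.
Proof.
move=> pl; rewrite {2}/rproj cs_mul_sumr; apply: eq_big_seq => e el.
by rewrite cs_mulA rproj_mem1.
Qed.

Lemma nrm_rproj l : pairwise_perp l -> nrm (rproj l) <= 1.
Proof. by move=> pl; apply: nrm_proj; [apply: rproj_star|apply: rproj_idem]. Qed.

Lemma rproj_rng l u : og_vertex u -> {in l, forall e, og_r e = u} ->
  tt T u ** rproj l = rproj l.
Proof.
move=> vu lu; rewrite cs_mul_sumr; apply: eq_big_seq => e /lu <-.
by rewrite cs_mulA tt_rng.
Qed.

(** The defect of [l] at [u]: it kills every path through [l] ([gap_mem]) and fixes every path from
    [u] that avoids [l] ([gap_perp]). *)
Definition gap l u : A := tt T u - rproj l.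

Lemma gap_star l u : og_vertex u -> (gap l u)^# = gap l u.
Proof. by move=> vu; rewrite cs_starB tt_vertex_star // rproj_star. Qed.

Lemma rproj_rng' l u : og_vertex u -> {in l, forall e, og_r e = u} ->
  rproj l ** tt T u = rproj l.
Proof.
move=> vu lu; rewrite -[LHS]cs_starK cs_starM tt_vertex_star // rproj_star.
by rewrite rproj_rng // rproj_star.
Qed.

Lemma gap_rng l u : og_vertex u -> {in l, forall e, og_r e = u} ->
  tt T u ** gap l u = gap l u.
Proof. by move=> vu lu; rewrite cs_mulBr tt_vertex_idem // rproj_rng. Qed.

Lemma gap_rng' l u : og_vertex u -> {in l, forall e, og_r e = u} ->
  gap l u ** tt T u = gap l u.
Proof. by move=> vu lu; rewrite cs_mulBl tt_vertex_idem // rproj_rng'. Qed.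

Lemma gap_idem l u : og_vertex u -> pairwise_perp l -> {in l, forall e, og_r e = u} ->
  gap l u ** gap l u = gap l u.
Proof.
move=> vu pl lu; rewrite {1}/gap cs_mulBl gap_rng //.
by rewrite {2}/gap cs_mulBr rproj_rng' // rproj_idem // subrr subr0.
Qed.

Lemma gap_mem l u e z : pairwise_perp l -> {in l, forall e, og_r e = u} -> e \in l ->
  og_s e = og_r z -> gap l u ** tt T (e • z) = 0.
Proof.
move=> pl lu el ez; rewrite cs_mulBl rproj_mem //.
by rewrite -(lu e el) -(og_rM ez) tt_rng // subrr.
Qed.

Lemma gap_perp l u w : og_r w = u -> {in l, forall e, og_perp e w} ->
  gap l u ** tt T w = tt T w.
Proof. by move=> <- pl; rewrite cs_mulBl rproj_perp // subr0 tt_rng. Qed.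

End Projections.

Lemma pairwise_perp_d (L : ordinalGraph) (l : seq L) (d : Ord) : uniq l ->
  {in l, forall e, oeq (og_d e) d} -> pairwise_perp l.
Proof.
move=> ul ld; split=> // e f el fl; apply: og_perp_d.
exact: oeq_trans (ld e el) (oeq_sym (ld f fl)).
Qed.

(* Iterating relation (iv) along the leading exponents of [d]. *)
Lemma exhaustive_sum (R : realType) (L : ordinalGraph) (A : cstarAlgebra R)
    (T : L -> A) : og_family T ->
  forall (d : Ord) (u : L) (H : seq L), og_vertex u -> uniq H ->
  {in H, forall h, og_r h = u /\ oeq (og_d h) d} ->
  (forall w, og_r w = u -> exists2 h, h \in H & ~ og_perp w h) ->
  tt T u = rproj T H.
Proof.
move=> FT d; have TT := og_family_toeplitz FT.
elim: (wf_olt d) => {}d _ IH u H vu uH Hd exh.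
have [d0|d0] := o0_or_gt d.
  have Hu h : h \in H -> h = u.
    by move=> hH; rewrite -(Hd h hH).1 og_d_eq0 //; apply: oeq_trans (Hd h hH).2 d0.
  have [h hH _] := exh u vu; have uH' : u \in H by rewrite -(Hu h hH).
  rewrite /rproj (bigD1_seq u) //= big1_seq ?addr0.
    by rewrite tt_vertex_star // tt_vertex_idem.
  by move=> e /andP[/eqP ne /Hu].
have [a [ad da]] := lead_exp d0.
have [d' add'] := osub ad.
have d'd : olt d' d.
  apply: oltNge => dd'; apply: ole_gtF da.
  apply: (oadd_fix_ge (c := oexpw a)); last exact: olexx.
  split; last exact: ole_addl.
  exact: ole_trans (oadd_monor _ dd') add'.1.
have ext_lt e : og_r e = u -> ole (og_d e) d -> exists2 h, h \in H & og_ext e h.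
  move=> ru ed; have [h hH /og_not_perp[]] := exh e ru; first by exists h.
  move=> he; exists h => //.
  have -> : h = e; last exact: og_ext_refl.
  by apply: og_ext_antisym he _; apply: ole_trans ed (Hd h hH).2.2.
have aH h : h \in H -> ole (oexpw a) (og_d h).
  by move=> hH; apply: ole_trans ad (Hd h hH).2.2.
pose pa h := xget h [set p : L | og_ext p h /\ oeq (og_d p) (oexpw a)]%classic.
have paP h : h \in H -> og_ext (pa h) h /\ oeq (og_d (pa h)) (oexpw a).
  move=> hH; rewrite /pa; case: xgetP => [p _ //|no].
  have [p [z [pz dp hE]]] := og_split (aH h hH).
  by case: (no p); split=> //; rewrite hE; apply: og_ext_comp.
have paE p h : h \in H -> og_ext p h -> oeq (og_d p) (oexpw a) -> p = pa h.
  move=> hH ph dp; have [h1 h2] := paP h hH.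
  exact: og_ext_eq ph h1 (oeq_trans dp (oeq_sym h2)).
(* Every path of length [ω^a] with range [u] is a prefix of some element of the finite list [H].
   This makes [u] an [a]-regular vertex, so that relation (iv) applies to it. *)
have fin : finite_set (og_paths u a).
  apply: (@sub_finite_set _ _ (pa @` [set` H])%classic); last first.
    by apply: finite_image; apply: finite_seq.
  move=> p [rp dp]; have [h hH ph] := ext_lt p rp (ole_trans dp.1 ad).
  by exists h => //; apply/esym/paE.
have reg : og_regular a u.
  split=> // e re ea; have [h hH [z ez hE]] := ext_lt e re (ole_trans (oltW ea) ad).
  have az : ole (oexpw a) (og_d z).
    apply: (ole_tail ea); apply: ole_trans (aH h hH) _.
    by rewrite hE; apply: (og_dM ez).1.
  have [p [z' [pz dp zE]]] := og_split az.
  by exists p; split=> //; rewrite ez zE og_rM.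
rewrite tt_vertex // (of_regular FT vu reg) fsbig_finite //=.
have memS p : p \in fset_set (og_paths u a) -> og_r p = u /\ oeq (og_d p) (oexpw a).
  by rewrite in_fset_set // => /set_mem.
transitivity (\sum_(p <- fset_set (og_paths u a))
   \sum_(h <- H) if `[< og_ext p h >] then tt T h ** (tt T h)^# else 0).
  apply: eq_big_seq => p /memS[rp dp].
  have pp : og_power p by exists a.
  rewrite -(tt_power TT pp) -{1}(tt_src TT p).
  pose Hp := [seq og_tail p h | h <- H & `[< og_ext p h >]].
  have HpP h : h \in [seq h <- H | `[< og_ext p h >]] -> h \in H /\ og_ext p h.
    by rewrite mem_filter => /andP[/asboolP].
  (* Induction: behind [p] the remainders of the elements of [H] all have length [d'] and exhaust
     the source of [p]. *)
  have -> : tt T (og_s p) = rproj T Hp.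
    apply: (IH d') => //.
    - exact: og_vertex_s.
    - rewrite map_inj_in_uniq ?filter_uniq // => h h' /HpP[_ ph] /HpP[_ ph'] E.
      by rewrite (og_tailP ph).2 (og_tailP ph').2 E.
    - move=> z /mapP[h /HpP[hH ph] ->]; have [t1 t2] := og_tailP ph.
      split; first exact: esym.
      apply: (@oadd_cancel (oexpw a)); apply: oeq_trans (oeq_sym add').
      apply: oeq_trans (Hd h hH).2; rewrite {2}t2.
      apply: oeq_trans (oeq_sym (og_dM t1)).
      exact: oadd_oeq (oeq_sym dp) (oeqxx _).
    - move=> w rw; have pw : og_s p = og_r w by [].
      have [|h hH np] := exh (p • w); first by rewrite og_rM.
      have ph : og_ext p h.
        case: (og_not_perp np) => [pwh|hpw].
          exact: og_ext_trans (og_ext_comp pw) pwh.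
        apply: og_ext_le (og_ext_comp pw) hpw _.
        exact: ole_trans dp.1 (aH h hH).
      have [t1 t2] := og_tailP ph.
      exists (og_tail p h); first by apply/map_f; rewrite mem_filter hH andbT; apply/asboolP.
      by move=> pp'; apply: np; rewrite t2; apply/og_perp_compl.
  rewrite /rproj cs_mul_sumr cs_mul_suml big_map big_filter -big_mkcond.
  apply: eq_bigr => h /asboolP ph.
  have [t1 t2] := og_tailP ph.
  by rewrite {3 4}t2 tt_comp // cs_starM !cs_mulA.
rewrite exchange_big /=; apply: eq_big_seq => h hH.
have [h1 h2] := paP h hH.
rewrite (bigD1_seq (pa h)) ?fset_uniq //=; last first.
  by rewrite in_fset_set //; apply: mem_set; split=> //; rewrite -(og_ext_r h1) (Hd h hH).1.
rewrite (asboolT h1) big1_seq ?addr0 // => p /andP[/eqP ne /memS[rp dp]].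
by case: asboolP => // ph; case: ne; apply: paE.
Qed.

(** * Formal sums and their heights *)

Section FormalSums.
Variables (R : realType) (L : ordinalGraph).
Implicit Types (e f g : L).

(* [(c, (g, f))] stands for c T_g T_f^* *)
Definition fterm := (R[i] * (L * L))%type.
Definition fsum := seq fterm.

Definition evt (A : cstarAlgebra R) (T : L -> A) (p : fterm) : A :=
  p.1 *: (tt T p.2.1 ** (tt T p.2.2)^#).

Definition ev (A : cstarAlgebra R) (T : L -> A) (a : fsum) : A :=
  \sum_(p <- a) evt T p.

Definition wft (p : fterm) := og_s p.2.1 = og_s p.2.2.
Definition wfs (a : fsum) := {in a, forall p, wft p}.

Definition htt (Ex : seq Ord) m (p : fterm) :=
  cnf Ex m (og_d p.2.1) /\ cnf Ex m (og_d p.2.2).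
Definition hts Ex m (a : fsum) := {in a, forall p, htt Ex m p}.

(** If the inner paths are incomparable the product vanishes; coefficient zero on the pair of [p]
    keeps the term well formed and its height bounded. *)
Definition tmul (p q : fterm) : fterm :=
  if `[< og_ext p.2.2 q.2.1 >] then
    (p.1 * q.1, (p.2.1 • og_tail p.2.2 q.2.1, q.2.2))
  else if `[< og_ext q.2.1 p.2.2 >] then
    (p.1 * q.1, (p.2.1, q.2.2 • og_tail q.2.1 p.2.2))
  else (0, p.2).

Definition fmul (a b : fsum) : fsum := [seq tmul p q | p <- a, q <- b].
Definition fstar (a : fsum) : fsum := [seq (p.1^*, (p.2.2, p.2.1)) | p <- a].
Definition fsqr (a : fsum) k : fsum := iter k (fun b => fmul b b) a.

Lemma wft_tmul p q : wft p -> wft q -> wft (tmul p q).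
Proof.
case: p q => c [g f] [c' [g' f']] wp wq; rewrite /tmul; rewrite /wft /= in wp wq *.
case: asboolP => [/og_tailP[t1 t2]|_].
  by rewrite /= og_sM ?wp // -wq [in RHS]t2 og_sM.
case: asboolP => [/og_tailP[t1 t2]|_] //.
by rewrite /= og_sM -?wq // wp [in LHS]t2 og_sM.
Qed.

Lemma wfs_fmul a b : wfs a -> wfs b -> wfs (fmul a b).
Proof.
by move=> wa wb _ /allpairsP[[p q] [/wa wp /wb wq ->]]; apply: wft_tmul.
Qed.

Lemma wfs_fstar a : wfs a -> wfs (fstar a).
Proof. by move=> wa _ /mapP[p /wa wp ->]. Qed.

Lemma wfs_fsqr a k : wfs a -> wfs (fsqr a k).
Proof. by move=> wa; elim: k => //= k IH; apply: wfs_fmul. Qed.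

(** The remainder of an inner path is a tail, bounded by [cnf_tail]; composing with it adds heights
    by [cnfD] and leaves the list of exponents alone. *)
Lemma htt_tmul Ex m n p q : decr Ex -> wft p -> wft q -> htt Ex m p -> htt Ex n q ->
  htt Ex (m + n) (tmul p q).
Proof.
case: p q => c [g f] [c' [g' f']] dE wp wq [hg hf] [hg' hf'].
rewrite /tmul; rewrite /wft /= in wp wq hg hf hg' hf' *.
have tl m' x y : og_s x = og_r (og_tail x y) -> y = x • og_tail x y ->
    cnf Ex m' (og_d y) -> cnf Ex m' (og_d (og_tail x y)).
  move=> t1 t2 cy; apply: (@cnf_tail _ _ (og_d x)); apply: cnf_oeq cy.
  by rewrite {1}t2; apply: og_dM.
case: asboolP => [/og_tailP[t1 t2]|_].
  split=> /=; last exact: cnf_le (leq_addl _ _) hf'.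
  apply: cnf_oeq (oeq_sym (og_dM _)) _; first by rewrite wp.
  by apply: cnfD => //; apply: tl.
case: asboolP => [/og_tailP[t1 t2]|_].
  split=> /=; first exact: cnf_le (leq_addr _ _) hg.
  apply: cnf_oeq (oeq_sym (og_dM _)) _; first by rewrite -wq.
  by rewrite addnC; apply: cnfD => //; apply: tl.
by split=> /=; apply: cnf_le (leq_addr _ _) _.
Qed.

Lemma hts_fmul Ex m n a b : decr Ex -> wfs a -> wfs b -> hts Ex m a -> hts Ex n b ->
  hts Ex (m + n) (fmul a b).
Proof.
move=> dE wa wb ha hb _ /allpairsP[[p q] [pa qb ->]].
by apply: htt_tmul => //; [apply: wa|apply: wb|apply: ha|apply: hb].
Qed.

Lemma hts_fstar Ex m a : hts Ex m a -> hts Ex m (fstar a).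
Proof. by move=> ha _ /mapP[p /ha[h1 h2] ->]. Qed.

Lemma hts_fsqr Ex m a k : decr Ex -> wfs a -> hts Ex m a -> hts Ex (m * 2 ^ k) (fsqr a k).
Proof.
move=> dE wa ha; elim: k => [|k IH]; first by rewrite muln1.
rewrite expnS mulnCA mul2n -addnn /=.
by apply: hts_fmul => //; apply: wfs_fsqr.
Qed.

Lemma fsum_height (a : fsum) : exists Ex m, decr Ex /\ hts Ex m a.
Proof.
have [Ex [m [dE h]]] := cnf_exists ([seq p.2.1 | p <- a] ++ [seq p.2.2 | p <- a]) (@og_d L).
exists Ex, m; split=> // p pa; split; apply: h; rewrite mem_cat; apply/orP.
  by left; apply: (map_f (fun p => p.2.1)).
by right; apply: (map_f (fun p => p.2.2)).
Qed.

Section Ev.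
Variables (A : cstarAlgebra R) (T : L -> A) (TT : toeplitz T).

Lemma evt_tmul p q : wft p -> wft q -> evt T p ** evt T q = evt T (tmul p q).
Proof.
case: p q => c [g f] [c' [g' f']] wp wq.
rewrite /evt /tmul /=; rewrite /wft /= in wp wq.
rewrite cs_scaleAl cs_scaleAr scalerA -cs_mulA.
case: asboolP => [/og_tailP[t1 t2]|nfg] /=.
  congr (_ *: _); rewrite [in LHS]t2 [X in _ ** X]cs_mulA tt_extl // cs_mulA -tt_comp //.
  by rewrite wp.
case: asboolP => [/og_tailP[t1 t2]|ngf] /=.
  congr (_ *: _); rewrite [in LHS]t2 [X in _ ** X]cs_mulA tt_extr // -cs_starM -tt_comp //.
  by rewrite -wq.
by rewrite [X in _ ** X]cs_mulA tt_perp // cs_0mul cs_mul0 scaler0 scale0r.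
Qed.

Lemma ev_fmul a b : wfs a -> wfs b -> ev T (fmul a b) = ev T a ** ev T b.
Proof.
move=> wa wb; rewrite /ev big_allpairs_dep cs_mul_suml; apply: eq_big_seq => p pa.
rewrite cs_mul_sumr; apply: eq_big_seq => q qb.
by rewrite evt_tmul //; [apply: wa|apply: wb].
Qed.

Lemma ev_fstar a : ev T (fstar a) = (ev T a)^#.
Proof.
rewrite /ev big_map cs_star_sum; apply: eq_bigr => p _.
by rewrite /evt cs_starZ cs_starM cs_starK.
Qed.

Lemma ev_fsqr a k : wfs a -> ev T (fsqr a k) = cpow (ev T a) (2 ^ k).-1.
Proof.
move=> wa; elim: k => [//|k IH] /=; rewrite ev_fmul; [|exact: wfs_fsqr..].
rewrite IH cpowD expnS mul2n -addnn; congr cpow.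
have k0 : (0 < 2 ^ k)%N by rewrite expn_gt0.
by rewrite -{3 4}(prednK k0) addSn addnS.
Qed.

Lemma ev_cat a b : ev T (a ++ b) = ev T a + ev T b.
Proof. by rewrite /ev big_cat. Qed.

Lemma ev_scale k a : ev T [seq (k * p.1, p.2) | p <- a] = k *: ev T a.
Proof.
by rewrite /ev big_map scaler_sumr; apply: eq_bigr => p _; rewrite /evt scalerA.
Qed.

End Ev.

Lemma ev_hom (A B : cstarAlgebra R) (h : A -> B) (T : L -> A) a :
  star_hom h -> toeplitz T -> ev (h \o T) a = h (ev T a).
Proof.
move=> hh TT; rewrite /ev (sh_sum hh); apply: eq_bigr => p _.
by rewrite /evt (shZ hh) (sh_mul hh) (sh_star hh) !tt_hom.
Qed.

End FormalSums.

(** * Level decompositions *)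

Fixpoint lvl (ds : seq Ord) (i : nat) : Ord :=
  match i, ds with i'.+1, d :: ds' => oadd d (lvl ds' i') | _, _ => ozero end.

Lemma lvl0 ds : lvl ds 0 = ozero. Proof. by case: ds. Qed.

Lemma levelsP ds x : levels ds x ->
  exists2 i, (i <= size ds)%N & oeq x (lvl ds i).
Proof.
elim: ds x => [|d ds IH] x; first by move=> [x0|//]; exists 0%N.
move=> [x0|[y /IH[i il yi] xy]]; first by exists 0%N.
by exists i.+1 => //; apply: oeq_trans xy (oadd_oeq (oeqxx _) yi).
Qed.

Lemma levels_lvl ds i : levels ds (lvl ds i).
Proof.
elim: ds i => [|d ds IH] [|i]; try by left; apply: oeqxx.
by right; exists (lvl ds i) => //; apply: oeqxx.
Qed.

Lemma lvlS ds i : (i < size ds)%N ->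
  oeq (lvl ds i.+1) (oadd (lvl ds i) (nth ozero ds i)).
Proof.
elim: ds i => // d ds IH [|i] il.
  rewrite lvl0 /= lvl0; apply: oeq_trans (oeq_sym (oadd0x _ (oeqxx _))).
  by apply: oaddx0; apply: oeqxx.
apply: oeq_trans (oaddA _ _ _); apply: oadd_oeq (oeqxx _) _.
exact: IH.
Qed.

Lemma lvl_lt ds i j : allpos ds -> (i < j)%N -> (j <= size ds)%N ->
  olt (lvl ds i) (lvl ds j).
Proof.
move=> + ij; elim: ds i j ij => [|d ds IH] i j ij pos js.
  by move: ij; rewrite leqn0 in js; rewrite (eqP js).
case: j i => [//|j] [|i] in ij js *.
  by apply: olt_le_trans pos.1 _; apply: ole_addr.
by apply: oadd_monor_lt; apply: IH => //; case: pos.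
Qed.

Section Pieces.
Variables (L : ordinalGraph) (ds : seq Ord) (F : seq L).
Hypothesis pos : allpos ds.
Implicit Types (e f g h u v z w : L).

Let piece i f h := exists e' z, [/\ og_s e' = og_r h, og_s h = og_r z,
  f = e' • (h • z), oeq (og_d e') (lvl ds i) & oeq (og_d h) (nth ozero ds i)].

(* the pieces, starting at [u], between the levels [i] and [i + 1] of the paths of [F] *)
Definition pieces i u : seq L :=
  if (i < size ds)%N then
    undup [seq h <- [seq xget f (piece i f) | f <- F & `[< exists h, piece i f h >]] | og_r h == u]
  else [::].

Lemma piecesP i u h : h \in pieces i u -> og_r h = u /\ oeq (og_d h) (nth ozero ds i).
Proof.
rewrite /pieces; case: ifP => // _; rewrite mem_undup mem_filter => /andP[/eqP ru].
move=> /mapP[f]; rewrite mem_filter => /andP[/asboolP[h' ph'] _] hE; split=> //.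
rewrite hE; case: xgetP => [k _ [e' [z [_ _ _ _ ]]]|/(_ h')] //.
Qed.

Lemma pieces_uniq i u : uniq (pieces i u).
Proof. by rewrite /pieces; case: ifP => // _; apply: undup_uniq. Qed.

Lemma pieces_big i u : (size ds <= i)%N -> pieces i u = [::].
Proof. by rewrite /pieces ltnNge => ->. Qed.

Lemma pieces_perp i u : pairwise_perp (pieces i u).
Proof.
by apply: (pairwise_perp_d (pieces_uniq i u) (d := nth ozero ds i)) => h /piecesP[].
Qed.

Lemma pieces_rng i u : {in pieces i u, forall h, og_r h = u}.
Proof. by move=> h /piecesP[]. Qed.

(* every passage of [e] through a level below [i] is one of the pieces *)
Definition good i e := forall j e', (j < i)%N -> oeq (og_d e') (lvl ds j) ->
  og_ext e' e -> exists2 h, h \in pieces j (og_s e') & og_ext (e' • h) e.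

Lemma good_mem f i : f \in F -> (i <= size ds)%N -> oeq (og_d f) (lvl ds i) -> good i f.
Proof.
move=> fF il df j e' ji de' [x ex fE].
have js : (j < size ds)%N by apply: leq_trans ji il.
have dx : ole (nth ozero ds j) (og_d x).
  apply: (@oadd_cancel_le (lvl ds j)); apply: ole_trans (lvlS js).2 _.
  apply: ole_trans (_ : ole _ (lvl ds i)) _.
    move: ji; rewrite leq_eqVlt => /orP[/eqP<-|ji]; first exact: olexx.
    by apply: oltW; apply: lvl_lt.
  apply: ole_trans df.2 _; rewrite fE; apply: ole_trans (og_dM ex).1 _.
  exact: oadd_monol de'.1.
have [h [z [hz dh xE]]] := og_split dx.
have eh : og_s e' = og_r h by rewrite ex xE og_rM.
have ph : piece j f h by exists e', z; split; rewrite -?xE.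
exists h; last by rewrite fE xE og_compA //; apply: og_ext_comp; rewrite og_sM.
rewrite /pieces js mem_undup mem_filter eh eqxx /=.
have -> : h = xget f (piece j f).
  case: xgetP => [k _ [e2 [z2 [eh2 hz2 fE2 de2 dh2]]]|/(_ h)//].
  have E : e' • (h • z) = e2 • (k • z2) by rewrite -fE2 -xE.
  have [||_ E2] := og_factor_inj _ _ (oeq_trans de' (oeq_sym de2)) E; rewrite ?og_rM //.
  by have [] := og_factor_inj hz hz2 (oeq_trans dh (oeq_sym dh2)) E2.
by apply/map_f; rewrite mem_filter fF andbT; apply/asboolP; exists h.
Qed.

Lemma good_step i e h : (i < size ds)%N -> oeq (og_d e) (lvl ds i) -> good i e ->
  h \in pieces i (og_s e) ->
  [/\ og_s e = og_r h, oeq (og_d (e • h)) (lvl ds i.+1) & good i.+1 (e • h)].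
Proof.
move=> il de ge hP; have [rh dh] := piecesP hP.
have eh : og_s e = og_r h by [].
have deh : oeq (og_d (e • h)) (lvl ds i.+1).
  apply: oeq_trans (og_dM eh) _; apply: oeq_trans (oeq_sym (lvlS il)).
  exact: oadd_oeq.
split=> // j e' ji de' e'eh; move: ji; rewrite ltnS leq_eqVlt => /orP[/eqP ji|ji].
  have e'e : e' = e.
    by apply: og_ext_eq e'eh (og_ext_comp eh) _; apply: oeq_trans de' _; rewrite ji; apply: oeq_sym.
  by exists h; rewrite ?e'e ?ji //; apply: og_ext_refl.
have e'e : og_ext e' e.
  apply: og_ext_le e'eh (og_ext_comp eh) _; apply: ole_trans de'.1 _.
  by apply: ole_trans de.2; apply: oltW; apply: lvl_lt => //; apply: ltnW.
have [k kP ke] := ge j e' ji de' e'e.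
by exists k => //; apply: og_ext_trans ke (og_ext_comp eh).
Qed.

(** Index set of the telescoping sum [descend_sum]: a pair [(i', q)] is a level together with a
    concatenation [q] of pieces leading from level [i] to level [i']. The argument [n] counts the
    levels still ahead. *)
Fixpoint descend n i u : seq (nat * L) :=
  (i, u) :: if n is n'.+1 then
    flatten [seq [seq (p.1, h • p.2) | p <- descend n' i.+1 (og_s h)] | h <- pieces i u]
  else [::].

Lemma descendP n i e p : (i + n = size ds)%N -> oeq (og_d e) (lvl ds i) -> good i e ->
  p \in descend n i (og_s e) ->
  [/\ og_s e = og_r p.2, (p.1 <= size ds)%N, good p.1 (e • p.2) &
      oeq (og_d (e • p.2)) (lvl ds p.1)].
Proof.
elim: n i e p => [|n IH] i e p iN de ge /=.
  rewrite inE => /eqP-> /=; rewrite og_rs og_idr; split=> //.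
  by rewrite -iN leq_addr.
rewrite inE => /orP[/eqP->|] /=.
  by rewrite og_rs og_idr; split=> //; rewrite -iN leq_addr.
move=> /flatten_mapP[h hP /mapP[q qD ->]] /=.
have il : (i < size ds)%N by rewrite -iN addnS ltnS leq_addr.
have [eh deh geh] := good_step il de ge hP.
have iN' : (i.+1 + n)%N = size ds by rewrite addSnnS.
rewrite -(og_sM eh) in qD; have [h1 h2 h3 h4] := IH i.+1 (e • h) q iN' deh geh qD.
have hq : og_s h = og_r q.2 by rewrite -h1 og_sM.
by rewrite og_compA // og_rM.
Qed.

Lemma descend_r n i u p : p \in descend n i u -> og_vertex u -> u = og_r p.2.
Proof.
elim: n i u p => [|n IH] i u p /=; rewrite inE.
  by move=> /eqP-> /= ->.
move=> /orP[/eqP-> /= -> //|] /flatten_mapP[h hP /mapP[q qD ->]] vu /=; have [rh _] := piecesP hP.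
by rewrite og_rM // (IH _ _ _ qD) //; apply: og_vertex_s.
Qed.

Section Gaps.
Variables (R : realType) (A : cstarAlgebra R) (T : L -> A).
Hypothesis TT : toeplitz T.

Definition lgap i u := gap T (pieces i u) u.

(** [T_u] is its gap plus the range projections of the pieces, and each of these is expanded in the
    same way at the source of its piece. At the last level there are no pieces, and the gap is [T_u]
    itself. *)
Lemma descend_sum n i u : og_vertex u -> (i + n = size ds)%N ->
  tt T u = \sum_(p <- descend n i u) tt T p.2 ** lgap p.1 (og_s p.2) ** (tt T p.2)^#.
Proof.
elim: n i u => [|n IH] i u vu iN.
  rewrite big_seq1 /= /lgap /gap /rproj pieces_big ?big_nil ?subr0; last by rewrite -iN addn0.
  by rewrite og_s_vertex // tt_vertex_star // !tt_vertex_idem.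
rewrite big_cons /= big_flatten big_map /= og_s_vertex // tt_vertex_star //.
have pr := @pieces_rng i u.
rewrite {1}/lgap gap_rng // gap_rng' // -[LHS](subrK (rproj T (pieces i u))); congr (_ + _).
apply: eq_big_seq => h hP; have [rh _] := piecesP hP.
rewrite -{1}(tt_src TT h) big_map (IH i.+1 (og_s h) (og_vertex_s h)); last by rewrite addSnnS.
rewrite cs_mul_sumr cs_mul_suml; apply: eq_big_seq => p pD.
have hp := descend_r pD (og_vertex_s h).
by rewrite tt_comp // cs_starM og_sM // !cs_mulA.
Qed.

End Gaps.
End Pieces.

Section Terms.
Variables (R : realType) (L : ordinalGraph) (ds : seq Ord) (x : fsum R L).
Hypotheses (pos : allpos ds) (wx : wfs x).
Hypothesis lx : {in x, forall p, levels ds (og_d p.2.2)}.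

Let F := [seq p.2.2 | p <- x].
Let pcs := pieces ds F.

Definition level_of (f : L) : nat :=
  xget 0%N [set i | (i <= size ds)%N /\ oeq (og_d f) (lvl ds i)]%classic.

Lemma level_ofP p : p \in x ->
  (level_of p.2.2 <= size ds)%N /\ oeq (og_d p.2.2) (lvl ds (level_of p.2.2)).
Proof.
move=> /lx/levelsP[i il di]; rewrite /level_of.
by case: xgetP => [j _ //|/(_ i)[]].
Qed.

(* the terms [(i, (c, (g, e)))], standing for c T_g r_i T_e^*, of the level
   decomposition of [x] *)
Definition terms : seq (nat * fterm R L) :=
  flatten [seq [seq (q.1, (p.1, (p.2.1 • q.2, p.2.2 • q.2)))
    | q <- descend ds F (size ds - level_of p.2.2) (level_of p.2.2) (og_s p.2.2)] | p <- x].

Lemma terms_inv t : t \in terms -> exists p q, [/\ p \in x, og_s p.2.2 = og_r q.2,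
  t = (q.1, (p.1, (p.2.1 • q.2, p.2.2 • q.2))), (q.1 <= size ds)%N &
  good ds F q.1 (p.2.2 • q.2) /\ oeq (og_d (p.2.2 • q.2)) (lvl ds q.1)].
Proof.
move=> /flatten_mapP[p px /mapP[q qD ->]]; exists p, q.
have [l1 l2] := level_ofP px.
have pF : p.2.2 \in F by apply: (map_f (fun p : fterm R L => p.2.2)).
by have [|h1 h2 h3 h4] := descendP pos _ l2 (good_mem pos pF l1 l2) qD; first exact: subnKC.
Qed.

Lemma termsP t : t \in terms -> [/\ (t.1 <= size ds)%N, wft t.2,
  good ds F t.1 t.2.2.2 & oeq (og_d t.2.2.2) (lvl ds t.1)].
Proof.
move=> /terms_inv[p [q [px pq -> ? [? ?]]]]; split=> //=.
by rewrite /wft /= !og_sM // (wx px).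
Qed.

(** The left path is [g q], where [q] is a tail of a path that ends at a level; both factors have
    height at most [m]. *)
Lemma terms_height Ex m t : decr Ex -> hts Ex m x ->
  (forall i, (i <= size ds)%N -> cnf Ex m (lvl ds i)) ->
  t \in terms -> cnf Ex (m + m) (og_d t.2.2.1).
Proof.
move=> dE hx hl /terms_inv[p [q [px pq -> iq [_ dq]]]] /=.
have wp : og_s p.2.1 = og_r q.2 by rewrite (wx px).
apply: cnf_oeq (oeq_sym (og_dM wp)) _; apply: cnfD => //; first by case: (hx p px).
apply: (@cnf_tail _ _ (og_d p.2.2)); apply: cnf_oeq (hl _ iq).
exact: oeq_trans (oeq_sym dq) (og_dM pq).
Qed.

Section EvTerms.
Variables (A : cstarAlgebra R) (T : L -> A).
Hypothesis TT : toeplitz T.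

Definition gapi i u := lgap ds F T i u.

Definition evterm (t : nat * fterm R L) : A :=
  t.2.1 *: (tt T t.2.2.1 ** gapi t.1 (og_s t.2.2.2) ** (tt T t.2.2.2)^#).

Lemma ev_terms : ev T x = \sum_(t <- terms) evterm t.
Proof.
rewrite /ev /terms big_flatten big_map /=; apply: eq_big_seq => p px.
have [l1 l2] := level_ofP px.
rewrite /evt -{1}(tt_src TT p.2.1) (wx px).
rewrite (descend_sum F TT (og_vertex_s p.2.2) (subnKC l1)).
rewrite cs_mul_sumr cs_mul_suml scaler_sumr big_map; apply: eq_big_seq => q qD /=.
have pq := descend_r qD (og_vertex_s _).
have gq : og_s p.2.1 = og_r q.2 by rewrite (wx px).
by rewrite /evterm /= !tt_comp // cs_starM og_sM // !cs_mulA.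
Qed.

(* Multiplying by T_e T_w with [w] incomparable to all pieces of level [i]
   selects the terms of level [i] with right path [e]. *)
Lemma ev_test i e w : (i <= size ds)%N -> oeq (og_d e) (lvl ds i) -> good ds F i e ->
  og_r w = og_s e -> {in pcs i (og_s e), forall h, og_perp w h} ->
  ev T x ** tt T (e • w) =
  \sum_(t <- terms | (t.1 == i) && (t.2.2.2 == e)) t.2.1 *: tt T (t.2.2.1 • w).
Proof.
move=> il de ge rw pw; rewrite ev_terms cs_mul_suml [RHS]big_mkcond /=.
have ew : og_s e = og_r w by [].
apply: eq_big_seq => -[i' [c [g e']]] /termsP[/= i'l wt ge' de'].
rewrite /evterm /= cs_scaleAl -!cs_mulA.
rewrite /wft /= in wt.
suff E : gapi i' (og_s e') ** ((tt T e')^# ** tt T (e • w)) =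
    if (i' == i) && (e' == e) then tt T w else 0.
  rewrite E; case: ifP => [/andP[_ /eqP ee]|]; last by rewrite cs_mul0 scaler0.
  by rewrite tt_comp // wt ee.
have noext : ~ og_ext e' (e • w) -> olt (og_d e') (og_d e) -> og_perp e' (e • w).
  move=> ne lt; split=> // /og_ext_d /ole_gtF; apply.
  exact: olt_le_trans lt (ole_trans (ole_addr _ _) (og_dM ew).2).
case: (ltngtP i' i) => [i'i|ii'|ii'] /=.
(* A lower level: if [e'] is a prefix of [e], then [e] goes on through one of the pieces behind
   [e'], which the gap of that level kills. *)
- have lt : olt (og_d e') (og_d e).
    by apply: ole_lt_trans de'.1 _; apply: olt_le_trans de.2; apply: lvl_lt.
  case: (pselect (og_ext e' (e • w))) => [e'ew|/noext/(_ lt) p]; last first.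
    by rewrite tt_perp // cs_mul0.
  have e'e := og_ext_le e'ew (og_ext_comp ew) (oltW lt).
  have [h hP [y hy eE]] := ge i' e' i'i de' e'e.
  have [rh _] := piecesP hP; have eh : og_s e' = og_r h by [].
  rewrite og_sM // in hy.
  have yw : og_s y = og_r w by rewrite -ew eE og_sM // og_sM.
  rewrite eE -og_compA ?og_sM // -og_compA ?og_rM // tt_extl //; last by rewrite og_rM ?og_rM.
  apply: gap_mem hP _ => //; rewrite ?og_rM //; first exact: pieces_perp.
  exact: pieces_rng.
(* A higher level: if [e'] extends [e], it does so through a piece of level [i], and [w] is
   incomparable to that piece. *)
- have lt : olt (og_d e) (og_d e').
    by apply: ole_lt_trans de.1 _; apply: olt_le_trans de'.2; apply: lvl_lt.
  case: (pselect (og_ext e e')) => [ee'|ne]; last first.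
    rewrite tt_perp ?cs_mul0 //; apply: og_perp_sym.
    apply: (@og_perp_ext _ e e'); [|exact: og_ext_comp|exact: og_ext_refl].
    by split=> // /og_ext_d /ole_gtF; apply.
  have [h hP ehe'] := ge' i e ii' de ee'; have [rh _] := piecesP hP.
  rewrite tt_perp ?cs_mul0 //; apply: og_perp_sym.
  apply: (@og_perp_ext _ (e • w) (e • h)); [|exact: og_ext_refl|exact: ehe'].
  by apply/og_perp_compl => //; apply: pw.
- subst i'; have [ee|ne] := eqVneq e' e.
    by rewrite ee tt_extl // gap_perp // => h hP; apply/og_perp_sym/pw.
  rewrite tt_perp ?cs_mul0 //.
  apply: (@og_perp_ext _ e' e); [|exact: og_ext_refl|exact: og_ext_comp].
  by apply: og_perp_d; [apply: oeq_trans de' (oeq_sym de)|apply/eqP].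
Qed.

End EvTerms.
End Terms.

Lemma big_keys (V : nmodType) (I K : eqType) (k : I -> K) (s : seq I) (f : I -> V) :
  \sum_(i <- s) f i = \sum_(e <- undup (map k s)) \sum_(i <- s | k i == e) f i.
Proof.
under [RHS]eq_bigr do rewrite big_mkcond.
rewrite exchange_big /=; apply: eq_big_seq => i si.
rewrite (bigD1_seq (k i)) ?undup_uniq //= ?mem_undup ?map_f //.
by rewrite eqxx big1 ?addr0 // => e; rewrite eq_sym => /negbTE ->.
Qed.

Lemma sum_le_const (R : realType) (I : eqType) (s : seq I) (f : I -> R) (c : R) :
  {in s, forall i, f i <= c} -> \sum_(i <- s) f i <= (size s)%:R * c.
Proof.
elim: s => [|i s IH] h; first by rewrite big_nil mul0r.
rewrite big_cons /= -natr1 mulrDl mul1r addrC lerD ?h ?mem_head //.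
by apply: IH => j js; apply: h; rewrite inE js orbT.
Qed.

Lemma nrm_mul_le1 (R : realType) (A : cstarAlgebra R) (x y : A) :
  nrm x <= 1 -> nrm y <= 1 -> nrm (x ** y) <= 1.
Proof.
move=> x1 y1; apply: le_trans (nrmM _ _) _.
by rewrite -[leRHS]mul1r ler_pM ?nrm_ge0.
Qed.

(** * The norm of one block *)

Section Block.
Variables (R : realType) (L : ordinalGraph) (yl : fsum R L) (dg de : Ord).
Hypothesis wy : wfs yl.
Hypothesis dgy : {in yl, forall p, oeq (og_d p.2.1) dg}.
Hypothesis dey : {in yl, forall p, oeq (og_d p.2.2) de}.

Definition rights := undup [seq p.2.2 | p <- yl].

(** The matrix of [block^# ** block] with respect to the elements [U e e']. It depends only on the
    coefficients of [yl], and so carries bounds from one family to another. *)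
Definition gram (e e' : L) : R[i] :=
  \sum_(q <- yl | q.2.2 == e') \sum_(p <- yl | (p.2.2 == e) && (p.2.1 == q.2.1)) p.1^* * q.1.

Fixpoint gramn n e e' : R[i] :=
  if n is n'.+1 then \sum_(e1 <- rights) gram e e1 * gramn n' e1 e' else gram e e'.

Lemma rightsP e : e \in rights -> oeq (og_d e) de.
Proof. by rewrite mem_undup => /mapP[p py ->]; apply: dey. Qed.

Lemma gram_source e e' : og_s e <> og_s e' -> gram e e' = 0.
Proof.
move=> ne; rewrite /gram big1_seq // => q /andP[/eqP qe qy].
rewrite big1_seq // => p /andP[/andP[/eqP pe /eqP pq] py]; case: ne.
by rewrite -pe -qe -(wy py) -(wy qy) pq.
Qed.

Lemma gramn_source n e e' : og_s e <> og_s e' -> gramn n e e' = 0.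
Proof.
elim: n e => [|n IH] e ne; first exact: gram_source.
rewrite /= big1 // => e1 _; case: (pselect (og_s e = og_s e1)) => [ee|/gram_source->].
  by rewrite IH ?mulr0 // -ee.
by rewrite mul0r.
Qed.

Section Upper.
Variables (A : cstarAlgebra R) (T : L -> A) (TT : toeplitz T) (r : L -> A) (M : R).
Hypothesis M0 : 0 <= M.
Hypothesis rstar : forall u, og_vertex u -> (r u)^# = r u.
Hypothesis ridem : forall u, og_vertex u -> r u ** r u = r u.
Hypothesis rrng : forall u, og_vertex u -> tt T u ** r u = r u.
Hypothesis bound : forall n e e', e \in rights -> e' \in rights -> og_s e = og_s e' ->
  r (og_s e) <> 0 -> nrmc (gramn n e e') <= M ^+ (2 * n.+1).

Definition block : A := \sum_(p <- yl) p.1 *: (tt T p.2.1 ** r (og_s p.2.2) ** (tt T p.2.2)^#).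

(** Right paths in a block have equal length, hence are equal or incomparable; so these elements
    multiply like matrix units among paths with a common source. *)
Let U e e' : A := tt T e ** r (og_s e) ** (tt T e')^#.

Let rsrc u : og_vertex u -> r u ** tt T u = r u.
Proof.
by move=> vu; rewrite -[LHS]cs_starK cs_starM tt_vertex_star // rstar // rrng // rstar.
Qed.

Let UU e e1 e2 e' : og_s e = og_s e1 -> e1 \in rights -> e2 \in rights ->
  U e e1 ** U e2 e' = if e1 == e2 then U e e' else 0.
Proof.
move=> ee e1R e2R; rewrite /U -!cs_mulA [(tt T e1)^# ** _]cs_mulA.
case: eqP => [<-|ne]; last first.
  rewrite tt_perp ?cs_0mul ?cs_mul0 //; apply: og_perp_d => //.
  exact: oeq_trans (rightsP e1R) (oeq_sym (rightsP e2R)).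
have vs := og_vertex_s e1.
rewrite tt_source // -ee in vs *.
by rewrite [tt T (og_s e) ** (_ ** _)]cs_mulA rrng // [r _ ** (r _ ** _)]cs_mulA ridem.
Qed.

Lemma block_gram : block^# ** block = \sum_(e <- rights) \sum_(e' <- rights) gram e e' *: U e e'.
Proof.
transitivity (\sum_(q <- yl) \sum_(p <- yl | p.2.1 == q.2.1) (p.1^* * q.1) *: U p.2.2 q.2.2).
  rewrite /block cs_star_sum cs_mul_suml.
  under eq_bigr do rewrite cs_mul_sumr.
  rewrite exchange_big; apply: eq_big_seq => q qy; rewrite [RHS]big_mkcond; apply: eq_big_seq => p py.
  have vp := og_vertex_s p.2.2; have vq := og_vertex_s q.2.2.
  rewrite cs_starZ cs_scaleAl cs_scaleAr scalerA !cs_starM cs_starK rstar //.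
  case: eqP => [pq|npq]; last first.
    rewrite -!cs_mulA [(tt T p.2.1)^# ** _]cs_mulA tt_perp ?cs_0mul ?cs_mul0 ?scaler0 //.
    by apply: og_perp_d => //; apply: oeq_trans (dgy py) (oeq_sym (dgy qy)).
  congr (_ *: _); rewrite /U -!cs_mulA [(tt T p.2.1)^# ** _]cs_mulA pq tt_source //.
  have ss : og_s q.2.1 = og_s p.2.2 by rewrite -pq (wy py).
  rewrite -(wy qy) ss [tt T (og_s p.2.2) ** (r _ ** _)]cs_mulA rrng //.
  by rewrite [r _ ** (r _ ** _)]cs_mulA ridem.
rewrite (big_keys (fun q : fterm R L => q.2.2)) [RHS]exchange_big.
apply: eq_big_seq => e' e'R /=.
transitivity (\sum_(e <- rights) \sum_(q <- yl | q.2.2 == e')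
    \sum_(p <- yl | (p.2.2 == e) && (p.2.1 == q.2.1)) (p.1^* * q.1) *: U e e').
  rewrite exchange_big /=; apply: eq_bigr => q /eqP qe.
  rewrite [LHS]big_mkcond (big_keys (fun p : fterm R L => p.2.2)); apply: eq_bigr => e _.
  rewrite -big_mkcondr; apply: eq_bigr => p /andP[/eqP pe _].
  by rewrite pe qe.
apply: eq_bigr => e _; rewrite /gram scaler_suml; apply: eq_bigr => q _.
by rewrite scaler_suml.
Qed.

Lemma cpow_block n : cpow (block^# ** block) n =
  \sum_(e <- rights) \sum_(e' <- rights) gramn n e e' *: U e e'.
Proof.
elim: n => [|n IH]; first exact: block_gram.
rewrite /= IH {1}block_gram cs_mul_suml; apply: eq_big_seq => e eR.
rewrite cs_mul_suml; under [LHS]eq_bigr do rewrite cs_mul_sumr.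
transitivity (\sum_(e1 <- rights) \sum_(e' <- rights) (gram e e1 * gramn n e1 e') *: U e e').
  apply: eq_big_seq => e1 e1R.
  under [LHS]eq_bigr do rewrite cs_mul_sumr.
  rewrite exchange_big /=; apply: eq_big_seq => e' e'R.
  case: (pselect (og_s e = og_s e1)) => [ee|/gram_source->]; last first.
    by rewrite mul0r !scale0r big1_seq // => e2 _; rewrite cs_0mul.
  rewrite (bigD1_seq e1) ?undup_uniq //= big1_seq ?addr0.
    by rewrite cs_scaleAl cs_scaleAr scalerA UU // eqxx.
  move=> e2 /andP[ne e2R].
  by rewrite cs_scaleAl cs_scaleAr UU // eq_sym (negbTE ne) !scaler0.
rewrite exchange_big /=; apply: eq_bigr => e' _.
by rewrite scaler_suml.
Qed.

Let nrmU e e' : nrm (U e e') <= 1.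
Proof.
have vs := og_vertex_s e.
apply: nrm_mul_le1; last by rewrite nrm_star nrm_tt.
by apply: nrm_mul_le1; [exact: nrm_tt|apply: nrm_proj; [apply: rstar|apply: ridem]].
Qed.

(** The coefficients of the power [2^k] of [block^# ** block] are at most [(M^2)^(2^k)] wherever
    [U e e'] is nonzero, and their number does not depend on [k]; so [growth] applies with
    [B = 1]. *)
Lemma nrm_block : nrm block <= M.
Proof.
have nb : (block^# ** block)^# = block^# ** block by rewrite cs_starM cs_starK.
suff : nrm (block^# ** block) <= M ^+ 2.
  by rewrite nrmS ler_pXn2r // nnegrE // nrm_ge0.
apply: (@growth _ _ _ (size rights * size rights) 1); rewrite ?nrm_ge0 ?exprn_ge0 // => k.
rewrite -nrm_cpow // exp1n muln1 cpow_block -exprM natrM -mulrA.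
have k0 : (0 < 2 ^ k)%N by rewrite expn_gt0.
apply: le_trans (nrm_sum _ _ _) _; apply: sum_le_const => e eR.
apply: le_trans (nrm_sum _ _ _) _; apply: sum_le_const => e' e'R.
rewrite nrmZ; case: (pselect (U e e' = 0)) => [->|U0].
  by rewrite nrm0 mulr0 exprn_ge0.
rewrite -[leRHS]mulr1 ler_pM ?nrm_ge0 ?nrmc_ge0 //.
case: (pselect (og_s e = og_s e')) => [ee|/gramn_source->]; last first.
  by rewrite /nrmc normr0 exprn_ge0.
rewrite -{2}(prednK k0); apply: bound => // r0; apply: U0.
by rewrite /U r0 cs_mul0 cs_0mul.
Qed.

End Upper.
End Block.

(** A space of vectors on which the family acts by left multiplication. Bounds are asked on [Y]
    only; for [X_alpha] it will consist of vectors built from the tails of one non-returning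
    path. *)
Record og_invariant (R : realType) (L : ordinalGraph) (A : cstarAlgebra R) (T : L -> A)
    (Y : A -> Prop) : Prop := Invariant {
  inv0 : Y 0;
  invD : forall x y, Y x -> Y y -> Y (x + y);
  invZ : forall (k : R[i]) x, Y x -> Y (k *: x);
  inv_mul : forall e x, Y x -> Y (tt T e ** x);
  inv_adj : forall e x, Y x -> Y ((tt T e)^# ** x)
}.

Section Invariant.
Variables (R : realType) (L : ordinalGraph) (A : cstarAlgebra R) (T : L -> A).
Variables (Y : A -> Prop) (YT : og_invariant T Y).

Lemma inv_sum (I : eqType) (s : seq I) (f : I -> A) :
  {in s, forall i, Y (f i)} -> Y (\sum_(i <- s) f i).
Proof.
elim: s => [|i s IH] h; first by rewrite big_nil; apply: inv0 YT.
rewrite big_cons; apply: (invD YT); first by apply: h; rewrite mem_head.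
by apply: IH => j js; apply: h; rewrite inE js orbT.
Qed.

Lemma inv_rproj l x : Y x -> Y (rproj T l ** x).
Proof.
move=> Yx; rewrite /rproj cs_mul_suml; apply: inv_sum => e _.
by rewrite -cs_mulA; apply: (inv_mul YT); apply: (inv_adj YT).
Qed.

Lemma inv_ev a x : Y x -> Y (ev T a ** x).
Proof.
move=> Yx; rewrite /ev cs_mul_suml; apply: inv_sum => p _.
rewrite /evt cs_scaleAl -cs_mulA; apply: (invZ YT).
by apply: (inv_mul YT); apply: (inv_adj YT).
Qed.

(** For [y = a^# x], which is again in [Y], one has [|y|^2 = |x^# (a y)| <= |x| M |y|]. *)
Lemma inv_bound_star a (M : R) : 0 <= M ->
  (forall x, Y x -> nrm (ev T a ** x) <= M * nrm x) ->
  forall x, Y x -> nrm ((ev T a)^# ** x) <= M * nrm x.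
Proof.
move=> M0 h x Yx; set y := (ev T a)^# ** x.
have Yy : Y y by rewrite /y -ev_fstar; apply: inv_ev.
have [y0|y0] := eqVneq (nrm y) 0; first by rewrite y0 mulr_ge0 // nrm_ge0.
have yp : 0 < nrm y by rewrite lt_neqAle eq_sym y0 nrm_ge0.
rewrite -(ler_pM2r yp) -expr2 -nrmS {1}/y cs_starM cs_starK -cs_mulA.
apply: le_trans (nrmM _ _) _; rewrite nrm_star.
apply: le_trans (_ : nrm x * (M * nrm y) <= _); last by rewrite mulrCA mulrA.
by rewrite ler_wpM2l ?nrm_ge0 // h.
Qed.

End Invariant.

Section Lower.
Variables (R : realType) (L : ordinalGraph) (tl : fsum R L) (K : L -> bool).
Variables (A : cstarAlgebra R) (T : L -> A) (TT : toeplitz T).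
Variables (X : A) (u w : L).
Hypotheses (wtl : wfs tl) (rw : og_r w = u).
Let yl := [seq t <- tl | K t.2.1].
Hypothesis hX : forall e, e \in rights yl -> og_s e = u ->
  X ** tt T (e • w) = \sum_(t <- tl | t.2.2 == e) t.1 *: tt T (t.2.1 • w).
Hypothesis sep : {in [seq p <- map (fun t => t.2.1) tl ++ rights yl | og_s p == u] &,
  forall p q, p <> q -> og_perp (p • w) (q • w)}.

Let wyl : wfs yl.
Proof. by move=> p; rewrite mem_filter => /andP[_ /wtl]. Qed.

Let Gs := undup [seq p.2.1 | p <- yl & og_s p.2.1 == u].
Let Es := [seq e <- rights yl | og_s e == u].
Let pG := rproj T [seq g • w | g <- Gs].
Let qE := rproj T [seq e • w | e <- Es].

Let GsP g : g \in Gs -> [/\ og_s g = u, K g &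
  g \in [seq p <- map (fun t => t.2.1) tl ++ rights yl | og_s p == u]].
Proof.
rewrite mem_undup => /mapP[p]; rewrite mem_filter => /andP[/eqP su].
rewrite mem_filter => /andP[Kp pt] ->; split=> //.
rewrite mem_filter su eqxx mem_cat; apply/orP; left.
exact: (map_f (fun t : fterm R L => t.2.1)).
Qed.

Let EsP e : e \in Es -> [/\ og_s e = u, e \in rights yl &
  e \in [seq p <- map (fun t => t.2.1) tl ++ rights yl | og_s p == u]].
Proof.
by rewrite mem_filter => /andP[/eqP su eR]; split; rewrite // mem_filter su eqxx mem_cat eR orbT.
Qed.

Let tlP t : t \in tl -> og_s t.2.2 = u ->
  t.2.1 \in [seq p <- map (fun t => t.2.1) tl ++ rights yl | og_s p == u].
Proof.
move=> ti su; rewrite mem_filter (wtl ti) su eqxx mem_cat; apply/orP; left.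
exact: (map_f (fun t : fterm R L => t.2.1)).
Qed.

Let pairwise l : uniq l ->
  {subset l <= [seq p <- map (fun t => t.2.1) tl ++ rights yl | og_s p == u]} ->
  pairwise_perp [seq g • w | g <- l].
Proof.
move=> ul sub; split.
  rewrite map_inj_in_uniq // => g h gl hl E; apply: contrapT => ne.
  by case: (og_perp_irr (sep (sub _ gl) (sub _ hl) ne)).
move=> _ _ /mapP[g gl ->] /mapP[h hl ->] ne; apply: sep; [exact: sub|exact: sub|].
by move=> gh; apply: ne; rewrite gh.
Qed.

Let ppG : pairwise_perp [seq g • w | g <- Gs].
Proof. by apply: pairwise; [exact: undup_uniq|move=> g /GsP[]]. Qed.

Let ppE : pairwise_perp [seq e • w | e <- Es].
Proof. by apply: pairwise; [apply/filter_uniq/undup_uniq|move=> g /EsP[]]. Qed.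

Let pX e : e \in Es -> pG ** (X ** tt T (e • w)) =
  \sum_(q <- yl | q.2.2 == e) q.1 *: tt T (q.2.1 • w).
Proof.
move=> eE; have [su eR _] := EsP eE; rewrite hX // cs_mul_sumr big_filter_cond.
rewrite [LHS]big_mkcond [RHS]big_mkcond; apply: eq_big_seq => t ti.
case: eqP => te; last by rewrite andbF.
have st : og_s t.2.2 = u by rewrite te.
rewrite andbT cs_scaleAr; case: ifP => Kt.
  rewrite rproj_mem1 //; apply: map_f; rewrite mem_undup.
  apply: (map_f (fun t : fterm R L => t.2.1)).
  by rewrite !mem_filter Kt ti (wtl ti) st eqxx.
rewrite rproj_perp ?scaler0 // => _ /mapP[g gG ->]; have [_ Kg gm] := GsP gG.
apply: sep => //; first exact: tlP.
by move=> E; rewrite -E Kg in Kt.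
Qed.

Let XP e g : e \in Es -> g \in Gs -> (tt T (e • w))^# ** (X^# ** tt T (g • w)) =
  (\sum_(p <- yl | (p.2.2 == e) && (p.2.1 == g)) p.1^*) *: tt T (og_s w).
Proof.
move=> eE gG; have [su eR _] := EsP eE; have [sg Kg gm] := GsP gG.
have -> : (tt T (e • w))^# ** (X^# ** tt T (g • w)) =
    ((tt T (g • w))^# ** (X ** tt T (e • w)))^#.
  by rewrite !cs_starM cs_starK -cs_mulA.
rewrite hX // cs_mul_sumr.
have gw : og_s g = og_r w by rewrite rw.
transitivity ((\sum_(p <- yl | (p.2.2 == e) && (p.2.1 == g)) p.1 *: tt T (og_s w))^#).
  congr (_^#); rewrite big_filter_cond [LHS]big_mkcond [RHS]big_mkcond.
  apply: eq_big_seq => t ti; case: eqP => te; last by rewrite andbF.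
  rewrite cs_scaleAr /=; case: eqP => [tg|ntg].
    by rewrite tg Kg /= tt_source // og_sM.
  rewrite andbF tt_perp ?scaler0 //; apply: sep => //; last exact/nesym.
  by apply: tlP; rewrite ?te.
rewrite cs_star_sum scaler_suml; apply: eq_bigr => p _.
by rewrite cs_starZ tt_vertex_star //; apply: og_vertex_s.
Qed.

(** On the vectors [T_(e w) z] this compression of [X^# X] acts as the matrix [gram]: [pG] discards
    the terms whose left path fails [K], and [qE] leads back to the right paths of the block. *)
Let Th := qE ** (X^# ** (pG ** X)).

Let Th_mul e' : e' \in Es -> Th ** tt T (e' • w) = \sum_(e <- Es) gram yl e e' *: tt T (e • w).
Proof.
move=> eE; have [su eR _] := EsP eE.
rewrite /Th -!cs_mulA pX // !cs_mul_sumr.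
under [RHS]eq_bigr do rewrite /gram scaler_suml.
rewrite [RHS]exchange_big /= ; rewrite big_seq_cond [RHS]big_seq_cond; apply: eq_bigr => q /andP[qy /eqP qe].
have gG : q.2.1 \in Gs.
  rewrite mem_undup; apply: (map_f (fun t : fterm R L => t.2.1)).
  by rewrite mem_filter qy andbT (wyl qy) qe su.
rewrite !cs_scaleAr /qE /rproj cs_mul_suml big_map scaler_sumr; apply: eq_big_seq => e eEs.
have [se _ _] := EsP eEs; have ew : og_s e = og_r w by rewrite rw.
rewrite -cs_mulA XP // cs_scaleAr -(og_sM ew) tt_src // scalerA; congr (_ *: _).
by rewrite mulr_sumr; apply: eq_bigr => p _; rewrite mulrC.
Qed.

Let Th_iter n e' z : e' \in Es -> iter n.+1 (cs_mul Th) (tt T (e' • w) ** z) =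
  \sum_(e <- Es) gramn yl n e e' *: (tt T (e • w) ** z).
Proof.
move=> eE; elim: n => [|n IH].
  by rewrite /= cs_mulA Th_mul // cs_mul_suml; apply: eq_bigr => e _; rewrite cs_scaleAl.
rewrite iterS IH cs_mul_sumr.
transitivity (\sum_(e1 <- Es) \sum_(e <- Es) (gram yl e e1 * gramn yl n e1 e') *: (tt T (e • w) ** z)).
  apply: eq_big_seq => e1 e1E; rewrite cs_scaleAr cs_mulA Th_mul // cs_mul_suml scaler_sumr.
  by apply: eq_bigr => e _; rewrite cs_scaleAl scalerA mulrC.
rewrite exchange_big /=; apply: eq_big_seq => e eEs; rewrite -scaler_suml; congr (_ *: _).
have [se _ _] := EsP eEs.
rewrite big_filter big_mkcond; apply: eq_bigr => e1 _; case: eqP => // ne.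
by rewrite gram_source ?mul0r // se => /esym.
Qed.

Variables (Y : A -> Prop) (YT : og_invariant T Y) (M : R) (M0 : 0 <= M).
Hypothesis YX : forall z, Y z -> Y (X ** z).
Hypothesis YX' : forall z, Y z -> Y (X^# ** z).
Hypothesis bX : forall z, Y z -> nrm (X ** z) <= M * nrm z.
Hypothesis bX' : forall z, Y z -> nrm (X^# ** z) <= M * nrm z.

Let proj_le l z : pairwise_perp l -> nrm (rproj T l ** z) <= nrm z.
Proof.
move=> pl; apply: le_trans (nrmM _ _) _; rewrite -[leRHS]mul1r.
by rewrite ler_wpM2r ?nrm_ge0 // nrm_rproj.
Qed.

Let Th_bound n z : Y z -> nrm (iter n (cs_mul Th) z) <= M ^+ (2 * n) * nrm z /\ Y (iter n (cs_mul Th) z).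
Proof.
move=> Yz; elim: n => [|n [IH1 IH2]]; first by rewrite muln0 expr0 mul1r.
set z' := iter n _ _ in IH1 IH2; rewrite iterS -/z' /Th -!cs_mulA.
have Y1 := YX IH2; have Y2 := inv_rproj YT [seq g • w | g <- Gs] Y1; have Y3 := YX' Y2.
split; last exact: inv_rproj.
apply: le_trans (proj_le _ ppE) _; apply: le_trans (bX' Y2) _.
rewrite mulnS exprD expr2 -!mulrA; apply: ler_wpM2l => //.
apply: le_trans (proj_le _ ppG) _; apply: le_trans (bX IH2) _.
by apply: ler_wpM2l.
Qed.

(** The entry is read off from [T_(e w)^# Th^(n+1) T_(e' w) z], a scalar multiple of [z], while [Th]
    has norm at most [M^2] on [Y]. *)
Lemma gramn_bound z n e e' : Y z -> z <> 0 -> tt T (og_s w) ** z = z ->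
  e \in rights yl -> e' \in rights yl -> og_s e = u -> og_s e' = u ->
  nrmc (gramn yl n e e') <= M ^+ (2 * n.+1).
Proof.
move=> Yz z0 wz eR e'R se se'.
have eE : e \in Es by rewrite mem_filter se eqxx.
have e'E : e' \in Es by rewrite mem_filter se' eqxx.
have ew : og_s e = og_r w by rewrite rw.
have zp : 0 < nrm z by rewrite lt_neqAle nrm_ge0 andbT eq_sym; apply/eqP => /nrm_eq0.
have le1 (x y : A) : nrm x <= 1 -> nrm (x ** y) <= nrm y.
  move=> x1; apply: le_trans (nrmM _ _) _; rewrite -[leRHS]mul1r.
  by rewrite ler_wpM2r ?nrm_ge0.
rewrite -(ler_pM2r zp) -nrmZ.
have -> : gramn yl n e e' *: z = (tt T (e • w))^# ** iter n.+1 (cs_mul Th) (tt T (e' • w) ** z).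
  rewrite Th_iter // cs_mul_sumr (bigD1_seq e) ?filter_uniq ?undup_uniq //= big1_seq ?addr0.
    by rewrite cs_scaleAr cs_mulA tt_source // og_sM // wz.
  move=> e1 /andP[/eqP ne e1E]; rewrite cs_scaleAr cs_mulA tt_perp ?cs_0mul ?scaler0 //.
  have [_ _ m1] := EsP eE; have [_ _ m2] := EsP e1E.
  by apply: sep => //; apply/nesym.
have [|h _] := @Th_bound n.+1 (tt T (e' • w) ** z); first exact: inv_mul.
apply: le_trans (le1 _ _ _) _; first by rewrite nrm_star nrm_tt.
apply: le_trans h _; apply: ler_wpM2l; first exact: exprn_ge0.
by apply: le1; apply: nrm_tt.
Qed.

End Lower.

Lemma nth_allpairs (S T U : Type) (f : S -> T -> U) (x0 : S) (y0 : T) (z0 : U) s t i :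
  (i < size [seq f x y | x <- s, y <- t])%N -> exists a b,
  [/\ (a < size s)%N, (b < size t)%N &
     nth z0 [seq f x y | x <- s, y <- t] i = f (nth x0 s a) (nth y0 t b)].
Proof.
elim: s i => //= x s IH i; rewrite size_cat size_map nth_cat size_map => il.
case: ifP => it; first by exists 0%N, i; split=> //=; rewrite (nth_map y0).
have [|a [b [sa tb E]]] := IH (i - size t)%N; last by exists a.+1, b.
by rewrite ltn_subLR // leqNgt it.
Qed.

Lemma cnf_nth_codes Ex m i : (i < size (cnf_codes Ex m))%N ->
  cnf Ex m (nth ozero (cnf_codes Ex m) i).
Proof.
elim: Ex i => [|a r IH] i; first by case: i => // _; apply: oeqxx.
rewrite cnf_codes_cons => /(nth_allpairs 0%N ozero ozero)[k [b [kl bl ->]]].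
exists k, (nth ozero (cnf_codes r m) b); split.
- by rewrite size_iota in kl; rewrite -ltnS.
- exact: IH.
- by rewrite size_iota in kl; rewrite nth_iota // add0n; apply: oeqxx.
Qed.

Lemma levels_oeq ds x y : oeq x y -> levels ds x -> levels ds y.
Proof.
move=> xy; case: ds => [|d ds] [x0|h].
- by left; apply: oeq_trans (oeq_sym xy) x0.
- by [].
- by left; apply: oeq_trans (oeq_sym xy) x0.
- by right; case: h => z zl xz; exists z => //; apply: oeq_trans (oeq_sym xy) xz.
Qed.

Lemma big_iota_key (V : nmodType) (I : eqType) (a : I -> nat) N (s : seq I) (f : I -> V) :
  {in s, forall i, (a i < N)%N} ->
  \sum_(i <- s) f i = \sum_(n <- iota 0 N) \sum_(i <- s | a i == n) f i.
Proof.
move=> aN; under [RHS]eq_bigr do rewrite big_mkcond.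
rewrite exchange_big /=; apply: eq_big_seq => i si.
rewrite (bigD1_seq (a i)) ?iota_uniq //= ?mem_iota ?aN //.
by rewrite eqxx big1 ?addr0 // => e; rewrite eq_sym => /negbTE ->.
Qed.

(** * The norm estimate *)

Section Main.
Variables (R : realType) (L : ordinalGraph) (SL : og_separating L).
Variables (B : cstarAlgebra R) (rho : L -> B) (FR : og_family rho).
Variables (J : Type) (E : J -> cstarAlgebra R) (pi : forall j, L -> E j).
Variable Y : forall j, E j -> Prop.
Hypothesis piT : forall j, toeplitz (pi j).
Hypothesis piY : forall j, og_invariant (pi j) (@Y j).
Hypothesis nonv : forall v, og_vertex v ->
  exists j z, [/\ Y z, z <> 0 & tt (pi j) v ** z = z].
Implicit Types x a : fsum R L.

(** The terms are sorted by their level, which is the length of the right path, and by the length of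
    the left path. Each block has norm at most [M]; the factor counts the levels, at most one more
    than the codes of height [m], times the codes of height [m + m]. *)
Lemma ev_bound Ex m x (M : R) : decr Ex -> wfs x -> hts Ex m x -> 0 <= M ->
  (forall j z, Y z -> nrm (ev (pi j) x ** z) <= M * nrm z) ->
  nrm (ev rho x) <= ((size (cnf_codes Ex m)).+1 * size (cnf_codes Ex (m + m)))%:R * M.
Proof.
move=> dE wx hx M0 bx.
have TR := og_family_toeplitz FR.
set c1 := cnf_codes Ex m; set c2 := cnf_codes Ex (m + m).
have [ds [pos sds inds out]] := levels_cover (iota 0 (size c1)) (nth ozero c1).
rewrite size_iota in sds.
have lx : {in x, forall p, levels ds (og_d p.2.2)}.
  move=> p px; have [_ /cnf_code[i il di]] := hx p px.
  apply: levels_oeq (oeq_sym di) _; apply: inds.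
  by rewrite mem_iota.
have hl i : (i <= size ds)%N -> cnf Ex m (lvl ds i).
  move=> il; have [l0|[k]] := out _ (levels_lvl ds i).
    exact: cnf_oeq (oeq_sym l0) (cnf0 _ _).
  rewrite mem_iota /= add0n => kl lk; apply: cnf_oeq (oeq_sym lk) _.
  exact: cnf_nth_codes.
set F := [seq p.2.2 | p <- x].
pose kap (g : L) := xget 0%N [set i | (i < size c2)%N /\ oeq (og_d g) (nth ozero c2 i)]%classic.
have kapP t : t \in terms ds x -> (kap t.2.2.1 < size c2)%N /\
    oeq (og_d t.2.2.1) (nth ozero c2 (kap t.2.2.1)).
  move=> tt; have [i il di] := cnf_code (terms_height pos wx lx dE hx hl tt).
  by rewrite /kap; case: xgetP => [k _ //|/(_ i)[]].
rewrite (ev_terms wx lx TR) (big_iota_key (a := fun t => t.1) (N := (size ds).+1)); last first.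
  by move=> t /(termsP pos wx lx)[].
apply: le_trans (nrm_sum _ _ _) _.
apply: le_trans (sum_le_const (c := (size c2)%:R * M) _) _; last first.
  rewrite size_iota natrM -mulrA ler_wpM2r ?mulr_ge0 // ler_nat ltnS //.
move=> i; rewrite mem_iota /= add0n ltnS => il.
rewrite -big_filter (big_iota_key (a := fun t => kap t.2.2.1) (N := size c2)); last first.
  by move=> t; rewrite mem_filter => /andP[_ /kapP[]].
apply: le_trans (nrm_sum _ _ _) _.
apply: le_trans (sum_le_const (c := M) _) _; last by rewrite size_iota.
move=> k _.
pose tl := [seq t.2 | t <- terms ds x & t.1 == i].
pose K g := kap g == k.
pose yl := [seq t <- tl | K t.2.1].
have tlP t : t \in tl -> exists2 t', t' \in terms ds x & t'.1 = i /\ t = t'.2.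
  by move=> /mapP[t' + ->]; rewrite mem_filter => /andP[/eqP ? ?]; exists t'.
have wtl : wfs tl by move=> t /tlP[t' /(termsP pos wx lx)[_ w _ _] [_ ->]].
have wyl : wfs yl by move=> t; rewrite mem_filter => /andP[_ /wtl].
pose r := gapi ds x rho i.
have -> : \sum_(t <- [seq t <- terms ds x | t.1 == i] | kap t.2.2.1 == k) evterm ds x rho t
    = block yl rho r.
  rewrite /block big_filter big_map [LHS]big_seq_cond [RHS]big_seq_cond.
  apply: eq_bigr => t /andP[]; rewrite mem_filter => /andP[/eqP ti _] _.
  by rewrite /evterm ti.
have pP u : pairwise_perp (pieces ds F i u) by apply: pieces_perp.
have pR u : {in pieces ds F i u, forall h, og_r h = u} by apply: pieces_rng.
apply: (@nrm_block _ _ yl (nth ozero c2 k) (lvl ds i)) => //.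
- move=> t; rewrite mem_filter => /andP[/eqP Kt /tlP[t' t't [_ tE]]].
  by rewrite -Kt tE; apply: (kapP t' t't).2.
- by move=> t; rewrite mem_filter => /andP[_ /tlP[t' /(termsP pos wx lx)[_ _ _ d] [<- ->]]].
- by move=> u vu; apply: gap_star.
- by move=> u vu; apply: gap_idem.
- by move=> u vu; apply: gap_rng.
move=> n e e' eR e'R ee r0; set u := og_s e in ee r0.
have vu : og_vertex u by apply: og_vertex_s.
have Hd : {in pieces ds F i u, forall h, og_r h = u /\ oeq (og_d h) (nth ozero ds i)}.
  by move=> h /piecesP.
(* A nonzero gap means that the pieces do not exhaust [u]; this is where relation (iv) for [rho]
   enters. *)
have [w0 rw0 pw0] : exists2 w, og_r w = u & {in pieces ds F i u, forall h, og_perp w h}.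
  apply: contrapT => no; apply: r0; rewrite /r /gapi /lgap /gap.
  rewrite (exhaustive_sum FR vu (pieces_uniq _ _ _ _) Hd) ?subrr // => w rw.
  apply: contrapT => no'; apply: no; exists w => // h hH.
  by apply: contrapT => np; apply: no'; exists h.
have [|w [rw pw sep]] := separate_avoiding SL (ps := [seq p <- map (fun t => t.2.1) tl ++ rights yl | og_s p == u])
    Hd (ex_intro2 _ _ w0 rw0 pw0).
  by move=> p; rewrite mem_filter => /andP[/eqP].
have [j [z [Yz z0 wz]]] := nonv (og_vertex_s w).
apply: (@gramn_bound _ _ tl K _ (pi j) (piT j) (ev (pi j) x) u w wtl rw _ sep (@Y j) (piY j) M M0 _ _ _ _ z) => //.
- move=> e1 e1R se1.
  have [t tt [ti tE]] : exists2 t, t \in terms ds x & t.1 = i /\ e1 = t.2.2.2.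
    move: e1R; rewrite mem_undup => /mapP[t]; rewrite mem_filter => /andP[_ /tlP[t' t't [ti ->]]] ->.
    by exists t'.
  have [_ _ ge de] := termsP pos wx lx tt; rewrite ti -tE in ge de.
  rewrite (ev_test pos wx lx (piT j) il de ge) ?se1 //.
  by rewrite /tl big_map big_filter_cond.
- by move=> z' Yz'; apply: inv_ev.
- by move=> z' Yz'; rewrite -ev_fstar; apply: inv_ev.
- exact: bx.
- by apply: inv_bound_star => //; apply: bx.
Qed.

Lemma cpow_iter (A : cstarAlgebra R) (y z : A) n : cpow y n ** z = iter n.+1 (cs_mul y) z.
Proof. by elim: n => [//|n IH]; rewrite iterS -IH cs_mulA. Qed.

(* The Cuntz-Krieger uniqueness theorem in quantitative form. *)
Theorem ev_le a (M : R) : wfs a -> 0 <= M ->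
  (forall j z, Y z -> nrm (ev (pi j) a ** z) <= M * nrm z) -> nrm (ev rho a) <= M.
Proof.
move=> wa M0 ba; have TR := og_family_toeplitz FR.
have [Ex [m [dE ha]]] := fsum_height a.
pose b := fmul (fstar a) a.
have wb : wfs b by apply: wfs_fmul => //; apply: wfs_fstar.
have hb : hts Ex (m + m) b.
  by apply: hts_fmul => //; [apply: wfs_fstar|apply: hts_fstar].
have evb (A : cstarAlgebra R) (T : L -> A) : toeplitz T -> ev T b = (ev T a)^# ** ev T a.
  by move=> TT; rewrite ev_fmul ?ev_fstar //; apply: wfs_fstar.
suff : nrm (ev rho b) <= M ^+ 2.
  by rewrite evb // nrmS ler_pXn2r // nnegrE // nrm_ge0.
have sb : (ev rho b)^# = ev rho b by rewrite evb // cs_starM cs_starK.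
have bb j z n : Y z -> nrm (iter n (cs_mul (ev (pi j) b)) z) <= (M ^+ 2) ^+ n * nrm z /\
    Y (iter n (cs_mul (ev (pi j) b)) z).
  move=> Yz; elim: n => [|n [IH1 IH2]]; first by rewrite expr0 mul1r.
  rewrite iterS; split; last exact: (inv_ev (piY j)).
  rewrite {1}evb // -cs_mulA; apply: le_trans (inv_bound_star (piY j) M0 (ba j) _) _.
    exact: (inv_ev (piY j)).
  rewrite exprS expr2 -!mulrA; apply: ler_wpM2l => //.
  apply: le_trans (ba j _ IH2) _; exact: ler_wpM2l.
pose mk k := ((m + m) * 2 ^ k)%N.
have key k : nrm (ev rho b) ^+ (2 ^ k) <=
    ((size (cnf_codes Ex (mk k))).+1 * size (cnf_codes Ex (mk k + mk k)))%:R * (M ^+ 2) ^+ (2 ^ k).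
  have k0 : (0 < 2 ^ k)%N by rewrite expn_gt0.
  rewrite -nrm_cpow // -ev_fsqr //; apply: ev_bound => //.
  - exact: wfs_fsqr.
  - exact: hts_fsqr.
  - by rewrite !exprn_ge0.
  - move=> j z Yz; rewrite ev_fsqr // cpow_iter prednK //.
    by have [] := bb j z (2 ^ k)%N Yz.
pose s := size Ex; pose m1 := (m + m).+1; pose m2 := ((m + m) + (m + m)).+1.
(* Both code counts obey [(n 2^k + 1)^s <= (n + 1)^s (2^s)^k], where [s] is the number of exponents;
   the factor 2 absorbs the successor in the number of levels. *)
apply: (@growth _ _ _ (2 * m1 ^ s * m2 ^ s) (2 ^ s * 2 ^ s)); rewrite ?nrm_ge0 ?exprn_ge0 // => k.
apply: le_trans (key k) _; rewrite ler_wpM2r ?exprn_ge0 // ler_nat !size_cnf_codes -/s.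
have le n : ((n * 2 ^ k).+1 ^ s <= n.+1 ^ s * (2 ^ s) ^ k)%N.
  rewrite -expnM [(s * k)%N]mulnC expnM -expnMn; case: (s) => // s'.
  by rewrite leq_exp2r // mulSn addnC -addn1 leq_add2l expn_gt0.
have h1 := le (m + m)%N; have h2 := le ((m + m) + (m + m))%N.
rewrite [(mk k + mk k)%N](_ : _ = ((m + m) + (m + m)) * 2 ^ k)%N; last by rewrite mulnDl.
have pos1 : (0 < (mk k).+1 ^ s)%N by rewrite expn_gt0.
rewrite expnMn [X in (_ <= X)%N](_ : _ = 2 * (m1 ^ s * (2 ^ s) ^ k) * (m2 ^ s * (2 ^ s) ^ k))%N.
  apply: leq_mul h2; apply: leq_trans (_ : 2 * (mk k).+1 ^ s <= _)%N.
    by rewrite mul2n -addnn -addn1 leq_add2l.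
  by rewrite leq_mul2l h1.
by rewrite -!mulnA; congr (_ * (_ * _))%N; rewrite mulnCA.
Qed.

End Main.

Local Open Scope classical_set_scope.

(** * Banach spaces from real-valued norms *)

Definition half_pow (R : realType) (n : nat) : R := 2^-1 ^+ n.

Section HalfPow.
Variable R : realType.

Lemma half_pow_gt0 n : 0 < half_pow R n.
Proof. by rewrite exprn_gt0 // invr_gt0. Qed.

Lemma half_powS n : half_pow R n.+1 + half_pow R n.+1 = half_pow R n.
Proof. by rewrite /half_pow exprS; lra. Qed.

Lemma half_pow_le n m : (n <= m)%N -> half_pow R m <= half_pow R n.
Proof.
move=> nm; rewrite /half_pow -(subnKC nm) exprD -[leRHS]mulr1.
apply: ler_wpM2l; first exact/ltW/half_pow_gt0.
by rewrite exprn_ile1 ?invr_ge0 // invf_le1 // ler1n.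
Qed.

Lemma half_pow_small (e : R) : 0 < e -> exists n, half_pow R n < e.
Proof.
move=> e0; exists (Num.truncn e^-1).+1.
rewrite /half_pow exprVn -[ltRHS]invrK ltf_pV2 ?posrE ?exprn_gt0 ?invr_gt0 //.
apply: lt_trans (truncnS_gt _) _; rewrite -natrX ltr_nat.
exact: ltn_expl.
Qed.

End HalfPow.

Section Banach.
Variables (R : realType) (V : lmodType R[i]).

(** Completeness is asked along sequences with a fixed rate, with the same rate for the limit;
    [complete_X] extracts such a sequence from a Cauchy filter. *)
Record banach_axioms (N : V -> R) : Prop := BanachAxioms {
  bnD : forall x y, N (x + y) <= N x + N y;
  bnZ : forall k x, N (k *: x) = nrmc k * N x;
  bn0 : forall x, N x = 0 -> x = 0;
  bnC : forall u : nat -> V,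
    (forall n m, (n <= m)%N -> N (u n - u m) <= half_pow R n) ->
    exists l, forall n, N (u n - l) <= half_pow R n
}.

Variables (N : V -> R) (bN : banach_axioms N).

Lemma bnN x : N (- x) = N x.
Proof.
rewrite -scaleN1r (bnZ bN).
by have -> : nrmc (-1 : R[i]) = 1; rewrite ?mul1r // /nrmc normrN normr1.
Qed.

Lemma bnB x y : N (x - y) <= N x + N y.
Proof. by rewrite -(bnN y) (bnD bN). Qed.

(** A copy of [V] that carries the proof [bN], so that the norm instance can depend on it. *)
Definition banach (bN : banach_axioms N) : Type := V.
Local Notation X := (banach bN).

HB.instance Definition _ := GRing.Lmodule.on X.

Let normX (x : X) : R[i] := (N x)%:C%C.

Let normXD (x y : X) : normX (x + y) <= normX x + normX y.
Proof. by rewrite /normX -rmorphD /= lecR (bnD bN). Qed.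

Let normXZ (k : R[i]) (x : X) : normX (k *: x) = `|k| * normX x.
Proof. by rewrite /normX (bnZ bN) rmorphM /= nrmcE. Qed.

Let normX0 (x : X) : normX x = 0 -> x = 0.
Proof. by move=> /complexI; apply: (bn0 bN). Qed.

HB.instance Definition _ := Lmodule_isNormed.Build R[i] X normXD normXZ normX0.

Let complete_X (F : set_system X) : ProperFilter F -> cauchy F -> cvg F.
Proof.
move=> PF cF; have /cauchyP h := cF.
have ex n : exists x : X, F (ball x (half_pow R n.+1)%:C%C).
  by apply: h; rewrite ltcR half_pow_gt0.
have [u uF] := choice ex.
have ballE (x y : X) (e : R) : ball x e%:C%C y <-> N (x - y) < e.
  by rewrite -ball_normE /= -[X in X < _]/(N (x - y))%:C%C ltcR.
have [|l hl] := bnC bN (u := u).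
  move=> n m nm; have [y [/ballE y1 /ballE y2]] := filter_ex (filterI (uF n) (uF m)).
  have -> : u n - u m = (u n - y) - (u m - y) by rewrite opprB addrA subrK.
  apply: le_trans (bnB _ _) _.
  rewrite -half_powS; apply: lerD; first exact: ltW.
  apply: le_trans (ltW y2) _; exact: half_pow_le.
apply/cvg_ex; exists (l : X); apply/fcvg_ballP => e e0.
have eE : e = (complex.Re e)%:C%C by apply/ge0_ReE/ltW.
have [|n hn] := @half_pow_small R (complex.Re e / 2).
  by rewrite divr_gt0 // -ltcR -eE.
apply: filterS (uF n) => y /ballE yn; rewrite eE; apply/ballE.
have -> : l - y = (u n - y) - (u n - l) by rewrite opprB [RHS]addrC addrA subrK.
apply: le_lt_trans (bnB _ _) _.
have := hl n; have := half_powS R n; have := half_pow_gt0 R n.+1.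
by move: yn hn; lra.
Qed.

HB.instance Definition _ := Uniform_isComplete.Build X complete_X.

Definition banach_space : completeNormedModType R[i] := X.

End Banach.

Lemma fast_cvg (R : realType) (V : completeNormedModType R[i]) (u : nat -> V) :
  (forall n m, (n <= m)%N -> nrm (u n - u m) <= half_pow R n) ->
  exists l, forall n, nrm (u n - l) <= half_pow R n.
Proof.
move=> hu.
have ballE (x y : V) (e : R) : ball x e%:C%C y <-> nrm (x - y) < e.
  by rewrite -ball_normE /= nrmE ltcR.
have /cauchy_cvg/cvg_ex[l /fcvg_ballP hl] : cauchy (u @ \oo).
  apply: cauchy_exP => e e0.
  have eE : e = (complex.Re e)%:C%C by apply/ge0_ReE/ltW.
  have [|n hn] := @half_pow_small R (complex.Re e); first by rewrite -ltcR -eE.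
  exists (u n); exists n => // m /= nm; rewrite eE; apply/ballE.
  exact: le_lt_trans (hu n m nm) hn.
exists l => n; apply/ler_addgt0Pl => e e0.
have [|k _ hk] := hl e%:C%C; first by rewrite ltcR.
have /ballE h := hk (maxn n k) (leq_maxr n k).
apply: le_trans (nrm_tri (u (maxn n k)) _ _) _; rewrite addrC lerD //; last exact/hu/leq_maxl.
by rewrite nrmBC ltW.
Qed.

(** * Closed subspaces *)

Section ClosedSub.
Variables (R : realType) (V : completeNormedModType R[i]).

Record closed_subspace (P : V -> Prop) : Prop := ClosedSubspace {
  cl0 : P 0;
  clD : forall x y, P x -> P y -> P (x + y);
  clZ : forall (k : R[i]) x, P x -> P (k *: x);
  clC : forall x, (forall e : R, 0 < e -> exists2 y, P y & nrm (x - y) < e) -> P x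
}.

Variables (P : V -> Prop) (cP : closed_subspace P).

(** The proof [cP] is a parameter so that the algebraic instances can be attached to it. *)
Definition clpred (cP : closed_subspace P) : {pred V} := fun x => `[< P x >].

Let clpred_submod : submod_closed (clpred cP).
Proof.
split; first by apply/asboolP; apply: cl0 cP.
move=> k x y /asboolP Px /asboolP Py; apply/asboolP.
by apply: (clD cP) => //; apply: (clZ cP).
Qed.

HB.instance Definition _ := GRing.isSubmodClosed.Build R[i] V (clpred cP) clpred_submod.

Definition clsub (cP : closed_subspace P) := {x : V | clpred cP x}.
HB.instance Definition _ := [isSub of clsub cP for (@proj1_sig _ _)].
HB.instance Definition _ := [Choice of clsub cP by <:].
HB.instance Definition _ := [SubChoice_isSubLmodule of clsub cP by <:].

Definition clmk x (Px : P x) : clsub cP := exist _ x (asboolT Px).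

Lemma clP (x : clsub cP) : P (val x). Proof. exact/asboolP/(valP x). Qed.

Lemma cl_banach : banach_axioms (fun x : clsub cP => nrm (val x)).
Proof.
split.
- by move=> x y; rewrite raddfD nrmD.
- by move=> k x; rewrite linearZ nrmZ.
- by move=> x /nrm_eq0 x0; apply: val_inj; rewrite x0 raddf0.
- move=> u hu; have [|l hl] := @fast_cvg _ _ (fun n => val (u n)).
    by move=> n m nm; have := hu n m nm; rewrite raddfB.
  have Pl : P l.
    apply: (clC cP) => e /half_pow_small[n hn]; exists (val (u n)); first exact: clP.
    by rewrite nrmBC; apply: le_lt_trans (hl n) hn.
  by exists (clmk Pl) => n; rewrite raddfB; apply: hl.
Qed.

Definition cl_space : completeNormedModType R[i] := banach_space cl_banach.

End ClosedSub.

(** * Closed subalgebras and products *)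

Section Subalgebra.
Variables (R : realType) (E : cstarAlgebra R) (P : E -> Prop).
Hypotheses (cP : closed_subspace P) (mP : forall x y, P x -> P y -> P (x ** y)).
Hypothesis sP : forall x, P x -> P x^#.

Let X := cl_space cP.
Let mulX (x y : X) : X := clmk cP (mP (clP x) (clP y)).
Let starX (x : X) : X := clmk cP (sP (clP x)).
Let inj (x y : X) : val x = val y -> x = y. Proof. exact: val_inj. Qed.

Let mA : associative mulX. Proof. by move=> x y z; apply: inj; rewrite /= cs_mulA. Qed.
Let mDl : left_distributive mulX +%R. Proof. by move=> x y z; apply: inj; rewrite /= cs_mulDl. Qed.
Let mDr : right_distributive mulX +%R. Proof. by move=> x y z; apply: inj; rewrite /= cs_mulDr. Qed.
Let mZl (k : R[i]) x y : mulX (k *: x) y = k *: mulX x y.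
Proof. by apply: inj; rewrite /= cs_scaleAl. Qed.
Let mZr (k : R[i]) x y : mulX x (k *: y) = k *: mulX x y.
Proof. by apply: inj; rewrite /= cs_scaleAr. Qed.
Let sK : involutive starX. Proof. by move=> x; apply: inj; rewrite /= cs_starK. Qed.
Let sD : {morph starX : x y / x + y}. Proof. by move=> x y; apply: inj; rewrite /= cs_starD. Qed.
Let sZ (k : R[i]) x : starX (k *: x) = k^* *: starX x.
Proof. by apply: inj; rewrite /= cs_starZ. Qed.
Let sM x y : starX (mulX x y) = mulX (starX y) (starX x).
Proof. by apply: inj; rewrite /= cs_starM. Qed.
Let nM x y : `|mulX x y| <= `|x| * `|y|.
Proof. by rewrite !nrmE -rmorphM lecR; apply: nrmM. Qed.
Let nS x : `|mulX (starX x) x| = `|x| ^+ 2.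
Proof. by rewrite !nrmE -rmorphXn; congr (_%:C%C); apply: nrmS. Qed.

Definition subalgebra : cstarAlgebra R :=
  CstarAlgebra mA mDl mDr mZl mZr sK sD sZ sM nM nS.

Definition sub_in (x : E) (Px : P x) : subalgebra := clmk cP Px.
Definition sub_val (x : subalgebra) : E := proj1_sig (x : clsub cP).

Lemma sub_valP x : P (sub_val x). Proof. exact: (clP (x : clsub cP)). Qed.
Lemma sub_val_inj : injective sub_val. Proof. by move=> x y; apply: val_inj. Qed.
Lemma sub_val_hom : star_hom sub_val. Proof. by split. Qed.

End Subalgebra.

Section Product.
Variables (R : realType) (A B : cstarAlgebra R).

Let V : lmodType R[i] := (A * B)%type.
Let N (x : V) : R := Num.max (nrm x.1) (nrm x.2).

Lemma prod_banach : banach_axioms N.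
Proof.
split.
- by move=> x y; rewrite /N ge_max; apply/andP; split; apply: le_trans (nrmD _ _) _;
    apply: lerD; rewrite le_max lexx ?orbT.
- by move=> k x; rewrite /N !nrmZ maxr_pMr // nrmc_ge0.
- move=> x Nx; have h1 : nrm x.1 <= N x by rewrite le_max lexx.
  have h2 : nrm x.2 <= N x by rewrite le_max lexx orbT.
  rewrite Nx in h1 h2; case: x {Nx} h1 h2 => x y /= h1 h2.
  by congr pair; apply: nrm_eq0; apply/le_anti; rewrite nrm_ge0 ?h1 ?h2.
- move=> u hu.
  have [|l1 h1] := @fast_cvg _ _ (fun n => (u n).1).
    by move=> n m /hu; apply: le_trans; rewrite le_max lexx.
  have [|l2 h2] := @fast_cvg _ _ (fun n => (u n).2).
    by move=> n m /hu; apply: le_trans; rewrite le_max lexx orbT.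
  by exists (l1, l2) => n; rewrite /N ge_max h1 h2.
Qed.

Let X := banach_space prod_banach.
Let mulX (x y : X) : X := (x.1 ** y.1, x.2 ** y.2).
Let starX (x : X) : X := (x.1^#, x.2^#).

Let mA : associative mulX. Proof. by move=> x y z; congr pair; rewrite /= cs_mulA. Qed.
Let mDl : left_distributive mulX +%R. Proof. by move=> x y z; congr pair; rewrite /= cs_mulDl. Qed.
Let mDr : right_distributive mulX +%R. Proof. by move=> x y z; congr pair; rewrite /= cs_mulDr. Qed.
Let mZl (k : R[i]) x y : mulX (k *: x) y = k *: mulX x y.
Proof. by congr pair; rewrite /= cs_scaleAl. Qed.
Let mZr (k : R[i]) x y : mulX x (k *: y) = k *: mulX x y.
Proof. by congr pair; rewrite /= cs_scaleAr. Qed.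
Let sK : involutive starX. Proof. by case=> x y; congr pair; rewrite /= cs_starK. Qed.
Let sD : {morph starX : x y / x + y}. Proof. by move=> x y; congr pair; rewrite /= cs_starD. Qed.
Let sZ (k : R[i]) x : starX (k *: x) = k^* *: starX x.
Proof. by congr pair; rewrite /= cs_starZ. Qed.
Let sM x y : starX (mulX x y) = mulX (starX y) (starX x).
Proof. by congr pair; rewrite /= cs_starM. Qed.
Let NE (x : X) : `|x| = (N x)%:C%C. Proof. exact: nrmE. Qed.
Let nM x y : `|mulX x y| <= `|x| * `|y|.
Proof.
rewrite !NE -rmorphM lecR /= /N ge_max; apply/andP; split; apply: le_trans (nrmM _ _) _;
  by apply: ler_pM; rewrite ?nrm_ge0 // le_max lexx ?orbT.
Qed.
Let nS x : `|mulX (starX x) x| = `|x| ^+ 2.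
Proof.
rewrite !NE -rmorphXn; congr (_%:C%C); rewrite /N /= !nrmS.
have [h|h] := leP (nrm x.1) (nrm x.2).
  by rewrite max_r // ler_pXn2r // nnegrE nrm_ge0.
by rewrite max_l // ler_pXn2r ?nnegrE ?nrm_ge0 // ltW.
Qed.

Definition product : cstarAlgebra R :=
  CstarAlgebra mA mDl mDr mZl mZr sK sD sZ sM nM nS.

Definition pair_in (x : A) (y : B) : product := (x, y).
Definition pfst (x : product) : A := (x : A * B).1.
Definition psnd (x : product) : B := (x : A * B).2.

Lemma pfst_hom : star_hom pfst. Proof. by split. Qed.
Lemma psnd_hom : star_hom psnd. Proof. by split. Qed.
Lemma product_nrm x : nrm x = Num.max (nrm (pfst x)) (nrm (psnd x)). Proof. by []. Qed.

Lemma product_eq (x y : product) : pfst x = pfst y -> psnd x = psnd y -> x = y.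
Proof. by case: x y => [x1 x2] [y1 y2] /= -> ->. Qed.

Lemma nrm_pfst x : nrm (pfst x) <= nrm x.
Proof. by rewrite product_nrm le_max lexx. Qed.

Lemma nrm_psnd x : nrm (psnd x) <= nrm x.
Proof. by rewrite product_nrm le_max lexx orbT. Qed.

End Product.

(** * Hilbert spaces and their bounded operators *)

Record prehilb (R : realType) (V : lmodType R[i]) (ip : V -> V -> R[i]) : Prop := Prehilb {
  ip_D : forall x y z, ip x (y + z) = ip x y + ip x z;
  ip_Z : forall k x y, ip x (k *: y) = k * ip x y;
  ip_J : forall x y, ip y x = (ip x y)^*;
  ip_ge0 : forall x, 0 <= ip x x;
  ip_def : forall x, ip x x = 0 -> x = 0
}.

Definition hn (R : realType) (V : lmodType R[i]) (ip : V -> V -> R[i]) (x : V) : R :=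
  Num.sqrt (complex.Re (ip x x)).

Section Prehilbert.
Variables (R : realType) (V : lmodType R[i]) (ip : V -> V -> R[i]).
Hypothesis ph : prehilb ip.
Local Notation "'N x" := (hn ip x) (at level 10, x at level 8).
Implicit Types x y z : V.

Lemma ip_DJ x y z : ip (y + z) x = ip y x + ip z x.
Proof.
by rewrite (ip_J ph x (y + z)) (ip_J ph x y) (ip_J ph x z) (ip_D ph) raddfD.
Qed.

Lemma ip_ZJ k x y : ip (k *: y) x = k^* * ip y x.
Proof. by rewrite (ip_J ph x (k *: y)) (ip_J ph x y) (ip_Z ph) rmorphM. Qed.

Lemma ip_N x y : ip x (- y) = - ip x y.
Proof. by rewrite -scaleN1r (ip_Z ph) mulN1r. Qed.

Lemma ip_NJ x y : ip (- y) x = - ip y x.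
Proof. by rewrite (ip_J ph x (- y)) (ip_J ph x y) ip_N raddfN. Qed.

Lemma ip_B x y z : ip x (y - z) = ip x y - ip x z.
Proof. by rewrite (ip_D ph) ip_N. Qed.

Lemma ip_BJ x y z : ip (y - z) x = ip y x - ip z x.
Proof. by rewrite ip_DJ ip_NJ. Qed.

Lemma ip_0 x : ip x 0 = 0.
Proof. by rewrite -(scale0r (0 : V)) (ip_Z ph) mul0r. Qed.

Lemma hn_ge0 x : 0 <= 'N x. Proof. exact: sqrtr_ge0. Qed.

Lemma hn_sq x : ip x x = ('N x ^+ 2)%:C%C.
Proof.
rewrite [LHS]ge0_ReE ?(ip_ge0 ph) // sqr_sqrtr //.
by rewrite -ler0c -ge0_ReE ?(ip_ge0 ph).
Qed.

Lemma hn_eq0 x : 'N x = 0 -> x = 0.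
Proof. by move=> x0; apply: (ip_def ph); rewrite hn_sq x0 expr0n. Qed.

Lemma hnZ k x : 'N (k *: x) = nrmc k * 'N x.
Proof.
apply/eqP; rewrite -(@eqrXn2 _ 2) ?mulr_ge0 ?hn_ge0 ?nrmc_ge0 //; apply/eqP/complexI.
have nk : (nrmc k ^+ 2)%:C%C = k^* * k.
  by rewrite rmorphXn /= -nrmcE normCK mulrC.
rewrite -hn_sq ip_ZJ (ip_Z ph) hn_sq mulrA exprMn -nk.
exact/esym/(rmorphM (real_complex R)).
Qed.

Lemma hn0 : 'N 0 = 0.
Proof. by rewrite -(scale0r (0 : V)) hnZ /nrmc normr0 mul0r. Qed.

Lemma cauchy_schwarz x y : nrmc (ip x y) <= 'N x * 'N y.
Proof.
have [y0|y0] := eqVneq ('N y) 0.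
  by rewrite y0 (hn_eq0 y0) ip_0 /nrmc normr0 mulr0.
have yp : 0 < 'N y by rewrite lt_neqAle eq_sym y0 hn_ge0.
rewrite -(@ler_pXn2r _ 2) ?nnegrE ?mulr_ge0 ?hn_ge0 ?nrmc_ge0 // exprMn.
pose a := ip y y; pose c := ip y x.
have aJ : a^* = a by rewrite /a -(ip_J ph).
have cJ : c^* = ip x y by rewrite /c -(ip_J ph).
have := ip_ge0 ph (a *: x - c *: y).
rewrite ip_B !ip_BJ !(ip_Z ph) !ip_ZJ aJ cJ -/a -/c.
rewrite [X in 0 <= X](_ : _ = a * (a * ip x x - ip x y * c)); last by ring.
have aE : a = ('N y ^+ 2)%:C%C by apply: hn_sq.
have cE : ip x y * c = (nrmc (ip x y) ^+ 2)%:C%C.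
  by rewrite rmorphXn /= -nrmcE normCK /c (ip_J ph x y).
rewrite cE aE hn_sq -rmorphM -rmorphB -rmorphM ler0c pmulr_rge0 ?exprn_gt0 //.
by rewrite subr_ge0 mulrC.
Qed.

Lemma Re_le_nrmc (k : R[i]) : complex.Re k <= nrmc k.
Proof.
have h := normc_ge_Re k; rewrite nrmcE lecR in h.
exact: le_trans (ler_norm _) h.
Qed.

Lemma hnD x y : 'N (x + y) <= 'N x + 'N y.
Proof.
rewrite -(@ler_pXn2r _ 2) ?nnegrE ?addr_ge0 ?hn_ge0 //.
have E : 'N (x + y) ^+ 2 = 'N x ^+ 2 + 'N y ^+ 2 + complex.Re (ip x y) *+ 2.
  have := congr1 (@complex.Re R) (hn_sq (x + y)); rewrite /= => <-.
  rewrite (ip_D ph) !ip_DJ !hn_sq (ip_J ph x y) !raddfD /=.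
  have -> : complex.Re (ip x y)^* = complex.Re (ip x y).
    by case: (ip x y).
  by rewrite mulr2n; ring.
have := le_trans (Re_le_nrmc _) (cauchy_schwarz x y); rewrite E mulr2n.
by move: (complex.Re _) ('N x) ('N y) => a b c; lra.
Qed.

Lemma hnN x : 'N (- x) = 'N x.
Proof. by rewrite -scaleN1r hnZ /nrmc normrN normr1 mul1r. Qed.

Lemma hnB x y : 'N (x - y) <= 'N x + 'N y.
Proof. by rewrite -(hnN y) hnD. Qed.

Lemma hn_tri y x z : 'N (x - z) <= 'N (x - y) + 'N (y - z).
Proof. by apply: le_trans (hnD _ _); rewrite addrA subrK. Qed.

Lemma hn_BC x y : 'N (x - y) = 'N (y - x).
Proof. by rewrite -hnN opprB. Qed.

Lemma ip_small x y : (forall z, ip z x = ip z y) -> x = y.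
Proof.
by move=> h; apply/subr0_eq/(ip_def ph); rewrite ip_B h subrr.
Qed.

End Prehilbert.

Section Operators.
Variables (R : realType) (V : lmodType R[i]) (ip : V -> V -> R[i]).
Hypothesis ph : prehilb ip.
Hypothesis complV : forall u : nat -> V,
  (forall n m, (n <= m)%N -> hn ip (u n - u m) <= half_pow R n) ->
  exists l, forall n, hn ip (u n - l) <= half_pow R n.
Local Notation "'N x" := (hn ip x) (at level 10, x at level 8).
Implicit Types x y z : V.

Definition adjoint_pair (f g : V -> V) := forall x y, ip (f x) y = ip x (g y).

Definition bounded_by (f : V -> V) (K : R) := forall x, 'N (f x) <= K * 'N x.

(** Linearity follows from the existence of an adjoint, see [adjoint_linear]. *)
Definition is_op (f : V -> V) :=
  (exists g, adjoint_pair f g) /\ (exists2 K, 0 <= K & bounded_by f K).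

Lemma adjoint_linear f g : adjoint_pair f g -> linear f.
Proof.
move=> fg k x y; apply: (ip_small ph) => z.
rewrite (ip_D ph) (ip_Z ph) !(ip_J ph _ z) !fg (ip_DJ ph) (ip_ZJ ph).
by rewrite raddfD /= rmorphM /= conjCK.
Qed.

Lemma adjoint_sym f g : adjoint_pair f g -> adjoint_pair g f.
Proof. by move=> fg x y; rewrite (ip_J ph y) -fg -(ip_J ph). Qed.

Lemma adjoint_uniq f g g' : adjoint_pair f g -> adjoint_pair f g' -> g = g'.
Proof. by move=> h h'; apply/funext => y; apply: (ip_small ph) => x; rewrite -h -h'. Qed.

Lemma adjoint_bound f g K : adjoint_pair f g -> 0 <= K -> bounded_by f K -> bounded_by g K.
Proof.
move=> fg K0 fK x.
have [y0|y0] := eqVneq ('N (g x)) 0; first by rewrite y0 mulr_ge0 // hn_ge0.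
have yp : 0 < 'N (g x) by rewrite lt_neqAle eq_sym y0 hn_ge0.
rewrite -(ler_pM2r yp) -expr2 -[X in X <= _]ger0_norm ?sqr_ge0 //.
have -> : `|'N (g x) ^+ 2| = nrmc (ip (g x) (g x)).
  by rewrite (hn_sq ph) nrmc_real ?sqr_ge0 // ger0_norm ?sqr_ge0.
rewrite -fg; apply: le_trans (cauchy_schwarz ph _ _) _.
by rewrite mulrAC ler_wpM2r ?hn_ge0.
Qed.

Let opred : {pred V -> V} := fun f => `[< is_op f >].

Let opred_submod : submod_closed opred.
Proof.
split.
  apply/asboolP; split; first by exists (fun=> 0) => x y; rewrite (ip_J ph) !(ip_0 ph) conjC0.
  by exists 0 => // x; rewrite (hn0 ph) mul0r.
move=> k f f' /asboolP[[g fg] [K K0 fK]] /asboolP[[g' fg'] [K' K0' fK']]; apply/asboolP; split.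
  exists (fun x => k^* *: g x + g' x) => x y.
  by rewrite /= (ip_DJ ph) (ip_ZJ ph) (ip_D ph) (ip_Z ph) fg fg'.
exists (nrmc k * K + K') => [|x]; first by rewrite addr_ge0 // mulr_ge0 // nrmc_ge0.
apply: le_trans (hnD ph _ _) _; rewrite (hnZ ph) mulrDl -mulrA.
by apply: lerD => //; apply: ler_wpM2l => //; apply: nrmc_ge0.
Qed.

HB.instance Definition _ := GRing.isSubmodClosed.Build R[i] (V -> V) opred opred_submod.

Definition op_ := {f : V -> V | opred f}.
HB.instance Definition _ := [isSub of op_ for (@proj1_sig _ _)].
HB.instance Definition _ := [Choice of op_ by <:].
HB.instance Definition _ := [SubChoice_isSubLmodule of op_ by <:].

Lemma opP (f : op_) : is_op (val f). Proof. exact/asboolP/(valP f). Qed.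
Definition opmk f (h : is_op f) : op_ := exist _ f (asboolT h).

Definition opn (f : op_) : R := sup [set 'N (val f x) | x in [set x | 'N x <= 1]].

Lemma opn_has (f : op_) : has_sup [set 'N (val f x) | x in [set x | 'N x <= 1]].
Proof.
have [_ [K K0 fK]] := opP f; split; first by exists ('N (val f 0)), 0 => //=; rewrite (hn0 ph).
exists K => _ [x /= x1 <-]; apply: le_trans (fK x) _.
by rewrite -[leRHS]mulr1 ler_wpM2l.
Qed.

Lemma op_linear (f : op_) : linear (val f).
Proof. by have [[g fg] _] := opP f; apply: adjoint_linear fg. Qed.

Lemma op0 (f : op_) : val f 0 = 0.
Proof. by have := op_linear f (-1) 0 0; rewrite !scaleN1r !addNr. Qed.

Lemma opZ (f : op_) k x : val f (k *: x) = k *: val f x.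
Proof. by have := op_linear f k x 0; rewrite !addr0 op0 addr0. Qed.

Lemma opD (f : op_) x y : val f (x + y) = val f x + val f y.
Proof. by have := op_linear f 1 x y; rewrite !scale1r. Qed.

Lemma opn_ge0 f : 0 <= opn f.
Proof.
apply: le_trans (hn_ge0 ip (val f 0)) _; apply: ub_le_sup; first by have [] := opn_has f.
by exists 0 => //=; rewrite (hn0 ph).
Qed.

Lemma opn_bound f : bounded_by (val f) (opn f).
Proof.
move=> x; have [x0|x0] := eqVneq ('N x) 0.
  by rewrite (hn_eq0 ph x0) op0 (hn0 ph) mulr0.
have xp : 0 < 'N x by rewrite lt_neqAle eq_sym x0 hn_ge0.
have iv : 0 <= ('N x)^-1 by rewrite invr_ge0 hn_ge0.
rewrite -ler_pdivrMr // mulrC -(nrmc_real iv) -(hnZ ph) -opZ.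
apply: ub_le_sup; first by have [] := opn_has f.
by eexists; [|reflexivity]; rewrite /= (hnZ ph) nrmc_real // mulVf.
Qed.

Lemma opn_le f K : bounded_by (val f) K -> 0 <= K -> opn f <= K.
Proof.
move=> fK K0; apply: ge_sup; first by have [] := opn_has f.
move=> _ [x /= x1 <-]; apply: le_trans (fK x) _.
by rewrite -[leRHS]mulr1 ler_wpM2l.
Qed.

Definition op_adj (f : op_) : V -> V := xget (id : V -> V) [set g : V -> V | adjoint_pair (val f) g].

Lemma op_adjP f : adjoint_pair (val f) (op_adj f).
Proof.
have [[g fg] _] := opP f; rewrite /op_adj; case: xgetP => [h _ //|/(_ g)]; case.
exact: fg.
Qed.

Lemma is_op_adj f : is_op (op_adj f).
Proof.
have fg := op_adjP f; split; first by exists (val f); apply: adjoint_sym.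
by exists (opn f); [apply: opn_ge0|apply: adjoint_bound fg (opn_ge0 f) (opn_bound f)].
Qed.

Lemma is_op_comp (f g : op_) : is_op (val f \o val g).
Proof.
split.
  exists (op_adj g \o op_adj f) => x y /=.
  by rewrite (op_adjP f) (op_adjP g).
exists (opn f * opn g) => [|x]; first by rewrite mulr_ge0 // opn_ge0.
apply: le_trans (opn_bound _ _) _; rewrite -mulrA; apply: ler_wpM2l; first exact: opn_ge0.
exact: opn_bound.
Qed.

(** Shifting the index by [j] with [C <= 2^j] produces a sequence with the rate that [complV] asks
    for. *)
Lemma complV_scaled (C : R) (u : nat -> V) : 0 <= C ->
  (forall n m, (n <= m)%N -> 'N (u n - u m) <= C * half_pow R n) ->
  exists l, forall n, 'N (u n - l) <= C * half_pow R n.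
Proof.
move=> C0 hu; pose j := (Num.truncn C).+1.
have Cj n : C * half_pow R (n + j) <= half_pow R n.
  rewrite /half_pow exprD mulrCA -[leRHS]mulr1; apply: ler_wpM2l.
    exact/ltW/half_pow_gt0.
  rewrite exprVn ler_pdivrMr ?exprn_gt0 // mul1r -natrX.
  apply: le_trans (ltW (truncnS_gt _)) _; rewrite ler_nat; exact/ltnW/ltn_expl.
have [|l hl] := complV (u := fun n => u (n + j)%N).
  move=> n m nm; apply: le_trans (hu _ _ _) (Cj n).
  by rewrite leq_add2r.
exists l => n; apply/ler_addgt0Pl => e /half_pow_small[k hk].
apply: le_trans (hn_tri ph (u (maxn n k + j)%N) _ _) _; rewrite addrC; apply: lerD.
  apply: le_trans (hl _) _; apply: le_trans (ltW hk); apply: half_pow_le.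
  exact: leq_maxr.
by apply: hu; apply: leq_trans (leq_maxl n k) (leq_addr _ _).
Qed.

Lemma val_opB (f g : op_) x : val (f - g) x = val f x - val g x.
Proof. by rewrite raddfB. Qed.

Lemma op_adj_bound (f g : op_) x : 'N (op_adj f x - op_adj g x) <= opn (f - g) * 'N x.
Proof.
have fg : adjoint_pair (val (f - g)) (fun x => op_adj f x - op_adj g x).
  by move=> y z; rewrite val_opB (ip_BJ ph) (ip_B ph) (op_adjP f) (op_adjP g).
exact: (adjoint_bound fg (opn_ge0 _) (opn_bound _)).
Qed.

(** Operators and adjoints converge pointwise, and the two limits stay adjoint to each other, which
    is what makes the limit an operator. *)
Lemma op_complete (u : nat -> op_) :
  (forall n m, (n <= m)%N -> opn (u n - u m) <= half_pow R n) ->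
  exists l, forall n, opn (u n - l) <= half_pow R n.
Proof.
move=> hu.
have hp n : 0 <= half_pow R n by apply/ltW/half_pow_gt0.
have /choice[f hf] x : exists l, forall n, 'N (val (u n) x - l) <= 'N x * half_pow R n.
  apply: complV_scaled; first exact: hn_ge0.
  move=> n m nm; rewrite -val_opB; apply: le_trans (opn_bound _ _) _.
  by rewrite mulrC ler_wpM2l ?hn_ge0 // hu.
have /choice[g hg] x : exists l, forall n, 'N (op_adj (u n) x - l) <= 'N x * half_pow R n.
  apply: complV_scaled; first exact: hn_ge0.
  move=> n m nm; apply: le_trans (op_adj_bound _ _ _) _.
  by rewrite mulrC ler_wpM2l ?hn_ge0 // hu.
have fg : adjoint_pair f g.
  move=> x y; apply/subr0_eq; have [z0|z0] := eqVneq (nrmc (ip (f x) y - ip x (g y))) 0.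
    by apply/normr0_eq0; rewrite nrmcE z0.
  have zp : 0 < nrmc (ip (f x) y - ip x (g y)) by rewrite lt_neqAle eq_sym z0 nrmc_ge0.
  pose C := 'N x * 'N y.
  have C1 : 0 < C + C + 1 by rewrite ltr_wpDl // addr_ge0 // mulr_ge0 // hn_ge0.
  have [|n] := @half_pow_small R (nrmc (ip (f x) y - ip x (g y)) / (C + C + 1)).
    by rewrite divr_gt0.
  rewrite ltr_pdivlMr // => hn'.
  suff : nrmc (ip (f x) y - ip x (g y)) <= half_pow R n * (C + C).
    rewrite mulrDr mulr1 in hn' => le; have := lt_le_trans hn' le.
    by rewrite -subr_gt0 opprD addrA subrr sub0r oppr_gt0 ltNge ltW ?half_pow_gt0.
  have -> : ip (f x) y - ip x (g y) =
      ip (f x - val (u n) x) y + ip x (op_adj (u n) y - g y).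
    by rewrite (ip_BJ ph) (ip_B ph) (op_adjP (u n)) addrA subrK.
  apply: le_trans (_ : nrmc (ip (f x - val (u n) x) y) + nrmc (ip x (op_adj (u n) y - g y)) <= _).
    by rewrite -lecR rmorphD /= -!nrmcE ler_normD.
  rewrite mulrDr; apply: lerD; apply: le_trans (cauchy_schwarz ph _ _) _.
    rewrite (hn_BC ph); apply: le_trans (ler_wpM2r (hn_ge0 ip y) (hf x n)) _.
    by rewrite /C mulrA [half_pow _ _ * _]mulrC.
  apply: le_trans (ler_wpM2l (hn_ge0 ip x) (hg y n)) _.
  by rewrite [leRHS]mulrC /C -mulrA lexx.
have fK : bounded_by f (opn (u 0%N) + 1).
  move=> x; rewrite -[f x](subKr (val (u 0%N) x)); apply: le_trans (hnB ph _ _) _.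
  rewrite mulrDl mul1r; apply: lerD; first exact: opn_bound.
  by apply: le_trans (hf x 0%N) _; rewrite /half_pow expr0 mulr1.
have fop : is_op f by split; [exists g|exists (opn (u 0%N) + 1); rewrite // addr_ge0 // opn_ge0].
exists (opmk fop) => n; apply: opn_le => // x.
by rewrite val_opB /= mulrC hf.
Qed.

Lemma op_banach : banach_axioms opn.
Proof.
split; last exact: op_complete.
- move=> f g; apply: opn_le; last by rewrite addr_ge0 // opn_ge0.
  move=> x; rewrite raddfD mulrDl; apply: le_trans (hnD ph _ _) _.
  by apply: lerD; apply: opn_bound.
- have h (k : R[i]) f : opn (k *: f) <= nrmc k * opn f.
    apply: opn_le => [x|]; last by rewrite mulr_ge0 ?nrmc_ge0 ?opn_ge0.
    rewrite linearZ /= (hnZ ph) -mulrA; apply: ler_wpM2l; first exact: nrmc_ge0.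
    exact: opn_bound.
  move=> k f; apply/le_anti; rewrite h /=.
  have [->|k0] := eqVneq k 0; first by rewrite /nrmc normr0 mul0r opn_ge0.
  have kp : 0 < nrmc k by rewrite -ltcR -nrmcE normr_gt0.
  rewrite -ler_pdivlMl // -{1}[f](scalerK k0); apply: le_trans (h _ _) _.
  suff -> : nrmc k^-1 = (nrmc k)^-1 by [].
  by apply: complexI; rewrite -nrmcE normfV nrmcE fmorphV.
- move=> f f0; apply: val_inj; apply/funext => x; apply: (hn_eq0 ph).
  by apply/le_anti; rewrite hn_ge0 andbT; have := opn_bound f x; rewrite f0 mul0r.
Qed.

Let X := banach_space op_banach.
Let mulX (x y : X) : X := opmk (is_op_comp x y).
Let starX (x : X) : X := opmk (is_op_adj x).
Let inj (f g : X) : (forall x, val (f : op_) x = val (g : op_) x) -> f = g.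
Proof. by move=> h; apply: val_inj; apply/funext. Qed.

Let star_pair (f : X) : adjoint_pair (val (f : op_)) (val (starX f : op_)).
Proof. exact: op_adjP. Qed.

Let star_uniq (f : X) (g : op_) : adjoint_pair (val (f : op_)) (val g) -> starX f = g.
Proof. by move=> fg; apply: val_inj; apply: adjoint_uniq (star_pair f) fg. Qed.

Let mA : associative mulX. Proof. by move=> x y z; apply: inj. Qed.
Let mDl : left_distributive mulX +%R. Proof. by move=> x y z; apply: inj. Qed.
Let mDr : right_distributive mulX +%R.
Proof. by move=> x y z; apply: inj => v; rewrite /= opD. Qed.
Let mZl (k : R[i]) (x y : X) : mulX (k *: x) y = k *: mulX x y. Proof. exact: inj. Qed.
Let mZr (k : R[i]) (x y : X) : mulX x (k *: y) = k *: mulX x y.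
Proof. by apply: inj => v; rewrite /= opZ. Qed.
Let sK : involutive starX.
Proof. by move=> f; apply: star_uniq; apply: adjoint_sym; apply: star_pair. Qed.
Let sD : {morph starX : x y / x + y}.
Proof.
move=> f g; apply: star_uniq => x y.
by rewrite /= (ip_DJ ph) (ip_D ph) (star_pair f) (star_pair g).
Qed.
Let sZ (k : R[i]) (x : X) : starX (k *: x) = k^* *: starX x.
Proof. by apply: star_uniq => v w; rewrite /= (ip_ZJ ph) (ip_Z ph) (star_pair x). Qed.
Let sM (x y : X) : starX (mulX x y) = mulX (starX y) (starX x).
Proof. by apply: star_uniq => v w; rewrite /= (star_pair x) (star_pair y). Qed.
Let NE (x : X) : `|x| = (opn x)%:C%C. Proof. exact: nrmE. Qed.
Let opnM (x y : X) : opn (mulX x y) <= opn x * opn y.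
Proof.
apply: opn_le; last by rewrite mulr_ge0 // opn_ge0.
move=> v; apply: le_trans (_ : opn x * 'N (val (y : op_) v) <= _).
  exact: (opn_bound x).
by rewrite -mulrA; apply: ler_wpM2l; [apply: opn_ge0|apply: opn_bound].
Qed.
Let opn_star (x : X) : opn (starX x) <= opn x.
Proof.
apply: opn_le; last exact: opn_ge0.
by apply: adjoint_bound (star_pair x) (opn_ge0 _) (opn_bound _).
Qed.
Let nM (x y : X) : `|mulX x y| <= `|x| * `|y|.
Proof. by rewrite !NE -rmorphM lecR opnM. Qed.
Let nS (x : X) : `|mulX (starX x) x| = `|x| ^+ 2.
Proof.
rewrite !NE -rmorphXn; congr (_%:C%C); apply/le_anti/andP; split.
  by apply: le_trans (opnM _ _) _; rewrite expr2 ler_wpM2r ?opn_ge0.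
have sq : Num.sqrt (opn (mulX (starX x) x)) ^+ 2 = opn (mulX (starX x) x).
  by rewrite sqr_sqrtr // opn_ge0.
rewrite -sq ler_pXn2r ?nnegrE ?sqrtr_ge0 ?opn_ge0 //.
apply: opn_le; last exact: sqrtr_ge0.
move=> v; rewrite -(@ler_pXn2r _ 2) ?nnegrE ?mulr_ge0 ?hn_ge0 ?sqrtr_ge0 //.
rewrite exprMn sq; have -> : 'N (val (x : op_) v) ^+ 2 = nrmc (ip (val (x : op_) v) (val (x : op_) v)).
  by rewrite (hn_sq ph) nrmc_real ?sqr_ge0.
rewrite (star_pair x); apply: le_trans (cauchy_schwarz ph _ _) _.
rewrite expr2 mulrA mulrC; apply: ler_wpM2r; first exact: hn_ge0.
exact: (opn_bound (mulX (starX x) x)).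
Qed.

Definition bounded_ops : cstarAlgebra R :=
  CstarAlgebra mA mDl mDr mZl mZr sK sD sZ sM nM nS.

Definition ops_in f (h : is_op f) : bounded_ops := opmk h.
Definition ops_fun (x : bounded_ops) : V -> V := val (x : op_).

Lemma ops_inj (x y : bounded_ops) : (forall v, ops_fun x v = ops_fun y v) -> x = y.
Proof. exact: inj. Qed.

Lemma ops_mulE (x y : bounded_ops) v : ops_fun (x ** y) v = ops_fun x (ops_fun y v). Proof. by []. Qed.
Lemma ops_addE (x y : bounded_ops) v : ops_fun (x + y) v = ops_fun x v + ops_fun y v. Proof. by []. Qed.

Lemma ops_adjP (x : bounded_ops) : adjoint_pair (ops_fun x) (ops_fun x^#).
Proof. exact: star_pair. Qed.

Lemma ops_star_uniq (x y : bounded_ops) : adjoint_pair (ops_fun x) (ops_fun y) -> x^# = y.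
Proof. exact: star_uniq. Qed.

Lemma ops_bound (x : bounded_ops) v : 'N (ops_fun x v) <= nrm x * 'N v.
Proof. exact: opn_bound. Qed.

Lemma ops_nrm_le (x : bounded_ops) K : bounded_by (ops_fun x) K -> 0 <= K -> nrm x <= K.
Proof. exact: opn_le. Qed.

End Operators.

(** * The Hilbert space l2(S) *)

Section Sums.
Variables (R : realType) (S : choiceType).
Implicit Types (p q f g : S -> R) (l : seq S).

Definition psummable p := exists K, forall l, uniq l -> \sum_(s <- l) p s <= K.
Definition nsum p : R := sup [set \sum_(s <- l) p s | l in [set l : seq S | uniq l]].

Lemma nsum_has p : psummable p -> has_sup [set \sum_(s <- l) p s | l in [set l : seq S | uniq l]].
Proof.
move=> [K hK]; split; first by exists (\sum_(s <- [::]) p s), [::].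
by exists K => _ [l ul <-]; apply: hK.
Qed.

Lemma nsum_ub p l : psummable p -> uniq l -> \sum_(s <- l) p s <= nsum p.
Proof. by move=> /nsum_has[_ h] ul; apply: ub_le_sup => //; exists l. Qed.

Lemma nsum_le p K : (forall l, uniq l -> \sum_(s <- l) p s <= K) -> nsum p <= K.
Proof.
move=> h; have sp : psummable p by exists K.
by apply: ge_sup; [have [] := nsum_has sp|move=> _ [l ul <-]; apply: h].
Qed.

Lemma psummable_le p q : (forall s, p s <= q s) -> psummable q -> psummable p.
Proof. by move=> pq [K hK]; exists K => l /hK; apply: le_trans; apply: ler_sum. Qed.

Lemma psummableD p q : psummable p -> psummable q -> psummable (fun s => p s + q s).
Proof. by move=> [K hK] [M hM]; exists (K + M) => l ul; rewrite big_split lerD ?hK ?hM. Qed.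

Lemma psummableZ c p : 0 <= c -> psummable p -> psummable (fun s => c * p s).
Proof. by move=> c0 [K hK]; exists (c * K) => l ul; rewrite -mulr_sumr ler_wpM2l ?hK. Qed.

Lemma sum_sub p l l' : (forall s, 0 <= p s) -> uniq l -> {subset l <= l'} ->
  \sum_(s <- l) p s <= \sum_(s <- l') p s.
Proof.
move=> p0; elim: l l' => [|s l IH] l'; first by move=> _ _; rewrite big_nil sumr_ge0.
move=> /= /andP[sl ul] sub; rewrite big_cons.
have sl' : s \in l' by apply: sub; rewrite mem_head.
rewrite (perm_big _ (perm_to_rem sl')) /= big_cons lerD2l; apply: IH => // t tl.
apply: rem_mem; last by apply: sub; rewrite inE tl orbT.
by apply: contraNneq sl => <-.
Qed.

Lemma nsumD p q : (forall s, 0 <= p s) -> (forall s, 0 <= q s) ->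
  psummable p -> psummable q -> nsum (fun s => p s + q s) = nsum p + nsum q.
Proof.
move=> p0 q0 sp sq; have spq := psummableD sp sq; apply/le_anti/andP; split.
  by apply: nsum_le => l ul; rewrite big_split; apply: lerD; apply: nsum_ub.
rewrite -lerBrDr; apply: nsum_le => l ul; rewrite lerBrDr addrC -lerBrDr.
apply: nsum_le => l' ul'; rewrite lerBrDr.
apply: le_trans (nsum_ub (l := undup (l ++ l')) spq (undup_uniq _)).
rewrite big_split addrC; apply: lerD; apply: sum_sub => // s sl; rewrite mem_undup mem_cat sl ?orbT //.
Qed.

Lemma nsum_ge0 p : psummable p -> 0 <= nsum p.
Proof. by move=> sp; have := @nsum_ub p [::] sp isT; rewrite big_nil. Qed.

Lemma nsum_term p s : psummable p -> p s <= nsum p.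
Proof. by move=> sp; have := @nsum_ub p [:: s] sp isT; rewrite big_seq1. Qed.

Lemma nsum0 : nsum (fun=> 0) = 0.
Proof.
apply/le_anti; rewrite nsum_ge0 ?andbT; last by exists 0 => l _; rewrite big1.
by apply: nsum_le => l _; rewrite big1.
Qed.

Lemma nsumZ c p : 0 <= c -> psummable p -> nsum (fun s => c * p s) = c * nsum p.
Proof.
move=> c0 sp; have [->|cn] := eqVneq c 0.
  rewrite mul0r (_ : (fun s => _) = fun=> 0) ?nsum0 //; by apply/funext => s; rewrite mul0r.
have cp : 0 < c by rewrite lt_neqAle eq_sym cn.
apply/le_anti/andP; split.
  by apply: nsum_le => l ul; rewrite -mulr_sumr; apply: ler_wpM2l => //; apply: nsum_ub.
rewrite -ler_pdivlMl //; apply: nsum_le => l ul; rewrite ler_pdivlMl // mulr_sumr.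
by apply: nsum_ub => //; apply: psummableZ.
Qed.

Definition asum f := nsum (fun s => Num.max (f s) 0) - nsum (fun s => Num.max (- f s) 0).

Definition asummable f := psummable (fun s => `|f s|).

(** Any splitting into nonnegative summable parts computes [asum]; linearity follows by choosing
    convenient splittings. *)
Lemma asum_diff f p q : (forall s, 0 <= p s) -> (forall s, 0 <= q s) ->
  psummable p -> psummable q -> (forall s, f s = p s - q s) -> asum f = nsum p - nsum q.
Proof.
move=> p0 q0 sp sq fE.
have f1 s : 0 <= Num.max (f s) 0 by rewrite le_max lexx orbT.
have f2 s : 0 <= Num.max (- f s) 0 by rewrite le_max lexx orbT.
have s1 : psummable (fun s => Num.max (f s) 0).
  by apply: psummable_le sp => s; rewrite ge_max p0 fE lerBlDr lerDl q0.
have s2 : psummable (fun s => Num.max (- f s) 0).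
  by apply: psummable_le sq => s; rewrite ge_max q0 fE opprB lerBlDr lerDl p0.
suff : nsum (fun s => Num.max (f s) 0) + nsum q = nsum (fun s => Num.max (- f s) 0) + nsum p.
  rewrite /asum => E; apply/eqP; rewrite subr_eq addrAC -subr_eq opprK; apply/eqP.
  by rewrite E addrC.
rewrite -!nsumD //; congr nsum; apply/funext => s.
have [h|h] := leP (f s) 0; rewrite ?(max_r h) ?(max_l (ltW h)).
  by rewrite max_l ?oppr_ge0 // fE; ring.
by rewrite max_r ?oppr_le0 ?ltW // fE; ring.
Qed.

Lemma asum_ge0 f : (forall s, 0 <= f s) -> psummable f -> asum f = nsum f.
Proof.
move=> f0 sf; rewrite (asum_diff (p := f) (q := fun=> 0)) // ?nsum0 ?subr0 //.
  by exists 0 => l _; rewrite big1.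
by move=> s; rewrite subr0.
Qed.

Let pos f s : 0 <= Num.max (f s) 0. Proof. by rewrite le_max lexx orbT. Qed.
Let neg f s : 0 <= Num.max (- f s) 0. Proof. by rewrite le_max lexx orbT. Qed.
Let spos f : asummable f -> psummable (fun s => Num.max (f s) 0).
Proof. by apply: psummable_le => s; rewrite ge_max ler_norm normr_ge0. Qed.
Let sneg f : asummable f -> psummable (fun s => Num.max (- f s) 0).
Proof. by apply: psummable_le => s; rewrite ge_max normr_ge0 andbT -normrN ler_norm. Qed.
Let fE f s : f s = Num.max (f s) 0 - Num.max (- f s) 0.
Proof.
have [h|h] := leP (f s) 0; first by rewrite max_l ?oppr_ge0 // opprK add0r.
by rewrite max_r ?oppr_le0 ?ltW // subr0.
Qed.

Lemma asumD f g : asummable f -> asummable g ->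
  asum (fun s => f s + g s) = asum f + asum g.
Proof.
move=> af ag; rewrite (asum_diff (p := fun s => Num.max (f s) 0 + Num.max (g s) 0)
  (q := fun s => Num.max (- f s) 0 + Num.max (- g s) 0)).
- by rewrite !nsumD //; try exact: sneg; try exact: spos; rewrite /asum; ring.
- by move=> s; rewrite addr_ge0.
- by move=> s; rewrite addr_ge0.
- by apply: psummableD; apply: spos.
- by apply: psummableD; apply: sneg.
- by move=> s; rewrite {1}(fE f) {1}(fE g); ring.
Qed.

Lemma asumZ c f : asummable f -> asum (fun s => c * f s) = c * asum f.
Proof.
move=> af; have [c0|/ltW c0] := leP 0 c.
  rewrite (asum_diff (p := fun s => c * Num.max (f s) 0) (q := fun s => c * Num.max (- f s) 0)).
  - by rewrite !nsumZ //; try exact: sneg; try exact: spos; rewrite /asum; ring.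
  - by move=> s; rewrite mulr_ge0.
  - by move=> s; rewrite mulr_ge0.
  - by apply: psummableZ => //; apply: spos.
  - by apply: psummableZ => //; apply: sneg.
  - by move=> s; rewrite {1}(fE f) mulrBr.
have nc0 : 0 <= - c by rewrite oppr_ge0.
rewrite (asum_diff (p := fun s => - c * Num.max (- f s) 0) (q := fun s => - c * Num.max (f s) 0)).
- by rewrite !nsumZ //; try exact: sneg; try exact: spos; rewrite /asum; ring.
- by move=> s; rewrite mulr_ge0.
- by move=> s; rewrite mulr_ge0.
- by apply: psummableZ => //; apply: sneg.
- by apply: psummableZ => //; apply: spos.
- by move=> s; rewrite {1}(fE f); ring.
Qed.

Lemma nsum_single p t : (forall s, 0 <= p s) -> (forall s, s != t -> p s = 0) ->
  psummable p /\ nsum p = p t.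
Proof.
move=> p0 pt.
have h l : uniq l -> \sum_(s <- l) p s <= p t.
  move=> ul; have [tl|tl] := boolP (t \in l).
    by rewrite (bigD1_seq t) //= big1 ?addr0 // => s /pt.
  rewrite big1_seq // => s /andP[_ sl]; apply: pt.
  by apply: contraNneq tl => <-.
have sp : psummable p by exists (p t).
by split=> //; apply/le_anti; rewrite nsum_le //= nsum_term.
Qed.

End Sums.

(** The limit is the supremum of the lower bounds [u n - 2^-n]. *)
Lemma real_fast_cvg (R : realType) (u : nat -> R) :
  (forall n m, (n <= m)%N -> `|u n - u m| <= half_pow R n) ->
  exists l, forall n, `|u n - l| <= half_pow R n.
Proof.
move=> hu; have hp n : 0 <= half_pow R n by apply/ltW/half_pow_gt0.
pose A := [set u n - half_pow R n | n in [set: nat]].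
have ub n x : A x -> x <= u n + half_pow R n.
  move=> [m _ <-]; case: (leqP n m) => nm.
    have := hu n m nm; rewrite ler_norml => /andP[h _].
    by move: h (hp m); move: (u n) (u m) (half_pow R m) (half_pow R n); clear; move=> *; lra.
  have := hu m n (ltnW nm); rewrite ler_norml => /andP[_ h].
  by move: h (hp n); move: (u n) (u m) (half_pow R m) (half_pow R n); clear; move=> *; lra.
have hA : has_sup A by split; [exists (u 0%N - half_pow R 0), 0%N|exists (u 0%N + half_pow R 0) => x /ub].
exists (sup A) => n; rewrite ler_norml; apply/andP; split.
  rewrite lerBrDr addrC -lerBrDr opprK; apply: ge_sup; [by case: hA|].
  by move=> x /(ub n).
rewrite lerBlDr addrC -lerBlDr; apply: ub_le_sup; first by case: hA.
by exists n.
Qed.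

Section L2.
Variables (R : realType) (S : choiceType).

Definition sqf (x : S -> R[i]^o) (s : S) : R := nrmc (x s) ^+ 2.

Let sq0 x s : 0 <= sqf x s. Proof. exact: sqr_ge0. Qed.

Let l2pred : {pred S -> R[i]^o} := fun x => `[< psummable (sqf x) >].

Lemma nrmcD (a b : R[i]) : nrmc (a + b) <= nrmc a + nrmc b.
Proof. by rewrite -lecR rmorphD /= -!nrmcE ler_normD. Qed.

Lemma nrmc_sqD (a b : R[i]) : nrmc (a + b) ^+ 2 <= 2 * nrmc a ^+ 2 + 2 * nrmc b ^+ 2.
Proof.
apply: le_trans (_ : (nrmc a + nrmc b) ^+ 2 <= _).
  by rewrite ler_pXn2r ?nnegrE ?addr_ge0 ?nrmc_ge0 // nrmcD.
move: (nrmc a) (nrmc b) => u v; have := sqr_ge0 (u - v); clear; move=> h; lra.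
Qed.

Let l2_submod : submod_closed l2pred.
Proof.
split.
  apply/asboolP; exists 0 => l _; rewrite big1 // => s _.
  by rewrite /sqf /nrmc normr0 expr0n.
move=> k x y /asboolP sx /asboolP sy; apply/asboolP.
apply: (@psummable_le _ _ _ (fun s => (2 * nrmc k ^+ 2) * sqf x s + 2 * sqf y s)).
  move=> s; apply: le_trans (nrmc_sqD _ _) _.
  by rewrite nrmcM exprMn mulrA.
apply: psummableD; apply: psummableZ => //.
by rewrite mulr_ge0 // exprn_ge0 // nrmc_ge0.
Qed.

HB.instance Definition _ := GRing.isSubmodClosed.Build R[i] (S -> R[i]^o) l2pred l2_submod.

Definition l2 := {x : S -> R[i]^o | l2pred x}.
HB.instance Definition _ := [isSub of l2 for (@proj1_sig _ _)].
HB.instance Definition _ := [Choice of l2 by <:].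
HB.instance Definition _ := [SubChoice_isSubLmodule of l2 by <:].

Implicit Types x y z : l2.

Lemma l2P x : psummable (sqf (val x)). Proof. exact/asboolP/(valP x). Qed.
Definition l2mk (x : S -> R[i]) (h : psummable (sqf x)) : l2 := exist _ x (asboolT h).

Let prod (x y : l2) s : R[i] := (val x s)^* * val y s.

Lemma nrm_prod x y s : nrmc ((val x s)^* * val y s) <= sqf (val x) s + sqf (val y) s.
Proof.
rewrite nrmcM nrmcJ /sqf; move: (nrmc_ge0 (val x s)) (nrmc_ge0 (val y s)).
move: (nrmc _) (nrmc _) => u v u0 v0; have := sqr_ge0 (u - v); have := mulr_ge0 u0 v0.
by clear; move=> *; lra.
Qed.

Lemma norm_Re_le (k : R[i]) : `|complex.Re k| <= nrmc k.
Proof. by have h := normc_ge_Re k; rewrite nrmcE lecR in h. Qed.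

Lemma nrmcN1 : nrmc (-1 : R[i]) = 1. Proof. by rewrite /nrmc normrN normr1. Qed.
Lemma nrmci : nrmc ('i%C : R[i]) = 1.
Proof. by rewrite /nrmc normc_def /= expr0n add0r expr1n sqrtr1. Qed.

Lemma norm_Im_le (k : R[i]) : `|complex.Im k| <= nrmc k.
Proof.
suff -> : complex.Im k = complex.Re (- ('i%C * k)).
  by apply: le_trans (norm_Re_le _) _; rewrite -mulN1r !nrmcM nrmcN1 nrmci !mul1r.
by case: k => a b /=; ring.
Qed.

Let sRe x y : asummable (fun s => complex.Re (prod x y s)).
Proof.
apply: psummable_le (psummableD (l2P x) (l2P y)) => s.
exact: le_trans (norm_Re_le _) (nrm_prod x y s).
Qed.

Let sIm x y : asummable (fun s => complex.Im (prod x y s)).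
Proof.
apply: psummable_le (psummableD (l2P x) (l2P y)) => s.
exact: le_trans (norm_Im_le _) (nrm_prod x y s).
Qed.

Definition l2ip (x y : l2) : R[i] :=
  (asum (fun s => complex.Re (prod x y s)) +i* asum (fun s => complex.Im (prod x y s)))%C.

Let prodxx x s : prod x x s = (sqf (val x) s)%:C%C.
Proof. by rewrite /prod mulrC -normCK nrmcE /sqf rmorphXn. Qed.

Lemma l2ip_self x : l2ip x x = (nsum (sqf (val x)))%:C%C.
Proof.
rewrite /l2ip; congr (_ +i* _)%C.
  rewrite -asum_ge0; [|exact: sq0|exact: l2P].
  by congr asum; apply/funext => s; rewrite prodxx.
rewrite (_ : (fun s => _) = (fun=> 0)); last by apply/funext => s; rewrite prodxx.
by rewrite asum_ge0 ?nsum0 //; exists 0 => l _; rewrite big1.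
Qed.

Lemma l2_prehilb : prehilb l2ip.
Proof.
split.
- move=> x y z; rewrite /l2ip; apply/eqP; rewrite eq_complex /= -!asumD; try exact: sRe; try exact: sIm.
  apply/andP; split; apply/eqP; congr asum; apply/funext => s; rewrite /prod raddfD /= mulrDr;
  by case: (_ * _) => a b; case: (_ * _) => c d.
- move=> [a b] x y; rewrite /l2ip; apply/eqP; rewrite eq_complex /=.
  have sZ (c : R) f : asummable f -> asummable (fun s : S => c * f s).
    by move=> sf; apply: psummable_le (psummableZ (normr_ge0 c) sf) => s; rewrite normrM.
  have -> : a * asum (fun s => complex.Re (prod x y s)) - b * asum (fun s => complex.Im (prod x y s)) =
      asum (fun s => a * complex.Re (prod x y s) + - b * complex.Im (prod x y s)).
    by rewrite asumD ?(asumZ _ (sRe x y)) ?(asumZ _ (sIm x y)) ?mulNr //; [exact/sZ/sRe|exact/sZ/sIm].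
  have -> : a * asum (fun s => complex.Im (prod x y s)) + b * asum (fun s => complex.Re (prod x y s)) =
      asum (fun s => a * complex.Im (prod x y s) + b * complex.Re (prod x y s)).
    by rewrite asumD ?(asumZ _ (sRe x y)) ?(asumZ _ (sIm x y)) //; [exact/sZ/sIm|exact/sZ/sRe].
  apply/andP; split; apply/eqP; congr asum; apply/funext => s; rewrite /prod;
    rewrite (_ : val ((a +i* b)%C *: y) s = (a +i* b)%C * val y s) //;
    by case: (val x s) (val y s) => p q [p1 q1] /=; ring.
- move=> x y; rewrite /l2ip; apply/eqP; rewrite eq_complex /= -mulN1r -asumZ; last exact: sIm.
  by apply/andP; split; apply/eqP; congr asum; apply/funext => s; rewrite /prod;
    case: (val x s) (val y s) => p q [p' q'] /=; ring.
- by move=> x; rewrite l2ip_self ler0c nsum_ge0 //; apply: l2P.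
- move=> x; rewrite l2ip_self => /complexI n0; apply: val_inj; apply/funext => s.
  have := nsum_term s (l2P x); rewrite n0 /sqf => h; apply/normr0_eq0; rewrite nrmcE.
  by congr (_%:C%C); apply/eqP; rewrite -sqrf_eq0; apply/eqP/le_anti; rewrite h sqr_ge0.
Qed.

Lemma l2_hn x : hn l2ip x = Num.sqrt (nsum (sqf (val x))).
Proof. by rewrite /hn l2ip_self. Qed.

Lemma l2_hn_sq x : hn l2ip x ^+ 2 = nsum (sqf (val x)).
Proof. by rewrite l2_hn sqr_sqrtr // nsum_ge0 //; apply: l2P. Qed.

Lemma l2_coord x s : nrmc (val x s) <= hn l2ip x.
Proof.
rewrite -(@ler_pXn2r _ 2) ?nnegrE ?nrmc_ge0 ?hn_ge0 // l2_hn_sq.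
exact: nsum_term (l2P x).
Qed.

Lemma sqr_nrmc (k : R[i]) : nrmc k ^+ 2 = complex.Re k ^+ 2 + complex.Im k ^+ 2.
Proof.
case: k => a b; rewrite /nrmc normc_def /= sqr_sqrtr //.
by rewrite addr_ge0 // sqr_ge0.
Qed.

(** The limit is taken coordinatewise, separately in real and imaginary parts; bounds on finite sums
    that are uniform in the list put it into l2. *)
Lemma l2_complete (u : nat -> l2) :
  (forall n m, (n <= m)%N -> hn l2ip (u n - u m) <= half_pow R n) ->
  exists l, forall n, hn l2ip (u n - l) <= half_pow R n.
Proof.
move=> hu; have ph := l2_prehilb.
have hp n : 0 <= half_pow R n by apply/ltW/half_pow_gt0.
have cu n m s : (n <= m)%N -> nrmc (val (u n) s - val (u m) s) <= half_pow R n.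
  by move=> /hu; apply: le_trans; have := l2_coord (u n - u m) s; rewrite raddfB.
have /choice[a ha] s : exists l, forall n, `|complex.Re (val (u n) s) - l| <= half_pow R n.
  apply: real_fast_cvg => n m /cu h; apply: le_trans (h s).
  by apply: le_trans (norm_Re_le _); rewrite raddfB.
have /choice[b hb] s : exists l, forall n, `|complex.Im (val (u n) s) - l| <= half_pow R n.
  apply: real_fast_cvg => n m /cu h; apply: le_trans (h s).
  by apply: le_trans (norm_Im_le _); rewrite raddfB.
pose y s : R[i] := (a s +i* b s)%C.
have hy n s : nrmc (val (u n) s - y s) ^+ 2 <= 2 * half_pow R n ^+ 2.
  rewrite sqr_nrmc; have := ha s n; have := hb s n; rewrite /y; case: (val (u n) s) => p q /=.
  rewrite -(@ler_pXn2r _ 2) ?nnegrE // => h1; rewrite -(@ler_pXn2r _ 2) ?nnegrE //.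
  by move: h1; rewrite !real_normK ?num_real // => h1 h2; rewrite mulr_natl mulr2n lerD.
have key n l : uniq l -> \sum_(s <- l) nrmc (val (u n) s - y s) ^+ 2 <= 2 * half_pow R n ^+ 2.
  move=> ul; apply/ler_addgt0Pl => e e0.
  pose N : R := (size l)%:R.
  (* Absorbs the errors of the [N] coordinates, each at most [4 * 2^-k]. *)
  have [|k hk] := @half_pow_small R (e / (4 * N + 1)).
    by rewrite divr_gt0 // ltr_wpDl // mulr_ge0 // ler0n.
  have k1 : half_pow R k <= 1 by rewrite -[leRHS](expr0 (2^-1)); apply: (@half_pow_le R 0 k).
  pose m := maxn n k.
  apply: le_trans (_ : \sum_(s <- l) (2 * sqf (val (u n - u m)) s + 2 * (2 * half_pow R m ^+ 2)) <= _).
    apply: ler_sum => s _; rewrite /sqf raddfB /=.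
    apply: le_trans (_ : 2 * nrmc (val (u n) s - val (u m) s) ^+ 2 + 2 * nrmc (val (u m) s - y s) ^+ 2 <= _).
      by apply: le_trans (nrmc_sqD _ _); rewrite addrA subrK.
    by rewrite lerD2l ler_wpM2l.
  rewrite big_split /= -mulr_sumr addrC; apply: lerD.
    rewrite big_const_seq count_predT iter_addr_0 -[X in X <= _]mulr_natl -/N.
    have mk : half_pow R m ^+ 2 <= half_pow R k.
      apply: le_trans (_ : half_pow R k ^+ 2 <= _).
        by rewrite ler_pXn2r ?nnegrE //; apply: half_pow_le; apply: leq_maxr.
      by rewrite expr2 -[leRHS]mulr1 ler_wpM2l.
    have N0 : 0 <= N by apply: ler0n.
    move: hk; rewrite ltr_pdivlMr ?ltr_wpDl ?mulr_ge0 // => hk.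
    apply: le_trans (_ : N * (2 * (2 * half_pow R k)) <= _); first by apply: ler_wpM2l => //; rewrite !ler_pM2l.
    move: hk (hp k) N0; move: (half_pow R k) => h; clear; move=> hk h0 N0; nra.
  apply: ler_wpM2l => //; apply: le_trans (nsum_ub (l2P (u n - u m)) ul) _.
  by rewrite -l2_hn_sq ler_pXn2r ?nnegrE ?hn_ge0 // hu // leq_maxl.
have sy : psummable (sqf y).
  apply: (@psummable_le _ _ _ (fun s => 2 * sqf (val (u 0%N)) s + 2 * nrmc (val (u 0%N) s - y s) ^+ 2)).
    move=> s; have -> : sqf y s = nrmc (val (u 0%N) s - (val (u 0%N) s - y s)) ^+ 2 by rewrite subKr.
    apply: le_trans (nrmc_sqD _ _) _; rewrite -[- (_ - _)]mulN1r (nrmcM (-1)) nrmcN1 mul1r.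
    exact: lexx.
  apply: psummableD; apply: psummableZ => //; first exact: l2P.
  by exists (2 * half_pow R 0 ^+ 2) => l /key.
have hn2 n : hn l2ip (u n - l2mk sy) <= 2 * half_pow R n.
  rewrite -(@ler_pXn2r _ 2) ?nnegrE ?hn_ge0 ?mulr_ge0 // l2_hn_sq exprMn.
  apply: nsum_le => l ul; rewrite /sqf raddfB /=; apply: le_trans (key n l ul) _.
  by apply: ler_wpM2r; rewrite ?exprn_ge0 // expr2 -natrM ler_nat.
(* The factor 2 in [hn2] disappears when [u n] is compared with a far term of the sequence first. *)
exists (l2mk sy) => n; apply/ler_addgt0Pl => e e0.
have [|k hk] := @half_pow_small R (e / 2); first by rewrite divr_gt0.
apply: le_trans (hn_tri ph (u (maxn n k)) _ _) _; rewrite addrC; apply: lerD; last exact/hu/leq_maxl.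
apply: le_trans (hn2 _) _; rewrite -ler_pdivlMl //.
apply: le_trans (half_pow_le R (leq_maxr n k)) _.
by rewrite mulrC ltW.
Qed.

Definition l2_ops : cstarAlgebra R := bounded_ops l2_prehilb l2_complete.

End L2.

(** * Partial isometries of l2(S) from partial bijections of S *)

Section Pull.
Variables (R : realType) (S : choiceType).

Definition inverse_pair (F G : S -> option S) := forall P Q, F P = Some Q <-> G Q = Some P.

Definition pull (V : nmodType) (F : S -> option S) (x : S -> V) (P : S) : V := oapp x 0 (F P).

Lemma inverse_pair_sym F G : inverse_pair F G -> inverse_pair G F.
Proof. by move=> h P Q; split=> /h. Qed.

Lemma sum_pull F G (p : S -> R) l : inverse_pair F G -> uniq l ->
  exists2 l', uniq l' & \sum_(s <- l) pull F p s = \sum_(s <- l') p s.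
Proof.
move=> FG ul; exists (pmap F l); last first.
  elim: l {ul} => [|s l IH]; first by rewrite !big_nil.
  by rewrite big_cons IH /pull /=; case: (F s) => [t|] /=; rewrite ?big_cons ?add0r.
elim: l ul => [//|s l IH] /= /andP[sl /IH ul]; case E: (F s) => [t|] //=.
rewrite ul andbT; apply: contra sl; rewrite mem_pmap => /mapP[r rl /esym /FG h].
by move/FG: E; rewrite h => -[<-].
Qed.

Lemma pull_summable F G (p : S -> R) : inverse_pair F G -> psummable p -> psummable (pull F p).
Proof.
move=> FG [K hK]; exists K => l ul.
by have [l' ul' ->] := sum_pull p FG ul; apply: hK.
Qed.

Lemma nsum_pull_le F G (p : S -> R) : inverse_pair F G -> psummable p -> nsum (pull F p) <= nsum p.
Proof.
move=> FG sp; apply: nsum_le => l ul.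
by have [l' ul' ->] := sum_pull p FG ul; apply: nsum_ub.
Qed.

Lemma pullK (V : nmodType) F G (x : S -> V) : inverse_pair F G -> (forall s, G s = None -> x s = 0) ->
  pull G (pull F x) = x.
Proof.
move=> FG x0; apply/funext => Q; rewrite /pull; case E: (G Q) => [P|] /=; last by rewrite x0.
by move/FG: E => ->.
Qed.

Lemma nsum_pull F G (p : S -> R) : inverse_pair F G -> psummable p ->
  (forall s, G s = None -> p s = 0) -> nsum (pull F p) = nsum p.
Proof.
move=> FG sp p0; apply/le_anti; rewrite (nsum_pull_le FG) //= -{1}(pullK FG p0).
by apply: (nsum_pull_le (inverse_pair_sym FG)); apply: (pull_summable FG).
Qed.

Lemma asum_pull F G (f : S -> R) : inverse_pair F G -> asummable f ->
  (forall s, G s = None -> f s = 0) -> asum (pull F f) = asum f.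
Proof.
move=> FG sf f0; rewrite /asum; congr (_ - _).
  rewrite -(nsum_pull FG (p := fun s => Num.max (f s) 0)).
  - by congr nsum; apply/funext => s; rewrite /pull; case: (F s) => //=; rewrite maxxx.
  - by apply: psummable_le sf => s; rewrite ge_max ler_norm normr_ge0.
  - by move=> s /f0 ->; rewrite maxxx.
rewrite -(nsum_pull FG (p := fun s => Num.max (- f s) 0)).
- by congr nsum; apply/funext => s; rewrite /pull; case: (F s) => //=; rewrite oppr0 maxxx.
- by apply: psummable_le sf => s; rewrite ge_max normr_ge0 andbT -normrN ler_norm.
- by move=> s /f0 ->; rewrite oppr0 maxxx.
Qed.

Variables (F G : S -> option S) (FG : inverse_pair F G).

Lemma sqf_pull K (x : S -> R[i]^o) : sqf (pull K x) = pull K (sqf x).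
Proof.
apply/funext => s; rewrite /sqf /pull; case: (K s) => //=.
by rewrite /nrmc normr0 expr0n.
Qed.

Lemma l2_pull_summable K K' (x : l2 R S) : inverse_pair K K' -> psummable (sqf (pull K (val x))).
Proof. by move=> KK'; rewrite sqf_pull; apply: (pull_summable KK'); apply: l2P. Qed.

Definition l2_pull K K' (h : inverse_pair K K') (x : l2 R S) : l2 R S := l2mk (l2_pull_summable x h).

Lemma l2_pull_adj : adjoint_pair (@l2ip R S) (l2_pull FG) (l2_pull (inverse_pair_sym FG)).
Proof.
move=> x y; have GF := inverse_pair_sym FG.
have aux (r : R[i] -> R) : r 0 = 0 -> (forall k, `|r k| <= nrmc k) ->
    asum (fun s => r ((val (l2_pull FG x) s)^* * val y s)) =
    asum (fun s => r ((val x s)^* * val (l2_pull GF y) s)).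
  move=> r0 rn; rewrite -(asum_pull FG (f := fun s => r ((val x s)^* * val (l2_pull GF y) s))).
  - congr asum; apply/funext => s; rewrite /= /pull; case E: (F s) => [t|] /=.
      by move/FG: E => ->.
    by rewrite conjC0 mul0r r0.
  - apply: psummable_le (psummableD (l2P x) (l2P (l2_pull GF y))) => s.
    by apply: le_trans (rn _) (nrm_prod _ _ _).
  - by move=> s E; rewrite /= /pull E /= mulr0 r0.
by rewrite /l2ip; congr (_ +i* _)%C; apply: aux => //; [exact: norm_Re_le|exact: norm_Im_le].
Qed.

Lemma l2_pull_op : is_op (@l2ip R S) (l2_pull FG).
Proof.
split; first by exists (l2_pull (inverse_pair_sym FG)); apply: l2_pull_adj.
exists 1 => // x; rewrite mul1r !l2_hn ler_sqrt ?nsum_ge0 //; last by apply: l2P.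
by rewrite /= sqf_pull; apply: (nsum_pull_le FG); apply: l2P.
Qed.

End Pull.

Section ShiftOp.
Variables (R : realType) (S : choiceType).

Definition shift_op (F G : S -> option S) (FG : inverse_pair F G) : l2_ops R S :=
  ops_in (l2_prehilb R S) (@l2_complete R S) (l2_pull_op R FG).

Definition l2_app (z : l2_ops R S) (x : l2 R S) : l2 R S := ops_fun z x.

Lemma shift_opE F G (FG : inverse_pair F G) x P : val (l2_app (shift_op FG) x) P = oapp (val x) 0 (F P).
Proof. by []. Qed.

Lemma shift_op_star F G (FG : inverse_pair F G) : (shift_op FG)^# = shift_op (inverse_pair_sym FG).
Proof. by apply: ops_star_uniq; apply: l2_pull_adj. Qed.

Lemma l2_opP (z w : l2_ops R S) : (forall x P, val (l2_app z x) P = val (l2_app w x) P) -> z = w.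
Proof. by move=> h; apply: ops_inj => x; apply: val_inj; apply/funext. Qed.

Definition l2_delta_fun (t s : S) : R[i] := if s == t then 1 else 0.

Lemma l2_delta_summable t : psummable (sqf (l2_delta_fun t)).
Proof.
have [] // := @nsum_single R S (sqf (l2_delta_fun t)) t.
  by move=> s; apply: sqr_ge0.
by move=> s /negPf st; rewrite /sqf /l2_delta_fun st /nrmc normr0 expr0n.
Qed.

Definition l2_delta t : l2 R S := l2mk (l2_delta_summable t).

End ShiftOp.

(** * Boundary paths and a faithful Cuntz-Krieger family *)

Section Boundary.
Variable L : ordinalGraph.
Implicit Types (e f g h u v : L) (P Q : set L).

Record chain v P : Prop := Chain {
  ch_start : P v;
  ch_rng : forall e, P e -> og_r e = v;
  ch_prefix : forall e f, P f -> og_ext e f -> P e;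
  ch_comparable : forall e f, P e -> P f -> og_ext e f \/ og_ext f e
}.

(** Maximal chains play the role of infinite paths. Such a chain need not have a greatest element,
    so it need not be the set of prefixes of a path. *)
Definition boundary v P := chain v P /\ forall Q, chain v Q -> P `<=` Q -> Q `<=` P.

Definition path_up e P : set L := [set g | exists2 h, P h & og_ext g (e • h)].
Definition path_dn e P : set L := [set h | og_s e = og_r h /\ P (e • h)].

Lemma chain_up e P : chain (og_s e) P -> chain (og_r e) (path_up e P).
Proof.
move=> cP; have es h : P h -> og_s e = og_r h by move/(ch_rng cP).
split.
- exists (og_s e); first exact: ch_start cP.
  by rewrite og_idr; exists e; rewrite ?og_sr ?og_idl.
- by move=> g [h /es eh /og_ext_r]; rewrite og_rM.
- by move=> g f [h Ph fh] gf; exists h => //; apply: og_ext_trans gf fh.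
- move=> g g' [h Ph gh] [h' Ph' gh'].
  case: (ch_comparable cP Ph Ph') => hh.
    apply: og_ext_comparable gh'; apply: og_ext_trans gh _.
    by apply/og_ext_compl => //; apply: es.
  apply: og_ext_comparable gh _; apply: og_ext_trans gh' _.
  by apply/og_ext_compl => //; apply: es.
Qed.

Lemma up_mem e P : chain (og_s e) P -> path_up e P e.
Proof. by move=> cP; exists (og_s e); rewrite ?og_idr; [apply: ch_start|apply: og_ext_refl]. Qed.

Lemma chain_dn v e P : chain v P -> P e -> chain (og_s e) (path_dn e P).
Proof.
move=> cP Pe; split.
- by rewrite /path_dn /= og_rs og_idr.
- by move=> h [].
- move=> g f [ef Pf] gf; have eg : og_s e = og_r g by rewrite ef (og_ext_r gf).
  by split=> //; apply: (ch_prefix cP Pf); apply/og_ext_compl.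
- move=> g f [eg Pg] [ef Pf]; case: (ch_comparable cP Pg Pf) => /og_ext_compl h.
    by left; apply: h.
  by right; apply: h.
Qed.

Lemma dn_up e P : chain (og_s e) P -> path_dn e (path_up e P) = P.
Proof.
move=> cP; have es h : P h -> og_s e = og_r h by move/(ch_rng cP).
apply/seteqP; split=> [h [eh [h' Ph' /og_ext_compl hh']]|h Ph].
  by apply: (ch_prefix cP Ph'); apply: hh' => //; apply: es.
by split; [apply: es|exists h => //; apply: og_ext_refl].
Qed.

Lemma up_dn v e P : chain v P -> P e -> path_up e (path_dn e P) = P.
Proof.
move=> cP Pe; apply/seteqP; split=> [g [h [eh Peh]] /(ch_prefix cP Peh)//|g Pg].
case: (ch_comparable cP Pe Pg) => [[h eh gE]|ge].
  by exists h; rewrite ?gE; [split=> //; rewrite -gE|apply: og_ext_refl].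
by exists (og_s e); rewrite ?og_idr //; split; rewrite ?og_rs ?og_idr.
Qed.

Lemma up_mono e P Q : P `<=` Q -> path_up e P `<=` path_up e Q.
Proof. by move=> PQ g [h /PQ]; exists h. Qed.

Lemma dn_mono e P Q : P `<=` Q -> path_dn e P `<=` path_dn e Q.
Proof. by move=> PQ h [eh /PQ]. Qed.

Lemma boundary_up e P : boundary (og_s e) P -> boundary (og_r e) (path_up e P).
Proof.
move=> [cP mP]; split; first exact: chain_up.
move=> Q cQ PQ; have Qe : Q e by apply: PQ; apply: up_mem.
rewrite -(up_dn cQ Qe); apply: up_mono; apply: mP; first exact: chain_dn cQ Qe.
by rewrite -{1}(dn_up cP); apply: dn_mono.
Qed.

Lemma boundary_dn v e P : boundary v P -> P e -> boundary (og_s e) (path_dn e P).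
Proof.
move=> [cP mP] Pe; have vE : v = og_r e by rewrite (ch_rng cP Pe).
split; first exact: chain_dn cP Pe.
move=> Q cQ PQ; rewrite -(dn_up cQ); apply: dn_mono; apply: mP.
  by rewrite vE; apply: chain_up.
by rewrite -{1}(up_dn cP Pe); apply: up_mono.
Qed.

Lemma dn_vertex v P : chain v P -> og_vertex v -> path_dn v P = P.
Proof.
move=> cP vv; apply/seteqP; split=> [h []|h Ph].
  by rewrite og_s_vertex // => ->; rewrite og_idl.
by have rh := ch_rng cP Ph; rewrite /path_dn /= og_s_vertex // -rh og_idl.
Qed.

Lemma dn_comp e f P : og_s e = og_r f -> path_dn f (path_dn e P) = path_dn (e • f) P.
Proof.
move=> ef; apply/seteqP; split=> h.
  by move=> [fh [efh]]; rewrite og_compA // => Ph; split; rewrite ?og_sM.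
move=> [fh Ph]; rewrite og_sM // in fh.
by split=> //; split; rewrite ?og_rM // og_compA.
Qed.

Lemma chain_prefixes g : chain (og_r g) [set h | og_ext h g].
Proof.
split=> /=.
- by exists g; rewrite ?og_sr ?og_idl.
- by move=> e /og_ext_r.
- by move=> e f fg ef; apply: og_ext_trans ef fg.
- by move=> e f; apply: og_ext_comparable.
Qed.

Lemma boundary_exists v : og_vertex v -> exists P, boundary v P.
Proof.
move=> vv; have [|P [cP mP]] := @Zorn_bigcup L [set P | P !=set0 -> chain v P].
  move=> F FP tF [x [X FX Xx]].
  have cF Y y : F Y -> Y y -> chain v Y by move=> FY Yy; apply: FP => //; exists y.
  split.
  - by exists X => //; apply: ch_start (cF X x FX Xx).
  - by move=> e [Y FY Ye]; apply: ch_rng (cF Y e FY Ye) _ Ye.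
  - by move=> e f [Y FY Yf] ef; exists Y => //; apply: ch_prefix (cF Y f FY Yf) _ _ Yf ef.
  - move=> e f [Y FY Ye] [Z FZ Zf]; case: (tF Y Z FY FZ) => [YZ|ZY].
      by apply: (ch_comparable (cF Z f FZ Zf)) => //; apply: YZ.
    by apply: (ch_comparable (cF Y e FY Ye)) => //; apply: ZY.
have mP' Q : chain v Q -> P `<=` Q -> Q `<=` P.
  move=> cQ PQ; apply: contrapT => nQP; exact: (mP Q (conj PQ nQP)).
exists P; split=> //; apply: cP; apply: contrapT => P0.
have cv := chain_prefixes v; rewrite vv in cv.
have P0' : P `<=` [set h | og_ext h v] by move=> x Px; case: P0; exists x.
by apply: P0; exists v; apply: (mP' _ cv P0'); apply: ch_start cv.
Qed.

Lemma chain_list_ub v P (s : seq L) : chain v P -> {in s, forall e, P e} ->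
  exists2 f, P f & {in s, forall e, og_ext e f}.
Proof.
move=> cP; elim: s => [|e s IH] sP; first by exists v => //; apply: ch_start cP.
have [|f Pf sf] := IH; first by move=> x xs; apply: sP; rewrite inE xs orbT.
have Pe : P e by apply: sP; rewrite mem_head.
case: (ch_comparable cP Pe Pf) => h.
  by exists f => // x; rewrite inE => /orP[/eqP->//|/sf].
exists e => // x; rewrite inE => /orP[/eqP->|/sf xf]; first exact: og_ext_refl.
exact: og_ext_trans xf h.
Qed.

(** Otherwise all members of [P] are shorter than [ω^a], and by source regularity each extends to a
    path of length [ω^a] from [v]. There are finitely many of these and [P] is linearly ordered, so
    one of them extends all of [P], against maximality. *)
Lemma boundary_regular v a P : og_regular a v -> boundary v P ->
  exists2 e, P e & og_paths v a e.
Proof.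
move=> [sr rf] [cP mP]; apply: contrapT => nP.
have rP e : P e -> og_r e = v by exact: (ch_rng cP).
have dP e : P e -> olt (og_d e) (oexpw a).
  move=> Pe; apply: contrapT => /(contra_not (@oltNge _ _))/contrapT/og_split[f [g [fg df E]]].
  have fe : og_ext f e by exists g.
  apply: nP; exists f; first exact: (ch_prefix cP Pe).
  by split=> //; apply: rP; apply: (ch_prefix cP Pe).
have ex e : P e -> exists2 g, og_paths v a g & og_ext e g.
  move=> Pe; have [f [rf' df]] := sr e (rP _ Pe) (dP _ Pe).
  exists (e • f); last by exists f.
  split; first by rewrite (og_rM (esym rf')) (rP _ Pe).
  apply: oeq_trans (og_dM (esym rf')) _.
  apply: oeq_trans (oadd_oeq (oeqxx _) df) _.
  exact: oabsorb (dP _ Pe) (olexx _).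
have [g [vg hg]] : exists g, og_paths v a g /\ forall e, P e -> og_ext e g.
  apply: contrapT => ng.
  have /choice[w hw] g : exists e, P e /\ (og_paths v a g -> ~ og_ext e g).
    have [vg|nvg] := pselect (og_paths v a g); last by exists v; split=> //; apply: ch_start cP.
    apply: contrapT => nw; apply: ng; exists g; split=> // e Pe.
    by apply: contrapT => neg; apply: nw; exists e.
  have /finite_seqP[s sE] := rf.
  have [|f Pf sf] := @chain_list_ub v P (map w s) cP.
    by move=> _ /mapP[g _ ->]; case: (hw g).
  have [g vg fg] := ex f Pf; have [_ /(_ vg)] := hw g; apply.
  apply: og_ext_trans fg; apply: sf; apply: map_f.
  by have := vg; rewrite sE.
have cg := chain_prefixes g; rewrite vg.1 in cg.
apply: nP; exists g => //; apply: (mP _ cg) => //=; exact: og_ext_refl.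
Qed.

End Boundary.

Section BoundaryFamily.
Variables (R : realType) (L : ordinalGraph).
Implicit Types (e f g h u v : L) (P Q : set L).

Definition bd_dn e P : option (set L) :=
  if `[< boundary (og_r e) P /\ P e >] then Some (path_dn e P) else None.
Definition bd_up e P : option (set L) :=
  if `[< boundary (og_s e) P >] then Some (path_up e P) else None.

Lemma bd_pair e : inverse_pair (bd_dn e) (bd_up e).
Proof.
move=> P Q; rewrite /bd_dn /bd_up; split.
  case: asboolP => // -[bP Pe] [<-]; case: asboolP => [_|]; first by rewrite (up_dn bP.1 Pe).
  by case; apply: boundary_dn bP Pe.
case: asboolP => // bQ [<-]; case: asboolP => [_|]; first by rewrite (dn_up bQ.1).
by case; split; [apply: boundary_up|apply: up_mem bQ.1].
Qed.

(** Sends the basis vector of a boundary path [Q] at the source of [e] to that of [path_up e Q]. *)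
Definition bd_op e : l2_ops R (set L) := shift_op R (bd_pair e).

Let appE e x P : val (l2_app (bd_op e) x) P = oapp (val x) 0 (bd_dn e P).
Proof. exact: shift_opE. Qed.

Let appsE e x P : val (l2_app (bd_op e)^# x) P = oapp (val x) 0 (bd_up e P).
Proof. by rewrite shift_op_star. Qed.

Let oappS (x : l2 R (set L)) P : oapp (val x) 0 (Some P) = val x P. Proof. by []. Qed.
Let oappN (x : l2 R (set L)) : oapp (val x) 0 None = 0. Proof. by []. Qed.

Let appM (z w : l2_ops R (set L)) x : l2_app (z ** w) x = l2_app z (l2_app w x).
Proof. by []. Qed.

Lemma bd_op_comp e f : og_s e = og_r f -> bd_op e ** bd_op f = bd_op (e • f).
Proof.
move=> ef; apply: l2_opP => x P; rewrite appM !appE /bd_dn.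
case: asboolP => [[bP Pe]|nP]; rewrite ?oappS ?oappN; last first.
  case: asboolP => [[bP Pef]|//]; case: nP; rewrite og_rM // in bP.
  by split=> //; apply: (ch_prefix bP.1 Pef); exists f.
rewrite appE /bd_dn (dn_comp _ ef); case: asboolP => [[_ [_ Pef]]|nP].
  by rewrite asboolT //= og_rM.
rewrite asboolF // => -[bP' Pef]; apply: nP; rewrite -ef; split; first exact: boundary_dn bP Pe.
by split.
Qed.

Lemma bd_op_vertex v x P : og_vertex v ->
  val (l2_app (bd_op v) x) P = if `[< boundary v P >] then val x P else 0.
Proof.
move=> vv; rewrite appE /bd_dn vv; case: (asboolP (boundary v P)) => [bP|nP].
  by rewrite asboolT /= ?(dn_vertex bP.1) //; split=> //; apply: ch_start bP.1.
by rewrite asboolF // => -[].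
Qed.

Lemma bd_op_source e : (bd_op e)^# ** bd_op e = bd_op (og_s e).
Proof.
apply: l2_opP => x P; rewrite appM appsE bd_op_vertex; last exact: og_vertex_s.
rewrite /bd_up; case: asboolP => // bP; rewrite ?oappS.
rewrite appE /bd_dn asboolT /= ?(dn_up bP.1) //.
by split; [apply: boundary_up|apply: up_mem bP.1].
Qed.

Lemma bd_op_range e x P : val (l2_app (bd_op e ** (bd_op e)^#) x) P =
  if `[< boundary (og_r e) P /\ P e >] then val x P else 0.
Proof.
rewrite appM appE /bd_dn; case: asboolP => // -[bP Pe]; rewrite ?oappS.
by rewrite appsE /bd_up asboolT /= ?(up_dn bP.1 Pe) //; apply: boundary_dn bP Pe.
Qed.

Let app_sum (I : Type) (s : seq I) (F : I -> l2_ops R (set L)) x P :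
  val (l2_app (\sum_(i <- s) F i) x) P = \sum_(i <- s) val (l2_app (F i) x) P.
Proof.
elim: s => [|i s IH]; first by rewrite !big_nil.
by rewrite !big_cons -IH.
Qed.

Lemma bd_op_family : og_family bd_op.
Proof.
have part e : bd_op e ** (bd_op e)^# ** bd_op e = bd_op e.
  by rewrite -cs_mulA bd_op_source bd_op_comp ?og_rs // og_idr.
split.
- by move=> e _.
- by move=> e _; apply: bd_op_source.
- by move=> e f _ _ ef _; apply: bd_op_comp.
- move=> e f _ _ /og_perpP ef; apply: l2_opP => x P; rewrite appM appsE /bd_up.
  case: asboolP => // bP; rewrite ?oappS; rewrite appE /bd_dn asboolF // => -[[cP _] Pf].
  have rE : og_r e = og_r f by rewrite (ch_rng cP (up_mem bP.1)).
  case: (ch_comparable cP Pf (up_mem bP.1)); [exact: ef.2|exact: ef.1].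
- move=> v a vv reg; have fin := reg.2.
  rewrite (fsbig_finite _ _ fin); apply: l2_opP => x P; rewrite bd_op_vertex // app_sum.
  under eq_bigr => e _ do rewrite bd_op_range.
  case: asboolP => [bP|nP]; last first.
    rewrite big1_seq // => e; rewrite in_fset_set // inE => /= -[re _].
    by rewrite asboolF // re => -[].
  (* Exactly one range projection in (iv) is nonzero at [P]: that of the prefix of [P] of length
     [ω^a]. *)
  have [e Pe he] := boundary_regular reg bP.
  rewrite (bigD1_seq e) ?fset_uniq ?in_fset_set ?inE //=.
  rewrite asboolT ?big1_seq ?addr0 //; last by rewrite he.1.
  move=> f /andP[/eqP fe]; rewrite in_fset_set // inE => /= -[rf df].
  rewrite asboolF // => -[_ Pf]; apply: fe.
  have dd : oeq (og_d f) (og_d e) by apply: oeq_trans df (oeq_sym he.2).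
  case: (ch_comparable bP.1 Pf Pe) => h; first exact: og_ext_antisym h dd.2.
  by apply/esym; apply: og_ext_antisym h dd.1.
Qed.

Lemma bd_op_neq0 v : og_vertex v -> bd_op v <> 0.
Proof.
move=> vv v0; have [P bP] := boundary_exists vv.
have := bd_op_vertex (l2_delta R P) P vv; rewrite v0 asboolT //= /l2_delta_fun eqxx => /esym/eqP.
by rewrite oner_eq0.
Qed.

End BoundaryFamily.

(** * Representations of the path algebra *)

Definition clos (R : realType) (V : normedModType R[i]) (P : V -> Prop) (x : V) :=
  forall e : R, 0 < e -> exists2 y, P y & nrm (x - y) < e.

Lemma clos_subspace (R : realType) (V : completeNormedModType R[i]) (P : V -> Prop) :
  P 0 -> (forall x y, P x -> P y -> P (x + y)) -> (forall (k : R[i]) x, P x -> P (k *: x)) ->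
  closed_subspace (clos P).
Proof.
move=> P0 PD PZ; split.
- by move=> e e0; exists 0; rewrite ?subr0 ?nrm0.
- move=> x y hx hy e e0; have e2 : 0 < e / 2 by rewrite divr_gt0.
  have [x' Px' xx] := hx _ e2; have [y' Py' yy] := hy _ e2.
  exists (x' + y'); first exact: PD.
  by rewrite opprD addrACA; apply: le_lt_trans (nrmD _ _) _; move: xx yy; clear; lra.
- move=> k x hx e e0; have kp : 0 < nrmc k + 1 by rewrite ltr_wpDl ?nrmc_ge0.
  have [|x' Px' xx] := hx (e / (nrmc k + 1)); first by rewrite divr_gt0.
  exists (k *: x'); first exact: PZ.
  rewrite -scalerBr nrmZ; move: xx; rewrite ltr_pdivlMr // => xx.
  apply: le_lt_trans xx; rewrite mulrC; apply: ler_wpM2l; first exact: nrm_ge0.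
  by rewrite lerDl.
- move=> x hx e e0; have e2 : 0 < e / 2 by rewrite divr_gt0.
  have [x1 hx1 xx1] := hx _ e2; have [x2 Px2 xx2] := hx1 _ e2.
  by exists x2 => //; apply: le_lt_trans (nrm_tri x1 _ _) _; move: xx1 xx2; clear; lra.
Qed.

Section ClosMul.
Variables (R : realType) (E : cstarAlgebra R).
Implicit Types P Q S : E -> Prop.

Lemma clos_mul P Q S x y : (forall a b, P a -> Q b -> S (a ** b)) ->
  clos P x -> clos Q y -> clos S (x ** y).
Proof.
move=> PQS hx hy e e0; pose K := nrm x + nrm y + 1.
have K1 : 1 <= K by rewrite lerDr addr_ge0 ?nrm_ge0.
have K0 : 0 < K by apply: lt_le_trans K1.
pose d := Num.min 1 (e / (K + K)).
have d0 : 0 < d by rewrite lt_min ltr01 divr_gt0 // addr_gt0.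
have [a Pa xa] := hx _ d0; have [b Qb yb] := hy _ d0.
exists (a ** b); first exact: PQS.
have -> : x ** y - a ** b = (x - a) ** y + a ** (y - b).
  by rewrite cs_mulBl cs_mulBr addrA subrK.
have na : nrm (a) <= nrm x + 1.
  apply: le_trans (nrm_le_dist _ x) _; rewrite lerD2l nrmBC; apply: ltW.
  by apply: lt_le_trans xa _; rewrite /d ge_min lexx.
have dK : d * (K + K) <= e.
  have KK : 0 < K + K by rewrite addr_gt0.
  by rewrite -(ler_pdivlMr _ _ KK) /d ge_min lexx orbT.
apply: le_lt_trans (nrmD _ _) _; apply: lt_le_trans dK; rewrite mulrDr.
apply: ltr_leD.
  apply: le_lt_trans (nrmM _ _) _; apply: le_lt_trans (_ : d * nrm y < _).
    by apply: ler_wpM2r; [apply: nrm_ge0|apply: ltW].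
  rewrite ltr_pM2l // /K; move: (nrm_ge0 x); move: (nrm x) (nrm y); move=> u w ?; lra.
apply: le_trans (nrmM _ _) _; rewrite mulrC; apply: ler_pM; rewrite ?nrm_ge0 //; first exact: ltW.
rewrite /K; move: na (nrm_ge0 y); move: (nrm (a)) (nrm x) (nrm y); move=> q u w ? ?; lra.
Qed.

Lemma clos_star P Q x : (forall a, P a -> Q a^#) -> clos P x -> clos Q x^#.
Proof.
move=> PQ hx e /hx[a Pa xa]; exists a^#; first exact: PQ.
by rewrite -cs_starB nrm_star.
Qed.

End ClosMul.

Section EvClosure.
Variables (R : realType) (L : ordinalGraph) (E : cstarAlgebra R) (t : L -> E) (Tt : toeplitz t).

Definition ev_closure : E -> Prop := clos (fun y => exists2 a, wfs a & y = ev t a).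

Lemma ev_closure_closed : closed_subspace ev_closure.
Proof.
apply: clos_subspace.
- by exists [::] => //; rewrite /ev big_nil.
- move=> _ _ [a wa ->] [b wb ->]; exists (a ++ b); last by rewrite ev_cat.
  by move=> p; rewrite mem_cat => /orP[/wa|/wb].
- move=> k _ [a wa ->]; exists [seq (k * p.1, p.2) | p <- a]; last by rewrite ev_scale.
  by move=> _ /mapP[p pa ->]; apply: (wa p pa).
Qed.

Lemma ev_closure_star x : ev_closure x -> ev_closure x^#.
Proof.
apply: clos_star => _ [a wa ->]; exists (fstar a); first exact: wfs_fstar.
by rewrite ev_fstar.
Qed.

Lemma ev_closure_mul x y : ev_closure x -> ev_closure y -> ev_closure (x ** y).
Proof.
apply: clos_mul => _ _ [a wa ->] [b wb ->].
by exists (fmul a b); rewrite ?ev_fmul //; apply: wfs_fmul.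
Qed.

Definition ev_algebra : cstarAlgebra R :=
  subalgebra ev_closure_closed ev_closure_mul ev_closure_star.

Definition ev_in x (hx : ev_closure x) : ev_algebra :=
  sub_in ev_closure_closed ev_closure_mul ev_closure_star hx.

Lemma ev_closure_tt e : ev_closure (tt t e).
Proof.
move=> d d0; exists (tt t e); last by rewrite subrr nrm0.
exists [:: (1, (e, og_s e))].
  by move=> p; rewrite inE => /eqP ->; rewrite /wft /= og_ss.
by rewrite /ev big_seq1 /evt /= scale1r tt_vertex_star // ?tt_src //; apply: og_vertex_s.
Qed.

End EvClosure.

Section Family.
Variables (R : realType) (L : ordinalGraph).

Lemma tt_gen (A : cstarAlgebra R) (T : L -> A) e : toeplitz T -> og_generator e -> tt T e = T e.
Proof. by move=> TT [/(tt_power TT)|/(tt_vertex TT)]. Qed.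

Lemma og_family_hom (A B : cstarAlgebra R) (h : A -> B) (T : L -> A) :
  star_hom h -> og_family T -> og_family (h \o T).
Proof.
move=> hh FT; split=> /=.
- by move=> e ge; rewrite -(sh_star hh) -!(sh_mul hh) (of_partial FT).
- by move=> e ge; rewrite -(sh_star hh) -!(sh_mul hh) (of_source FT).
- by move=> e g ge gg eg d; rewrite -!(sh_mul hh) (of_comp FT).
- by move=> e g ge gg p; rewrite -(sh_star hh) -!(sh_mul hh) (of_disjoint FT) ?sh0.
- move=> v a vv reg; rewrite (of_regular FT vv reg) !(fsbig_finite _ _ reg.2) (sh_sum hh).
  by apply: eq_bigr => e _; rewrite (sh_mul hh) (sh_star hh).
Qed.

Lemma og_family_inj (A B : cstarAlgebra R) (h : A -> B) (T : L -> A) :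
  star_hom h -> injective h -> og_family (h \o T) -> og_family T.
Proof.
move=> hh hi FT; split.
- by move=> e ge; apply: hi; rewrite !(sh_mul hh) (sh_star hh) (of_partial FT).
- by move=> e ge; apply: hi; rewrite !(sh_mul hh) (sh_star hh) (of_source FT).
- by move=> e g ge gg eg d; apply: hi; rewrite !(sh_mul hh) (of_comp FT).
- by move=> e g ge gg p; apply: hi; rewrite !(sh_mul hh) (sh_star hh) (of_disjoint FT) ?sh0.
- move=> v a vv reg; apply: hi; have := of_regular FT vv reg.
  rewrite /= !(fsbig_finite _ _ reg.2) (sh_sum hh) => ->.
  by apply: eq_bigr => e _; rewrite (sh_mul hh) (sh_star hh).
Qed.

Lemma og_family_ext (A : cstarAlgebra R) (T T' : L -> A) :
  (forall e, og_generator e -> T e = T' e) -> og_family T -> og_family T'.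
Proof.
move=> E FT; have gs (e : L) : og_generator (og_s e) by right; apply: og_vertex_s.
split.
- by move=> e ge; rewrite -!E // (of_partial FT).
- by move=> e ge; rewrite -!E // (of_source FT).
- move=> e f ge gf ef d; rewrite -!E ?(of_comp FT) //.
  left; case: gf => [[b db]|/og_d_vertex d0]; last first.
    by exfalso; apply: (@ole_gtF ozero (og_d e)); [case|apply: olt_le_trans d d0.1].
  exists b; apply: oeq_trans (og_dM ef) _; apply: oeq_trans (oadd_oeq (oeqxx _) db) _.
  by apply: oabsorb (olexx _); apply: olt_le_trans d db.1.
- by move=> e g ge gg p; rewrite -!E // (of_disjoint FT).
- move=> v a vv reg; rewrite -E; last by right.
  rewrite (of_regular FT vv reg) !(fsbig_finite _ _ reg.2); apply: eq_fbigr => e.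
  by rewrite in_fset_set ?inE; [move=> -[_ d]; rewrite !E //; left; exists a|apply: reg.2].
Qed.

End Family.

(** * Density and isometry from the universal property *)

Section Universal.
Variables (R : realType) (L : ordinalGraph) (O : cstarAlgebra R) (T : L -> O).
Hypothesis UT : og_algebra T.

Let FT : og_family T := UT.1.
Let TT : toeplitz T := og_family_toeplitz UT.1.

Lemma og_algebra_unique (B : cstarAlgebra R) (p q : O -> B) : star_hom p -> star_hom q ->
  (forall e, og_generator e -> p (T e) = q (T e)) -> p =1 q.
Proof.
move=> hp hq pq x; have [f _ uf] := UT.2 B (p \o T) (og_family_hom hp FT).
by rewrite (uf p) // (uf q) // => e /pq.
Qed.

Lemma og_algebra_neq0 v : og_vertex v -> T v <> 0.
Proof.
move=> vv v0; have [f [hf fE] _] := UT.2 _ _ (bd_op_family R L).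
by case: (bd_op_neq0 (R:=R) vv); rewrite -fE ?v0 ?(sh0 hf) //; right.
Qed.

Section Density.
Variables (B : cstarAlgebra R) (p : O -> B) (hp : star_hom p).

Let graph (x : O) : product O B := pair_in x (p x).
Let graph_hom : star_hom graph.
Proof.
split=> [k x y|x y|x]; apply: product_eq => //=.
- by rewrite (sh_linear hp).
- by rewrite (sh_mul hp).
- by rewrite (sh_star hp).
Qed.
Let t := graph \o T.
Let Tt : toeplitz t. Proof. exact: toeplitz_hom. Qed.
Let G := ev_algebra Tt.
Let t' (e : L) : G := ev_in Tt (ev_closure_tt Tt e).

(** Continuity of [p] has not been established at this point, so [x] and [p x] must be approximated
    by one and the same sum; this is why the graph of [p] is used. *)
Lemma og_algebra_dense x (e : R) : 0 < e ->
  exists2 a, wfs a & nrm (x - ev T a) < e /\ nrm (p x - ev (p \o T) a) < e.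
Proof.
move=> e0; pose val' : G -> product O B := @sub_val _ _ _ _ _ _.
have hv : star_hom val' by apply: sub_val_hom.
have Ft : og_family t by apply: og_family_hom.
have Ft' : og_family t'.
  apply: (og_family_inj (h := val')) => //; first exact: sub_val_inj.
  apply: og_family_ext Ft => g gg; rewrite -[RHS]/(tt t g).
  by rewrite (tt_gen Tt).
have [f [hf fE] _] := UT.2 _ _ Ft'.
have hvf : star_hom (val' \o f).
  split=> [k u w|u w|u] /=; first by rewrite (sh_linear hf) (sh_linear hv).
    by rewrite (sh_mul hf) (sh_mul hv).
  by rewrite (sh_star hf) (sh_star hv).
(* Uniqueness in the universal property identifies the map into the closure with the graph map, so
   the graph lies in the closure. *)
have fx u : val' (f u) = graph u.
  apply: (og_algebra_unique hvf graph_hom) => g gg /=.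
  by rewrite fE // -[LHS]/(tt t g) (tt_gen Tt).
have [_ [a wa ->] xa] := sub_valP (f x) e e0; exists a => //.
rewrite -/val' fx in xa.
have E1 : pfst (ev t a) = ev T a by rewrite -(ev_hom _ (pfst_hom O B) Tt).
have E2 : psnd (ev t a) = ev (p \o T) a by rewrite -(ev_hom _ (psnd_hom O B) Tt).
split; [rewrite -E1|rewrite -E2].
  by apply: le_lt_trans (nrm_pfst _) xa.
by apply: le_lt_trans (nrm_psnd _) xa.
Qed.

Hypothesis SL : og_separating L.

Let Ep : toeplitz (p \o T). Proof. exact: toeplitz_hom. Qed.

Let full_inv (A : cstarAlgebra R) (w : L -> A) : og_invariant w (fun=> True). Proof. by split. Qed.

Let limit_le x : (forall a, wfs a -> nrm (ev (p \o T) a) <= nrm (ev T a)) -> nrm (p x) <= nrm x.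
Proof.
move=> h; apply/ler_addgt0Pl => e e0; have e2 : 0 < e / 2 by rewrite divr_gt0.
have [a wa [xa pa]] := og_algebra_dense x e2.
apply: le_trans (nrm_le_dist _ (ev (p \o T) a)) _.
apply: le_trans (lerD (h a wa) (ltW pa)) _.
apply: le_trans (lerD (nrm_le_dist _ x) (lexx _)) _.
rewrite (nrmBC _ x); move: xa; move: (nrm (x - _)) (nrm x) => u w ?; lra.
Qed.

(** [ev_le] bounds the family [p \o T] by [T], whose vertex projections never vanish;
    [og_algebra_isometric] exchanges the roles. *)
Lemma og_algebra_contractive x : nrm (p x) <= nrm x.
Proof.
apply: limit_le => a wa.
apply: (ev_le SL (og_family_hom hp FT) (J := unit) (E := fun=> O) (pi := fun=> T) (Y := fun=> fun=> True)) => //.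
- by move=> v vv; exists Datatypes.tt, (T v); split=> //; [apply: og_algebra_neq0|rewrite tt_vertex ?(tp_vertex_idem TT)].
- exact: nrm_ge0.
- by move=> _ z _; apply: nrmM.
Qed.

Lemma og_algebra_isometric x : (forall v, og_vertex v -> p (T v) <> 0) -> nrm (p x) = nrm x.
Proof.
move=> pv; apply/le_anti; rewrite og_algebra_contractive /=.
apply/ler_addgt0Pl => e e0; have e2 : 0 < e / 2 by rewrite divr_gt0.
have [a wa [xa pa]] := og_algebra_dense x e2.
have le : nrm (ev T a) <= nrm (ev (p \o T) a).
  apply: (ev_le SL FT (J := unit) (E := fun=> B) (pi := fun=> p \o T) (Y := fun=> fun=> True)) => //.
  - move=> v vv; exists Datatypes.tt, (p (T v)); split=> //; first exact: pv.
    by rewrite tt_vertex // (tp_vertex_idem Ep).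
  - exact: nrm_ge0.
  - by move=> _ z _; apply: nrmM.
apply: le_trans (nrm_le_dist _ (ev T a)) _.
apply: le_trans (lerD le (ltW xa)) _.
apply: le_trans (lerD (nrm_le_dist _ (p x)) (lexx _)) _.
rewrite (nrmBC _ (p x)); move: pa; move: (nrm (p x - _)) (nrm (p x)) => u w ?; lra.
Qed.

Lemma og_algebra_injective : injective p <-> forall v, og_vertex v -> p (T v) <> 0.
Proof.
split=> [ip v vv pv|pv x y pxy].
  by apply: (og_algebra_neq0 vv); apply: ip; rewrite pv (sh0 hp).
apply/subr0_eq/nrm_eq0; rewrite -(og_algebra_isometric _ pv) (shB hp) pxy subrr.
exact: nrm0.
Qed.

End Density.

End Universal.

(** * Square roots *)

Lemma subr_double (V : zmodType) (w b c d : V) :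
  w + w - c - (b + b - d) = (w - b) + (w - b) - (c - d).
Proof.
rewrite !opprB [X in _ = X + _]addrACA -opprD addrACA [RHS]addrACA.
by congr (_ + _); rewrite addrC.
Qed.

Section HalfSqrt.
Variable R : realType.

(** The recursion of [wit] at [e = 1]. It majorises the norms and increments of [wit], whose
    iterates are polynomials in [e] with nonnegative coefficients. *)
Fixpoint sqs (k : nat) : R := if k is k'.+1 then (1 + sqs k' ^+ 2) / 2 else 0.

Lemma sqs_ge0 k : 0 <= sqs k.
Proof. by case: k => //= k; rewrite divr_ge0 // addr_ge0 // sqr_ge0. Qed.

Lemma sqs_le1 k : sqs k <= 1.
Proof.
elim: k => [//|k IH] /=; rewrite ler_pdivrMr // mul1r.
have : sqs k ^+ 2 <= 1 by rewrite expr_le1 // sqs_ge0.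
by move: (sqs k ^+ 2) => u; lra.
Qed.

(** The gap [d = 1 - sqs k] turns into [d - d^2 / 2], which is increasing for [d <= 1] and takes
    [2 / (k + 2)] below [2 / (k + 3)]. *)
Lemma sqs_gap k : 1 - sqs k <= 2 / k.+2%:R.
Proof.
elim: k => [|k IH] /=; first by rewrite subr0 divff.
have E : 1 - (1 + sqs k ^+ 2) / 2 = (1 - sqs k) - (1 - sqs k) ^+ 2 / 2 by field.
rewrite E; move: IH (sqs_le1 k) (sqs_ge0 k); move: (sqs k) => s IH s1 s0.
have n0 : 0 < k%:R + 2 :> R by rewrite ltr_wpDl.
have n3 : 0 < k%:R + 3 :> R by rewrite ltr_wpDl.
rewrite (_ : k.+2%:R = k%:R + 2) in IH; last by rewrite -addn2 natrD.
rewrite (_ : k.+3%:R = k%:R + 3); last by rewrite -addn3 natrD.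
have k0 : 0 <= k%:R :> R by [].
move: k0 n0 n3 IH; move: (k%:R : R) => n n00 n0 n3 IH.
pose d := 2 / (n + 2).
have d1 : d <= 1 by rewrite /d ler_pdivrMr // mul1r; move: n00; clear -n; lra.
have dd : (1 - s) - (1 - s) ^+ 2 / 2 <= d - d ^+ 2 / 2.
  move: IH; rewrite -/d; move: d1 s0 s1; move: d => d d1 s0 s1 IH; nra.
apply: le_trans dd _; rewrite /d ler_pdivlMr //.
have -> : (2 / (n + 2) - (2 / (n + 2)) ^+ 2 / 2) * (n + 3) = 2 * ((n + 1) * (n + 3)) / (n + 2) ^+ 2.
  by field; rewrite gt_eqF.
rewrite ler_pdivrMr ?exprn_gt0 //; rewrite ler_pM2l //; lra.
Qed.

Lemma sqs_cvg (e : R) : 0 < e -> exists k, 1 - sqs k < e.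
Proof.
move=> e0; exists (Num.truncn (2 / e)).
apply: le_lt_trans (sqs_gap _) _; rewrite ltr_pdivrMr // mulrC -ltr_pdivrMr //.
apply: lt_trans (truncnS_gt _) _; by rewrite ltr_nat.
Qed.

Variables (A : cstarAlgebra R) (e : A).
Hypotheses (e1 : nrm e <= 1) (es : e^# = e).

Fixpoint wit (k : nat) : A := if k is k'.+1 then (2^-1)%:C%C *: (e + wit k' ** wit k') else 0.

Let nh (x : A) : nrm ((2^-1)%:C%C *: x) = nrm x / 2.
Proof. by rewrite nrmZ nrmc_real ?invr_ge0 // mulrC. Qed.

Lemma wit_star k : (wit k)^# = wit k.
Proof.
elim: k => [|k IH]; first exact: cs_star0.
by rewrite /= cs_starZ cs_starD cs_starM es IH geC0_conj // ler0c invr_ge0.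
Qed.

Lemma wit_le k : nrm (wit k) <= sqs k.
Proof.
elim: k => [|k IH]; first by rewrite nrm0.
rewrite /= nh ler_wpM2r ?invr_ge0 //; apply: le_trans (nrmD _ _) _; apply: lerD => //.
by apply: le_trans (nrmM _ _) _; rewrite expr2; apply: ler_pM; rewrite ?nrm_ge0.
Qed.

Lemma wit_step k : nrm (wit k.+1 - wit k) <= sqs k.+1 - sqs k.
Proof.
elim: k => [|k IH].
  by rewrite /= subr0 subr0 cs_mul0 addr0 nh expr0n addr0 ler_wpM2r ?invr_ge0.
have -> : wit k.+2 - wit k.+1 = (2^-1)%:C%C *:
    (wit k.+1 ** (wit k.+1 - wit k) + (wit k.+1 - wit k) ** wit k).
  rewrite -[in LHS]/((2^-1)%:C%C *: (e + wit k.+1 ** wit k.+1)).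
  rewrite -[wit k.+1 as X in _ - X]/((2^-1)%:C%C *: (e + wit k ** wit k)).
  rewrite -scalerBr; congr (_ *: _).
  by rewrite cs_mulBr cs_mulBl addrA subrK opprD addrACA subrr add0r.
rewrite nh.
have -> : sqs k.+2 - sqs k.+1 = (sqs k.+1 * (sqs k.+1 - sqs k) + (sqs k.+1 - sqs k) * sqs k) / 2.
  rewrite -[sqs k.+2]/((1 + sqs k.+1 ^+ 2) / 2) -[X in _ - X = _]/((1 + sqs k ^+ 2) / 2).
  by field.
rewrite ler_wpM2r ?invr_ge0 //; apply: le_trans (nrmD _ _) _; apply: lerD;
  by apply: le_trans (nrmM _ _) _; apply: ler_pM; rewrite ?nrm_ge0 // wit_le.
Qed.

Lemma wit_dist k m : (k <= m)%N -> nrm (wit m - wit k) <= sqs m - sqs k.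
Proof.
move=> /subnKC <-; elim: (m - k)%N => [|j IH]; first by rewrite addn0 !subrr nrm0.
rewrite addnS; apply: le_trans (nrm_tri (wit (k + j)) _ _) _.
apply: le_trans (lerD (wit_step _) IH) _.
by rewrite addrA subrK.
Qed.

(* [1 - w] is the positive square root of [1 - e], obtained as the limit of
   power series in [e] with nonnegative coefficients. *)
Lemma half_sqrt : exists w, [/\ w^# = w, w + w - w ** w = e &
  forall d : R, 0 < d -> exists k, nrm (w - wit k) < d /\ 1 - sqs k < d].
Proof.
have /choice[n hn] j : exists k, 1 - sqs k < half_pow R j by apply/sqs_cvg/half_pow_gt0.
have [w hw] : exists w, forall j, nrm (wit (n j) - w) <= half_pow R j.
  apply: fast_cvg => j m jm.
  case: (leqP (n m) (n j)) => h.
    apply: le_trans (wit_dist h) _; apply: le_trans (_ : 1 - sqs (n m) <= _).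
      by rewrite lerD2r sqs_le1.
    by apply: le_trans (ltW (hn m)) _; apply: half_pow_le.
  rewrite nrmBC; apply: le_trans (wit_dist (ltnW h)) _.
  by apply: le_trans (ltW (hn j)); rewrite lerD2r sqs_le1.
have lim d : 0 < d -> exists k, nrm (w - wit k) < d /\ 1 - sqs k < d.
  move=> /half_pow_small[j hj]; exists (n j); split; last exact: lt_trans (hn j) hj.
  by rewrite nrmBC; apply: le_lt_trans (hw j) hj.
exists w; split=> //.
  apply: nrm_small_eq => d d0; have [|k [hk _]] := lim (d / 2); first by rewrite divr_gt0.
  apply: le_trans (nrm_tri (wit k) _ _) _; rewrite -{1}(wit_star k) -cs_starB nrm_star (nrmBC _ w).
  by move: hk; move: (nrm _) => u; lra.
have nw : nrm w <= 2.
  have [k [hk _]] := lim 1 ltr01; apply: le_trans (nrm_le_dist _ (wit k)) _.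
  by apply: lerD; [apply: le_trans (wit_le k) (sqs_le1 k)|apply: ltW].
apply: nrm_small_eq => d d0; have d8 : 0 < d / 8 by rewrite divr_gt0.
have [k [hk sk]] := lim _ d8.
have st : nrm (wit k.+1 - wit k) <= d / 8.
  apply: le_trans (wit_step k) _; apply: le_trans (ltW sk); rewrite lerD2r; exact: sqs_le1.
have eE : e = wit k.+1 + wit k.+1 - wit k ** wit k.
  rewrite -[wit k.+1]/((2^-1)%:C%C *: (e + wit k ** wit k)) -scalerDl -rmorphD /=.
  rewrite (_ : 2^-1 + 2^-1 = 1 :> R); last by field.
  by rewrite scale1r addrK.
have -> : w + w - w ** w - e = (w - wit k.+1) + (w - wit k.+1) - (w ** (w - wit k) + (w - wit k) ** wit k).
  have -> : w ** (w - wit k) + (w - wit k) ** wit k = w ** w - wit k ** wit k.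
    by rewrite cs_mulBr cs_mulBl addrA subrK.
  rewrite [X in _ - X = _]eE; exact: subr_double.
have hk1 : nrm (w - wit k.+1) <= d / 8 + d / 8.
  apply: le_trans (nrm_tri (wit k) _ _) _; apply: lerD; [exact: ltW|by rewrite nrmBC].
apply: le_trans (nrmB _ _) _; apply: le_trans (lerD (nrmD _ _) (nrmD _ _)) _.
have b1 : nrm (w ** (w - wit k)) <= 2 * (d / 8).
  by apply: le_trans (nrmM _ _) _; apply: ler_pM; rewrite ?nrm_ge0 // ltW.
have b2 : nrm ((w - wit k) ** wit k) <= d / 8 * 1.
  apply: le_trans (nrmM _ _) _; apply: ler_pM; rewrite ?nrm_ge0 //; first exact: ltW.
  exact: le_trans (wit_le k) (sqs_le1 k).
move: hk1 b1 b2 d0; move: (nrm (w - wit k.+1)) (nrm (w ** _)) (nrm (_ ** wit k)) => u v x; lra.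
Qed.

End HalfSqrt.

Lemma subr_square_expand (V : zmodType) (a b l p r : V) :
  a + b - (a - l + (b - p - (p - r))) = l + p + p - r.
Proof.
rewrite !opprD !opprK [LHS](AC (2*(2*(2*2))) ((1*3)*(2*5)*(4*6*7*8)))%AC /=.
by rewrite !subrr !add0r.
Qed.

Lemma subrACA (V : zmodType) (a b c d : V) : a - b - (c - d) = a - c - (b - d).
Proof. by rewrite !opprB (AC (2*2) ((1*4)*(3*2)))%AC. Qed.

(** * Extending isometries from dense subspaces *)

Section Extend.
Variables (R : realType) (V W : completeNormedModType R[i]) (P : V -> W -> Prop).
Hypothesis P_lin : forall (k : R[i]) x y x' y', P x y -> P x' y' -> P (k *: x + x') (k *: y + y').
Hypothesis P_iso : forall x y, P x y -> nrm y = nrm x.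
Hypothesis P_dense : forall x (e : R), 0 < e -> exists x' y', P x' y' /\ nrm (x - x') < e.

Definition approx x y := forall e : R, 0 < e ->
  exists x' y', [/\ P x' y', nrm (x - x') < e & nrm (y - y') < e].

Let P_diff x y x' y' : P x y -> P x' y' -> nrm (y' - y) = nrm (x' - x).
Proof.
by move=> h h'; have := P_iso (P_lin (-1) h h'); rewrite !scaleN1r ![- _ + _]addrC.
Qed.

Lemma approx_iso x y : approx x y -> nrm y = nrm x.
Proof.
move=> h; apply/eqP; rewrite -subr_eq0 -normr_le0; apply/ler_addgt0Pl => e e0.
have [|x' [y' [p hx hy]]] := h (e / 2); first by rewrite divr_gt0.
have q := P_iso p.
have h1 := nrm_le_dist y y'; have h2 := nrm_le_dist y' y; have h3 := nrm_le_dist x x'; have h4 := nrm_le_dist x' x.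
rewrite (nrmBC y') in h2; rewrite (nrmBC x') in h4.
rewrite addr0 ler_norml; move: h1 h2 h3 h4 q hx hy.
move: (nrm y) (nrm y') (nrm x) (nrm x') (nrm (x - x')) (nrm (y - y')) => *.
by apply/andP; split; lra.
Qed.

Lemma approx_lin (k : R[i]) x y x' y' : approx x y -> approx x' y' -> approx (k *: x + x') (k *: y + y').
Proof.
move=> h h' e e0; have kp : 0 < nrmc k + 1 by rewrite ltr_wpDl ?nrmc_ge0.
have [|x1 [y1 [p1 hx1 hy1]]] := h (e / (nrmc k + 1) / 2); first by rewrite !divr_gt0.
have [|x2 [y2 [p2 hx2 hy2]]] := h' (e / 2); first by rewrite divr_gt0.
have aux (U : completeNormedModType R[i]) (u u' w w' : U) : nrm (u - u') < e / (nrmc k + 1) / 2 ->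
    nrm (w - w') < e / 2 -> nrm (k *: u + w - (k *: u' + w')) < e.
  move=> a b; rewrite opprD addrACA -scalerBr; apply: le_lt_trans (nrmD _ _) _.
  rewrite nrmZ; have : (nrmc k + 1) * nrm (u - u') <= e / 2.
    by rewrite mulrC -ler_pdivlMr // mulrAC ltW.
  have := nrmc_ge0 k; have := nrm_ge0 (u - u').
  move: b; move: (nrm (w - w')) (nrm (u - u')) (nrmc k) => q1 q2 q3 *; nra.
exists (k *: x1 + x2), (k *: y1 + y2); split; [exact: P_lin|exact: aux|exact: aux].
Qed.

Lemma approx_exists x : exists y, approx x y.
Proof.
have /choice[u hu] n : exists p : V * W, P p.1 p.2 /\ nrm (x - p.1) < half_pow R n.+1.
  by have [x' [y' [p h]]] := P_dense x (half_pow_gt0 R n.+1); exists (x', y').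
have [y hy] : exists y, forall n, nrm ((u n).2 - y) <= half_pow R n.
  apply: fast_cvg => n m nm; rewrite (P_diff (hu m).1 (hu n).1).
  apply: le_trans (nrm_tri x _ _) _; rewrite (nrmBC _ x) -half_powS; apply: lerD.
    exact: ltW (hu n).2.
  by apply: le_trans (ltW (hu m).2) _; apply: half_pow_le.
exists y => e e0; have [n hn] := half_pow_small e0.
exists (u n).1, (u n).2; split; first exact: (hu n).1.
  by apply: lt_trans (hu n).2 (le_lt_trans _ hn); apply: half_pow_le.
by rewrite nrmBC; apply: le_lt_trans (hy n) hn.
Qed.

Lemma approx_uniq x y y' : approx x y -> approx x y' -> y = y'.
Proof.
move=> h h'; apply/esym/subr0_eq/nrm_eq0.
have := approx_iso (approx_lin (-1) h h').
by rewrite !scaleN1r addNr nrm0 addrC.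
Qed.

(** The partial isometry is given as a relation, because a vector has many expressions as a finite
    sum; linearity and [P_iso] make the relation single-valued. *)
Lemma extend_isometry : exists J : V -> W, [/\ linear J, (forall x, nrm (J x) = nrm x) & 
  (forall x y, P x y -> J x = y)].
Proof.
have /choice[J hJ] := approx_exists; exists J; split.
- by move=> k x y; apply: (approx_uniq (hJ _)); apply: approx_lin.
- by move=> x; apply: approx_iso (hJ x).
- move=> x y p; apply: (approx_uniq (hJ x)) => e e0; exists x, y.
  by split=> //; rewrite subrr nrm0.
Qed.

End Extend.

Section IsoRange.
Variables (R : realType) (V W : completeNormedModType R[i]) (f : V -> W).
Hypotheses (fl : linear f) (fi : forall x, nrm (f x) = nrm x).

Lemma iso_sub x y : f (x - y) = f x - f y.
Proof. by have := fl (-1) y x; rewrite !scaleN1r ![- _ + _]addrC. Qed.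

Lemma iso_inj : injective f.
Proof. by move=> x y fxy; apply/subr0_eq/nrm_eq0; rewrite -fi iso_sub fxy subrr nrm0. Qed.

Lemma iso_range_closed : closed_subspace (fun z => exists x, z = f x).
Proof.
have f0 : f 0 = 0 by rewrite -(subrr 0) iso_sub subrr.
split.
- by exists 0.
- by move=> _ _ [x ->] [y ->]; exists (x + y); have := fl 1 x y; rewrite !scale1r.
- by move=> k _ [x ->]; exists (k *: x); have := fl k x 0; rewrite f0 !addr0.
- move=> z hz; have /choice[u hu] n : exists x, nrm (z - f x) < half_pow R n.+1.
    by have [_ [x ->] h] := hz _ (half_pow_gt0 R n.+1); exists x.
  have [x hx] : exists x, forall n, nrm (u n - x) <= half_pow R n.
    apply: fast_cvg => n m nm; rewrite -fi iso_sub; apply: le_trans (nrm_tri z _ _) _.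
    rewrite (nrmBC _ z) -half_powS; apply: lerD; first exact: ltW.
    by apply: le_trans (ltW (hu m)) _; apply: half_pow_le.
  exists x; apply: nrm_small_eq => e /half_pow_small[n hn].
  apply: le_trans (nrm_tri (f (u n.+1)) _ _) _.
  rewrite -iso_sub fi; apply: le_trans (ltW hn); rewrite -half_powS; apply: lerD => //.
  by apply: le_trans (ltW (hu n.+1)) _; apply: half_pow_le.
Qed.

End IsoRange.

(** * Positivity in an isometric representation *)

Section IsoPositive.
Variables (R : realType) (S : choiceType) (A : cstarAlgebra R) (la : A -> l2_ops R S).
Hypotheses (hla : star_hom la) (ila : forall x, nrm (la x) = nrm x).
Local Notation LH := (l2_ops R S).
Local Notation "'N x" := (hn (@l2ip R S) x) (at level 10, x at level 8).
Local Notation ph := (l2_prehilb R S).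

Let id_op : is_op (@l2ip R S) id.
Proof. by split; [exists id|exists 1 => // x; rewrite mul1r]. Qed.

Let one : LH := ops_in ph (@l2_complete R S) id_op.
Let one_star : one^# = one. Proof. by apply: ops_star_uniq. Qed.
Let mul1 x : one ** x = x. Proof. exact: ops_inj. Qed.
Let mulx1 x : x ** one = x. Proof. exact: ops_inj. Qed.

Let la_inj : injective la. Proof. exact: iso_inj (sh_linear hla) ila. Qed.

Lemma ip_star_self (z : LH) h : l2ip h (ops_fun (z^# ** z) h) = ('N (ops_fun z h) ^+ 2)%:C%C.
Proof. by rewrite ops_mulE -(ops_adjP z) -(hn_sq ph). Qed.

(** [1 - w] is a self-adjoint square root of [la c]. The unit need not lie in the closed range of
    [la], but [sqs k - wit e k] does: with [e = 1 - la c] it is a polynomial in [la c] whose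
    constant term cancels, since [sqs] is [wit] at [e = 1]. *)
Let positive_small c z : nrm z <= 1 -> la c = z^# ** z -> cs_positive c.
Proof.
move=> z1 lc; pose e := one - la c.
have es : e^# = e by rewrite /e cs_starB one_star lc cs_starM cs_starK.
have e1 : nrm e <= 1.
  apply: ops_nrm_le => // h; rewrite mul1r -(@ler_pXn2r _ 2) ?nnegrE ?hn_ge0 //.
  pose g := ops_fun z h.
  have zz : ops_fun (la c) h = ops_fun z^# g by rewrite lc.
  have E : 'N (ops_fun e h) ^+ 2 = 'N h ^+ 2 - 'N g ^+ 2 - 'N g ^+ 2 + 'N (ops_fun z^# g) ^+ 2.
    apply: complexI; rewrite rmorphD !rmorphB /= -!(hn_sq ph).
    have -> : ops_fun e h = h - ops_fun z^# g by rewrite -zz.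
    have hu : l2ip h (ops_fun z^# g) = l2ip g g by rewrite -(ops_adjP z).
    have uh : l2ip (ops_fun z^# g) h = l2ip g g by rewrite (ip_J ph h) hu -(ip_J ph).
    by rewrite (ip_B ph) !(ip_BJ ph) hu uh; ring.
  have h1 : 'N (ops_fun z^# g) ^+ 2 <= 'N g ^+ 2.
    rewrite ler_pXn2r ?nnegrE ?hn_ge0 //; apply: le_trans (ops_bound _ _) _.
    by rewrite nrm_star -[leRHS]mul1r ler_wpM2r ?hn_ge0.
  rewrite E; move: h1 (sqr_ge0 ('N g)); move: ('N (ops_fun z^# g) ^+ 2) ('N g ^+ 2) ('N h ^+ 2).
  by move=> *; lra.
have [w [ws we lim]] := half_sqrt e1 es.
have [y yE] : exists y, one - w = la y.
  apply: (clC (iso_range_closed (sh_linear hla) ila)) => d d0.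
  have [k [wk sk]] : exists k, nrm (w - wit e k) < d / 2 /\ 1 - sqs R k < d / 2.
    by apply: lim; rewrite divr_gt0.
  exists ((sqs R k)%:C%C *: one - wit e k).
    elim: {wk sk} k => [|k [y IH]]; first by exists 0; rewrite (sh0 hla) scale0r subr0.
    exists ((2^-1)%:C%C *: (c + (sqs R k)%:C%C *: y + (sqs R k)%:C%C *: y - y ** y)).
    rewrite (shZ hla) (shB hla) !(shD hla) !(shZ hla) (sh_mul hla).
    have wE : wit e k = (sqs R k)%:C%C *: one - la y by rewrite -IH subKr.
    rewrite -[sqs R k.+1]/((1 + sqs R k ^+ 2) / 2) -[wit e k.+1]/((2^-1)%:C%C *: (e + wit e k ** wit e k)).
    rewrite mulrC rmorphM -scalerA -scalerBr; congr (_ *: _).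
    have ww : wit e k ** wit e k = ((sqs R k) ^+ 2)%:C%C *: one - (sqs R k)%:C%C *: la y -
        ((sqs R k)%:C%C *: la y - la y ** la y).
      rewrite wE cs_mulBl !cs_mulBr !cs_scaleAl !cs_scaleAr mul1 mul1 mulx1 scalerA.
      by rewrite expr2 rmorphM.
    rewrite ww /e rmorphD /= scalerDl scale1r; exact: subr_square_expand.
  have -> : one - w - ((sqs R k)%:C%C *: one - wit e k) = (1 - sqs R k)%:C%C *: one - (w - wit e k).
    by rewrite rmorphB scalerBl scale1r; apply: subrACA.
  have n1 : nrm one <= 1 by apply: ops_nrm_le => // h; rewrite mul1r.
  have s0 : 0 <= 1 - sqs R k by rewrite subr_ge0 sqs_le1.
  apply: le_lt_trans (nrmB _ _) _; rewrite nrmZ nrmc_real //.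
  have := ler_wpM2l s0 n1; rewrite mulr1; move: wk sk.
  by move: (nrm (w - _)) (sqs R k) (_ * nrm one) => *; lra.
exists y; apply: la_inj; rewrite (sh_mul hla) (sh_star hla) -yE cs_starB one_star ws.
rewrite cs_mulBl mul1 cs_mulBr mulx1.
by rewrite -[LHS](subKr one) -/e -we -[RHS]addrA -[in RHS]opprD addrA.
Qed.

(** Scaling by [1 / (|z| + 1)] brings [z] into the unit ball. This supplies the positivity of inner
    products on the tensor powers built later. *)
Lemma iso_positive c z : la c = z^# ** z -> cs_positive c.
Proof.
move=> lc; pose r := nrm z + 1; have r0 : 0 < r by rewrite ltr_wpDl ?nrm_ge0.
pose k : R[i] := (r^-1)%:C%C.
have kJ : k^* = k by rewrite geC0_conj // ler0c invr_ge0 ltW.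
have [||y yE] := @positive_small ((k * k) *: c) (k *: z).
- rewrite nrmZ /k nrmc_real; last by rewrite invr_ge0 ltW.
  by rewrite ler_pdivrMl // mulr1 lerDl ler01.
- by rewrite (shZ hla) lc cs_starZ kJ cs_scaleAl cs_scaleAr scalerA.
exists (r%:C%C *: y); have rJ : (r%:C%C)^* = r%:C%C :> R[i] by rewrite geC0_conj // ler0c ltW.
rewrite cs_starZ rJ cs_scaleAl cs_scaleAr -yE !scalerA [X in X *: _](_ : _ = 1) ?scale1r //.
rewrite /k -!rmorphM /= [X in X%:C%C](_ : _ = 1) //.
by field; rewrite gt_eqF.
Qed.

(** On l2 one has [|x h|^2 <= <h, (x^# x + y^# y) h>]. *)
Lemma iso_norm_mono (x y : A) : nrm (x^# ** x) <= nrm (x^# ** x + y^# ** y).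
Proof.
rewrite nrmS -(sqr_sqrtr (nrm_ge0 (_ + _))) ler_pXn2r ?nnegrE ?nrm_ge0 ?sqrtr_ge0 //.
rewrite -ila; apply: ops_nrm_le; last exact: sqrtr_ge0.
move=> h; rewrite -(@ler_pXn2r _ 2) ?nnegrE ?mulr_ge0 ?hn_ge0 ?sqrtr_ge0 // exprMn.
set q := x^# ** x + y^# ** y; rewrite [Num.sqrt (nrm q) ^+ 2]sqr_sqrtr ?nrm_ge0 //; apply: le_trans (_ : 'N (ops_fun (la x) h) ^+ 2 + 'N (ops_fun (la y) h) ^+ 2 <= _).
  by rewrite lerDl sqr_ge0.
rewrite -(@nrmc_real R (_ + _)) ?addr_ge0 ?sqr_ge0 // rmorphD /= -!ip_star_self -(ip_D ph) -ops_addE.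
rewrite -!(sh_star hla) -!(sh_mul hla) -(shD hla) -/q.
apply: le_trans (cauchy_schwarz ph _ _) _; rewrite mulrC expr2 mulrA; apply: ler_wpM2r; first exact: hn_ge0.
by rewrite -(ila q); apply: ops_bound.
Qed.

End IsoPositive.

(** * Hilbert modules and correspondences *)

Lemma subr_complement (V : zmodType) (a p r : V) : a = p + p - r + (a - p - (p - r)).
Proof. by rewrite -(addrA a) -opprD (addrA p) [RHS]addrC subrK. Qed.

Section HilbertModules.
Variables (R : realType) (A : cstarAlgebra R).

Section Module.
Variable X : hilbertModule A.
Implicit Types x y z : X.

Lemma hm_ipD x y z : hm_ip x (y + z) = hm_ip x y + hm_ip x z.
Proof. by have := hm_ip_linear x 1 y z; rewrite !scale1r. Qed.

Lemma hm_ip0 x : hm_ip x 0 = 0.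
Proof. by have := hm_ip_linear x (-1) 0 0; rewrite !scaleN1r !addNr. Qed.

Lemma hm_ipZ (k : R[i]) x y : hm_ip x (k *: y) = k *: hm_ip x y.
Proof. by have := hm_ip_linear x k y 0; rewrite !addr0 hm_ip0 addr0. Qed.

Lemma hm_ipB x y z : hm_ip x (y - z) = hm_ip x y - hm_ip x z.
Proof. by rewrite hm_ipD -scaleN1r hm_ipZ scaleN1r. Qed.

Lemma hm_ipDl x y z : hm_ip (y + z) x = hm_ip y x + hm_ip z x.
Proof. by rewrite -hm_ip_star hm_ipD cs_starD !hm_ip_star. Qed.

Lemma hm_ipZl (k : R[i]) x y : hm_ip (k *: y) x = k^* *: hm_ip y x.
Proof. by rewrite -hm_ip_star hm_ipZ cs_starZ hm_ip_star. Qed.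

Lemma hm_ipBl x y z : hm_ip (y - z) x = hm_ip y x - hm_ip z x.
Proof. by rewrite -hm_ip_star hm_ipB cs_starB !hm_ip_star. Qed.

Lemma hm_ip_actl x y b : hm_ip (hm_act x b) y = b^# ** hm_ip x y.
Proof. by rewrite -hm_ip_star hm_ip_act cs_starM hm_ip_star. Qed.

Lemma hm_nrm x : nrm x ^+ 2 = nrm (hm_ip x x).
Proof. by apply: complexI; rewrite rmorphXn /= -!nrmE hm_norm. Qed.

Lemma hm_eq0 x : hm_ip x x = 0 -> x = 0.
Proof.
move=> x0; apply: nrm_eq0; apply/eqP; rewrite -sqrf_eq0; apply/eqP.
by rewrite hm_nrm x0 nrm0.
Qed.

Lemma hm_nondeg x y : (forall z, hm_ip z x = hm_ip z y) -> x = y.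
Proof. by move=> h; apply/subr0_eq/hm_eq0; rewrite hm_ipB h subrr. Qed.

Lemma hm_ip_suml (I : Type) (s : seq I) (F : I -> X) x :
  hm_ip (\sum_(i <- s) F i) x = \sum_(i <- s) hm_ip (F i) x.
Proof.
elim: s => [|i s IH]; last by rewrite !big_cons hm_ipDl IH.
by rewrite !big_nil -hm_ip_star hm_ip0 cs_star0.
Qed.

Lemma hm_ip_sumr (I : Type) (s : seq I) (F : I -> X) x :
  hm_ip x (\sum_(i <- s) F i) = \sum_(i <- s) hm_ip x (F i).
Proof.
by elim: s => [|i s IH]; rewrite ?big_nil ?hm_ip0 // !big_cons hm_ipD IH.
Qed.

Let polar x y : 4 *: hm_ip x y =
  hm_ip (x + y) (x + y) - hm_ip (x - y) (x - y)
  + ((- 'i)%C *: hm_ip (x + 'i%C *: y) (x + 'i%C *: y) + 'i%C *: hm_ip (x - 'i%C *: y) (x - 'i%C *: y)).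
Proof.
pose C a b c d := a *: hm_ip x x + b *: hm_ip x y + c *: hm_ip y x + d *: hm_ip y y.
have CD a b c d a' b' c' d' : C a b c d + C a' b' c' d' = C (a + a') (b + b') (c + c') (d + d').
  by rewrite /C !scalerDl (addrACA (_ + _)) [X in X + _ = _](addrACA (_ + _)) (addrACA (a *: _)).
have CZ k a b c d : k *: C a b c d = C (k * a) (k * b) (k * c) (k * d).
  by rewrite /C !scalerDr !scalerA.
have CN a b c d : - C a b c d = C (- a) (- b) (- c) (- d).
  by rewrite -scaleN1r CZ !mulN1r.
have F u : hm_ip (x + u *: y) (x + u *: y) = C 1 u u^* (u * u^*).
  rewrite hm_ipD !hm_ipDl !hm_ipZ !hm_ipZl /C scale1r scalerA !addrA; congr (_ + _); exact: addrAC.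
have -> : x + y = x + 1 *: y by rewrite scale1r.
have -> : x - y = x + (- 1) *: y by rewrite scaleN1r.
have -> : x - 'i%C *: y = x + (- 'i)%C *: y by rewrite scaleNr.
rewrite !F CN !CZ !CD.
have -> : 4 *: hm_ip x y = C 0 4 0 0 by rewrite /C !scale0r add0r !addr0.
by congr C; apply/eqP; rewrite eq_complex /=; apply/andP; split; apply/eqP; ring.
Qed.

(** Polarisation in place of the Cauchy-Schwarz inequality: for unit vectors each of the four terms
    is at most [(1 + 1)^2]. The bound serves only for continuity. *)
Lemma hm_ip_bound x y : nrm (hm_ip x y) <= 4 * (nrm x * nrm y).
Proof.
have sum2 (u v : X) : nrm (hm_ip u v) <= (nrm u + nrm v) ^+ 2.
  have n4 : nrm (4 *: hm_ip u v) = 4 * nrm (hm_ip u v).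
    rewrite nrmZ; congr (_ * _); rewrite -[RHS]nrmc_real //; congr nrmc.
    by rewrite rmorph_nat.
  have b (w : X) : nrm w <= nrm u + nrm v -> nrm (hm_ip w w) <= (nrm u + nrm v) ^+ 2.
    by move=> h; rewrite -(hm_nrm w) ler_pXn2r ?nnegrE ?addr_ge0 ?nrm_ge0.
  have ni : nrmc ('i%C : R[i]) = 1 by apply: nrmci.
  have nmi : nrmc ((- 'i)%C : R[i]) = 1 by rewrite -mulN1r nrmcM nrmcN1 ni mul1r.
  have iv : nrm ('i%C *: v) = nrm v by rewrite nrmZ ni mul1r.
  rewrite -(@ler_pM2l _ 4) // -n4 polar.
  apply: le_trans (nrmD _ _) _; apply: le_trans (lerD (nrmB _ _) (nrmD _ _)) _.
  rewrite !nrmZ ni nmi !mul1r.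
  have b1 := b _ (nrmD u v); have b2 := b _ (nrmB u v).
  have b3 : nrm (hm_ip (u + 'i%C *: v) (u + 'i%C *: v)) <= (nrm u + nrm v) ^+ 2.
    by apply: b; apply: le_trans (nrmD _ _) _; rewrite iv.
  have b4 : nrm (hm_ip (u - 'i%C *: v) (u - 'i%C *: v)) <= (nrm u + nrm v) ^+ 2.
    by apply: b; apply: le_trans (nrmB _ _) _; rewrite iv.
  apply: le_trans (lerD (lerD b1 b2) (lerD b3 b4)) _.
  by move: (_ ^+ 2) => q; lra.
have [->|x0] := eqVneq x 0.
  by rewrite -hm_ip_star hm_ip0 cs_star0 !nrm0 mul0r mulr0.
have [->|y0] := eqVneq y 0; first by rewrite hm_ip0 !nrm0 !mulr0.
have pos (u : X) : u != 0 -> 0 < nrm u.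
  by move=> u0; rewrite lt_neqAle nrm_ge0 andbT eq_sym; apply: contra_neq u0; apply: nrm_eq0.
have xp := pos _ x0; have yp := pos _ y0.
have := sum2 ((nrm x)^-1%:C%C *: x) ((nrm y)^-1%:C%C *: y).
rewrite !nrmZ !nrmc_real ?invr_ge0 ?nrm_ge0 // !mulVf ?gt_eqF // hm_ipZ hm_ipZl scalerA nrmZ.
rewrite geC0_conj ?ler0c ?invr_ge0 ?nrm_ge0 // -rmorphM nrmc_real ?mulr_ge0 ?invr_ge0 ?nrm_ge0 //.
rewrite -invfM mulrC ler_pdivrMr ?mulr_gt0 // => h; apply: le_trans h _.
by rewrite [nrm y * _]mulrC ler_pM2r ?mulr_gt0 //; lra.
Qed.

End Module.

Section Corr.
Variable X : correspondence A.
Implicit Types x y z : X.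

Lemma co_act_lin b (k : R[i]) x y : co_act b (k *: x + y) = k *: co_act b x + co_act b y.
Proof.
apply: hm_nondeg => z; rewrite hm_ipD hm_ipZ.
by rewrite -{1 2 3}(cs_starK b) -!co_adj hm_ipD hm_ipZ.
Qed.

Lemma co_act0 b : co_act b (0 : X) = 0.
Proof. by have := co_act_lin b (-1) 0 0; rewrite !scaleN1r !addNr. Qed.

Lemma co_actDr b x y : co_act b (x + y) = co_act b x + co_act b y.
Proof. by have := co_act_lin b 1 x y; rewrite !scale1r. Qed.

Lemma co_act_sum b (I : Type) (s : seq I) (F : I -> X) :
  co_act b (\sum_(i <- s) F i) = \sum_(i <- s) co_act b (F i).
Proof. exact: (big_morph _ (co_actDr b) (co_act0 b)). Qed.

Lemma co_act_hm b x c : co_act b (hm_act x c) = hm_act (co_act b x) c.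
Proof.
apply: hm_nondeg => z; rewrite hm_ip_act.
by rewrite -{1 2}(cs_starK b) -!co_adj hm_ip_act.
Qed.

Lemma co_actBl a b x : co_act (a - b) x = co_act a x - co_act b x.
Proof. by rewrite co_actD -scaleN1r co_actZ scaleN1r. Qed.

Lemma co_actBr b x y : co_act b (x - y) = co_act b x - co_act b y.
Proof. by have := co_act_lin b (-1) y x; rewrite !scaleN1r ![- _ + _]addrC. Qed.

Variables (S : choiceType) (la : A -> l2_ops R S).
Hypotheses (hla : star_hom la) (ila : forall b : A, nrm (la b) = nrm b).

(** For [|c| <= 1] and [e = c^# c], [half_sqrt] gives [1 - e = (1 - w)^2]. Hence
    [<x, x> = <c x, c x> + <z, z>] with [z = x - w x], and [iso_norm_mono] applies. *)
Lemma co_act_bound b x : nrm (co_act b x) <= nrm b * nrm x.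
Proof.
have small c : nrm c <= 1 -> nrm (co_act c x) <= nrm x.
  move=> c1; pose e := c^# ** c.
  have es : e^# = e by rewrite /e cs_starM cs_starK.
  have e1 : nrm e <= 1 by rewrite /e nrmS expr_le1 // nrm_ge0.
  have [w [ws we _]] := half_sqrt e1 es.
  pose z := x - co_act w x.
  have [p pE] := hm_ip_pos (co_act c x); have [q qE] := hm_ip_pos z.
  have E : hm_ip x x = p^# ** p + q^# ** q.
    rewrite -pE -qE /z hm_ipB !hm_ipBl.
    rewrite [hm_ip (co_act w x) x]co_adj [hm_ip (co_act w x) (co_act w x)]co_adj ws -co_actM.
    rewrite [hm_ip (co_act c x) _]co_adj -co_actM -/e -we co_actBl co_actD hm_ipB hm_ipD.
    exact: subr_complement.
  rewrite -(@ler_pXn2r _ 2) ?nnegrE ?nrm_ge0 // !hm_nrm pE E.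
  exact: (iso_norm_mono hla ila).
have [b0|b0] := eqVneq b 0.
  by rewrite b0 -(scale0r (0 : A)) co_actZ !scale0r !nrm0 mul0r.
have bp : 0 < nrm b.
  by rewrite lt_neqAle nrm_ge0 andbT eq_sym; apply: contra_neq b0; apply: nrm_eq0.
have := small ((nrm b)^-1%:C%C *: b); rewrite co_actZ !nrmZ nrmc_real ?invr_ge0 ?nrm_ge0 //.
by rewrite mulVf ?gt_eqF // lexx => /(_ isT); rewrite ler_pdivrMl.
Qed.

End Corr.

End HilbertModules.

(** * Tensor powers inside an isometric representation *)

Lemma contractive_continuous (R : realType) (V W : completeNormedModType R[i]) (f : V -> W) :
  linear f -> (forall x, nrm (f x) <= nrm x) -> continuous f.
Proof.
move=> fl fc x; apply/cvgrPdist_lt => e e0; near=> y.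
have -> : f x - f y = f (x - y).
  by have := fl (-1) y x; rewrite !scaleN1r ![- _ + _]addrC.
rewrite nrmE; apply: le_lt_trans (_ : `|x - y| < e); first by rewrite nrmE lecR.
by near: y; apply: cvgr_dist_lt.
Unshelve. all: by end_near. Qed.

Lemma clos_closed (R : realType) (V : completeNormedModType R[i]) (P : V -> Prop) x :
  closed_subspace P -> clos P x -> P x.
Proof. by move=> cP h; apply: (clC cP). Qed.

Section Representation.
Variables (R : realType) (A E : cstarAlgebra R) (X : correspondence A).
Variables (psi : X -> E) (pi : A -> E) (rep : representation psi pi).
Hypothesis ipi : forall b, nrm (pi b) = nrm b.

Let hpi : star_hom pi := re_pi rep.

Lemma rep_inj : injective pi. Proof. exact: iso_inj (sh_linear hpi) ipi. Qed.

Lemma rep_nrm x : nrm (psi x) = nrm x.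
Proof.
apply/eqP; rewrite -(@eqrXn2 _ 2) ?nrm_ge0 //; apply/eqP.
by rewrite -nrmS (re_ip rep) ipi hm_nrm.
Qed.

End Representation.

Section TensorStep.
Variables (R : realType) (A E : cstarAlgebra R) (X Y : correspondence A).
Variables (Psi : X -> E) (Pi : A -> E) (rep : representation Psi Pi).
Variables (j : Y -> E) (rej : representation j Pi).
Hypothesis iPi : forall b, nrm (Pi b) = nrm b.
Hypothesis posPi : forall c z, Pi c = z^# ** z -> cs_positive c.

Let hPi : star_hom Pi := re_pi rep.
Let Pi_inj : injective Pi := rep_inj rep iPi.

Definition tgen (z : E) := exists l : seq (Y * X), z = \sum_(q <- l) j q.1 ** Psi q.2.

Let cspan : closed_subspace (clos tgen).
Proof.
apply: clos_subspace.
- by exists [::]; rewrite big_nil.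
- by move=> _ _ [l ->] [l' ->]; exists (l ++ l'); rewrite big_cat.
- move=> k _ [l ->]; exists [seq (k *: q.1, q.2) | q <- l].
  rewrite big_map scaler_sumr; apply: eq_bigr => q _ /=.
  have := re_psi rej k q.1 0; rewrite !addr0; have := re_psi rej (-1) 0 0.
  by rewrite !scaleN1r !addNr => ->; rewrite !addr0 => ->; rewrite cs_scaleAl.
Qed.

Let V := cl_space cspan.
Let incl (z : V) : E := proj1_sig (z : clsub cspan).
Let inclP z : clos tgen (incl z). Proof. exact: (clP (z : clsub cspan)). Qed.
Let mk z (h : clos tgen z) : V := clmk cspan h.
Let incl_inj (z w : V) : incl z = incl w -> z = w. Proof. exact: val_inj. Qed.
Let inclD (z w : V) : incl (z + w) = incl z + incl w. Proof. by []. Qed.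
Let inclZ k (z : V) : incl (k *: z) = k *: incl z. Proof. by []. Qed.

Let act_clos z b : clos tgen z -> clos tgen (z ** Pi b).
Proof.
move=> hz; apply: (clos_mul (P := tgen) (Q := fun w => w = Pi b)) hz _.
  move=> _ _ [l ->] ->; exists [seq (q.1, hm_act q.2 b) | q <- l].
  rewrite big_map cs_mul_suml; apply: eq_bigr => q _ /=.
  by rewrite (re_actr rep) cs_mulA.
by move=> e e0; exists (Pi b); rewrite // subrr nrm0.
Qed.

Let lact_clos z b : clos tgen z -> clos tgen (Pi b ** z).
Proof.
move=> hz; apply: (clos_mul (P := fun w => w = Pi b) (Q := tgen)) _ hz.
  move=> _ _ -> [l ->]; exists [seq (co_act b q.1, q.2) | q <- l].
  rewrite big_map cs_mul_sumr; apply: eq_bigr => q _ /=.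
  by rewrite (re_actl rej) cs_mulA.
by move=> e e0; exists (Pi b); rewrite // subrr nrm0.
Qed.

Let ip_exists (z w : V) : exists b, (incl z)^# ** incl w = Pi b.
Proof.
apply: (clos_closed (iso_range_closed (sh_linear hPi) iPi)).
apply: (clos_mul (P := fun u => tgen u^#) (Q := tgen)) (inclP w); last first.
  by apply: clos_star (inclP z) => u; rewrite cs_starK.
move=> u _ [l lE] [l' ->]; rewrite -(cs_starK u) lE.
exists (\sum_(q <- l) \sum_(q' <- l') hm_ip q.2 (co_act (hm_ip q.1 q'.1) q'.2)).
rewrite (sh_sum hPi) cs_star_sum cs_mul_suml; apply: eq_bigr => q _.
rewrite (sh_sum hPi) cs_mul_sumr; apply: eq_bigr => q' _.
rewrite -(re_ip rep) (re_actl rep) -(re_ip rej) cs_starM !cs_mulA.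
by [].
Qed.

Let ip (z w : V) : A := sval (cid (ip_exists z w)).
Let ipE z w : Pi (ip z w) = (incl z)^# ** incl w.
Proof. by rewrite /ip; case: cid. Qed.

Let act (z : V) b : V := mk (act_clos b (inclP z)).
Let actE z b : incl (act z b) = incl z ** Pi b. Proof. by []. Qed.

Let actDl x y b : act (x + y) b = act x b + act y b.
Proof. by apply: incl_inj; rewrite inclD !actE inclD cs_mulDl. Qed.
Let actDr x b c : act x (b + c) = act x b + act x c.
Proof. by apply: incl_inj; rewrite inclD !actE (shD hPi) cs_mulDr. Qed.
Let actZl (k : R[i]) x b : act (k *: x) b = k *: act x b.
Proof. by apply: incl_inj; rewrite inclZ !actE inclZ cs_scaleAl. Qed.
Let actZr (k : R[i]) x b : act x (k *: b) = k *: act x b.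
Proof. by apply: incl_inj; rewrite inclZ !actE (shZ hPi) cs_scaleAr. Qed.
Let actM x b c : act x (b ** c) = act (act x b) c.
Proof. by apply: incl_inj; rewrite !actE (sh_mul hPi) cs_mulA. Qed.
Let ip_lin x : linear (ip x).
Proof. by move=> k y z; apply: Pi_inj; rewrite (sh_linear hPi) !ipE inclD inclZ cs_mulDr cs_scaleAr. Qed.
Let ip_act x y b : ip x (act y b) = ip x y ** b.
Proof. by apply: Pi_inj; rewrite (sh_mul hPi) !ipE actE cs_mulA. Qed.
Let ip_star x y : (ip x y)^# = ip y x.
Proof. by apply: Pi_inj; rewrite (sh_star hPi) !ipE cs_starM cs_starK. Qed.
Let ip_pos x : cs_positive (ip x x). Proof. exact: posPi (ipE x x). Qed.
Let ip_norm (x : V) : `|x| ^+ 2 = `|ip x x|.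
Proof.
by rewrite !nrmE -rmorphXn /=; congr (_%:C%C); rewrite -[nrm (ip x x)]iPi ipE nrmS.
Qed.

Let ZM := HilbertModule actDl actDr actZl actZr actM ip_lin ip_act ip_star ip_pos ip_norm.

Let lact b (z : ZM) : ZM := mk (lact_clos b (inclP z)).
Let lactE b z : incl (lact b z) = Pi b ** incl z. Proof. by []. Qed.
Let lact_adj b (x y : ZM) : hm_ip (lact b x) y = hm_ip x (lact b^# y).
Proof. by apply: Pi_inj; rewrite !ipE !lactE cs_starM (sh_star hPi) cs_mulA. Qed.
Let lactD b c (x : ZM) : lact (b + c) x = lact b x + lact c x.
Proof. by apply: incl_inj; rewrite inclD !lactE (shD hPi) cs_mulDl. Qed.
Let lactZ (k : R[i]) b (x : ZM) : lact (k *: b) x = k *: lact b x.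
Proof. by apply: incl_inj; rewrite inclZ !lactE (shZ hPi) cs_scaleAl. Qed.
Let lactM b c (x : ZM) : lact (b ** c) x = lact b (lact c x).
Proof. by apply: incl_inj; rewrite !lactE (sh_mul hPi) cs_mulA. Qed.

Let Z := Correspondence lact_adj lactD lactZ lactM.

Let t_clos y x : clos tgen (j y ** Psi x).
Proof.
by move=> e e0; exists (j y ** Psi x); rewrite ?subrr ?nrm0 //; exists [:: (y, x)]; rewrite big_seq1.
Qed.

Let t (y : Y) (x : X) : Z := mk (t_clos y x).
Let tE y x : incl (t y x) = j y ** Psi x. Proof. by []. Qed.
Let incl_sum (l : seq (Y * X)) : incl (\sum_(q <- l) t q.1 q.2) = \sum_(q <- l) j q.1 ** Psi q.2.
Proof. by elim: l => [|q l IH]; rewrite ?big_nil // !big_cons inclD IH. Qed.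

Lemma tensor_step : exists (Z : correspondence A) (t : Y -> X -> Z) (i : Z -> E),
  [/\ tensor_product t, representation i Pi & forall y x, i (t y x) = j y ** Psi x].
Proof.
exists Z, t, incl; split=> //; last first.
  by split=> // z w; rewrite -ipE.
split.
- by move=> x k y y'; apply: incl_inj; rewrite inclD inclZ !tE (re_psi rej) cs_mulDl cs_scaleAl.
- by move=> y k x x'; apply: incl_inj; rewrite inclD inclZ !tE (re_psi rep) cs_mulDr cs_scaleAr.
- by move=> y b x; apply: incl_inj; rewrite !tE (re_actr rej) (re_actl rep) cs_mulA.
- move=> y x y' x'; apply: Pi_inj; rewrite ipE !tE -(re_ip rep) (re_actl rep) -(re_ip rej).
  by rewrite cs_starM !cs_mulA.
- by move=> y x b; apply: incl_inj; rewrite actE !tE (re_actr rep) cs_mulA.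
- by move=> b y x; apply: incl_inj; rewrite lactE !tE (re_actl rej) cs_mulA.
- move=> z e e0; have eE : e = (complex.Re e)%:C%C by apply/ge0_ReE/ltW.
  have [|_ [l ->] h] := inclP z (e := complex.Re e); first by rewrite -ltcR -eE.
  exists l; rewrite nrmE eE ltcR; apply: le_lt_trans h.
  by rewrite -incl_sum lexx.
Qed.

End TensorStep.

Section TensorPowers.
Variables (R : realType) (A E O : cstarAlgebra R) (X : correspondence A).
Variables (Psi : X -> E) (Pi : A -> E) (rep : representation Psi Pi).
Hypothesis iPi : forall b, nrm (Pi b) = nrm b.
Hypothesis posPi : forall c z, Pi c = z^# ** z -> cs_positive c.
Variables (p : E -> O) (hp : star_hom p) (cp : forall z, nrm (p z) <= nrm z).
Variables (psi : X -> O) (psiE : forall x, psi x = p (Psi x)).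

Inductive power_word : nat -> E -> Prop :=
| power_word1 x : power_word 1 (Psi x)
| power_wordS n z x : power_word n z -> power_word n.+1 (z ** Psi x).

Lemma power_word_inv n z : power_word n z -> match n with
  | 0 => False | 1 => exists x, z = Psi x
  | k.+2 => exists w x, power_word k.+1 w /\ z = w ** Psi x end.
Proof.
elim=> [x|[|m] w x pw IH //]; first by exists x.
by exists w, x.
Qed.

(** The powers are built inside [E], where [psi^n] becomes the restriction of [p]; [psi] itself is
    not known to be isometric. The last clause turns products formed in [E] into vectors. *)
Lemma tensor_powers n : exists (Z : correspondence A) (psin : Z -> O) (i : Z -> E),
  [/\ tensor_power psi n.+1 psin, representation i Pi, (forall z, psin z = p (i z)) &
    forall z, power_word n.+1 z -> exists y, z = i y].
Proof.
elim: n => [|n [Y [psin [j [tY rj pj wj]]]]].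
  exists X, psi, Psi; split=> //; first exact: tensor_power1.
  by move=> z /power_word_inv.
have [Z [t [i [tZ ri iE]]]] := tensor_step rep rj iPi posPi.
have lp : linear (p \o i) by move=> k x y /=; rewrite (re_psi ri) (sh_linear hp).
exists Z, (p \o i), i; split=> //.
  apply: (tensor_powerS (t := t) tY) => //.
    by apply: contractive_continuous => // z; rewrite -(rep_nrm ri iPi); apply: cp.
  by move=> y x /=; rewrite iE (sh_mul hp) -pj psiE.
move=> z /power_word_inv[w [x [/wj[y ->] ->]]].
by exists (t y x); rewrite iE.
Qed.

End TensorPowers.

(** * The correspondence of a truncation *)

Section Restriction.
Variables (R : realType) (L : ordinalGraph) (b : Ord) (B : cstarAlgebra R) (t : L -> B).
Hypothesis Ft : og_family t.

Lemma trunc_generator (g : trunc L b) : og_generator g -> og_generator (val g).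
Proof. by case=> [[c dc]|/(congr1 val) rg]; [left; exists c|right]. Qed.

(** A vertex that is [c]-source-regular in the truncation has a path of length [ω^c] there, so
    [c < b]. Then all paths of length [ω^c] belong to the truncation, and regularity means the same
    in both graphs. *)
Lemma trunc_family : og_family (fun g : trunc L b => t (val g)).
Proof.
split.
- by move=> e /trunc_generator ge; apply: of_partial Ft _ ge.
- by move=> e /trunc_generator ge; apply: of_source Ft _ ge.
- move=> e f /trunc_generator ge /trunc_generator gf /(congr1 val)/= ef d.
  by rewrite (of_comp Ft ge gf ef d) /= val_trunc_comp.
- move=> e f /trunc_generator ge /trunc_generator gf /og_perpP/og_perp_trunc/og_perpP.
  exact: of_disjoint Ft _ _ ge gf.
- move=> v c vv [sr rf]; have cb : olt c b.
    have dv : olt (og_d v) (oexpw c) by rewrite -vv; apply: ole_lt_trans (og_d1 v).1 (oexpw_gt0 c).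
    have [f [_ df]] := sr v vv dv; apply: oexpw_lt_inv; apply: ole_lt_trans df.2 _.
    exact/asboolP/(valP f).
  have cb' : ole (oexpw c) (oexpw b) by apply/oexpw_mono/oltW.
  have small (e : L) : oeq (og_d e) (oexpw c) -> og_small b e.
    by move=> de; apply/asboolP; apply: ole_lt_trans de.1 (oexpw_lt cb).
  have vv' : og_vertex (val v) by have := congr1 val vv.
  have bij : set_bij (og_paths v c) (og_paths (val v) c) val.
    split; last first.
    - move=> e [re de]; exists (exist _ e (small e de)) => //; split=> //.
      exact: val_inj.
    - by move=> ? ? _ _; apply: val_inj.
    - by move=> g [rg dg]; split=> //; have := congr1 val rg.
  have reg : og_regular c (val v).
    split.
      move=> e re de; have he : og_small b e by apply/asboolP; apply: olt_le_trans de cb'.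
      have [|//|f [rf' df]] := sr (exist _ e he); first exact: val_inj.
      by exists (val f); split=> //; have := congr1 val rf'.
    have [_ _ sur] := bij; exact: sub_finite_set sur (finite_image _ rf).
  by rewrite (of_regular Ft vv' reg) (reindex_fsbig _ _ _ _ bij).
Qed.

End Restriction.

Lemma bounded_eq0 (R : realType) (V W : completeNormedModType R[i]) (f : V -> W) (K : R) x :
  0 <= K -> (forall x y, f (x - y) = f x - f y) -> (forall x, nrm (f x) <= K * nrm x) ->
  (forall e : R, 0 < e -> exists2 y, f y = 0 & nrm (x - y) < e) -> f x = 0.
Proof.
move=> K0 fB fK h; apply: nrm_small_eq => e e0; have K1 : 0 < K + 1 by rewrite ltr_wpDl.
have [|y fy xy] := h (e / (K + 1)); first by rewrite divr_gt0.
rewrite -fy -fB; apply: le_trans (fK _) _.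
rewrite ltr_pdivlMr // in xy; move: xy (nrm_ge0 (x - y)); move: (nrm (x - y)) => u xy u0.
by nra.
Qed.

Lemma representation_actr (R : realType) (A B : cstarAlgebra R) (X : hilbertModule A) (J : X -> B) (la : A -> B) :
  star_hom la -> (forall x y, (J x)^# ** J y = la (hm_ip x y)) ->
  forall x c, J (hm_act x c) = J x ** la c.
Proof.
move=> hla Jip x c; apply/subr0_eq/nrm_eq0/eqP; rewrite -sqrf_eq0 -nrmS.
have h z : (J z)^# ** (J (hm_act x c) - J x ** la c) = 0.
  by rewrite cs_mulBr cs_mulA !Jip hm_ip_act (sh_mul hla) subrr.
by rewrite cs_starB cs_starM cs_mulBl -cs_mulA !h cs_mul0 subrr nrm0.
Qed.

Section XAlphaRep.
Variables (R : realType) (L : ordinalGraph) (SL : og_separating L) (a : Ord).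
Variables (A : cstarAlgebra R) (T : trunc L a -> A) (UT : og_algebra T).
Variables (X : correspondence A) (i : (L -> A) -> X) (xa : xalpha T i).

Let FT : og_family T := UT.1.
Let TT : toeplitz T := og_family_toeplitz UT.1.
Let SLa : og_separating (trunc L a) := @og_separating_trunc L a SL.
Local Notation LH := (l2_ops R (set L)).
Local Notation bd := (bd_op R).
Implicit Types (e f : L) (g : trunc L a).

(** The boundary family of all of [L] is restricted, so that the operators [bd e] with [d(e) = ω^a]
    live in the same algebra and can represent [δ_e]. *)
Lemma trunc_rep : exists la : A -> LH,
  [/\ star_hom la, forall b, nrm (la b) = nrm b & forall g, la (tt T g) = bd (val g)].
Proof.
have [la [hla laE] _] := UT.2 _ _ (trunc_family a (bd_op_family R L)).
exists la; split=> //.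
  move=> b; apply: (og_algebra_isometric UT hla SLa) => v vv.
  rewrite laE; last by right.
  by apply: bd_op_neq0; have := congr1 val vv.
have wd m h y : word T m h y -> la y = bd (val h).
  elim=> [v vv|k e f x pe ef w IH]; first by rewrite laE //; right.
  have {}ef : og_s (val e) = og_r (val f) by have := congr1 val ef.
  by rewrite (sh_mul hla) IH laE ?bd_op_comp ?val_trunc_comp //; left.
by move=> g; have [n w] := ttP TT g; apply: wd w.
Qed.

Let gs f : og_vertex (L := trunc L a) (trunc_s a f). Proof. by apply: val_inj; rewrite /= og_rs. Qed.

Definition pdelta e : X := i (xalpha_delta T e).

Lemma pre_delta e b : oeq (og_d e) (oexpw a) -> xalpha_pre T (fun f => xalpha_delta T e f ** b).
Proof.
move=> de; split.
- by move=> f; rewrite /xalpha_delta; case: eqP => [->//|_]; rewrite cs_0mul.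
- apply: (sub_finite_set (B := [set e])) => // f /=.
  by rewrite /xalpha_delta; case: eqP => // _; rewrite cs_0mul.
- move=> f; rewrite /xalpha_delta; case: eqP => [->|_]; last by rewrite cs_0mul cs_mul0.
  by rewrite cs_mulA (tp_vertex_idem TT).
Qed.

Lemma pre_delta1 e : oeq (og_d e) (oexpw a) -> xalpha_pre T (xalpha_delta T e).
Proof.
move=> de; have := pre_delta (T (trunc_s a e)) de; congr (xalpha_pre T _).
apply/funext => f; rewrite /xalpha_delta; case: eqP => _; last exact: cs_0mul.
by rewrite (tp_vertex_idem TT).
Qed.

Lemma pdelta_src e : oeq (og_d e) (oexpw a) -> hm_act (pdelta e) (T (trunc_s a e)) = pdelta e.
Proof.
move=> de; rewrite /pdelta -(xa_act xa _ (pre_delta1 de)); congr i.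
apply/funext => f; rewrite /xalpha_delta; case: eqP => _; last exact: cs_0mul.
by rewrite (tp_vertex_idem TT).
Qed.

Lemma pdelta_ip e f : oeq (og_d e) (oexpw a) -> oeq (og_d f) (oexpw a) ->
  hm_ip (pdelta e) (pdelta f) = if e == f then T (trunc_s a e) else 0.
Proof.
move=> de df; rewrite /pdelta (xa_ip xa (pre_delta1 de) (pre_delta1 df)).
rewrite -(@fsbig_widen _ _ _ _ [set e]) //; last first.
  by move=> h [_ /= /eqP/negPf he]; rewrite /xalpha_delta he cs_star0 cs_0mul.
rewrite fsbig_set1 /xalpha_delta eqxx; case: eqP => [->|_]; last exact: cs_mul0.
by rewrite (tp_vertex_star TT) // (tp_vertex_idem TT).
Qed.

Lemma pdelta_act g e : oeq (og_d e) (oexpw a) -> 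
  co_act (tt T g) (pdelta e) = if og_s (val g) == og_r e then pdelta (val g • e) else 0.
Proof.
by move=> de; have [h1 h2] := xa_left xa (tt_og_word TT g) de; case: eqP => [/h1|/h2].
Qed.

Definition delta_list (l : seq (L * A)) := {in l, forall q, oeq (og_d q.1) (oexpw a)}.
Definition delta_sum (l : seq (L * A)) : X := \sum_(q <- l) hm_act (pdelta q.1) q.2.

Lemma pre_sum x : xalpha_pre T x -> exists2 l, delta_list l & i x = delta_sum l.
Proof.
move=> px; have /finite_seqP[s sE] := xp_finite px.
have {sE} : forall e, x e <> 0 -> e \in s by move=> e xe; have : [set e | x e <> 0] e by []; rewrite sE.
elim: s x px => [|e s IH] x px xs.
  exists [::] => //; rewrite /delta_sum big_nil.
  have x0 : x = fun=> 0 by apply/funext => e; apply: contrapT => /xs.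
  have := xa_linear xa (-1) px px; rewrite scaleN1r addNr => <-; congr i.
  by rewrite x0; apply/funext => f; rewrite scaler0 addr0.
have [x0|/eqP x0] := eqVneq (x e) 0.
  apply: IH => // f xf; have := xs f xf; rewrite inE => /orP[/eqP fe|//].
  by rewrite fe in xf.
have de := xp_supp px x0.
pose x' f := if f == e then 0 else x f.
have px' : xalpha_pre T x'.
  split.
  - by move=> f; rewrite /x'; case: eqP => // _; apply: xp_supp px _.
  - apply: sub_finite_set (xp_finite px) => f /=; rewrite /x'; case: eqP => // _.
  - by move=> f; rewrite /x'; case: eqP => _; rewrite ?cs_mul0 // (xp_source px).
have [|l hl lE] := IH x' px'.
  move=> f; rewrite /x'; case: eqP => // fe xf; have := xs f xf; rewrite inE => /orP[/eqP//|//].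
exists ((e, x e) :: l); first by move=> q; rewrite inE => /orP[/eqP ->|/hl].
rewrite /delta_sum big_cons /= -/(delta_sum l) -lE /pdelta -(xa_act xa _ (pre_delta1 de)).
rewrite -[X in X + _]scale1r -(xa_linear xa 1 (pre_delta (x e) de) px'); congr i.
apply/funext => f; rewrite scale1r /xalpha_delta /x'; case: eqP => [->|_].
  by rewrite (xp_source px) addr0.
by rewrite cs_0mul add0r.
Qed.

Lemma delta_dense x (d : R) : 0 < d -> exists2 l, delta_list l & nrm (x - delta_sum l) < d.
Proof.
move=> d0; have [|y py] := xa_dense xa x (eps := d%:C%C); first by rewrite ltcR.
by rewrite nrmE ltcR; have [l hl ->] := pre_sum py; exists l.
Qed.

Variables (la : A -> LH) (hla : star_hom la) (ila : forall b, nrm (la b) = nrm b).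
Hypothesis laE : forall g, la (tt T g) = bd (val g).

Definition delta_op (l : seq (L * A)) : LH := \sum_(q <- l) bd q.1 ** la q.2.

Let gen e : oeq (og_d e) (oexpw a) -> og_generator e. Proof. by left; exists a. Qed.

Lemma delta_op_ip l l' : delta_list l -> delta_list l' ->
  (delta_op l)^# ** delta_op l' = la (hm_ip (delta_sum l) (delta_sum l')).
Proof.
move=> hl hl'; rewrite /delta_sum hm_ip_suml (sh_sum hla) cs_star_sum cs_mul_suml.
apply: eq_big_seq => q /hl dq; rewrite hm_ip_sumr (sh_sum hla) cs_mul_sumr.
apply: eq_big_seq => q' /hl' dq'; rewrite hm_ip_act hm_ip_actl pdelta_ip // !(sh_mul hla) (sh_star hla).
rewrite cs_starM -!cs_mulA; congr (_ ** _); rewrite !cs_mulA; congr (_ ** _).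
case: eqP => [<-|ne].
  by rewrite bd_op_source -(tt_vertex TT (gs q.1)) laE.
rewrite (sh0 hla); apply: (of_disjoint (bd_op_family R L)); [exact: gen|exact: gen|].
apply/og_perpP; apply: og_perp_d ne; exact: oeq_trans dq (oeq_sym dq').
Qed.

Lemma delta_rep : exists J : X -> LH, [/\ linear J, forall x, nrm (J x) = nrm x,
  forall x y, (J x)^# ** J y = la (hm_ip x y) &
  forall e, oeq (og_d e) (oexpw a) -> J (pdelta e) = bd e].
Proof.
pose P (x : X) (y : LH) := exists l, [/\ delta_list l, x = delta_sum l & y = delta_op l].
have [|||J [Jl Ji JP]] := @extend_isometry R X LH P.
- move=> k _ _ _ _ [l [hl -> ->]] [l' [hl' -> ->]].
  exists ([seq (q.1, k *: q.2) | q <- l] ++ l'); split.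
  + by move=> q; rewrite mem_cat => /orP[/mapP[r /hl ? ->]|/hl'].
  + rewrite /delta_sum big_cat big_map scaler_sumr; congr (_ + _).
    by apply: eq_bigr => q _; rewrite hm_actZr.
  + rewrite /delta_op big_cat big_map scaler_sumr; congr (_ + _).
    by apply: eq_bigr => q _; rewrite (shZ hla) cs_scaleAr.
- move=> _ _ [l [hl -> ->]]; apply/eqP; rewrite -(@eqrXn2 _ 2) ?nrm_ge0 //; apply/eqP.
  by rewrite -nrmS delta_op_ip // ila hm_nrm.
- move=> x d /(delta_dense x)[l hl xl]; exists (delta_sum l), (delta_op l); split=> //.
  by exists l.
have JB x y : J (x - y) = J x - J y by apply: iso_sub.
have Jpre x y : (J x)^# ** J y = la (hm_ip x y).
  have half l z : delta_list l -> (J (delta_sum l))^# ** J z = la (hm_ip (delta_sum l) z).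
    move=> hl; apply/subr0_eq.
    apply: (@bounded_eq0 _ _ _ (fun z => (J (delta_sum l))^# ** J z - la (hm_ip (delta_sum l) z)) (5 * nrm (delta_sum l))).
    - by rewrite mulr_ge0 ?nrm_ge0.
    - by move=> u v; rewrite JB cs_mulBr hm_ipB (shB hla) subrACA.
    - move=> u; apply: le_trans (nrmB _ _) _; apply: le_trans (lerD (nrmM _ _) (lexx _)) _.
      rewrite ila nrm_star !Ji; apply: le_trans (lerD (lexx _) (hm_ip_bound _ _)) _.
      by rewrite -mulrA; move: (_ * _) => w; lra.
    - move=> d /(delta_dense z)[l' hl' zl]; exists (delta_sum l') => //.
      have -> : J (delta_sum l) = delta_op l by apply: JP; exists l.
      have -> : J (delta_sum l') = delta_op l' by apply: JP; exists l'.
      by rewrite delta_op_ip // subrr.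
  rewrite -[LHS]cs_starK cs_starM cs_starK; apply: (canLR (@cs_starK _ _)).
  rewrite -(sh_star hla) hm_ip_star; apply/subr0_eq.
  apply: (@bounded_eq0 _ _ _ (fun z => (J y)^# ** J z - la (hm_ip y z)) (5 * nrm y)).
  - by rewrite mulr_ge0 ?nrm_ge0.
  - by move=> u v; rewrite JB cs_mulBr hm_ipB (shB hla) subrACA.
  - move=> u; apply: le_trans (nrmB _ _) _; apply: le_trans (lerD (nrmM _ _) (lexx _)) _.
    rewrite ila nrm_star !Ji; apply: le_trans (lerD (lexx _) (hm_ip_bound _ _)) _.
    by rewrite -mulrA; move: (_ * _) => w; lra.
  - move=> d /(delta_dense x)[l hl xl]; exists (delta_sum l) => //.
    have := half l y hl => /(congr1 (@cs_star _ _)).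
    by rewrite cs_starM cs_starK -(sh_star hla) hm_ip_star => ->; rewrite subrr.
exists J; split=> // e de; rewrite -(pdelta_src de).
have -> : hm_act (pdelta e) (T (trunc_s a e)) = delta_sum [:: (e, T (trunc_s a e))].
  by rewrite /delta_sum big_seq1.
rewrite (JP _ (delta_op [:: (e, T (trunc_s a e))])).
  rewrite /delta_op big_seq1 -[q in la q]/(T (trunc_s a e)) -(tt_vertex TT (gs e)) laE -[bd (val _)]/(bd (og_s e)).
  by rewrite bd_op_comp ?og_rs // og_idr.
by exists [:: (e, T (trunc_s a e))]; split=> // q; rewrite inE => /eqP ->.
Qed.

(** The model of [X_a] prescribes only the action of [T_g] on [δ_e]. For the adjoint of [T_g], cut
    [e = e1 e2] with [d(e1) = d(g)]: then [e2] again has length [ω^a], and [e1] equals [g] or is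
    incomparable to it. Density of finite sums in [A] does the rest. *)
Lemma delta_rep_left J : linear J -> (forall x : X, nrm (J x) = nrm x) ->
  (forall x y, (J x)^# ** J y = la (hm_ip x y)) ->
  (forall e, oeq (og_d e) (oexpw a) -> J (pdelta e) = bd e) ->
  forall b x, J (co_act b x) = la b ** J x.
Proof.
move=> Jl Ji Jip Jd.
have JB x y : J (x - y) = J x - J y by apply: iso_sub.
have J0 : J 0 = 0 by rewrite -(subrr 0) JB subrr.
have JD x y : J (x + y) = J x + J y by have := Jl 1 x y; rewrite !scale1r.
have Js (I : Type) (s : seq I) (F : I -> X) : J (\sum_(q <- s) F q) = \sum_(q <- s) J (F q).
  exact: (big_morph _ JD J0).
have Ja := representation_actr hla Jip.
have on_delta b : (forall e, oeq (og_d e) (oexpw a) -> J (co_act b (pdelta e)) = la b ** J (pdelta e)) ->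
    forall x, J (co_act b x) = la b ** J x.
  move=> hb x; apply/subr0_eq.
  apply: (@bounded_eq0 _ _ _ (fun z => J (co_act b z) - la b ** J z) (2 * nrm b)).
  - by rewrite mulr_ge0 ?nrm_ge0.
  - by move=> u v; rewrite co_actBr !JB cs_mulBr subrACA.
  - move=> u; apply: le_trans (nrmB _ _) _; apply: le_trans (lerD (lexx _) (nrmM _ _)) _.
    rewrite ila !Ji; apply: le_trans (lerD (co_act_bound hla ila _ _) (lexx _)) _.
    by rewrite -mulrA; move: (_ * _) => w; lra.
  - move=> d /(delta_dense x)[l hl xl]; exists (delta_sum l) => //.
    apply/eqP; rewrite subr_eq0; apply/eqP; rewrite /delta_sum co_act_sum !Js cs_mul_sumr.
    by apply: eq_big_seq => q /hl dq; rewrite co_act_hm !Ja hb // cs_mulA.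
have h1 g : forall x, J (co_act (tt T g) x) = la (tt T g) ** J x.
  apply: on_delta => e de; rewrite pdelta_act // (Jd e de) laE; case: eqP => ge.
    rewrite Jd ?bd_op_comp //; apply: oeq_trans (og_dM ge) _.
    apply: oeq_trans (oadd_oeq (oeqxx _) de) _; apply: oabsorb (olexx _).
    exact/asboolP/(valP g).
  rewrite J0; have Tb := og_family_toeplitz (bd_op_family R L).
  have vg := og_vertex_s (val g); have vr := og_vertex_r e.
  rewrite -[bd e](_ : bd (og_r e) ** bd e = _); last by rewrite bd_op_comp ?og_sr // og_idl.
  rewrite -[bd (val g)](_ : bd (val g) ** bd (og_s (val g)) = _); last first.
    by rewrite bd_op_comp ?og_rs // og_idr.
  rewrite -cs_mulA [bd (og_s _) ** _]cs_mulA -{1}(tp_vertex_star Tb vg).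
  rewrite (tp_disjoint Tb) ?cs_0mul ?cs_mul0 //; [by right|by right|].
  by apply: og_perp_r; rewrite og_rs og_rr.
have h2 g : forall x, J (co_act (tt T g)^# x) = la (tt T g)^# ** J x.
  apply: on_delta => e de.
  have dg : olt (og_d (val g)) (oexpw a) by apply/asboolP/(valP g).
  have [e1 [e2 [e12 d1 eE]]] := og_split (ole_trans (oltW dg) de.2).
  have he1 : og_small a e1 by apply/asboolP; apply: ole_lt_trans d1.1 dg.
  pose g1 : trunc L a := exist _ e1 he1.
  have e2pos : olt ozero (og_d e2).
    apply: oltNge => h; apply: (@ole_gtF (oexpw a) (og_d e1)).
      apply: ole_trans de.2 _; rewrite eE; apply: ole_trans (og_dM e12).1 _.
      by apply: ole_trans (oadd_monor _ h) (oadd0 _).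
    by apply: ole_lt_trans d1.1 dg.
  have de2 : oeq (og_d e2) (oexpw a).
    have [] // := @oexpw_tail a (og_d e1) (og_d e2) _ e2pos.
    by apply: oeq_trans (oeq_sym (og_dM e12)) _; rewrite -eE.
  have eE' : pdelta e = co_act (tt T g1) (pdelta e2) by rewrite pdelta_act //= e12 eqxx -eE.
  rewrite eE' -co_actM h1 cs_mulA -(sh_mul hla).
  have [<-|ne] := pselect (g = g1); first by rewrite tt_source // h1.
  have gp : og_perp g g1 by apply: og_perp_d ne; apply: oeq_sym d1.
  by rewrite tt_perp // (sh0 hla) cs_0mul -(scale0r (0 : A)) co_actZ scale0r J0.
move=> b x; apply/subr0_eq.
apply: (@bounded_eq0 _ _ _ (fun b => J (co_act b x) - la b ** J x) (2 * nrm x)).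
- by rewrite mulr_ge0 ?nrm_ge0.
- by move=> u v; rewrite co_actBl JB (shB hla) cs_mulBl subrACA.
- move=> u; apply: le_trans (nrmB _ _) _; apply: le_trans (lerD (lexx _) (nrmM _ _)) _.
  rewrite ila !Ji; apply: le_trans (lerD (co_act_bound hla ila _ _) (lexx _)) _.
  by rewrite -mulrA [nrm u * _]mulrC; move: (_ * _) => w; lra.
- have hid : star_hom (@id A) by split.
  move=> d /(og_algebra_dense UT hid b)[c wc [bc _]]; exists (ev T c) => //.
  apply/eqP; rewrite subr_eq0; apply/eqP; rewrite /ev.
  elim: c {wc bc} => [|q c IH].
    by rewrite big_nil (sh0 hla) cs_0mul -(scale0r (0 : A)) co_actZ scale0r J0.
  rewrite big_cons co_actD JD (shD hla) cs_mulDl IH; congr (_ + _).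
  rewrite /evt co_actZ co_actM (shZ hla) (sh_mul hla) cs_scaleAl -cs_mulA -h2 -h1.
  by have := Jl q.1 (co_act (tt T q.2.1) (co_act (tt T q.2.2)^# x)) 0; rewrite J0 !addr0.
Qed.

End XAlphaRep.

Section XAlphaIso.
Variables (R : realType) (L : ordinalGraph) (SL : og_separating L) (a : Ord).
Variables (A : cstarAlgebra R) (T : trunc L a -> A) (UT : og_algebra T).
Variables (X : correspondence A) (i : (L -> A) -> X) (xa : xalpha T i).
Variables (O : cstarAlgebra R) (psi : X -> O) (pi : A -> O) (rep : representation psi pi).

(* [E] is the product of [O] with the operators on the boundary paths of the
   whole graph; the second factor makes the representation isometric. *)
Lemma xalpha_isometric_rep : exists (E : cstarAlgebra R) (Psi : X -> E) (Pi : A -> E) (p : E -> O),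
  [/\ representation Psi Pi, (forall b, nrm (Pi b) = nrm b),
      (forall c z, Pi c = z^# ** z -> cs_positive c), star_hom p &
      (forall z, nrm (p z) <= nrm z) /\ (forall x, psi x = p (Psi x))].
Proof.
have [la [hla ila laE]] := trunc_rep SL UT.
have [J [Jl Ji Jip Jd]] := delta_rep UT xa hla ila laE.
have Ja := representation_actr hla Jip.
have Jleft := delta_rep_left UT xa hla ila laE Jl Ji Jip Jd.
pose E := product (l2_ops R (set L)) O.
exists E, (fun x => pair_in (J x) (psi x)), (fun b => pair_in (la b) (pi b)), (@psnd _ _ _).
have hpi := re_pi rep.
split.
- split.
  + split=> [k x y|x y|x]; apply: product_eq => //=.
    * exact: (sh_linear hla).
    * exact: (sh_linear hpi).
    * exact: (sh_mul hla).
    * exact: (sh_mul hpi).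
    * exact: (sh_star hla).
    * exact: (sh_star hpi).
  + by move=> k x y; apply: product_eq; [apply: Jl|apply: (re_psi rep)].
  + by move=> x y; apply: product_eq; [apply: Jip|apply: (re_ip rep)].
  + by move=> b x; apply: product_eq; [apply: Jleft|apply: (re_actl rep)].
  + by move=> x b; apply: product_eq; [apply: Ja|apply: (re_actr rep)].
- move=> b; rewrite product_nrm -[pfst _]/(la b) -[psnd _]/(pi b) ila max_l //.
  exact: (og_algebra_contractive UT hpi (og_separating_trunc SL)).
- move=> c z /(congr1 (@pfst _ _ _)) h; apply: (iso_positive hla ila (z := pfst z)); exact: h.
- exact: psnd_hom.
- by split=> // z; apply: nrm_psnd.
Qed.

End XAlphaIso.

(** * Tails of a non-returning path *)

Section Tails.
Variables (L : ordinalGraph) (a : Ord) (f : L).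
Implicit Types (x y z g h q u : L).
Local Notation w := (oexpw a).

(* [x] arises from [f] by changing an initial segment of length below [w^a] *)
Definition og_tail_of x : Prop := exists g x2 f1,
  [/\ olt (og_d g) w, olt (og_d f1) w, og_s f1 = og_r x2, f = f1 • x2 &
      og_s g = og_r x2 /\ x = g • x2].

Lemma d_small_comp x y : og_s x = og_r y -> olt (og_d x) w -> olt (og_d y) w -> olt (og_d (x • y)) w.
Proof. by move=> xy hx hy; apply: ole_lt_trans (og_dM xy).1 _; apply: oadd_oexpw. Qed.

Lemma og_tail_of_comp x q : og_tail_of x -> og_s q = og_r x -> olt (og_d q) w -> og_tail_of (q • x).
Proof.
move=> [g [x2 [f1 [dg df fx fE [gx ->]]]]]; rewrite og_rM // => qg dq.
exists (q • g), x2, f1; split=> //; first exact: d_small_comp.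
by rewrite og_sM // -og_compA.
Qed.

(** Depending on which of [q] and the new start [g] is longer, the cut falls into the old tail [x2]
    or into [g]. *)
Lemma og_tail_of_tail q z : og_tail_of (q • z) -> og_s q = og_r z -> olt (og_d q) w -> og_tail_of z.
Proof.
move=> [g [x2 [f1 [dg df fx fE [gx E]]]]] qz dq.
have eq : og_ext q (q • z) by exists z.
have eg : og_ext g (q • z) by exists x2.
case: (og_ext_comparable eq eg) => -[u]; last first.
  move=> gu qE; have uz : og_s u = og_r z by rewrite -qz qE og_sM.
  have x2E : x2 = u • z.
    by apply: (og_cancel gx); rewrite ?og_rM // -E qE og_compA.
  have fu : og_s f1 = og_r u by rewrite fx x2E og_rM.
  have du : olt (og_d u) w.
    by apply: ole_lt_trans dq; rewrite qE; apply: ole_trans (og_dM gu).2; apply: ole_addl.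
  exists (og_r z), z, (f1 • u); split=> //.
  - by apply: ole_lt_trans (og_d1 z).1 _; apply: oexpw_gt0.
  - exact: d_small_comp.
  - by rewrite og_sM.
  - by rewrite fE x2E og_compA.
  - by rewrite og_sr og_idl.
move=> qu gE; have ux : og_s u = og_r x2 by rewrite -gx gE og_sM.
have zE : z = u • x2 by apply: (og_cancel qz); rewrite ?og_rM // E gE og_compA.
exists u, x2, f1; split=> //.
by apply: ole_lt_trans dg; rewrite gE; apply: ole_trans (og_dM qu).2; apply: ole_addl.
Qed.

Lemma og_tail_of_d x : ole w (og_d f) -> og_tail_of x -> oeq (og_d x) (og_d f).
Proof.
move=> wf [g [x2 [f1 [dg df fx fE [gx ->]]]]].
have fd : oeq (og_d f) (oadd (og_d f1) (og_d x2)) by rewrite fE; apply: og_dM.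
have wx : ole w (og_d x2) by apply: (ole_tail df); apply: ole_trans wf fd.1.
apply: oeq_trans (og_dM gx) _; apply: oeq_trans (oabsorb dg wx) _.
by apply: oeq_sym; apply: oeq_trans fd _; exact: oabsorb df wx.
Qed.

Lemma oadd_lt_small m (x y : Ord) : olt x (omul w (ofin m.+1)) -> olt y w -> olt (oadd x y) (omul w (ofin m.+1)).
Proof.
move=> /omul_lt_split[j [r [jm rw xE]]] yw.
apply: ole_lt_trans (oadd_oeq xE (oeqxx y)).1 _; apply: ole_lt_trans (oaddA _ _ _).2 _.
apply: olt_le_trans (oadd_monor_lt _ (oadd_oexpw rw yw)) _.
apply: ole_trans (omulS_ge _ _) _; exact: (@omul_le (oexpw a) j.+1 m.+1 jm).
Qed.

(* If a path of length at least [w^a] leads from one tail of [f] to another,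
   then [f] returns to itself. *)
Lemma nonreturning_tails m x y z h : og_nonreturning a f -> ole (omul w (ofin m.+1)) (og_d f) ->
  og_tail_of x -> og_tail_of z -> og_s h = og_r z -> og_s x = og_r y -> h • z = x • y ->
  ole w (og_d h) -> olt (og_d h) (omul w (ofin m.+1)) -> False.
Proof.
move=> [_ nr] mf Wx [u [x2 [f2 [du df2 fx2 fE2 [ux2 ->]]]]] hz sx E wh hm.
have {Wx} [g1 [x1 [f1 [dg df1 fx1 fE1 [gx1 xE]]]]] := Wx; subst x.
rewrite og_sM // in sx; rewrite og_rM // in hz.
pose h' := h • u.
have h'x2 : og_s h' = og_r x2 by rewrite /h' og_sM.
have E' : h' • x2 = g1 • (x1 • y) by rewrite /h' -og_compA // E og_compA.
have dh' : olt (og_d h') (omul w (ofin m.+1)).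
  by apply: ole_lt_trans (og_dM hz).1 _; apply: oadd_lt_small.
have wh' : ole w (og_d h').
  by apply: ole_trans wh _; apply: ole_trans (og_dM hz).2; apply: ole_addr.
have [c gc h'E] : og_ext g1 h'.
  apply: (@og_ext_le _ g1 h' (h' • x2)); last exact: ole_trans (oltW dg) wh'.
    by rewrite E'; exists (x1 • y); rewrite ?og_rM.
  by exists x2.
have cx2 : og_s c = og_r x2 by rewrite -h'x2 h'E og_sM.
have cE : c • x2 = x1 • y.
  by apply: (@og_cancel _ g1); rewrite ?og_rM // -E' h'E og_compA.
have dc : ole (og_d c) (og_d h').
  by rewrite h'E; apply: ole_trans (og_dM gc).2; apply: ole_addl.
have wc : ole w (og_d c).
  by apply: (ole_tail dg); apply: ole_trans wh' _; rewrite h'E; apply: (og_dM gc).1.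
have f1c : og_s f1 = og_r c by rewrite fx1 -(og_rM sx) -cE og_rM.
have fcd : oeq (og_d (f1 • c)) (og_d c) by apply: oeq_trans (og_dM f1c) _; exact: oabsorb df1 wc.
have sf : og_s f = og_r y by rewrite fE1 og_sM.
have fcx : f1 • c • x2 = f • y by rewrite -og_compA // cE og_compA // -fE1.
have lt : olt (og_d (f1 • c)) (og_d f).
  apply: ole_lt_trans fcd.1 _; apply: ole_lt_trans dc _; exact: olt_le_trans dh' mf.
have [d fcd' fE] : og_ext (f1 • c) f.
  apply: (@og_ext_le _ _ f (f • y)); [|by exists y|exact: oltW].
  by rewrite -fcx; exists x2; rewrite ?og_sM.
(* Here [f = f1 x1 = f2 x2] and [c x2 = x1 y]. So [f1 c] is a proper initial segment of [f] of
   length at least [ω^a], and restarting behind it at the tail [x2] gives [f1 c x2 = f y]. *)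
apply: (nr (og_d (f1 • c)) (og_d f2) (f1 • c) d f2 x2) => //.
- by apply: ole_trans wc fcd.2.
- by split=> //; apply: oeqxx.
- by split=> //; apply: oeqxx.
- by rewrite og_sM.
- by rewrite fcx; exists y.
Qed.

End Tails.

(** * The Toeplitz family generated by a representation of X_alpha *)

Section Extended.
Variables (R : realType) (L : ordinalGraph) (a : Ord).
Variables (A : cstarAlgebra R) (T : trunc L a -> A) (UT : og_algebra T).
Variables (X : correspondence A) (i : (L -> A) -> X) (xa : xalpha T i).
Variables (E : cstarAlgebra R) (Psi : X -> E) (Pi : A -> E) (rep : representation Psi Pi).

Let FT : og_family T := UT.1.
Let TT : toeplitz T := og_family_toeplitz UT.1.
Let hPi : star_hom Pi := re_pi rep.
Local Notation G := (trunc L (osucc a)).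
Local Notation pd := (pdelta T i).
Implicit Types (e f : G) (g h : trunc L a).

Let Psi0 : Psi 0 = 0.
Proof. by have := re_psi rep (-1) 0 0; rewrite !scaleN1r !addNr. Qed.

Lemma og_small_succ (x : L) : og_small a x -> og_small (osucc a) x.
Proof. by move=> /asboolP h; apply/asboolP; apply: olt_le_trans h (oltW (oexpw_ltS a)). Qed.

Definition up g : G := exist _ (val g) (og_small_succ (valP g)).

Lemma up_s g : og_s (up g) = up (og_s g). Proof. exact: val_inj. Qed.
Lemma up_r g : og_r (up g) = up (og_r g). Proof. exact: val_inj. Qed.
Lemma up_comp g h : og_s g = og_r h -> up (g • h) = up g • up h.
Proof.
move=> gh; have vgh : og_s (val g) = og_r (val h) by have := congr1 val gh.
by apply: val_inj; rewrite /= !val_trunc_comp.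
Qed.
Lemma up_perp g h : og_perp (up g) (up h) -> og_perp g h.
Proof. by move=> /og_perp_trunc p; apply/og_perp_trunc. Qed.

(** A generator of the truncation at [a + 1] has length below [ω^a] or exactly [ω^a] ([gen_cases]);
    the first kind goes through [Pi], the second through [Psi]. *)
Definition tG e : E :=
  match pselect (og_small a (val e)) with
  | left h => Pi (T (exist _ (val e) h))
  | right _ => Psi (pd (val e))
  end.

Lemma tG_up g : tG (up g) = Pi (T g).
Proof.
rewrite /tG; case: pselect => [h|]; last by have := valP g.
by congr (Pi (T _)); apply: val_inj.
Qed.

Lemma tG_big e : oeq (og_d (val e)) (oexpw a) -> tG e = Psi (pd (val e)).
Proof.
move=> de; rewrite /tG; case: pselect => // h; have /asboolP h' := h.
by case: (ole_gtF de.2 h').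
Qed.

Lemma gen_cases e : og_generator e ->
  (exists2 g, og_generator g & e = up g) \/ oeq (og_d (val e)) (oexpw a).
Proof.
case=> [[b db]|ve].
  have ba : ole b a.
    apply/olt_osucc; apply: oexpw_lt_inv; apply: ole_lt_trans db.2 _; exact/asboolP/(valP e).
  case: (ole_or_lt a b) => [ab|/oexpw_lt lt]; [right|left].
    by apply: oeq_trans db _; split; apply: oexpw_mono.
  have h : og_small a (val e) by apply/asboolP; apply: ole_lt_trans db.1 lt.
  by exists (exist _ (val e) h); [left; exists b|apply: val_inj].
left; have rv : og_r (val e) = val e by have := congr1 val ve.
have h : og_small a (val e).
  by apply/asboolP; rewrite -rv; apply: ole_lt_trans (og_d1 _).1 (oexpw_gt0 a).
by exists (exist _ (val e) h); [right; apply: val_inj|apply: val_inj].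
Qed.

Let up_small g : olt (og_d (val (up g))) (oexpw a).
Proof. exact/asboolP/(valP g). Qed.

Lemma pdelta_adj0 g (x : L) : oeq (og_d x) (oexpw a) -> og_perp (val g) x -> co_act (tt T g)^# (pd x) = 0.
Proof.
move=> dx px; have dg : olt (og_d (val g)) (oexpw a) by apply/asboolP/(valP g).
have [e1 [e2 [e12 d1 xE]]] := og_split (ole_trans (oltW dg) dx.2).
have he1 : og_small a e1 by apply/asboolP; apply: ole_lt_trans d1.1 dg.
pose g1 : trunc L a := exist _ e1 he1.
have de2 : oeq (og_d e2) (oexpw a).
  have e2pos : olt ozero (og_d e2).
    apply: oltNge => h; apply: (@ole_gtF (oexpw a) (og_d e1)); last exact: ole_lt_trans d1.1 dg.
    apply: ole_trans dx.2 _; rewrite xE; apply: ole_trans (og_dM e12).1 _.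
    by apply: ole_trans (oadd_monor _ h) (oadd0 _).
  have [] // := @oexpw_tail a (og_d e1) (og_d e2) _ e2pos.
  by apply: oeq_trans (oeq_sym (og_dM e12)) _; rewrite -xE.
have -> : pd x = co_act (tt T g1) (pd e2) by rewrite (pdelta_act UT xa) //= e12 eqxx -xE.
rewrite -co_actM tt_perp //; first by rewrite -(scale0r (0 : A)) co_actZ scale0r.
apply: og_perp_d; first exact: oeq_sym d1.
by move=> gE; case: px => + _; apply; rewrite gE xE; exists e2.
Qed.

(** At an [a]-regular vertex relation (iv) would express covariance, which [rep] is not assumed to
    have; hence a Toeplitz family only. *)
Lemma toeplitz_G : toeplitz tG.
Proof.
have src e : og_generator e -> (tG e)^# ** tG e = tG (og_s e).
  case/gen_cases => [[g gg ->]|de].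
    by rewrite up_s !tG_up -(sh_star hPi) -(sh_mul hPi) (of_source FT).
  rewrite (tG_big de) (re_ip rep) (pdelta_ip UT xa) // eqxx.
  by rewrite -(tG_up (trunc_s a (val e))); congr tG; apply: val_inj.
split=> //.
- move=> e ge; rewrite -cs_mulA src //; case: (gen_cases ge) => [[g gg ->]|de].
    by rewrite up_s !tG_up -(sh_mul hPi) -(of_source FT gg) cs_mulA (of_partial FT gg).
  have -> : og_s e = up (trunc_s a (val e)) by apply: val_inj.
  by rewrite tG_up (tG_big de) -(re_actr rep) (pdelta_src UT xa).
- move=> e f ge gf ef d; case: (gen_cases gf) => [[h gh fE]|df].
    case: (gen_cases ge) => [[g gg eE]|de].
      have gh' : og_s g = og_r h by apply: val_inj; move: ef; rewrite eE fE => /(congr1 val).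
      by rewrite eE fE -up_comp // !tG_up -(sh_mul hPi) (of_comp FT) //; move: d; rewrite eE fE.
    exfalso; apply: (@ole_gtF (oexpw a) (og_d (val f))).
      by apply: ole_trans de.2 (oltW d).
    by rewrite fE.
  case: (gen_cases ge) => [[g gg eE]|de].
    rewrite eE tG_up (tG_big df) -(re_actl rep) -(tt_gen TT gg) (pdelta_act UT xa) //.
    have ef' : og_s (val g) = og_r (val f) by move: ef; rewrite eE => /(congr1 val).
    rewrite ef' eqxx tG_big ?val_trunc_comp //.
    apply: oeq_trans (og_dM ef') _; apply: oeq_trans (oadd_oeq (oeqxx _) df) _.
    by apply: oabsorb (olexx _); apply: up_small.
  by case: (ole_gtF (ole_trans df.1 de.2) d).
- have sb g e : og_generator g -> oeq (og_d (val e)) (oexpw a) -> og_perp (up g) e -> (tG (up g))^# ** tG e = 0.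
    move=> gg de p; rewrite tG_up (tG_big de) -(sh_star hPi) -(re_actl rep) -(tt_gen TT gg).
    by rewrite pdelta_adj0 //; have /og_perp_trunc := p.
  move=> e f ge gf p; case: (gen_cases ge) => [[g gg eE]|de]; case: (gen_cases gf) => [[h gh fE]|df].
  + rewrite eE fE !tG_up -(sh_star hPi) -(sh_mul hPi) (tp_disjoint TT) ?(sh0 hPi) //.
    by apply: up_perp; rewrite -eE -fE.
  + by rewrite eE sb // -eE.
  + rewrite fE -[LHS]cs_starK cs_starM cs_starK sb ?cs_star0 // -fE.
    exact: og_perp_sym.
  + rewrite !tG_big // (re_ip rep) (pdelta_ip UT xa) //; case: eqP => [ef|_]; last exact: (sh0 hPi).
    by have := og_perp_irr p; case; apply: val_inj.
Qed.

Lemma tt_up g : tt tG (up g) = Pi (tt T g).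
Proof.
have wd m h y : word T m h y -> tt tG (up h) = Pi y.
  elim=> [v vv|k x z y' px xz w IH].
    by rewrite (tt_vertex toeplitz_G) ?tG_up // /og_vertex up_r vv.
  rewrite up_comp // (tt_comp toeplitz_G) ?up_s ?up_r ?xz // IH (sh_mul hPi).
  by rewrite (tt_power toeplitz_G) ?tG_up.
by have [n w] := ttP TT g; apply: wd w.
Qed.

Lemma tt_big e : oeq (og_d (val e)) (oexpw a) -> tt tG e = Psi (pd (val e)).
Proof. by move=> de; rewrite (tt_power toeplitz_G) ?tG_big //; exists a. Qed.

Lemma tt_tail_src e : tt tG e = tt tG e ** Pi (T (trunc_s a (val e))).
Proof.
rewrite -{1}(tt_src toeplitz_G e); congr (_ ** _).
have -> : og_s e = up (trunc_s a (val e)) by apply: val_inj.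
by rewrite tt_up tt_vertex //; apply: val_inj; rewrite /= og_rs.
Qed.

Lemma power_word_tt n e b : oeq (og_d (val e)) (omul (oexpw a) (ofin n.+1)) ->
  power_word Psi n.+1 (tt tG e ** Pi b).
Proof.
elim: n e b => [|n IH] e b de.
  have de' : oeq (og_d (val e)) (oexpw a) by apply: oeq_trans de (omul1 _).
  by rewrite tt_big // -(re_actr rep); apply: power_word1.
have dS := oeq_trans de (omulS _ _).
have [|e1 [e2 [e12 d1 eE]]] := @og_split G e (omul (oexpw a) (ofin n.+1)).
  by apply: ole_trans (ole_addr _ _) dS.2.
have d2 : oeq (og_d (val e2)) (oexpw a).
  apply: (@oadd_cancel (omul (oexpw a) (ofin n.+1))); apply: oeq_trans _ dS.
  apply: oeq_trans (oadd_oeq (oeq_sym d1) (oeqxx _)) _.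
  by rewrite eE; apply: oeq_sym; apply: og_dM.
rewrite eE (tt_comp toeplitz_G) // -cs_mulA (tt_big d2) -(re_actr rep) tt_tail_src.
exact: power_wordS (IH e1 _ d1).
Qed.

End Extended.

(** * Condition (S) for X_alpha *)

Section Span.
Variables (R : realType) (L : ordinalGraph) (a : Ord) (O : cstarAlgebra R).
Local Notation G := (trunc L (osucc a)).
Local Notation w := (oexpw a).
Variables (t : G -> O) (Tt : toeplitz t).
Implicit Types (e f h q x y z : G).

(** The terms [T_h T_q^#] that occur in [psi^m]: up to short segments, [h] is a product of [m] paths
    of length [ω^a], so its length is at least [ω^a] and below [ω^a (m + 1)]; [q] comes from the
    coefficients. *)
Definition level m (p : G * G) :=
  [/\ ole w (og_d (val p.1)), olt (og_d (val p.1)) (omul w (ofin m.+1)) & olt (og_d (val p.2)) w].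

Lemma levelP m h q : level m (h, q) ->
  [/\ ole w (og_d (val h)), olt (og_d (val h)) (omul w (ofin m.+1)) & olt (og_d (val q)) w].
Proof. by []. Qed.

Definition Sspan m (s : O) := exists2 l : fsum R G, {in l, forall p, level m p.2} & s = ev t l.

Lemma Sspan0 m : Sspan m 0. Proof. by exists [::]; rewrite // /ev big_nil. Qed.

Lemma SspanD m s s' : Sspan m s -> Sspan m s' -> Sspan m (s + s').
Proof.
move=> [l hl ->] [l' hl' ->]; exists (l ++ l'); last by rewrite ev_cat.
by move=> p; rewrite mem_cat => /orP[/hl|/hl'].
Qed.

Lemma SspanZ m (k : R[i]) s : Sspan m s -> Sspan m (k *: s).
Proof.
move=> [l hl ->]; exists [seq (k * p.1, p.2) | p <- l]; last by rewrite ev_scale.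
by move=> _ /mapP[p /hl pl ->].
Qed.

Lemma Sspan_sum m (I : eqType) (s : seq I) (F : I -> O) :
  {in s, forall j, Sspan m (F j)} -> Sspan m (\sum_(j <- s) F j).
Proof.
move=> h; rewrite big_seq; elim/big_rec: _ => [|j u js hu]; first exact: Sspan0.
by apply: SspanD hu; apply: h.
Qed.

Lemma Sspan1 m h q : level m (h, q) -> Sspan m (tt t h ** (tt t q)^#).
Proof.
move=> hq; exists [:: (1, (h, q))]; first by move=> p; rewrite inE => /eqP ->.
by rewrite /ev big_seq1 /evt scale1r.
Qed.

Lemma Sspan_closed m : closed_subspace (clos (Sspan m)).
Proof. by apply: clos_subspace; [apply: Sspan0|apply: SspanD|apply: SspanZ]. Qed.

(** Since [q] is shorter than [h'], the inner product [T_q^# T_h'] vanishes or cancels [q]. The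
    remainder of [h'] is still at least [ω^a] long, and [oadd_lt_mul] adds the two bounds. *)
Lemma Sspan_term m h q h' q' : level m (h, q) -> level 1 (h', q') ->
  Sspan m.+1 ((tt t h ** (tt t q)^#) ** (tt t h' ** (tt t q')^#)).
Proof.
move=> /levelP[wh hm qw] /levelP[wh' hm' qw'].
have [hq|hq] := pselect (og_s h = og_s q); last first.
  rewrite -(tt_src Tt q) cs_starM (tt_vertex_star Tt (og_vertex_s q)) [tt t h ** _]cs_mulA.
  by rewrite (tt_comp0 Tt) ?og_rs // !cs_0mul; apply: Sspan0.
rewrite -cs_mulA [(tt t q)^# ** _]cs_mulA.
have [qh|nqh] := pselect (og_ext q h'); last first.
  suff p : og_perp q h' by rewrite (tt_perp Tt p) cs_0mul cs_mul0; apply: Sspan0.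
  by split=> // /og_ext_d d; apply: (ole_gtF (ole_trans wh' d) qw).
have [z qz hE] := qh; rewrite hE (tt_extl Tt qz) cs_mulA -(tt_comp Tt) ?hq //.
have dh' : oeq (og_d (val h')) (oadd (og_d (val q)) (og_d (val z))) by rewrite hE; apply: (og_dM qz).
have wz : ole w (og_d (val z)) by apply: (ole_tail qw); apply: ole_trans wh' dh'.1.
have hz : oeq (og_d (val (h • z))) (oadd (og_d (val h)) (og_d (val z))).
  by apply: (og_dM (e := h)); rewrite hq.
apply: Sspan1; split=> //=.
  by apply: ole_trans wz _; apply: ole_trans hz.2; apply: ole_addl.
apply: ole_lt_trans hz.1 _; have := @oadd_lt_mul a m 1 _ _ hm wz; rewrite addn1; apply.
by apply: ole_lt_trans hm'; apply: ole_trans dh'.2; apply: ole_addl.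
Qed.

Lemma Sspan_mul m s s' : Sspan m s -> Sspan 1 s' -> Sspan m.+1 (s ** s').
Proof.
move=> [l hl ->] [l' hl' ->]; rewrite /ev cs_mul_suml; apply: Sspan_sum => p /hl lp.
rewrite cs_mul_sumr; apply: Sspan_sum => p' /hl' lp'.
rewrite /evt cs_scaleAl cs_scaleAr; do 2 apply: SspanZ.
by move: lp lp'; case: p.2 p'.2 => [h q] [h' q']; apply: Sspan_term.
Qed.

Variables (f : L) (k : nat) (df : oeq (og_d f) (omul w (ofin k))) (nf : og_nonreturning a f).
Local Notation W x := (og_tail_of a f (val (x : G))).

(** A nonzero product needs [y = q z] and [h z] comparable to [x]. Then [z] is a tail of [f] too,
    and [h], which by [m < k] is shorter than [f], leads from one tail to another against
    [nonreturning_tails]. *)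
Lemma tail_vanish m p x y : (m < k)%N -> level m p -> W x -> W y ->
  (tt t x)^# ** (tt t p.1 ** (tt t p.2)^#) ** tt t y = 0.
Proof.
case: p => h q mk /levelP[wh hm qw] Wx Wy; rewrite -[(h, q).1]/h -[(h, q).2]/q.
have mf : ole (omul w (ofin m.+1)) (og_d f) by apply: ole_trans df.2; apply: omul_le.
have wf : ole w (og_d f).
  by apply: ole_trans mf; apply: ole_trans (omul1 _).2 _; apply: omul_le.
have dy := og_tail_of_d wf Wy; have dx := og_tail_of_d wf Wx.
rewrite -!cs_mulA; have [qy|nqy] := pselect (og_ext q y); last first.
  suff p : og_perp q y by rewrite (tt_perp Tt p) !cs_mul0.
  by split=> // /og_ext_d d; apply: (ole_gtF (ole_trans wf (ole_trans dy.2 d)) qw).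
have [z qz yE] := qy; rewrite yE (tt_extl Tt qz).
have qz' : og_s (val q) = og_r (val z) by have := congr1 val qz.
have Wz : W z by apply: (og_tail_of_tail (q := val q)) => //; move: Wy; rewrite yE val_trunc_comp.
have [hz|hz] := pselect (og_s h = og_r z); last by rewrite (tt_comp0 Tt hz) cs_mul0.
rewrite -(tt_comp Tt hz).
have hz' : og_s (val h) = og_r (val z) by have := congr1 val hz.
have no u : og_s x = og_r u -> h • z = x • u -> False.
  move=> xu /(congr1 val); have xu' : og_s (val x) = og_r (val u) by have := congr1 val xu.
  rewrite !val_trunc_comp // => E.
  exact: (nonreturning_tails nf mf Wx Wz hz' xu' E wh hm).
have [[u xu hzE]|nxh] := pselect (og_ext x (h • z)); first by case: (no u).
have [hx|nhx] := pselect (og_ext (h • z) x); last by rewrite (tt_perp Tt).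
(* If [h z] is a prefix of [x], equality follows from the lengths: the tail [z] is as long as [x].
   The continuation [y] of [nonreturning_tails] is then a vertex. *)
have xE : h • z = x.
  apply: (og_ext_antisym hx); apply: ole_trans dx.1 _.
  apply: ole_trans (og_tail_of_d wf Wz).2 _.
  by apply: ole_trans (og_dM hz).2; apply: ole_addl.
by case: (no (og_s x)); rewrite ?og_rs ?og_idr.
Qed.

Lemma tail_vanish_clos m s x y : (m < k)%N -> W x -> W y -> clos (Sspan m) s ->
  (tt t x)^# ** s ** tt t y = 0.
Proof.
move=> mk Wx Wy hs.
apply: (@bounded_eq0 _ _ _ (fun s => (tt t x)^# ** s ** tt t y) (nrm (tt t x) * nrm (tt t y))).
- by rewrite mulr_ge0 ?nrm_ge0.
- by move=> u v; rewrite cs_mulBr cs_mulBl.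
- move=> u; apply: le_trans (nrmM _ _) _; rewrite mulrAC; apply: ler_wpM2r; first exact: nrm_ge0.
  by apply: le_trans (nrmM _ _) _; rewrite nrm_star.
- move=> e /hs[_ [l hl ->] sl]; exists (ev t l) => //.
  rewrite /ev cs_mul_sumr cs_mul_suml big1_seq // => p /andP[_ /hl lp].
  by rewrite /evt cs_scaleAr cs_scaleAl (tail_vanish mk lp Wx Wy) scaler0.
Qed.

End Span.

(** * Non-returning vectors that compute the norm *)

Section Main.
Variables (R : realType) (L : ordinalGraph) (hS : og_conditionS L) (a : Ord).
Variables (ex : exists e : L, oeq (og_d e) (oexpw a)).
Variables (A : cstarAlgebra R) (T : trunc L a -> A) (UT : og_algebra T).
Variables (X : correspondence A) (i : (L -> A) -> X) (xa : xalpha T i).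
Variables (E : cstarAlgebra R) (Psi : X -> E) (Pi : A -> E) (rep : representation Psi Pi).
Hypothesis iPi : forall b, nrm (Pi b) = nrm b.
Variables (O : cstarAlgebra R) (p : E -> O) (hp : star_hom p).
Hypothesis cp : forall z, nrm (p z) <= nrm z.
Variables (psi : X -> O) (psiE : forall x, psi x = p (Psi x)).

Local Notation G := (trunc L (osucc a)).
Local Notation w := (oexpw a).
Local Notation pd := (pdelta T i).
Let FT : og_family T := UT.1.
Let TT : toeplitz T := og_family_toeplitz UT.1.
Let hPi : star_hom Pi := re_pi rep.
Let SL : og_separating L := og_conditionS_separating hS.
Let SLa : og_separating (trunc L a) := og_separating_trunc SL.

Definition tE : G -> E := tG T i Psi Pi.
Let TE : toeplitz tE := toeplitz_G UT xa rep.
Definition tO : G -> O := p \o tE.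
Let TO : toeplitz tO. Proof. exact: toeplitz_hom. Qed.

Let psiB x y : psi (x - y) = psi x - psi y.
Proof.
by rewrite !psiE -(shB hp); congr p; have := re_psi rep (-1) y x; rewrite !scaleN1r ![- _ + _]addrC.
Qed.

Lemma power_one x : clos (Sspan tO 1) (psi x).
Proof.
have delta_term (e : L) b : oeq (og_d e) w -> clos (Sspan tO 1) (p (Psi (pd e) ** Pi b)).
  move=> de; have he : og_small (osucc a) e.
    by apply/asboolP; apply: ole_lt_trans de.1 (oexpw_ltS a).
  pose e' : G := exist _ e he.
  have -> : Psi (pd e) = tt tE e' by rewrite (tt_big UT xa rep).
  rewrite (sh_mul hp) -(tt_hom hp _ TE).
  apply: (clos_mul (P := fun u => u = tt tO e') (Q := fun u => exists2 c, wfs c & u = p (Pi (ev T c)))).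
  - move=> _ _ -> [c wc ->].
    rewrite -(ev_hom c hPi TT) /ev (sh_sum hp) cs_mul_sumr; apply: Sspan_sum => q _.
    rewrite /evt (shZ hp) cs_scaleAr; apply: SspanZ.
    rewrite !(tt_hom hPi _ TT) -!(tt_up UT xa rep) (sh_mul hp) (sh_star hp) -!(tt_hom hp _ TE) cs_mulA.
    have [eq|ne] := pselect (og_s e' = og_r (up q.2.1)); last first.
      by rewrite (tt_comp0 TO ne) cs_0mul; apply: Sspan0.
    rewrite -(tt_comp TO eq); apply: Sspan1; split.
    + by apply: ole_trans de.2 _; apply: ole_trans (og_dM eq).2; apply: ole_addr.
    + apply: ole_lt_trans (og_dM eq).1 _.
      have sm : olt (og_d (val q.2.1)) w by apply/asboolP/(valP q.2.1).
      apply: olt_le_trans (oadd_monor_lt _ sm) _.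
      apply: ole_trans (oadd_monol _ de.1) _; apply: ole_trans (omulS w 1).2.
      exact: oadd_monol (omul1 _).2.
    + exact/asboolP/(valP q.2.2).
  - by move=> d d0; exists (tt tO e'); rewrite ?subrr ?nrm0.
  - have hid : star_hom (@id A) by split.
    move=> d /(og_algebra_dense UT hid b)[c wc [bc _]]; exists (p (Pi (ev T c))); first by exists c.
    by rewrite -(shB hp) -(shB hPi); apply: le_lt_trans (cp _) _; rewrite iPi.
apply: (clC (Sspan_closed tO 1)) => d /(delta_dense UT xa x)[l hl xl]; exists (psi (delta_sum T i l)); last first.
  by rewrite -psiB psiE; apply: le_lt_trans (cp _) _; rewrite (rep_nrm rep iPi).
have PsiD u v : Psi (u + v) = Psi u + Psi v by have := re_psi rep 1 u v; rewrite !scale1r.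
have Psi0 : Psi 0 = 0 by have := re_psi rep (-1) 0 0; rewrite !scaleN1r !addNr.
rewrite psiE /delta_sum (big_morph _ PsiD Psi0) (sh_sum hp).
elim: l hl {xl} => [|q l IH] hl; first by rewrite big_nil; apply: cl0 (Sspan_closed _ _).
rewrite big_cons; apply: (clD (Sspan_closed tO 1)).
  by rewrite (re_actr rep); apply: delta_term; apply: hl; rewrite mem_head.
by apply: IH => r rl; apply: hl; rewrite inE rl orbT.
Qed.

(** Proved for every model of the tensor power, since [nonreturning_vector] quantifies over all of
    them. *)
Lemma power_clos m (Z : correspondence A) (psim : Z -> O) :
  tensor_power psi m psim -> forall z, clos (Sspan tO m) (psim z).
Proof.
elim=> [|n Y Z1 t psin psiSn _ IH tp lin cont tE1 z]; first exact: power_one.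
have psiSB u v : psiSn (u - v) = psiSn u - psiSn v.
  by have := lin (-1) v u; rewrite !scaleN1r ![- _ + _]addrC.
apply: (clC (Sspan_closed tO n.+1)) => d d0.
have /cvgrPdist_lt/(_ d%:C%C) := cont z; rewrite ltcR => /(_ d0)/nbhs_ballP[r r0 hr].
have [l zl] := tp_dense tp z r0.
exists (psiSn (\sum_(q <- l) t q.1 q.2)); last first.
  by rewrite -ltcR -nrmE; apply: hr; rewrite -ball_normE.
have psiD u v : psiSn (u + v) = psiSn u + psiSn v by have := lin 1 u v; rewrite !scale1r.
have psi0 : psiSn 0 = 0 by have := lin (-1) 0 0; rewrite !scaleN1r !addNr.
rewrite (big_morph _ psiD psi0); elim: l {zl} => [|q l IHl].
  by rewrite big_nil; apply: cl0 (Sspan_closed _ _).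
rewrite big_cons; apply: (clD (Sspan_closed tO n.+1)) => //.
rewrite tE1; apply: (clos_mul (P := Sspan tO n) (Q := Sspan tO 1)) => //.
  by move=> u v; apply: Sspan_mul.
exact: power_one.
Qed.

Section Vectors.
Variables (f : L) (k : nat) (df : oeq (og_d f) (omul w (ofin k.+1))) (nf : og_nonreturning a f).
Local Notation W x := (og_tail_of a f (val (x : G))).

Definition tail_vector (z : E) := exists2 l : seq (G * A), {in l, forall q, W q.1} &
  z = \sum_(q <- l) tt tE q.1 ** Pi q.2.

Let wf : ole w (og_d f).
Proof. by apply: ole_trans df.2; apply: ole_trans (omul1 _).2 _; apply: omul_le. Qed.

Let tail0 : tail_vector 0. Proof. by exists [::]; rewrite ?big_nil. Qed.

Let tailD x y : tail_vector x -> tail_vector y -> tail_vector (x + y).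
Proof.
move=> [l hl ->] [l' hl' ->]; exists (l ++ l'); last by rewrite big_cat.
by move=> q; rewrite mem_cat => /orP[/hl|/hl'].
Qed.

Lemma tail_vector1 (x : G) b : W x -> tail_vector (tt tE x ** Pi b).
Proof. by move=> Wx; exists [:: (x, b)]; rewrite ?big_seq1 // => q; rewrite inE => /eqP ->. Qed.

Let tail_act (c : E) x : (forall (y : G) b, W y -> tail_vector (c ** (tt tE y ** Pi b))) ->
  tail_vector x -> tail_vector (c ** x).
Proof.
move=> h [l hl ->]; rewrite cs_mul_sumr big_seq; elim/big_rec: _ => [|q u ql hu]; first exact: tail0.
by apply: tailD hu; apply: h; apply: hl.
Qed.

(** Short paths can be prepended to tails and removed from them; and as [g] is shorter than a tail
    [y], it is a prefix of [y] or incomparable to it. *)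
Lemma tail_invariant : og_invariant (Pi \o T) tail_vector.
Proof.
split=> //.
- move=> c _ [l hl ->]; exists [seq (q.1, c *: q.2) | q <- l].
    by move=> _ /mapP[q /hl Wq ->].
  rewrite big_map scaler_sumr; apply: eq_bigr => q _.
  by rewrite (shZ hPi) cs_scaleAr.
- move=> g x Yx; rewrite (tt_hom hPi _ TT) -(tt_up UT xa rep).
  apply: tail_act Yx => y b Wy; rewrite cs_mulA.
  have [gy|gy] := pselect (og_s (up g) = og_r y); last by rewrite (tt_comp0 TE gy) cs_0mul.
  rewrite -(tt_comp TE gy); apply: tail_vector1; rewrite val_trunc_comp; last by have := congr1 val gy.
  apply: og_tail_of_comp => //; first by have := congr1 val gy.
  exact/asboolP/(valP g).
- move=> g x Yx; rewrite (tt_hom hPi _ TT) -(tt_up UT xa rep).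
  apply: tail_act Yx => y b Wy; rewrite cs_mulA.
  have sg : olt (og_d (val g)) w by apply/asboolP/(valP g).
  have [[z gz yE]|ngy] := pselect (og_ext (up g) y).
    rewrite yE (tt_extl TE gz); apply: tail_vector1.
    have gz' : og_s (val g) = og_r (val z) by have := congr1 val gz.
    by apply: (og_tail_of_tail (q := val g)) => //; move: Wy; rewrite yE val_trunc_comp.
  suff py : og_perp (up g) y by rewrite (tt_perp TE py) cs_0mul.
  split=> // /og_ext_d d; apply: (ole_gtF _ sg).
  by apply: ole_trans wf _; apply: ole_trans (og_tail_of_d wf Wy).2 d.
Qed.

Lemma tail_word (x : G) : W x -> forall b, power_word Psi k.+1 (tt tE x ** Pi b).
Proof.
move=> Wx b; apply: (power_word_tt UT xa rep).
exact: oeq_trans (og_tail_of_d wf Wx) df.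
Qed.

Lemma tail_range (Z : correspondence A) (j : Z -> E) z : representation j Pi ->
  (forall z, power_word Psi k.+1 z -> exists y, z = j y) -> tail_vector z -> exists y, z = j y.
Proof.
move=> rj hj [l hl ->]; rewrite big_seq; elim/big_rec: _ => [|q u ql [y ->]].
  by exists 0; have := re_psi rj (-1) 0 0; rewrite !scaleN1r !addNr.
have [y' ->] := hj _ (tail_word (hl q ql) q.2).
by exists (y' + y); have := re_psi rj 1 y' y; rewrite !scale1r.
Qed.

Lemma tail_nonreturning (Z : correspondence A) (psin : Z -> O) (j : Z -> E) y :
  (forall z, psin z = p (j z)) -> tail_vector (j y) -> nonreturning_vector psi k.+1 psin y.
Proof.
move=> pj [l hl jE] m Y psim u /andP[_ mk] tm; rewrite pj jE.
have hu := power_clos tm u.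
rewrite (sh_sum hp) cs_star_sum cs_mul_suml cs_mul_suml big1_seq // => q /andP[_ /hl Wq].
rewrite cs_mul_sumr big1_seq // => r /andP[_ /hl Wr].
rewrite !(sh_mul hp) cs_starM -!(tt_hom hp _ TE) !cs_mulA.
rewrite -!(cs_mulA (p (Pi q.2))^#) (tail_vanish_clos TO df nf mk Wq Wr hu).
by rewrite cs_0mul cs_mul0.
Qed.

End Vectors.

(** Fullness joins [v] by a short path [g] to a tail [e2] of [f]. The vector is [T_(g e2)], nonzero
    because its source projection is. *)
Lemma full_vector (f : L) (v : trunc L a) : (og_d f < oexpw (osucc a))%Ord -> og_full a f ->
  og_vertex v -> og_connected v (trunc_r a f) ->
  exists z, [/\ tail_vector f z, z <> 0 & tt (Pi \o T) v ** z = z].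
Proof.
move=> df ff vv /(ff v vv)[b [e1 [e2 [g [bw [e12 d1 fE] gs gr]]]]].
have dg : olt (og_d (val g)) w by apply/asboolP/(valP g).
have ge : og_s (val g) = og_r e2 by have := congr1 val gs; rewrite /= => ->.
have he : og_small (osucc a) (val g • e2).
  apply/asboolP; apply: ole_lt_trans (og_dM ge).1 _; apply: oadd_oexpw.
    exact: olt_le_trans dg (oltW (oexpw_ltS a)).
  apply: ole_lt_trans df; rewrite fE; apply: ole_trans (og_dM e12).2; exact: ole_addl.
pose x : G := exist (fun y : L => og_small (osucc a) y) (val g • e2) he.
have Wx : og_tail_of a f (val x).
  exists (val g), e2, e1; split=> //.
  exact: ole_lt_trans d1.1 bw.
exists (tt tE x ** Pi (T (trunc_s a (val x)))); rewrite -(tt_tail_src UT xa rep); split.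
- by rewrite (tt_tail_src UT xa rep); apply: tail_vector1.
- move=> x0; have := tt_source TE x; rewrite /tE x0 cs_mul0.
  have -> : og_s x = up (trunc_s a (val x)) by apply: val_inj.
  have vs : og_vertex (L := trunc L a) (trunc_s a (val x)) by apply: val_inj; rewrite /= og_rs.
  rewrite (tt_up UT xa rep) tt_vertex // => /esym T0.
  apply: (og_algebra_neq0 UT vs); apply: (rep_inj rep iPi).
  by rewrite T0 (sh0 hPi).
- have -> : v = og_r g by rewrite gr.
  rewrite (tt_hom hPi _ TT) -(tt_up UT xa rep).
  have -> : up (og_r g) = og_r x by apply: val_inj; rewrite /= og_rM.
  exact: tt_rng.
Qed.

Lemma good_paths (N : nat) : exists F : trunc L a -> L, forall v : trunc L a,
  [/\ og_nonreturning a (F v), og_full a (F v), og_connected v (trunc_r a (F v)),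
      ole (omul w (ofin N)) (og_d (F v)) & olt (og_d (F v)) (oexpw (osucc a))].
Proof.
have /choice[F hF] (v : trunc L a) : exists f : L, [/\ og_nonreturning a f, og_full a f,
    og_connected v (trunc_r a f), ole (omul w (ofin N)) (og_d f) & olt (og_d f) (oexpw (osucc a))].
  have cv : og_component (og_connected v) by exists v.
  have [f fP] := hS ex cv N; by exists f.
by exists F.
Qed.

Lemma tail_length (f : L) N : og_nonreturning a f -> ole (omul w (ofin N.+1)) (og_d f) ->
  exists2 k, (N <= k)%N & oeq (og_d f) (omul w (ofin k.+1)).
Proof.
move=> [[k dk] _] Nf; have : (N < k)%N.
  rewrite ltnNge; apply/negP => kN; apply: (ole_gtF (ole_trans Nf dk.1)).
  by apply: omul_lt_mono; rewrite ltnS.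
by case: k dk => // k dk Nk; exists k.
Qed.

(** If [|Pi y z|^2 <= r |z|^2] held for all tail vectors, [ev_le], with one invariant set for each
    chosen path, would give [|y|^2 <= r]. The sets of all components are used together, since the
    tails of one path reach only the vertices of its own component. *)
Lemma norming_vector (y : A) N (r : R) : r < nrm y ^+ 2 -> exists f z,
  [/\ og_nonreturning a f, ole (omul w (ofin N.+1)) (og_d f), tail_vector f z, z <> 0 &
      r * nrm z ^+ 2 < nrm (Pi y ** z) ^+ 2].
Proof.
(* Length at least [ω^a (N + 1)], so that the vectors belong to a tensor power of order above
   [N]. *)
move=> ry; have [F hF] := good_paths N.+1.
have nonv v : og_vertex v ->
    exists z, [/\ tail_vector (F v) z, z <> 0 & tt (Pi \o T) v ** z = z].
  by move=> vv; have [_ ff cv _ dv] := hF v; apply: full_vector.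
(* For negative [r] any nonzero tail vector will do; the path of length [ω^a] provides a vertex to
   find one. *)
have [r0|r0] := ltP r 0.
  have [e de] := ex; have vv : og_vertex (L := trunc L a) (trunc_r a e) by apply: val_inj; rewrite /= og_rr.
  have [z [Yz z0 _]] := nonv _ vv; have [nf _ _ Nf _] := hF (trunc_r a e).
  exists (F (trunc_r a e)), z; split=> //.
  apply: lt_le_trans (sqr_ge0 _); rewrite pmulr_llt0 // exprn_gt0 //.
  by rewrite lt_neqAle nrm_ge0 andbT eq_sym; apply/eqP => /nrm_eq0.
apply: contrapT => no; pose th := Num.sqrt r.
have th0 : 0 <= th by apply: sqrtr_ge0.
have bnd v z : tail_vector (F v) z -> nrm (Pi y ** z) <= th * nrm z.
  move=> Yz; have [->|z0] := pselect (z = 0); first by rewrite cs_mul0 !nrm0 mulr0.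
  rewrite leNgt; apply/negP => lt; apply: no; have [nf _ _ Nf _] := hF v.
  exists (F v), z; split=> //; rewrite -[r](sqr_sqrtr r0) -exprMn.
  by rewrite ltr_pXn2r // nnegrE ?nrm_ge0 // mulr_ge0 ?nrm_ge0.
suff : nrm y <= th.
  rewrite leNgt => /negP; apply; rewrite -(@ltr_pXn2r _ 2) ?nnegrE ?nrm_ge0 //.
  by rewrite sqr_sqrtr.
apply/ler_addgt0Pl => d d0; have d2 : 0 < d / 2 by rewrite divr_gt0.
have hid : star_hom (@id A) by split.
have [c wc [yc _]] := og_algebra_dense UT hid y d2.
have le : nrm (ev T c) <= th + d / 2.
  apply: (ev_le SLa FT (J := trunc L a) (E := fun=> E) (pi := fun=> Pi \o T) (Y := fun v => tail_vector (F v))) => //.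
  - by move=> _; apply: toeplitz_hom.
  - move=> v; have [nf _ _ Nf _] := hF v; have [k _ df] := tail_length nf Nf.
    exact: tail_invariant df.
  - by move=> v vv; have [z [? ? ?]] := nonv v vv; exists v, z.
  - by rewrite addr_ge0 // ltW.
  - move=> v z Yz; rewrite (ev_hom c hPi TT).
    apply: le_trans (nrm_le_dist _ (Pi y ** z)) _; rewrite mulrDl; apply: lerD (bnd v z Yz) _.
    rewrite -cs_mulBl; apply: le_trans (nrmM _ _) _; apply: ler_wpM2r; first exact: nrm_ge0.
    by rewrite -(shB hPi) iPi nrmBC ltW.
apply: le_trans (nrm_le_dist _ (ev T c)) _; apply: le_trans (lerD le (ltW yc)) _.
by rewrite -addrA -splitr addrC.
Qed.

Hypothesis posPi : forall c z, Pi c = z^# ** z -> cs_positive c.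

(** The tail vector is normalised and read as a vector [z] of the tensor power of order [k + 1];
    under [Pi] the element [<z, y^# y z>] becomes a product of the form [u^# u] with
    [u = Pi y z]. *)
Lemma xalpha_vector (y : A) N (r : R) : r < nrm (y^# ** y) ->
  exists (m : nat) (Z : correspondence A) (psim : Z -> O) (z : Z),
    [/\ (N < m)%N, tensor_power psi m psim, nonreturning_vector psi m psim z,
        nrm z = 1 & r < nrm (hm_ip z (co_act (y^# ** y) z))].
Proof.
rewrite nrmS => ry; have [f [u [nf Nf Yu u0 lt]]] := norming_vector N ry.
have [k Nk df] := tail_length nf Nf.
have [Z [psin [j [tp rj pj wj]]]] := tensor_powers rep iPi posPi hp cp psiE k.
have nu : 0 < nrm u by rewrite lt_neqAle nrm_ge0 andbT eq_sym; apply/eqP => /nrm_eq0.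
pose c : R[i] := (nrm u)^-1%:C%C.
have nc : nrmc c = (nrm u)^-1 by rewrite /c nrmc_real // invr_ge0 ltW.
have Yc : tail_vector f (c *: u) by apply: (invZ (tail_invariant df)).
have [z zE] := tail_range df rj wj Yc.
have nz : nrm z = 1 by rewrite -(rep_nrm rj iPi) -zE nrmZ nc mulVf // gt_eqF.
exists k.+1, Z, psin, z; split=> //.
  by apply: (tail_nonreturning df nf pj); rewrite -zE.
rewrite -iPi -(re_ip rj) (re_actl rj) (sh_mul hPi) (sh_star hPi) -zE -cs_mulA cs_mulA -cs_starM nrmS.
rewrite cs_scaleAr nrmZ nc exprMn exprVn ltr_pdivlMl ?exprn_gt0 //.
by rewrite mulrC.
Qed.

End Main.

(** The existence of a path of length [ω^a] excludes the case in which [X_a] and its tensor powers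
    are zero and contain no unit vector. *)
Lemma xalpha_conditionS (R : realType) (L : ordinalGraph) (hS : og_conditionS L) (a : Ord) :
  (exists e : L, oeq (og_d e) (oexpw a)) ->
  forall (A : cstarAlgebra R) (T : trunc L a -> A), og_algebra T ->
  forall (X : correspondence A) (i : (L -> A) -> X), xalpha T i ->
  correspondence_conditionS X.
Proof.
move=> ex A T UT X i xa O psi pi [[rep _] _] b [y ->] n eps eps0.
have [E [Psi [Pi [p [repE iPi posPi hp [cp psiE]]]]]] :=
  xalpha_isometric_rep (og_conditionS_separating hS) UT xa rep.
have eE : eps = (complex.Re eps)%:C%C by apply/ge0_ReE/ltW.
have [|m [Z [psim [z [nm tp nr nz lt]]]]] :=
  @xalpha_vector R L hS a ex A T UT X i xa E Psi Pi repE iPi O p hp cp psi psiE posPi y n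
    (nrm (y^# ** y) - complex.Re eps).
  by rewrite ltrBlDr ltrDl -ltcR -eE.
exists m, Z, psim, z; split=> //; first by rewrite nrmE nz.
by rewrite !nrmE eE -rmorphB ltcR.
Qed.

Theorem corollary5p10 (R : realType) (L : ordinalGraph)
    (hS : og_conditionS L) :
  (forall (a : Ord), (exists e : L, oeq (og_d e) (oexpw a)) ->
   forall (A : cstarAlgebra R) (T : trunc L a -> A), og_algebra T ->
   forall (X : correspondence A) (i : (L -> A) -> X), xalpha T i ->
   correspondence_conditionS X) /\
  (forall (O : cstarAlgebra R) (T : L -> O), og_algebra T ->
   forall (B : cstarAlgebra R) (p : O -> B), star_hom p ->
   (injective p <-> forall v : L, og_vertex v -> p (T v) <> 0%R)).
Proof.
split; first exact: xalpha_conditionS.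
move=> O T UT B p hp; exact: og_algebra_injective (og_conditionS_separating hS).
Qed.
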